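(* Let $\kappa\ge 3$ be an integer, let $\theta_\kappa=\frac{(\kappa-2)\pi}{\kappa}$ and $r_\kappa=\left(\frac{4\tan(\pi/\kappa)}{\kappa}\right)^{1/2}$, and let $\mathbb{P}_\kappa(n)$ be the probability that $n$ independent uniform random points in a regular $\kappa$-gon of area $1$ are in convex position. Then, as $n\to+\infty$, $$\mathbb{P}_{\kappa}(n)\sim C_\kappa\cdot\frac{e^{2n}}{4^n}\,\frac{\kappa^{3n}\,r_\kappa^{2n}\,\sin(\theta_\kappa)^{n}}{n^{2n+\kappa/2}},$$ where $$C_\kappa=\frac{1}{\pi^{\kappa/2}\sqrt{d_\kappa}}\;\frac{\sqrt{\kappa}^{\,\kappa+1}}{4^\kappa(1+\cos\theta_\kappa)^\kappa},\qquad d_\kappa=\frac{\kappa}{3\cdot 2^\kappa}\left(2(-1)^{\kappa-1}+(2-\sqrt3)^\kappa+(2+\sqrt3)^\kappa\right).$$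
   Context: Points $z_1,\dots,z_n\in\mathbb{R}^2$ are in convex position if $\{z_1,\dots,z_n\}$ is the vertex set of a convex polygon (with $n$ vertices). $r_\kappa$ is the side length and $\theta_\kappa$ the interior angle of the regular $\kappa$-gon of area $1$. $a_n\sim b_n$ means $a_n/b_n\to1$. *)

(* Defs.v *)
From HB Require Import structures.
From mathcomp Require Import all_boot all_order all_algebra.
From mathcomp Require Import all_classical all_reals all_analysis.
From mathcomp Require Import measurable_realfun.

Set Implicit Arguments.
Unset Strict Implicit.
Unset Printing Implicit Defensive.

Import Order.TTheory GRing.Theory Num.Theory.
Import numFieldNormedType.Exports.

Local Open Scope classical_set_scope.
Local Open Scope ring_scope.

(* [plane R] is convertible to [R * R], whose vector space structure is used
   for the geometry; the alias [measurableTypeR] makes the measurable structure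
   of each factor the one on which [lebesgue_measure] is defined. *)
Notation plane R := (measurableTypeR R * measurableTypeR R)%type.

Definition convex_hull (R : realType) (m : nat) (p : 'I_m -> R * R) :
    set (R * R) :=
  [set x | exists2 w : 'I_m -> R,
     (forall i, 0 <= w i) /\ \sum_(i < m) w i = 1 &
     x = \sum_(i < m) w i *: p i].

(* The vertices of a polygon are its extreme points. *)
Definition vertices (R : realType) (A : set (R * R)) : set (R * R) :=
  [set x | A x /\ forall (a b : R * R) (t : R),
     A a -> A b -> 0 < t < 1 -> x = t *: a + (1 - t) *: b -> a = b].

(* A convex polygon is the convex hull of a finite family of points. *)
Definition convex_position (R : realType) (n : nat) (z : n.-tuple (R * R)) :
    Prop :=
  uniq z /\
  exists (m : nat) (p : 'I_m -> R * R), vertices (convex_hull p) = [set` z].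

Definition regular_vertex (R : realType) (kappa : nat) (c : R * R)
    (rho phi : R) (k : 'I_kappa) : R * R :=
  let t := phi + 2 * pi * k%:R / kappa%:R in c + rho *: (cos t, sin t).

(* The closed regular [kappa]-gon with center [c] and circumradius [rho];
   [phi] fixes its orientation. *)
Definition regular_polygon (R : realType) (kappa : nat) (c : R * R)
    (rho phi : R) : set (R * R) :=
  convex_hull (regular_vertex (kappa := kappa) c rho phi).

Definition lebesgue_measure2 (R : realType) :
    {measure set (plane R) -> \bar R} :=
  (@lebesgue_measure R \x @lebesgue_measure R)%E.

Lemma open_measurable2 (R : realType) (A : set (R * R)) :
  open A -> measurable (A : set (plane R)).
Proof.
move=> oA.
pose B (q : (rat * rat) * (rat * rat)) : set (R * R) :=
  (ball (ratr q.1.1 : R) (ratr q.1.2)) `*` (ball (ratr q.2.1 : R) (ratr q.2.2)).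
have -> : A = \bigcup_(q in [set q | B q `<=` A]) B q.
  apply/seteqP; split=> [[x y] Axy|z [q + Bz]]; last exact.
  have : nbhs (x, y) A by apply: open_nbhs_nbhs.
  rewrite -nbhs_ballE => -[e /= e0 eA].
  have [c1 [r1 [/set_mem x1 s1]]] := @open_subball_rat R (ball x e) x
    (ball_open x e) (mem_set (ballxx x e0)).
  have [c2 [r2 [/set_mem y2 s2]]] := @open_subball_rat R (ball y e) y
    (ball_open y e) (mem_set (ballxx y e0)).
  exists ((c1, r1), (c2, r2)); last by split.
  by move=> [u v] [/= /s1 ? /s2 ?]; apply: eA; split.
rewrite bigcup_mkcond; apply: countable_bigcupT_measurable => // q.
case: ifPn => // _; apply: measurableX; exact: (open_measurable (ball_open _ _)).
Qed.

Lemma convex_hull_compact (R : realType) (m : nat) (p : 'I_m -> R * R) :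
  compact (convex_hull p).
Proof.
have sumC (a : 'I_m -> R) :
    continuous (fun v : 'rV[R]_m => \sum_(i < m) v ord0 i * a i).
  apply: continuous_big => [|i _ v]; first exact: add_continuous.
  by apply: continuousM; [exact: coord_continuous|exact: cst_continuous].
pose S := [set v : 'rV[R]_m | forall i, `[0, 1]%classic (v ord0 i)] `&`
          [set v : 'rV[R]_m | \sum_(i < m) v ord0 i * 1 = 1].
pose f (v : 'rV[R]_m) : R * R :=
  (\sum_(i < m) v ord0 i * (p i).1, \sum_(i < m) v ord0 i * (p i).2).
have cS : compact S.
  apply: compact_closedI.
    apply: (@rV_compact R m (fun=> `[0, 1]%classic)) => i.
    exact: segment_compact.
  by move/continuous_closedP : (sumC (fun=> 1)) => /(_ _ (@closed_eq _ 1)).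
have -> : convex_hull p = f @` S.
  have fE (w : 'I_m -> R) : \sum_(i < m) w i *: p i =
      (\sum_(i < m) w i * (p i).1, \sum_(i < m) w i * (p i).2).
    by elim/big_rec3 : _ => // i y1 y2 y _ ->.
  apply/seteqP; split => [x [w [w0 w1] ->]|_ [v [v01 v1] <-]].
    exists (\row_i w i); last first.
      by rewrite fE /f; congr pair; apply: eq_bigr => i _; rewrite mxE.
    split => [i|/=]; last by under eq_bigr do rewrite mxE mulr1.
    rewrite /= in_itv/= mxE w0/= -w1 (bigD1 i)//= lerDl.
    by apply: sumr_ge0.
  exists (fun i => v ord0 i); last by rewrite fE.
  split=> [i|]; first by have := v01 i; rewrite /= in_itv/= => /andP[].
  by rewrite -[RHS]v1; apply: eq_bigr => i _; rewrite mulr1.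
apply: (@continuous_compact _ _ f S _ cS); apply: continuous_subspaceT => v.
exact: (cvg_pair (sumC (fun i => (p i).1) v) (sumC (fun i => (p i).2) v)).
Qed.

Lemma measurable_regular_polygon (R : realType) (kappa : nat) (c : R * R)
    (rho phi : R) :
  measurable (regular_polygon kappa c rho phi : set (plane R)).
Proof.
rewrite -[X in measurable X]setCK; apply: measurableC.
apply: open_measurable2; rewrite openC; apply: compact_closed.
  exact: norm_hausdorff.
exact: convex_hull_compact.
Qed.

(* [mnormalize] uses its last argument only when the area is [0] or [+oo]. *)
Definition uniform_law (R : realType) (D : set (plane R))
    (mD : measurable D) : probability (plane R) R :=
  mnormalize (mrestr (lebesgue_measure2 R) mD) point.

Definition cons_point (d : measure_display) (T : measurableType d) (n : nat)
    (u : T * n.-tuple T) : n.+1.-tuple T := [tuple of u.1 :: u.2].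

Lemma measurable_cons_point (d : measure_display) (T : measurableType d)
    (n : nat) : measurable_fun setT (@cons_point d T n).
Proof. by apply: measurable_cons. Qed.

HB.instance Definition _ (d : measure_display) (T : measurableType d)
    (n : nat) :=
  isMeasurableFun.Build _ _ _ _ (@cons_point d T n)
    (@measurable_cons_point d T n).

(* Joint law of [n] independent points with law [mu]. *)
Fixpoint iid_law (R : realType) (d : measure_display) (T : measurableType d)
    (mu : probability T R) (n : nat) : probability (n.-tuple T) R :=
  match n with
  | 0 => dirac [tuple]
  | k.+1 => distribution (mu \x iid_law mu k)%E (@cons_point d T k)
  end.

Definition convex_position_proba (R : realType) (kappa : nat) (c : R * R)
    (rho phi : R) (n : nat) : R :=
  fine (iid_law (uniform_law (measurable_regular_polygon kappa c rho phi)) n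
    [set z | convex_position z]).

Definition theta (R : realType) (kappa : nat) : R :=
  (kappa%:R - 2) * pi / kappa%:R.

Definition side_length (R : realType) (kappa : nat) : R :=
  Num.sqrt (4 * tan (pi / kappa%:R) / kappa%:R).

Definition d_const (R : realType) (kappa : nat) : R :=
  kappa%:R / (3 * 2 ^+ kappa) *
  (2 * (-1) ^+ kappa.-1 + (2 - Num.sqrt 3) ^+ kappa
   + (2 + Num.sqrt 3) ^+ kappa).

Definition C_const (R : realType) (kappa : nat) : R :=
  1 / (pi `^ (kappa%:R / 2) * Num.sqrt (d_const R kappa)) *
  (Num.sqrt kappa%:R ^+ kappa.+1 /
   (4 ^+ kappa * (1 + cos (theta R kappa)) ^+ kappa)).

Definition equivalent_seq (R : realType) (kappa n : nat) : R :=
  C_const R kappa * (expR (2 * n%:R) / 4 ^+ n) *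
  (kappa%:R ^+ (3 * n) * side_length R kappa ^+ (2 * n)
   * sin (theta R kappa) ^+ n / n%:R `^ (2 * n%:R + kappa%:R / 2)).

(* Main.v *)
(* Let the sides of the k-gon K be numbered cyclically. A sample in convex
   position with no ties determines a circumscribed equiangular polygon, whose
   sides are parallel to those of K and touch the sample in k contact points,
   and k convex chains joining consecutive contact points. A chain with m inner
   vertices fills its corner triangle with probability proportional to the m-th
   power of the area over (m + 1)! (m!)^2. When the contact points are distinct,
   beta integrals along the sides leave, for each composition (t_i) of n - k, a
   product of the factors c_i ^ (t_i + t_(i-1) + 1) / (t_i + t_(i-1) + 1)! and
   1 / (t_i + 1)!, integrated over the distances l_i of the sides to those of K,
   where c_i is the length of side i of the circumscribed polygon. The samples
   with fewer than k contact points contribute at most a polynomial times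
   ((k - 1) / k) ^ n relative to this main part.

   Each power over a factorial is a Poisson weight times an exponential, and the
   exponentials combine into exp (- theta * sum of n l_i). With
   t_i + 1 = n / k + sqrt n * x_i and l_i = y_i / n the Poisson weights tend to
   Gaussian densities, dominated by Cauchy densities, and the sum becomes the
   integral of exp (- k (sum x_i ^ 2 + x_i x_(i+1) / 2)) over the hyperplane
   sum x_i = 0. Adding the mean of the x_i as a variable gives an integral over
   R^k, which is computed by successively integrating out the vertices of the
   cycle; the recurrence S_(m+2) = 4 S_(m+1) - S_m that appears produces the
   powers of 2 + sqrt 3 and 2 - sqrt 3 in the constant d. *)
Require Import Defs.
From HB Require Import structures.
From mathcomp Require Import all_boot all_order all_algebra.
From mathcomp Require Import all_classical all_reals all_analysis.
From mathcomp Require Import measurable_realfun ring lra zify.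
Set Implicit Arguments.
Unset Strict Implicit.
Unset Printing Implicit Defensive.
Import Order.TTheory GRing.Theory Num.Theory.
Import numFieldNormedType.Exports.
Local Open Scope classical_set_scope.
Local Open Scope ring_scope.

(** * Iterated integrals over lists *)

(** The sample is an ordered tuple while the decomposition concerns a set, and no measurable map
    between the two is ever built. The indicator of convex position is enclosed between sums, over
    all orderings of the sample, of indicators of chain configurations: a set determines its
    configuration, so such a sum is at most the indicator; every sample without ties has a possibly
    degenerate one, so the indicator is at most the sum. Integration turns the orderings into a
    factorial.

    A repeated contact point forces two neighbouring sides to share one, so one of the [k] chains is
    empty. Multinomial sums then run over [k - 1] parts instead of [k], whence the ratio
    [(k - 1) / k].

    Distances are scaled by the sample size because moving a side by [l] changes a power of that
    order by a factor linear in [l]. The domination has to cover all compositions, also those far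
    from the centre, where Poisson weights are not close to Gaussian. A bound in the difference of
    the square roots of index and mean is uniform in both tails; it is weakened to a Cauchy bound in
    the plain deviation, and it also yields Stirling's formula. *)

Lemma ge0_le_integralT d (T : measurableType d) (R : realType)
    (mu : {measure set T -> \bar R}) (f g : T -> \bar R) :
  (forall x, 0 <= f x)%E -> (forall x, f x <= g x)%E ->
  (\int[mu]_x f x <= \int[mu]_x g x)%E.
Proof.
move=> f0 fg; have g0 x : (0 <= g x)%E by exact: le_trans (f0 x) (fg x).
rewrite !ge0_integralTE//; apply: ereal_sup_le => _ [h hf <-].
by exists h => // x; exact: le_trans (hf x) (fg x).
Qed.

Section iterated_integral.
Context d (T : measurableType d) (R : realType).
Variable mu : {sigma_finite_measure set T -> \bar R}.
Local Open Scope ereal_scope.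

(** Integrands depend on lists, so that blocks of variables can be split and joined by [take],
    [drop] and [++] without casts between tuple types. *)
Fixpoint iint n (F : seq T -> \bar R) : \bar R :=
  match n with
  | 0 => F [::]
  | k.+1 => \int[mu]_x iint k (fun t => F (x :: t))
  end.

Lemma eq_iint n F G : (forall t, size t = n -> F t = G t) ->
  iint n F = iint n G.
Proof.
elim: n F G => [|n IH] F G FG /=; first exact: FG.
by apply: eq_integral => x _; apply: IH => t st; apply: FG => /=; rewrite st.
Qed.

Lemma iint_ge0 n F : (forall t, 0 <= F t) -> 0 <= iint n F.
Proof.
elim: n F => [|n IH] F F0 /=; first exact: F0.
by apply: integral_ge0 => x _; apply: IH.
Qed.

(** Rests on the integral of a nonnegative function being a supremum over the simple functions below
    it. It therefore applies to the indicator of convex position, about whose measurability nothing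
    is established here. *)
Lemma le_iint n F G : (forall t, 0 <= F t) -> (forall t, size t = n -> F t <= G t) ->
  iint n F <= iint n G.
Proof.
elim: n F G => [|n IH] F G F0 FG /=; first exact: FG.
apply: ge0_le_integralT => x; first exact: iint_ge0.
by apply: IH => // t st; apply: FG => /=; rewrite st.
Qed.

Lemma iint_cat a b F :
  iint (a + b) F = iint a (fun s => iint b (fun t => F (s ++ t))).
Proof.
elim: a F => [//|a IH] F /=.
by apply: eq_integral => x _; rewrite IH.
Qed.

End iterated_integral.

Section mseq.
Context d (T : measurableType d).

(** Lists are read through tuples, which carry the measurable structure. The parameter [p] absorbs
    the variables already peeled off in inductions on [n]. *)
Definition mseq dY (Y : measurableType dY) n dP (P : measurableType dP)
    (F : P -> seq T -> Y) : Prop :=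
  measurable_fun setT (fun q : P * n.-tuple T => F q.1 q.2).

Lemma mseq0 dY (Y : measurableType dY) dP (P : measurableType dP)
    (F : P -> seq T -> Y) :
  mseq 0 F <-> measurable_fun setT (fun p => F p [::]).
Proof.
rewrite /mseq; split => mF.
  have -> : (fun p => F p [::]) =
      (fun q : P * 0.-tuple T => F q.1 q.2) \o (fun p => (p, [tuple])) by [].
  by apply: measurableT_comp => //; exact: measurable_fun_pair.
rewrite [X in measurable_fun _ X](_ : _ = (fun p => F p [::]) \o fst).
  by apply: measurableT_comp => //; exact: measurable_fst.
by apply/funext => -[p t]/=; rewrite tuple0.
Qed.

Lemma mseqS dY (Y : measurableType dY) n dP (P : measurableType dP)
    (F : P -> seq T -> Y) :
  mseq n.+1 F <-> mseq n (fun (q : P * T) t => F q.1 (q.2 :: t)).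
Proof.
rewrite /mseq; split => mF.
  rewrite [X in measurable_fun _ X](_ : _ =
    (fun q : P * n.+1.-tuple T => F q.1 q.2) \o
    (fun q : (P * T) * n.-tuple T => (q.1.1, [tuple of q.1.2 :: q.2])))//.
  apply: measurableT_comp => //; apply: measurable_fun_pair.
    by apply: measurableT_comp; [exact: measurable_fst|exact: measurable_fst].
  apply: measurable_cons; last exact: measurable_snd.
  by apply: measurableT_comp; [exact: measurable_snd|exact: measurable_fst].
rewrite [X in measurable_fun _ X](_ : _ =
    (fun q : (P * T) * n.-tuple T => F q.1.1 (q.1.2 :: q.2)) \o
    (fun q : P * n.+1.-tuple T =>
      ((q.1, tnth q.2 ord0), [tuple of behead q.2]))); last first.
  by apply/funext => -[p t]/=; congr F; rewrite {1}(tuple_eta t).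
apply: measurableT_comp => //; apply: measurable_fun_pair.
  apply: measurable_fun_pair; first exact: measurable_fst.
  by apply: (measurableT_comp (measurable_tnth _)); exact: measurable_snd.
exact: (measurableT_comp (@measurable_behead _ T n)
  (@measurable_snd _ _ P (n.+1.-tuple T))).
Qed.

Lemma mseq_cst dY (Y : measurableType dY) n dP (P : measurableType dP)
    (f : P -> Y) :
  measurable_fun setT f -> mseq n (fun p _ => f p).
Proof. by move=> mf; apply: measurableT_comp => //; exact: measurable_fst. Qed.

Lemma mseq_nth n dP (P : measurableType dP) (x0 : T) i :
  mseq n (fun (_ : P) t => nth x0 t i).
Proof.
rewrite /mseq; have [ni|ni] := leqP n i.
  under eq_fun do rewrite nth_default ?size_tuple//.
  exact: measurable_cst.
under eq_fun do rewrite -(tnth_nth x0 _ (Ordinal ni)).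
apply: (measurableT_comp (measurable_tnth _)); exact: measurable_snd.
Qed.

Lemma mseq_param dY (Y : measurableType dY) n dP (P : measurableType dP)
  dQ (Q : measurableType dQ) (h : Q -> P) (F : P -> seq T -> Y) :
  measurable_fun setT h -> mseq n F -> mseq n (fun q t => F (h q) t).
Proof.
move=> mh mF; rewrite /mseq.
rewrite [X in measurable_fun _ X](_ : _ =
  (fun q : P * n.-tuple T => F q.1 q.2) \o
  (fun q : Q * n.-tuple T => (h q.1, q.2)))//.
apply: measurableT_comp => //; apply: measurable_fun_pair.
  by apply: (measurableT_comp mh); exact: measurable_fst.
exact: measurable_snd.
Qed.

Lemma mseq_catl dY (Y : measurableType dY) a b dP (P : measurableType dP)
    (F : P -> seq T -> Y) :
  mseq (a + b) F ->
  mseq b (fun (q : P * a.-tuple T) t => F q.1 (q.2 ++ t)).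
Proof.
rewrite /mseq => mF.
rewrite [X in measurable_fun _ X](_ : _ =
  (fun q : P * (a + b).-tuple T => F q.1 q.2) \o
  (fun q : (P * a.-tuple T) * b.-tuple T => (q.1.1, [tuple of q.1.2 ++ q.2])))//.
apply: measurableT_comp => //; apply: measurable_fun_pair.
  by apply: measurableT_comp; [exact: measurable_fst|exact: measurable_fst].
apply/measurable_fun_tnthP => i.
pose j := fintype.split i.
rewrite [X in measurable_fun _ X](_ : _ = match j with
  | inl k => fun q : (P * a.-tuple T) * b.-tuple T => tnth q.1.2 k
  | inr k => fun q : (P * a.-tuple T) * b.-tuple T => tnth q.2 k end); last first.
  apply/funext => q /=; rewrite -[in LHS](splitK i) /j.
  case: (fintype.split i) => k; first by rewrite /= tnth_lshift.
  by rewrite /= tnth_rshift.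
case: j => k.
  apply: (measurableT_comp (measurable_tnth _)).
  by apply: measurableT_comp; [exact: measurable_snd|exact: measurable_fst].
by apply: (measurableT_comp (measurable_tnth _)); exact: measurable_snd.
Qed.

End mseq.

Notation mseqF n F := (mseq n (fun (_ : unit) t => F t)).

Section mseq_facts.
Context d (T : measurableType d).

Lemma mseqF_cons dY (Y : measurableType dY) n (F : seq T -> Y) :
  mseqF n.+1 F -> mseq n (fun (x : T) t => F (x :: t)).
Proof.
move=> /mseqS mF.
by apply: (mseq_param (h := fun x : T => (tt, x)) _ mF); exact: measurable_fun_pair.
Qed.

Lemma mseq_sec dY (Y : measurableType dY) n dP (P : measurableType dP)
    (F : P -> seq T -> Y) p : mseq n F -> mseqF n (F p).
Proof. by move=> mF; apply: (mseq_param (h := fun _ : unit => p) _ mF). Qed.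

Lemma mseqF_catl dY (Y : measurableType dY) a b (F : seq T -> Y) :
  mseqF (a + b) F -> mseq b (fun (s : a.-tuple T) t => F (s ++ t)).
Proof.
move=> /mseq_catl mF.
apply: (mseq_param (h := fun s : a.-tuple T => (tt, s)) _ mF).
exact: measurable_fun_pair.
Qed.

End mseq_facts.

Section iint_fubini.
Context d (T : measurableType d) (R : realType).
Variable mu : {sigma_finite_measure set T -> \bar R}.
Local Open Scope ereal_scope.

Lemma measurable_iint n dP (P : measurableType dP) (F : P -> seq T -> \bar R) :
  (forall p t, 0 <= F p t) -> mseq n F ->
  measurable_fun setT (fun p => iint mu n (F p)).
Proof.
elim: n dP P F => [|n IH] dP P F F0 mF /=; first exact/mseq0.
apply: (measurable_fun_fubini_tonelli_F
  (fun q : P * T => iint mu n (fun t => F q.1 (q.2 :: t)))).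
  by apply: IH => //; exact/mseqS.
by move=> q; exact: iint_ge0.
Qed.

Lemma mseq_iint d' (S : measurableType d') a b dP (P : measurableType dP)
    (F : P -> seq S -> seq T -> \bar R) :
  (forall p s t, 0 <= F p s t) ->
  mseq b (fun (q : P * a.-tuple S) t => F q.1 q.2 t) ->
  mseq a (fun p s => iint mu b (F p s)).
Proof. by move=> F0 mF; apply: measurable_iint. Qed.

Lemma integral_iint_swap d' (S : measurableType d')
    (nu : {sigma_finite_measure set S -> \bar R}) n (F : S -> seq T -> \bar R) :
  (forall x t, 0 <= F x t) -> mseq n F ->
  \int[nu]_x iint mu n (F x) = iint mu n (fun t => \int[nu]_x F x t).
Proof.
elim: n F => [//|n IH] F F0 mF /=.
rewrite (fubini_tonelli (fun q : S * T => iint mu n (fun t => F q.1 (q.2 :: t))))/=.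
- apply: eq_integral => y _; rewrite -IH//.
  apply: (mseq_param (h := fun x : S => (x, y)) _ (iffLR (mseqS _ _) mF)).
  by apply: measurable_fun_pair.
- by apply: measurable_iint => //; exact/mseqS.
- by move=> q; exact: iint_ge0.
Qed.

Lemma iintZl n (c : \bar R) (F : seq T -> \bar R) :
  0 <= c -> (forall t, 0 <= F t) -> mseqF n F ->
  iint mu n (fun t => c * F t) = c * iint mu n F.
Proof.
move=> c0; elim: n F => [//|n IH] F F0 mF /=.
rewrite -ge0_integralZl//.
- apply: eq_integral => x _; rewrite IH//.
  exact: (mseq_sec _ (mseqF_cons mF)).
- apply: measurable_iint => //; exact: mseqF_cons.
- by move=> x _; exact: iint_ge0.
Qed.

Lemma iint_sum n (I : Type) (r : seq I) (F : I -> seq T -> \bar R) :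
  (forall i t, 0 <= F i t) -> (forall i, mseqF n (F i)) ->
  iint mu n (fun t => \sum_(i <- r) F i t) = \sum_(i <- r) iint mu n (F i).
Proof.
elim: n F => [//|n IH] F F0 mF /=.
rewrite -ge0_integral_sum//.
- apply: eq_integral => x _; apply: (IH (fun i t => F i (x :: t))) => // i.
  exact: (mseq_sec _ (mseqF_cons (mF i))).
- by move=> i; apply: measurable_iint => //; exact: mseqF_cons.
- by move=> i x _; exact: iint_ge0.
Qed.

(** By Tonelli the outermost variable may be moved past the first [k] others. This symmetry of the
    product measure is behind both [iint_allperms] and [iint_tie]. *)
Lemma iint_insert n k (F : seq T -> \bar R) : (k <= n)%N ->
  (forall t, 0 <= F t) -> mseqF n.+1 F ->
  \int[mu]_x iint mu n (fun t => F (take k t ++ x :: drop k t)) =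
  iint mu n.+1 F.
Proof.
move=> kn F0 mF.
rewrite -{1}(subnKC kn).
under eq_integral do rewrite iint_cat.
pose G x s := iint mu (n - k) (fun t => F (s ++ x :: t)).
transitivity (\int[mu]_x iint mu k (G x)).
  apply: eq_integral => x _; apply: eq_iint => s sk; apply: eq_iint => t _.
  by rewrite take_cat drop_cat sk ltnn subnn take0 drop0 cats0.
have nk : n.+1 = (k + (n - k).+1)%N by rewrite addnS subnKC.
rewrite integral_iint_swap.
- by rewrite nk iint_cat.
- by move=> x t; exact: iint_ge0.
apply: mseq_iint => //.
rewrite nk in mF.
have := mseqF_catl mF => /mseqS mF'.
apply: (mseq_param (h := fun q : T * k.-tuple T => (q.2, q.1)) _ mF').
by apply: measurable_fun_pair; [exact: measurable_snd|exact: measurable_fst].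
Qed.

Lemma iint_cat_prod a b (F G : seq T -> \bar R) :
  (forall t, 0 <= F t) -> (forall t, 0 <= G t) -> mseqF a F -> mseqF b G ->
  iint mu (a + b) (fun t => F (take a t) * G (drop a t)) =
  iint mu a F * iint mu b G.
Proof.
move=> F0 G0 mF mG; rewrite iint_cat.
rewrite muleC -iintZl//; last exact: iint_ge0.
apply: eq_iint => s sa; rewrite muleC -iintZl//.
apply: eq_iint => t _.
by rewrite take_cat drop_cat sa ltnn subnn take0 drop0 cats0.
Qed.

End iint_fubini.

(** Both sides obey the same recursion: a product measure evaluated at a set is by definition the
    integral of the measures of its sections. *)
Lemma iid_lawE (R : realType) d (T : measurableType d) (P : probability T R) n
    (A : set (seq T)) :
  iid_law P n [set z | A (tval z)] =
  iint P n (fun t => (\1_A t)%:E).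
Proof.
elim: n A => [|n IH] A.
  rewrite /= diracE /= indicE; congr (_%:R%:E).
rewrite /= /pushforward /= /product_measure1 /=.
apply: eq_integral => x _.
transitivity (iid_law P n [set z | (fun t => A (x :: t)) (tval z)]).
  congr (iid_law P n _); apply/seteqP; split => z /=; rewrite /xsection/= ?inE//=.
rewrite (IH (fun t => A (x :: t))); apply: eq_iint => t _.
by rewrite !indicE; congr (_%:R%:E).
Qed.

Lemma mseq_map d (T : measurableType d) dY (Y : measurableType dY) n m
    dP (P : measurableType dP) dQ (Q : measurableType dQ)
    d' (T' : measurableType d') (x0 : T')
    (F : P -> seq T' -> Y) (h : Q -> P) (g : Q -> seq T -> seq T') :
  measurable_fun setT h ->
  (forall q t, size t = n -> size (g q t) = m) ->
  (forall i, (i < m)%N -> mseq n (fun q t => nth x0 (g q t) i)) ->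
  mseq m F -> mseq n (fun q t => F (h q) (g q t)).
Proof.
move=> mh sg mg mF; rewrite /mseq.
rewrite [X in measurable_fun _ X](_ : _ =
  (fun q : P * m.-tuple T' => F q.1 q.2) \o
  (fun q : Q * n.-tuple T =>
     (h q.1, [tuple nth x0 (g q.1 q.2) i | i < m]))); last first.
  apply/funext => -[q t]/=; congr F.
  apply: (@eq_from_nth _ x0); first by rewrite sg ?size_tuple// card_ord.
  rewrite sg ?size_tuple// => i im.
  by rewrite (nth_map (Ordinal im)) ?size_enum_ord ?card_ord// nth_enum_ord.
apply: measurableT_comp => //; apply: measurable_fun_pair.
  by apply: (measurableT_comp mh); exact: measurable_fst.
apply/measurable_fun_tnthP => i.
rewrite [X in measurable_fun _ X](_ : _ =
  fun q : Q * n.-tuple T => nth x0 (g q.1 q.2) i); first exact: mg.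
by apply/funext => q /=; rewrite tnth_mktuple.
Qed.

(** * Symmetrization over the orderings of a sample *)

Section allperms.
Variable T : eqType.
Implicit Types (x : T) (s t w z : seq T).

Definition insert_at k x t := take k t ++ x :: drop k t.

(** Built by insertion so that [iint_insert] applies position by position. Repeated entries are not
    merged: a list of length [n] always yields [n]! orderings. *)
Fixpoint allperms s : seq (seq T) :=
  match s with
  | [::] => [:: [::]]
  | x :: t => flatten [seq [seq insert_at k x w | w <- allperms t]
                      | k <- iota 0 (size t).+1]
  end.

Lemma perm_insert_at k x t : perm_eq (insert_at k x t) (x :: t).
Proof.
by rewrite /insert_at -cat1s perm_catCA /= perm_cons cat_take_drop.
Qed.

Lemma allperms_cons x t : allperms (x :: t) =
  flatten [seq [seq insert_at k x w | w <- allperms t]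
          | k <- iota 0 (size t).+1].
Proof. by []. Qed.

Lemma allperms_perm z w : w \in allperms z -> perm_eq w z.
Proof.
elim: z w => [|x t IH] w; first by rewrite inE => /eqP->.
rewrite allperms_cons.
move=> /allpairsPdep[k [w' [_ /IH ww' ->]]].
by rewrite (perm_trans (perm_insert_at _ _ _))// perm_cons.
Qed.

Lemma mem_allperms z w : perm_eq w z -> w \in allperms z.
Proof.
elim: z w => [|x t IH] w; first by move=> /perm_nilP ->.
rewrite allperms_cons.
move=> wxt; have xw : x \in w by rewrite (perm_mem wxt) mem_head.
move: (wxt) (perm_size wxt) => {wxt}.
case/splitPr: xw => p q pq.
have pqt : perm_eq (p ++ q) t.
  by rewrite -(perm_cons x) -(permPr pq) perm_sym -cat1s perm_catCA.
rewrite size_cat [size (x :: q)]/= addnS => -[spq].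
apply/allpairsPdep; exists (size p), (p ++ q); split; last 1 first.
- by rewrite /insert_at take_size_cat// drop_size_cat.
- by rewrite mem_iota add0n ltnS -spq; exact: leq_addr.
- exact: IH.
Qed.

Lemma allperms_uniq z : uniq z -> uniq (allperms z).
Proof.
elim: z => [//|x t IH]; rewrite cons_uniq allperms_cons => /andP[xt ut].
(* As [x] does not occur in [w], the place of insertion can be read back as the index of [x]. *)
have ix k w : w \in allperms t -> (k < (size t).+1)%N ->
    index x (insert_at k x w) = k.
  move=> wt kt; have pw := allperms_perm wt.
  rewrite /insert_at index_cat; case: ifPn => [/mem_take xw|_].
    by rewrite -(perm_mem pw) xw in xt.
  by rewrite /= eqxx addn0 size_takel// (perm_size pw).
have injk k : (k < (size t).+1)%N -> {in allperms t &, injective (insert_at k x)}.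
  move=> kt w w' /[dup] wt /allperms_perm pw /allperms_perm pw'.
  rewrite /insert_at => /eqP; rewrite eqseq_cat; last first.
    by rewrite !size_takel// ?(perm_size pw) ?(perm_size pw').
  rewrite eqseq_cons eqxx /= => /andP[/eqP e1 /eqP e2].
  by rewrite -(cat_take_drop k w) e1 e2 cat_take_drop.
have : {subset iota 0 (size t).+1 <= gtn (size t).+1}.
  by move=> k; rewrite mem_iota add0n.
have := iota_uniq 0 (size t).+1.
elim: (iota 0 _) => [//|k r IHr] /= /andP[kr ur] rs.
have kt : (k < (size t).+1)%N by apply: rs; rewrite mem_head.
rewrite cat_uniq IHr//; last by move=> j jr; apply: rs; rewrite inE jr orbT.
rewrite map_inj_in_uniq ?IH//=; last exact: injk.
rewrite andbT; apply/hasPn => /= _ /flattenP[/= _ /mapP[j jr ->]] /mapP[w wt ->].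
apply/mapP => -[w' wt' e].
have jt : (j < (size t).+1)%N by apply: rs; rewrite inE jr orbT.
by move: kr; rewrite -(ix _ _ wt' kt) -e (ix _ _ wt jt) jr.
Qed.

End allperms.

Section iint_allperms.
Context d (T : measurableType d) (R : realType).
Variable mu : {sigma_finite_measure set T -> \bar R}.
Local Open Scope ereal_scope.

Lemma mseq_insert_at dP (P : measurableType dP) n k (F : P -> seq T -> \bar R) :
  (k <= n)%N -> mseq n.+1 F ->
  mseq n (fun (q : P * T) t => F q.1 (insert_at k q.2 t)).
Proof.
move=> kn mF; rewrite /mseq; apply/measurable_funTS.
(* Reading entries by [nth] takes a default element of [T]; if there is none, the domain is
   empty. *)
case: (pselect (inhabited T)) => [[x0]|N]; last first.
  by rewrite [X in measurable_fun X](_ : _ = set0);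
    [exact: measurable_fun_set0|
     apply/seteqP; split => // -[[p x] t] _; case: N; constructor].
apply: (@mseq_map _ _ _ _ n n.+1 _ _ _ _ _ _ x0 F fst
  (fun q t => insert_at k q.2 t)) => //.
- by move=> q t st; rewrite (perm_size (perm_insert_at _ _ _))/= st.
move=> i ni; case: (ltngtP i k) => ik.
- rewrite /mseq [X in measurable_fun _ X](_ : _ =
    (fun q : (P * T) * n.-tuple T => nth x0 q.2 i)).
    exact: (@mseq_nth _ T n _ (P * T)%type x0 i).
  apply/funext => q /=; rewrite /insert_at nth_cat size_takel ?size_tuple//.
  by rewrite ik nth_take.
- rewrite /mseq [X in measurable_fun _ X](_ : _ =
    (fun q : (P * T) * n.-tuple T => nth x0 q.2 i.-1)).
    exact: (@mseq_nth _ T n _ (P * T)%type x0 i.-1).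
  apply/funext => q /=; rewrite /insert_at nth_cat size_takel ?size_tuple//.
  rewrite ltnNge (ltnW ik)/= -{1}(prednK (leq_ltn_trans (leq0n k) ik)).
  rewrite subSn; last by rewrite -ltnS prednK//; apply: leq_ltn_trans ik.
  by rewrite /= nth_drop subnKC// -ltnS prednK//; apply: leq_ltn_trans ik.
- rewrite /mseq [X in measurable_fun _ X](_ : _ = snd \o fst).
    by apply: measurableT_comp; [exact: measurable_snd|exact: measurable_fst].
  apply/funext => q /=; rewrite /insert_at nth_cat size_takel ?size_tuple//.
  by rewrite ik ltnn subnn.
Qed.

Lemma mseq_sum_allperms dP (P : measurableType dP) n (F : P -> seq T -> \bar R) :
  (forall p t, 0 <= F p t) ->
  mseq n F -> mseq n (fun p t => \sum_(w <- allperms t) F p w).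
Proof.
elim: n dP P F => [|n IH] dP P F F0 mF.
  apply/mseq0; move/mseq0 : mF; apply: eq_measurable_fun => p _ /=.
  by rewrite big_seq1.
apply/mseqS; rewrite /mseq.
rewrite [X in measurable_fun _ X](_ : _ = fun q : (P * T) * n.-tuple T =>
  \sum_(k <- iota 0 n.+1) \sum_(w <- allperms q.2)
    F q.1.1 (insert_at k q.1.2 w)); last first.
  apply/funext => -[[p x] t]; rewrite allperms_cons big_flatten big_map size_tuple.
  by apply: eq_bigr => k _; rewrite big_map.
rewrite [X in measurable_fun _ X](_ : _ = fun q : (P * T) * n.-tuple T =>
  \sum_(k <- iota 0 n.+1) (if (k <= n)%N then \sum_(w <- allperms q.2)
    F q.1.1 (insert_at k q.1.2 w) else 0)); last first.
  apply/funext => q; rewrite !big_seq; apply: eq_bigr => k.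
  by rewrite mem_iota add0n /= ltnS => ->.
apply: emeasurable_sum => k; case: leqP => kn; last exact: measurable_cst.
apply: (IH _ (P * T)%type (fun q w => F q.1 (insert_at k q.2 w))) => //.
exact: mseq_insert_at.
Qed.

(** Converts volumes of ordered configurations into volumes for the unordered sample: the first
    variable has [n.+1] possible places, all with the same integral by [iint_insert]. *)
Lemma iint_allperms n (F : seq T -> \bar R) :
  (forall t, 0 <= F t) -> mseqF n F ->
  iint mu n (fun t => \sum_(w <- allperms t) F w) = (n`!%:R)%:E * iint mu n F.
Proof.
elim: n F => [|n IH] F F0 mF; first by rewrite /= big_seq1 mul1e.
have mI k : (k <= n)%N -> mseq n (fun x t => F (insert_at k x t)).
  move=> kn; have := mseq_insert_at kn mF.
  by apply: (mseq_param (h := fun x : T => (tt, x))); exact: measurable_fun_pair.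
transitivity (\int[mu]_x \sum_(k < n.+1)
    iint mu n (fun t => \sum_(w <- allperms t) F (insert_at k x w))).
  apply: eq_integral => x _.
  rewrite -(big_mkord xpredT (fun k => iint mu n
    (fun t => \sum_(w <- allperms t) F (insert_at k x w)))).
  transitivity (iint mu n (fun t => \sum_(k <- index_iota 0 n.+1)
    (if (k <= n)%N then \sum_(w <- allperms t) F (insert_at k x w) else 0))).
    apply: eq_iint => t st.
    rewrite allperms_cons big_flatten big_map st /index_iota subn0 big_seq.
    rewrite [RHS]big_seq; apply: eq_bigr => k.
    by rewrite mem_iota add0n /= ltnS => ->; rewrite big_map.
  rewrite iint_sum//.
  - by rewrite big_seq [RHS]big_seq; apply: eq_bigr => k; rewrite mem_index_iota ltnS => /andP[_ ->].
  - by move=> k t; case: ifP => // _; exact: sume_ge0.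
  - move=> k; have [kn|_] := leqP k n; last first.
      by apply: (@mseq_cst _ T _ _ n _ unit (fun _ => 0)); exact: measurable_cst.
    apply: (@mseq_sum_allperms _ unit n (fun _ w => F (insert_at k x w))) => //.
    exact: (mseq_sec _ (mI _ kn)).
transitivity (\int[mu]_x \sum_(k < n.+1)
    (n`!%:R)%:E * iint mu n (fun t => F (insert_at k x t))).
  apply: eq_integral => x _; apply: eq_bigr => k _.
  by rewrite IH//; apply: (mseq_sec _ (mI _ _)); rewrite -ltnS.
rewrite ge0_integral_sum//; last 2 first.
- move=> k; apply: measurable_funeM; apply: measurable_iint => //.
  by apply: mI; rewrite -ltnS.
- by move=> k x _; rewrite mule_ge0// ?lee_fin//; exact: iint_ge0.
transitivity (\sum_(k < n.+1) (n`!%:R)%:E * iint mu n.+1 F).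
  apply: eq_bigr => k _; rewrite ge0_integralZl//.
  - by rewrite -(iint_insert mu (k := k))// -ltnS.
  - by apply: measurable_iint => //; apply: mI; rewrite -ltnS.
  - by move=> x _; exact: iint_ge0.
rewrite -ge0_sume_distrl//; congr (_ * _).
by rewrite sumEFin sumr_const card_ord factS natrM mulr_natl.
Qed.

End iint_allperms.

(** * Affine changes of variables *)

Section real_line.
Context {R : realType}.
Local Notation mu := (@lebesgue_measure R).
Local Open Scope ereal_scope.

Definition affine (a b : R) (x : measurableTypeR R) : measurableTypeR R :=
  (a * x + b)%R.

Lemma measurable_affine a b : measurable_fun setT (affine a b).
Proof.
apply: measurable_funD => //; exact: mulrl_measurable.
Qed.

HB.instance Definition _ a b :=
  isMeasurableFun.Build _ _ _ _ (affine a b) (measurable_affine a b).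

(** By uniqueness of Lebesgue measure it is enough to compare the scaled image measure with it on
    half-open intervals. *)
Lemma lebesgue_measure_affine (a b : R) : (0 < a)%R ->
  forall A : set (measurableTypeR R), measurable A ->
  mu A = a%:E * mu (affine a b @^-1` A).
Proof.
move=> a0.
pose m0 : {measure set (measurableTypeR R) -> \bar R} :=
  mscale (NngNum (ltW a0)) (pushforward mu (affine a b)).
pose m' := m0 (measurable_affine a b).
move=> A mA; rewrite (@lebesgue_measure_unique R m')//.
move=> _ [[u v]] _ <-.
change (mu `]u, v] = a%:E * mu (affine a b @^-1` `]u, v])).
rewrite (_ : affine a b @^-1` _ = `]((u - b) / a)%R, ((v - b) / a)%R]%classic); last first.
  apply/seteqP; split => x /=; rewrite /affine !in_itv/= ltr_pdivrMr// ler_pdivlMr//.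
    by rewrite ltrBlDr lerBrDr mulrC.
  by rewrite ltrBlDr lerBrDr [in X in X -> _]mulrC.
rewrite !lebesgue_measure_itv/= !lte_fin ltr_pM2r ?invr_gt0//.
rewrite ltrD2r; case: ifPn => _; last by rewrite mule0.
rewrite -!EFinB -EFinM; congr EFin.
by field; rewrite gt_eqF.
Qed.

Lemma ge0_integral_affine (a b : R) (f : measurableTypeR R -> \bar R) :
  a != 0%R -> measurable_fun setT f -> (forall x, 0 <= f x) ->
  \int[mu]_x f x = `|a|%:E * \int[mu]_x f (a * x + b)%R.
Proof.
move=> a0 mf f0.
have pos (c e : R) (g : measurableTypeR R -> \bar R) : (0 < c)%R ->
    measurable_fun setT g -> (forall x, 0 <= g x) ->
    \int[mu]_x g x = c%:E * \int[mu]_x g (c * x + e)%R.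
  move=> c0 mg g0.
  pose m0 : {measure set (measurableTypeR R) -> \bar R} :=
    mscale (NngNum (ltW c0)) (pushforward mu (affine c e)).
  pose m' := m0 (measurable_affine c e).
  transitivity (\int[m']_x g x).
    apply: eq_measure_integral => A mA _.
    exact: (lebesgue_measure_affine e c0 mA).
  rewrite ge0_integral_mscale//; congr (_ * _).
  by rewrite ge0_integral_pushforward.
have [a_gt0|a_lt0|a_eq0] := ltgtP 0%R a; last by rewrite a_eq0 eqxx in a0.
  by rewrite gtr0_norm// (pos a b).
rewrite ltr0_norm//.
transitivity (\int[mu]_x f (- x)%R).
  transitivity (\int[pushforward mu (-%R : measurableTypeR R -> measurableTypeR R)]_x f x).
    by apply: eq_measure_integral => A mA _; exact/esym/lebesgue_measureN.
  by rewrite ge0_integral_pushforward.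
rewrite (pos (- a)%R (- b)%R (fun x => f (- x)%R)) ?oppr_gt0//; last first.
  by apply: measurableT_comp => //; exact: oppr_measurable.
congr (_ * _); apply: eq_integral => x _; congr f.
by rewrite opprD opprK mulNr opprK.
Qed.

Lemma ge0_integral_translation (b : R) (f : measurableTypeR R -> \bar R) :
  measurable_fun setT f -> (forall x, 0 <= f x) ->
  \int[mu]_x f (x + b)%R = \int[mu]_x f x.
Proof.
move=> mf f0; rewrite [RHS](ge0_integral_affine b (oner_neq0 R))// normr1 mul1e.
by apply: eq_integral => x _; rewrite mul1r.
Qed.

End real_line.

Definition cross (R : realType) (u v : R * R) : R := u.1 * v.2 - u.2 * v.1.

Section plane.
Context {R : realType}.
Local Notation mu := (@lebesgue_measure R).
Local Open Scope ereal_scope.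

(** A copy of the area measure that carries a sigma-finite structure, as [iint] and Tonelli
    require. *)
Definition leb2 : set (plane R) -> \bar R := lebesgue_measure2 R.

HB.instance Definition _ := Measure.copy leb2 (lebesgue_measure2 R).

Let leb2_sigma_finite : sigma_finite setT leb2.
Proof.
have /sigma_finiteP[F [TF ndF Foo]] := sigma_finiteT (@lebesgue_measure R).
exists (fun n => F n `*` F n).
  apply/seteqP; split => // -[x y] _.
  have : setT x by []. have : setT y by [].
  rewrite TF => -[n _ Fy] [m _ Fx]; exists (maxn n m) => //; split.
    by move: x Fx; exact/subsetPset/ndF/leq_maxr.
  by move: y Fy; exact/subsetPset/ndF/leq_maxl.
move=> k; have [mFk Fk] := Foo k; split; first exact: measurableX.
rewrite /leb2 /lebesgue_measure2 [X in X < _]product_measure1E//.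
by rewrite lte_mul_pinfty// ge0_fin_numE.
Qed.

HB.instance Definition _ := Measure_isSigmaFinite.Build _ _ _ leb2 leb2_sigma_finite.

Definition frame (p u v : R * R) (z : plane R) : plane R :=
  (p.1 + z.1 * u.1 + z.2 * v.1, p.2 + z.1 * u.2 + z.2 * v.2)%R.

Lemma measurable_frame_param d (P : measurableType d)
   (p u v z : P -> plane R) :
  measurable_fun setT p -> measurable_fun setT u -> measurable_fun setT v ->
  measurable_fun setT z ->
  measurable_fun setT (fun q => frame (p q) (u q) (v q) (z q)).
Proof.
move=> mp mu mv mz.
have m1 (f : P -> plane R) : measurable_fun setT f ->
    measurable_fun setT (fun q => (f q).1).
  by move=> mf; apply: measurableT_comp => //; exact: measurable_fst.
have m2 (f : P -> plane R) : measurable_fun setT f ->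
    measurable_fun setT (fun q => (f q).2).
  by move=> mf; apply: measurableT_comp => //; exact: measurable_snd.
apply: measurable_fun_pair.
  by repeat first [apply: measurable_funD|apply: measurable_funM|exact: m1|exact: m2].
by repeat first [apply: measurable_funD|apply: measurable_funM|exact: m1|exact: m2].
Qed.

Lemma measurable_frame p u v : measurable_fun setT (frame p u v).
Proof. by apply: measurable_frame_param => //. Qed.

(** Two affine substitutions on the line: for fixed [x] the variable [y] is replaced by the first
    coordinate [t] of the image point, which divides by [v.1]; after an exchange of integrals, [x]
    is replaced by the second coordinate for fixed [t]. The factors [v.1] and [c] multiply to the
    determinant up to sign. *)
Let iterated_frame (p u v : R * R) (f : plane R -> \bar R) :
  v.1 != 0%R -> cross u v != 0%R ->
  measurable_fun setT f -> (forall z, 0 <= f z) ->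
  \int[mu]_x \int[mu]_y f (x, y) =
  `|cross u v|%:E * \int[mu]_x \int[mu]_y f (frame p u v (x, y)).
Proof.
move=> v10 uv mf f0.
have mfr : measurable_fun setT (fun z => f (frame p u v z)).
  by apply: measurableT_comp => //; exact: measurable_frame.
pose c := (u.2 - u.1 * v.2 / v.1)%R.
have cE : (`|cross u v| = `|v.1| * `|c|)%R.
  by rewrite -normrM /c /cross -[LHS]normrN; congr (`|_|)%R; field.
have c0 : c != 0%R.
  by apply: contra_neq uv => c0; apply/eqP; rewrite -normr_eq0 cE c0 normr0 mulr0.
pose e x := (p.2 - (p.1 + x * 0) * v.2 / v.1)%R.
pose g x t := f (t, p.2 + x * u.2 + (t - p.1 - x * u.1) / v.1 * v.2)%R.
have mg : measurable_fun setT (fun q : plane R => g q.1 q.2).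
  apply: measurableT_comp => //; apply: measurable_fun_pair => //.
  have m1 : measurable_fun setT (fun q : plane R => q.1) by exact: measurable_fst.
  have m2 : measurable_fun setT (fun q : plane R => q.2) by exact: measurable_snd.
  apply: measurable_funD.
    by apply: measurable_funD => //; exact: measurable_funM.
  apply: measurable_funM => //; apply: measurable_funM => //.
  apply: measurable_funB; first exact: measurable_funB.
  exact: measurable_funM.
have g0 (q : plane R) : 0 <= g q.1 q.2 by exact: f0.
have inner x : \int[mu]_t g x t = `|v.1|%:E * \int[mu]_y f (frame p u v (x, y)).
  rewrite (ge0_integral_affine (p.1 + x * u.1)%R v10)//; last first.
  - by move=> y; exact: f0.
  - by apply: (measurableT_comp (f := fun q : plane R => g q.1 q.2) mg
      (g := fun y : measurableTypeR R => (x, y))); exact: measurable_fun_pair.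
  congr (_ * _); apply: eq_integral => y _; rewrite /g /frame/=; congr f.
  by congr pair; field.
transitivity (`|c|%:E * \int[mu]_x \int[mu]_t g x t); last first.
  rewrite cE EFinM -!muleA muleCA; congr (_ * _).
  under eq_integral do rewrite inner.
  rewrite ge0_integralZl//.
  - exact: (measurable_fun_fubini_tonelli_F (fun z => f (frame p u v z))).
  - by move=> x _; exact: integral_ge0.
rewrite (fubini_tonelli (fun q : plane R => g q.1 q.2))//=.
rewrite -ge0_integralZl//; last 2 first.
- exact: (measurable_fun_fubini_tonelli_G (fun q : plane R => g q.1 q.2)).
- by move=> t _; apply: integral_ge0 => x _; exact: (g0 (x, t)).
apply: eq_integral => t _.
rewrite (ge0_integral_affine (p.2 + (t - p.1) / v.1 * v.2)%R c0)//; last first.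
  by apply: measurableT_comp => //; exact: measurable_fun_pair.
congr (_ * _); apply: eq_integral => x _; rewrite /g /c; congr f.
by congr pair; field.
Qed.

Lemma integral_frame (p u v : R * R) (f : plane R -> \bar R) :
  cross u v != 0%R -> measurable_fun setT f -> (forall z, 0 <= f z) ->
  \int[leb2]_z f z = `|cross u v|%:E * \int[leb2]_z f (frame p u v z).
Proof.
move=> uv mf f0.
have mfr u' v' : measurable_fun setT (fun z => f (frame p u' v' z)).
  by apply: measurableT_comp => //; exact: measurable_frame.
rewrite /leb2 !fubini_tonelli1//.
(* If [v.1 = 0] then [u.1 != 0], and the two vectors exchange their roles by Tonelli. *)
have [v10|v10] := eqVneq v.1 0%R; last first.
  by rewrite /fubini_F; exact: iterated_frame.
rewrite /fubini_F.
rewrite (fubini_tonelli (fun z => f (frame p u v z)))//=.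
have -> : cross u v = (- cross v u)%R by rewrite /cross; ring.
have u10 : u.1 != 0%R.
  by move: uv; rewrite /cross v10 mulr0 subr0 mulf_eq0 => /norP[].
have vu : cross v u != 0%R.
  move: uv; rewrite -oppr_eq0 /cross opprB.
  by rewrite [(v.2 * _)%R]mulrC [(v.1 * _)%R]mulrC.
rewrite normrN (iterated_frame p u10 vu mf f0).
congr (_ * _); apply: eq_integral => x _; apply: eq_integral => y _.
by rewrite /frame /=; congr f; congr pair; ring.
Qed.

(** Separates the two coordinates of all points. For contact points the outer variables become the
    distances of the sides, and the inner ones the positions along the sides, which can be
    integrated first. *)
Lemma iint_zip n (F : seq (plane R) -> \bar R) :
  (forall t, 0 <= F t) -> mseqF n F ->
  iint leb2 n F =
  iint mu n (fun l => iint mu n (fun t => F (zip l t))).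
Proof.
elim: n F => [//|n IH] F F0 mF /=.
have mF1 := mseqF_cons mF.
have mS : mseq n (fun (q : (plane R) * n.-tuple (measurableTypeR R)) t =>
    F (q.1 :: zip q.2 t)).
  pose F' (x : plane R) t := F (x :: t).
  suff : mseq n (fun (q : (plane R) * n.-tuple (measurableTypeR R)) t =>
    F' q.1 (zip q.2 t)) by [].
  apply: (@mseq_map _ (measurableTypeR R) _ _ n n _ (plane R) _ _ _ (plane R)
    ((0%R, 0%R) : plane R)) => //.
  - by move=> [x l] t st /=; rewrite size_zip size_tuple st minnn.
  move=> i ni; rewrite /mseq.
  rewrite [X in measurable_fun _ X](_ : _ = (fun q => (tnth q.1.2 (Ordinal ni), tnth q.2 (Ordinal ni)))).
    apply: measurable_fun_pair.
      apply: (measurableT_comp (measurable_tnth _)).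
      by apply: measurableT_comp; [exact: measurable_snd|exact: measurable_fst].
    by apply: (measurableT_comp (measurable_tnth _)); exact: measurable_snd.
  apply/funext => -[[x l] t]; rewrite nth_zip ?size_tuple//=.
  by rewrite !(tnth_nth 0%R).
have mSl : mseq n (fun (x : plane R) (l : seq (measurableTypeR R)) =>
    iint mu n (fun t => F (x :: zip l t))).
  exact: (@mseq_iint _ _ _ mu _ _ n n _ _ (fun x l t => F (x :: zip l t))).
transitivity (\int[leb2]_x iint mu n (fun l => iint mu n (fun t => F (x :: zip l t)))).
  apply: eq_integral => x _; apply: IH => //.
  exact: (mseq_sec _ mF1).
rewrite /leb2 fubini_tonelli1; last 2 first.
- by apply: measurable_iint => // x l; exact: iint_ge0.
- by move=> x; apply: iint_ge0 => l; exact: iint_ge0.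
apply: eq_integral => x _; rewrite /fubini_F.
rewrite (integral_iint_swap mu mu
  (F := fun (y : measurableTypeR R) l => iint mu n (fun t => F ((x, y) :: zip l t))))//.
  by move=> y l; exact: iint_ge0.
apply: (mseq_param (h := fun y : measurableTypeR R => (x, y)) _ mSl).
exact: measurable_fun_pair.
Qed.

End plane.

(** * Volume of convex chains *)

Lemma measurable_boolR d (T : measurableType d) (R : realType) (f : T -> bool) :
  measurable_fun setT f -> measurable_fun setT (fun x => (f x)%:R : R).
Proof.
move=> mf; rewrite (_ : (fun x => _) = (fun x => if f x then 1 else 0 : R)).
  by apply: measurable_fun_if => //; exact: measurable_cst.
by apply/funext => x; case: (f x).
Qed.

Lemma measurable_comp_fst d d1 d2 (T : measurableType d) (T1 : measurableType d1)
   (T2 : measurableType d2) (F : T1 -> T) :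
  measurable_fun setT F -> measurable_fun setT (fun x : T1 * T2 => F x.1).
Proof. by move=> mF; apply: (measurableT_comp mF measurable_fst). Qed.

Lemma measurable_p1 (R : realType) d (T : measurableType d) (f : T -> plane R) :
  measurable_fun setT f -> measurable_fun setT (fun x => (f x).1).
Proof. by move=> mf; apply: (measurableT_comp measurable_fst mf). Qed.

Lemma measurable_p2 (R : realType) d (T : measurableType d) (f : T -> plane R) :
  measurable_fun setT f -> measurable_fun setT (fun x => (f x).2).
Proof. by move=> mf; apply: (measurableT_comp measurable_snd mf). Qed.

Lemma measurable_fst_comp d d1 d2 (T : measurableType d) (T1 : measurableType d1)
   (T2 : measurableType d2) (f : T -> T1 * T2) :
  measurable_fun setT f -> measurable_fun setT (fun x => (f x).1).
Proof. by move=> mf; apply: (measurableT_comp measurable_fst mf). Qed.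

Lemma measurable_snd_comp d d1 d2 (T : measurableType d) (T1 : measurableType d1)
   (T2 : measurableType d2) (f : T -> T1 * T2) :
  measurable_fun setT f -> measurable_fun setT (fun x => (f x).2).
Proof. by move=> mf; apply: (measurableT_comp measurable_snd mf). Qed.

(** Inversion is the power function of exponent [-1] on the nonnegative reals, continued by
    oddness. *)
Lemma measurable_invr (R : realType) d (T : measurableType d) (f : T -> R) :
  measurable_fun setT f -> measurable_fun setT (fun x => (f x)^-1).
Proof.
have mN : measurable_fun setT (fun x : R => - x) by exact: oppr_measurable.
have mV : measurable_fun setT (fun x : R => x^-1).
  rewrite (_ : (fun _ => _) = (fun x : R => if 0 <= x then x `^ (-1)
    else - ((- x) `^ (-1)))); last first.
    apply/funext => x; case: leP => x0; first by rewrite powR_inv1.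
    by rewrite powR_inv1 ?oppr_ge0 ?ltW// invrN opprK.
  apply: measurable_fun_if => //.
  - exact: measurable_fun_ler.
  - by apply: measurable_funTS; exact: measurable_powR.
  - apply: measurable_funTS; apply: (measurableT_comp mN).
    apply: (@measurableT_comp _ _ _ _ _ _ (fun x : R => x `^ (-1)) setT
      (fun x : R => - x)) => //; exact: measurable_powR.
by move=> mf; exact: (measurableT_comp mV mf).
Qed.

Ltac meas := repeat first
  [ assumption
  | exact: measurable_cst
  | exact: measurable_id
  | exact: measurable_fst
  | exact: measurable_snd
  | apply: measurable_fun_pair
  | apply: measurable_and
  | apply: measurable_boolR
  | apply: measurable_fun_ltr
  | apply: measurable_fun_ler
  | apply: measurable_funB
  | apply: measurable_funD
  | apply: measurable_funM
  | apply: measurable_funX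
  | apply: measurable_invr
  | apply: measurable_p1
  | apply: measurable_p2
  | apply: measurable_fst_comp
  | apply: measurable_snd_comp ].

Lemma iint0 d (T : measurableType d) (R : realType)
    (mu : {sigma_finite_measure set T -> \bar R}) n : iint mu n (fun=> 0%E) = 0%E.
Proof. by elim: n => [//|n IH] /=; under eq_integral do rewrite IH; rewrite integral0. Qed.

Section one_dimensional_integrals.
Context {R : realType}.
Local Notation mu := (@lebesgue_measure R).
Local Open Scope ereal_scope.

(** The scaling [x = A y] reduces it to Euler's beta function at integers. *)
Lemma integral_beta (A : R) a b : (0 < A)%R ->
  \int[mu]_x ((0 < x < A)%R%:R * (x ^+ a * (A - x) ^+ b))%:E =
  (A ^+ (a + b).+1 * ((a`! * b`!)%:R / (a + b).+1`!%:R))%:E.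
Proof.
move=> A0.
rewrite (@ge0_integral_affine _ A 0%R)//; last 3 first.
- by rewrite gt_eqF.
- by apply/measurable_EFinP; meas.
- move=> x; rewrite lee_fin; case: (boolP (0 < x < A)%R) => [/andP[x0 xA]|_].
    by rewrite mul1r mulr_ge0// exprn_ge0 ?subr_ge0// ltW.
  by rewrite mul0r.
rewrite gtr0_norm//.
transitivity (A%:E * \int[mu]_x ((A ^+ (a + b))%:E *
    ((0 < x < 1)%R%:R * XMonemX a b x)%:E)).
  congr (_ * _); apply: eq_integral => x _; rewrite -EFinM; congr EFin.
  rewrite addr0 pmulr_rgt0//.
  have -> : (A * x < A)%R = (x < 1)%R by rewrite -[X in (_ < X)%R]mulr1 ltr_pM2l.
  case: (0 < x < 1)%R; rewrite ?mul0r ?mulr0// !mul1r /XMonemX.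
  by rewrite exprMn -{2}[A]mulr1 -mulrBr exprMn exprD; ring.
rewrite ge0_integralZl//; last 3 first.
- by apply/measurable_EFinP; apply: measurable_funM; [meas|exact: measurable_XMonemX].
- move=> x _; rewrite lee_fin; case: (boolP (0 < x < 1)%R) => [/andP[x0 xA]|_].
    by rewrite mul1r XMonemX_ge0// in_itv/= !ltW.
  by rewrite mul0r.
- by rewrite lee_fin exprn_ge0// ltW.
have -> : \int[mu]_x ((0 < x < 1)%R%:R * XMonemX a b x)%:E =
    (beta_fun a.+1 b.+1)%:E.
  rewrite EFin_beta_fun/= integral_XMonemX_restrict setTI.
  rewrite integral_itv_bndoo; last first.
    by apply/measurable_EFinP; exact: measurable_XMonemX.
  rewrite [RHS]integral_mkcond; apply: eq_integral => x _.
  rewrite patchE mem_setE in_itv/=; case: (0 < x < 1)%R.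
    by rewrite mul1r.
  by rewrite mul0r.
rewrite beta_fun_fact -!EFinM; congr EFin.
by rewrite exprS -mulrA.
Qed.

End one_dimensional_integrals.

Section chains.
Context {R : realType}.
Implicit Types (p q d e w : R * R) (t : seq (R * R)).

(* Convex chains from [p] to [q] all of whose edges turn left of [d] and stay
   right of [e]; [t] lists the vertices strictly between the end points. *)
Fixpoint chain e p d t q : bool :=
  match t with
  | [::] => (0 < cross d (q - p)) && (0 < cross (q - p) e)
  | w :: t' => [&& 0 < cross d (w - p), 0 < cross (w - p) e
                & chain e w (w - p) t' q]
  end.

(* Volume of the chains with [m] inner vertices, for [d] and [e] with
   [cross d e = 1]. *)
Definition chain_const m : R := ((m.+1`! * m`! * m`!)%:R)^-1.

Lemma chain_const_ge0 m : 0 <= chain_const m.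
Proof. by rewrite invr_ge0 ler0n. Qed.

(** With [q - p = A d + B e] the base of the power is [A B cross d e], twice the area of the
    triangle formed by the chord and the lines through [p] along [d] and through [q] along [e]. The
    Boolean factor says that the chord points into the cone between [d] and [e]. *)
Definition chain_vol m e p d q : R :=
  ((0 < cross d (q - p)) && (0 < cross (q - p) e))%:R *
  (chain_const m * (cross d (q - p) * cross (q - p) e / cross d e) ^+ m).

Lemma measurable_cross dT (T : measurableType dT) (f g : T -> plane R) :
  measurable_fun setT f -> measurable_fun setT g ->
  measurable_fun setT (fun x => cross (f x) (g x)).
Proof. by move=> mf mg; rewrite /cross; meas. Qed.

Lemma measurable_subpt dT (T : measurableType dT) (f g : T -> plane R) :
  measurable_fun setT f -> measurable_fun setT g ->
  measurable_fun setT (fun x => ((f x : R * R) - g x : R * R) : plane R).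
Proof.
move=> mf mg.
rewrite (_ : (fun x => _) = (fun x => ((f x).1 - (g x).1, (f x).2 - (g x).2) : plane R))//.
by meas.
Qed.

Lemma mseq_chain dT (P : measurableType dT) m (e p d q : P -> plane R) :
  measurable_fun setT e -> measurable_fun setT p -> measurable_fun setT d ->
  measurable_fun setT q ->
  mseq m (fun x (t : seq (plane R)) => chain (e x) (p x) (d x) t (q x)).
Proof.
elim: m dT P e p d q => [|m IH] dT P e p d q me mp md mq.
  apply/mseq0; rewrite /=; apply: measurable_and; apply: measurable_fun_ltr => //;
    by apply: measurable_cross => //; exact: measurable_subpt.
apply/mseqS => /=.
have mfst (f : P -> plane R) : measurable_fun setT f ->
    measurable_fun setT (fun q : P * plane R => f q.1).
  by move=> mf; apply: (measurableT_comp mf); exact: measurable_fst.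
have mw : measurable_fun setT (fun q : P * plane R => q.2) by exact: measurable_snd.
have mwp := measurable_subpt mw (mfst _ mp).
apply: measurable_and.
  apply: (measurable_comp_fst (F := fun q : P * plane R =>
    0 < cross (d q.1) ((q.2 : R * R) - p q.1))).
  apply: measurable_fun_ltr => //; apply: measurable_cross => //; exact: mfst.
apply: measurable_and.
  apply: (measurable_comp_fst (F := fun q : P * plane R =>
    0 < cross ((q.2 : R * R) - p q.1) (e q.1))).
  apply: measurable_fun_ltr => //; apply: measurable_cross => //; exact: mfst.
by apply: (IH _ (P * plane R)%type (fun x => e x.1) (fun x => x.2)
  (fun x => (x.2 : R * R) - p x.1) (fun x => q x.1)) => //; exact: mfst.
Qed.

Let factn0 m : (m`!%:R : R) != 0.
Proof. by rewrite pnatr_eq0 -lt0n fact_gt0. Qed.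

Let chain_alg_inner (K A B x : R) m : A != 0 -> x != 0 ->
  K * (A - x) ^+ m * (A / x) ^+ m *
    ((x * B / A) ^+ m.+1 * (m`!%:R / m.+1`!%:R)) =
  K * B ^+ m.+1 / A / m.+1%:R * (x * (A - x) ^+ m).
Proof.
move=> A0 x0; have f0 := factn0 m.
have m0 : (m.+1%:R : R) != 0 by rewrite pnatr_eq0.
rewrite factS natrM (exprS (x * B / A)) (exprS B).
have -> : (x * B / A) ^+ m = B ^+ m * (x / A) ^+ m by rewrite -exprMn; congr (_ ^+ _); ring.
have e1 : (A / x) ^+ m * (x / A) ^+ m = 1.
  by rewrite -exprMn (_ : A / x * (x / A) = 1) ?expr1n//; field; rewrite A0 x0.
transitivity (K * (A - x) ^+ m * ((A / x) ^+ m * (x / A) ^+ m) *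
  (x * B / A * B ^+ m * (m`!%:R / (m.+1%:R * m`!%:R)))); first by ring.
rewrite e1; move: (m.+1%:R) (m`!%:R) m0 f0 => M F M0 F0; field.
by rewrite A0 F0 M0.
Qed.

Let chain_alg_outer (D A B : R) m : A != 0 -> D != 0 ->
  D * (chain_const m * D ^+ m * B ^+ m.+1 / A / m.+1%:R *
    (A ^+ (1 + m).+1 * ((1`! * m`!)%:R / (1 + m).+1`!%:R))) =
  chain_const m.+1 * (B * D * (A * D) / D) ^+ m.+1.
Proof.
move=> A0 D0; have f0 := factn0 m.
have m0 : (m.+1%:R : R) != 0 by rewrite pnatr_eq0.
have m20 : (m.+2%:R : R) != 0 by rewrite pnatr_eq0.
have -> : B * D * (A * D) / D = A * B * D by field.
rewrite /chain_const add1n !factS fact0 muln1 mul1n !natrM !exprMn.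
rewrite (exprS A m.+1) (exprS D m).
move: (m.+1%:R) (m.+2%:R) (m`!%:R) m0 m20 f0 => M M2 F M0 M20 F0; field.
by rewrite A0 F0 M0 M20.
Qed.

Local Open Scope ereal_scope.
Local Notation mu := (@lebesgue_measure R).
Local Notation leb2 := (@leb2 R).

(** The first inner vertex is [p + x d + y e], and the end is [q = p + A d + B e]. The left turn at
    this vertex becomes [y < x B / A]: the vertex lies on the corner side of the chord. The volume
    of the remaining chain is then a product of powers, ready for beta integrals first in [y], then
    in [x]. *)
Let chain_vol_frame (p d e q : R * R) (A B : R) m (x y : R) :
  (0 < cross d e)%R -> (q.1 = p.1 + A * d.1 + B * e.1)%R ->
  (q.2 = p.2 + A * d.2 + B * e.2)%R ->
  let w := (p.1 + x * d.1 + y * e.1, p.2 + x * d.2 + y * e.2)%R in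
  (([&& 0 < cross d (w - p)%R & 0 < cross (w - p)%R e])%:R *
    chain_vol m e w (w - p) q =
  (0 < x < A)%R%:R * ((0 < y < x * B / A)%R%:R *
    (chain_const m * cross d e ^+ m * (A - x) ^+ m * (A / x) ^+ m
     * (x * B / A - y) ^+ m)))%R.
Proof.
move=> D0 q1 q2 w.
have E1 : (cross d (w - p) = y * cross d e)%R by rewrite /cross/=; ring.
have E2 : (cross (w - p) e = x * cross d e)%R by rewrite /cross/=; ring.
have E3 : (cross (w - p) (q - w) = (x * B - y * A) * cross d e)%R.
  by rewrite /cross/= q1 q2; ring.
have E4 : (cross (q - w) e = (A - x) * cross d e)%R.
  by rewrite /cross/= q1 q2; ring.
rewrite /chain_vol E1 E2 E3 E4 !pmulr_lgt0// !subr_gt0.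
case: (ltrP 0%R y) => y0; last by rewrite /= !mul0r mulr0.
case: (ltrP 0%R x) => x0; last by rewrite /= !mul0r.
case: (ltrP x A) => xA; last by rewrite /= andbF !mul0r mulr0.
have A0 : (0 < A)%R by exact: lt_trans xA.
rewrite /= andbT ltr_pdivlMr//.
case: (ltrP (y * A) (x * B))%R => yA; last by rewrite !mul0r !mulr0.
rewrite !mul1r -!mulrA; congr (_ * _)%R.
rewrite -!exprMn; congr (_ ^+ _)%R.
by field; rewrite !gt_eqF.
Qed.

(** Induction on the first inner vertex [w]: what follows is a chain for the directions [w - p] and
    [e], so [p] and [d] must stay general. The integrals over [y] and [x] contribute [1 / (m + 1)]
    and [1 / ((m + 1) (m + 2))], the quotient of two successive values of [chain_const]. *)
Lemma iint_chain m e p d q : (0 < cross d e)%R ->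
  iint leb2 m (fun t => (chain e p d t q)%:R%:E) = (chain_vol m e p d q)%:E.
Proof.
elim: m p d => [|m IH] p d D0.
  by rewrite /= /chain_vol expr0 /chain_const/= invr1 !mulr1.
pose A := (cross (q - p) e / cross d e)%R.
pose B := (cross d (q - p) / cross d e)%R.
have D0' : cross d e != 0%R by rewrite gt_eqF.
have q1 : (q.1 = p.1 + A * d.1 + B * e.1)%R.
  by move: D0'; rewrite /A /B /cross /= => ?; field.
have q2 : (q.2 = p.2 + A * d.2 + B * e.2)%R.
  by move: D0'; rewrite /A /B /cross /= => ?; field.
pose h (w : plane R) : R := (([&& 0 < cross d ((w : R * R) - p)%R
  & 0 < cross ((w : R * R) - p)%R e])%:R * chain_vol m e w ((w : R * R) - p) q)%R.
have hge0 w : (0 <= h w)%R.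
  rewrite /h /chain_vol.
  case: (boolP (_ && _)) => [/andP[a1 a2]|_]; last by rewrite mul0r.
  rewrite mul1r; case: (boolP (_ && _)) => [/andP[a3 a4]|_]; last by rewrite mul0r.
  rewrite mul1r mulr_ge0 ?chain_const_ge0// exprn_ge0// divr_ge0 ?(ltW a2)//.
  by rewrite mulr_ge0// ltW.
rewrite /=.
transitivity (\int[leb2]_w (h w)%:E).
  apply: eq_integral => w _; rewrite /h.
  case: (boolP (0 < cross d (w - p))%R) => a1 /=; last first.
    by rewrite mul0r iint0.
  case: (boolP (0 < cross (w - p) e)%R) => a2 /=; last first.
    by rewrite mul0r iint0.
  by rewrite mul1r -IH.
have mh : measurable_fun setT h.
  have mw : measurable_fun setT (fun w : plane R => w) by exact: measurable_id.
  have mp : measurable_fun setT (fun w : plane R => (p : plane R)) by exact: measurable_cst.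
  have md : measurable_fun setT (fun w : plane R => (d : plane R)) by exact: measurable_cst.
  have me : measurable_fun setT (fun w : plane R => (e : plane R)) by exact: measurable_cst.
  have mq : measurable_fun setT (fun w : plane R => (q : plane R)) by exact: measurable_cst.
  have mwp := measurable_subpt mw mp.
  have mqw := measurable_subpt mq mw.
  have c1 := measurable_cross md mwp.
  have c2 := measurable_cross mwp me.
  have c3 := measurable_cross mwp mqw.
  have c4 := measurable_cross mqw me.
  rewrite /h /chain_vol; apply: measurable_funM; first by meas.
  apply: measurable_funM; first by meas.
  apply: measurable_funM; first by meas.
  apply: measurable_funX; apply: measurable_funM; first by meas.
  by apply: measurable_invr.
rewrite (integral_frame p D0')//; last first.
  by apply/measurable_EFinP.
rewrite gtr0_norm//.
pose g (x y : R) := ((0 < x < A)%R%:R * ((0 < y < x * B / A)%R%:R *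
    (chain_const m * cross d e ^+ m * (A - x) ^+ m * (A / x) ^+ m
     * (x * B / A - y) ^+ m)))%R.
have hg (z : plane R) : h (frame p d e z) = g z.1 z.2.
  by rewrite /h /g -(chain_vol_frame m _ _ D0 q1 q2).
rewrite fubini_tonelli1//=; last first.
- by move=> z; rewrite lee_fin.
- by apply/measurable_EFinP; apply: (measurableT_comp mh); exact: measurable_frame.
rewrite /fubini_F.
have CC0 : (0 <= chain_const m * cross d e ^+ m)%R.
  by rewrite mulr_ge0 ?chain_const_ge0// exprn_ge0// ltW.
have AD : cross (q - p)%R e = (A * cross d e)%R by rewrite /A mulfVK.
have BD : cross d (q - p)%R = (B * cross d e)%R by rewrite /B mulfVK.
have [/andP[A0 B0]|AB] := boolP ((0 < A) && (0 < B))%R; last first.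
  rewrite [X in _ * X = _](_ : _ = 0); last first.
    rewrite integral0_eq// => x _; rewrite integral0_eq// => y _; rewrite hg /g/=.
    case: (boolP (0 < x < A)%R) => [/andP[x0 xA]|]; last by rewrite mul0r.
    case: (boolP (0 < y < x * B / A)%R) => [/andP[y0 yB]|]; last by rewrite mul0r mulr0.
    have A0 := lt_trans x0 xA; move: AB; rewrite A0/= => /negP[].
    have := lt_trans y0 yB; by rewrite pmulr_lgt0 ?invr_gt0// pmulr_rgt0.
  rewrite mule0 /chain_vol AD BD.
  have -> : ((0 < B * cross d e) && (0 < A * cross d e))%R = false.
    by rewrite !(pmulr_lgt0 _ D0) andbC; exact/negbTE.
  by rewrite mul0r.
transitivity ((cross d e)%:E * \int[mu]_x ((chain_const m * cross d e ^+ m * B ^+ m.+1 / A / m.+1%:R)%:E *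
    ((0 < x < A)%R%:R * (x ^+ 1 * (A - x) ^+ m))%:E)).
  congr (_ * _); apply: eq_integral => x _.
  transitivity (\int[mu]_y (((0 < x < A)%R%:R * (chain_const m * cross d e ^+ m * (A - x) ^+ m * (A / x) ^+ m))%:E *
     ((0 < y < x * B / A)%R%:R * (y ^+ 0 * (x * B / A - y) ^+ m))%:E)).
    apply: eq_integral => y _; rewrite hg /g/= -EFinM; congr EFin.
    by rewrite expr0 mul1r; ring.
  case: (boolP (0 < x < A)%R) => [/andP[x0 xA]|_]; last first.
    rewrite !mul0r !mule0; under eq_integral do rewrite mul0e.
    by rewrite integral0.
  have c0 : (0 < x * B / A)%R by rewrite divr_gt0// mulr_gt0.
  rewrite ge0_integralZl//.
  - rewrite integral_beta// -!EFinM; congr EFin.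
    by rewrite add0n fact0 mul1n !mul1r expr1 chain_alg_inner ?gt_eqF.
  - by apply/measurable_EFinP; meas.
  - move=> y _; rewrite lee_fin; case: (boolP (0 < y < _)%R) => [/andP[y0 yc]|_].
      by rewrite expr0 !mul1r exprn_ge0// subr_ge0 ltW.
    by rewrite mul0r.
  - rewrite lee_fin mul1r; apply: mulr_ge0; last by rewrite exprn_ge0// divr_ge0// ltW.
    by apply: mulr_ge0 => //; rewrite exprn_ge0// subr_ge0 ltW.
rewrite ge0_integralZl//; last 3 first.
- by apply/measurable_EFinP; meas.
- move=> x _; rewrite lee_fin; case: (boolP (0 < x < A)%R) => [/andP[x0 xA]|_].
    by rewrite expr1 mul1r mulr_ge0 ?exprn_ge0 ?subr_ge0 ?(ltW xA)// ltW.
  by rewrite mul0r.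
- rewrite lee_fin; apply: mulr_ge0; last by rewrite invr_ge0 ler0n.
  apply: mulr_ge0; last by rewrite invr_ge0 ltW.
  by apply: mulr_ge0 => //; rewrite exprn_ge0// ltW.
rewrite integral_beta// -!EFinM; congr EFin.
rewrite /chain_vol AD BD !(pmulr_lgt0 _ D0) A0 B0 mul1r.
by rewrite chain_alg_outer ?gt_eqF.
Qed.

End chains.

(** * Convex position and turns *)

Section convex_hulls.
Context {R : realType}.
Implicit Types (x y a b d e u : R * R).

Lemma plane_eqP x y : x.1 = y.1 -> x.2 = y.2 -> x = y.
Proof. by case: x => ? ?; case: y => ? ? /= -> ->. Qed.

Lemma cross_decomp d e u : cross d e != 0 ->
  u = (cross u e / cross d e) *: d + (cross d u / cross d e) *: e.
Proof.
case: d e u => [d1 d2] [e1 e2] [u1 u2]; rewrite /cross/= => h0.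
by apply: plane_eqP; rewrite /= /GRing.scale/=; field.
Qed.

Lemma convex_hull_convex m (p : 'I_m -> R * R) x y (t : R) :
  convex_hull p x -> convex_hull p y -> 0 <= t <= 1 ->
  convex_hull p (t *: x + (1 - t) *: y).
Proof.
move=> [w [w0 w1] ->] [v [v0 v1] ->] /andP[t0 t1].
have t1' : 0 <= 1 - t by rewrite subr_ge0.
exists (fun i => t * w i + (1 - t) * v i).
  split=> [i|]; first by rewrite addr_ge0// mulr_ge0.
  by rewrite big_split/= -!mulr_sumr w1 v1 !mulr1 addrC subrK.
rewrite !scaler_sumr -big_split/=; apply: eq_bigr => i _.
by rewrite !scalerA -scalerDl.
Qed.

Lemma convex_hull_point m (p : 'I_m -> R * R) i : convex_hull p (p i).
Proof.
exists (fun j => (j == i)%:R).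
  split=> [j|]; first by rewrite ler0n.
  by rewrite (bigD1 i)//= eqxx big1 ?addr0// => j /negPf ->.
by rewrite (bigD1 i)//= eqxx scale1r big1 ?addr0// => j /negPf ->; rewrite scale0r.
Qed.

(** Carathéodory's form of convex position in the plane. The three points may coincide, so segments
    are covered too; all geometric arguments about a given sample use convex position only in this
    form. *)
Definition conv3_free (z : seq (R * R)) := forall x y1 y2 y3 (a b c : R),
  x \in z -> y1 \in z -> y2 \in z -> y3 \in z ->
  y1 != x -> y2 != x -> y3 != x ->
  0 <= a -> 0 <= b -> 0 <= c -> a + b + c = 1 ->
  x = a *: y1 + b *: y2 + c *: y3 -> False.

(** A vertex is not a combination of two other points of the hull, and a combination of three points
    is one of [y1] and a point [y'] of the segment from [y2] to [y3]. *)
Lemma convex_position_conv3_free n (z : n.-tuple (R * R)) :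
  convex_position z -> conv3_free z.
Proof.
move=> [uz [m [p hp]]] x y1 y2 y3 a b c xz y1z y2z y3z n1 n2 n3 a0 b0 c0 abc xE.
have H y : y \in (z : seq _) -> vertices (convex_hull p) y by rewrite hp.
have [_ xv] := H _ xz.
have [h1 _] := H _ y1z; have [h2 _] := H _ y2z; have [h3 _] := H _ y3z.
have two t u v : convex_hull p u -> convex_hull p v -> u != x -> v != x ->
    0 <= t <= 1 -> x = t *: u + (1 - t) *: v -> False.
  move=> hu hv ux vx /andP[t0 t1] E.
  have [t_0|tn0] := eqVneq t 0.
    by move: vx; rewrite E t_0 scale0r add0r subr0 scale1r eqxx.
  have [t_1|tn1] := eqVneq t 1.
    by move: ux; rewrite E t_1 scale1r subrr scale0r addr0 eqxx.
  have t01 : 0 < t < 1 by rewrite lt_def tn0 t0/= lt_neqAle tn1.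
  have uv := xv _ _ _ hu hv t01 E.
  by move: ux; rewrite E uv -scalerDl addrC subrK scale1r eqxx.
have [a1|an1] := eqVneq a 1.
  apply: (two 1 y1 y2) => //; first by rewrite ler01 lexx.
  have b_0 : b = 0 by lra. have c_0 : c = 0 by lra.
  by rewrite xE a1 b_0 c_0 subrr !scale0r !addr0.
have a_lt1 : a < 1 by rewrite lt_neqAle an1/=; lra.
pose t := b / (1 - a).
pose y' := t *: y2 + (1 - t) *: y3.
have a1n : 1 - a != 0 by rewrite subr_eq0 eq_sym.
have t01 : 0 <= t <= 1.
  by rewrite divr_ge0 ?subr_ge0 ?(ltW a_lt1)//= ler_pdivrMr ?subr_gt0//; lra.
have hy' : convex_hull p y' by exact: convex_hull_convex.
have yx : y' != x.
  apply/eqP => E; apply: (two t y2 y3) => //.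
apply: (two a y1 y') => //; first by rewrite a0 ltW.
rewrite /y' scalerDr !scalerA addrA xE.
have -> : (1 - a) * t = b by rewrite /t mulrC divfK.
by have -> : (1 - a) * (1 - t) = c; first (rewrite /t; have -> : c = 1 - a - b by lra); [field|].
Qed.

(** Every linear functional of the plane is some [cross g], and a strict minimizer is an extreme
    point. Conversely, an extreme point of the hull has a positive weight at some [tnth z i];
    splitting the combination into this point and the normalized rest forces equality with it. *)
Lemma convex_position_functional n (z : n.-tuple (R * R)) :
  uniq z ->
  (forall x, x \in (z : seq _) -> exists g : R * R, forall y, y \in (z : seq _) ->
    y != x -> cross g x < cross g y) ->
  convex_position z.
Proof.
move=> uz ex; split=> //; exists n, (tnth z).
have crossS g m (w : 'I_m -> R) (q : 'I_m -> R * R) :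
    cross g (\sum_i w i *: q i) = \sum_i w i * cross g (q i).
  elim/big_rec2 : _ => [|i u v _ IH]; first by rewrite /cross/= !mulr0 subrr.
  by rewrite -IH /cross/= /GRing.scale/=; ring.
apply/seteqP; split=> x /=.
  move=> [[w [w0 w1] xE] xv].
  have [i wi] : exists i, 0 < w i.
    apply/not_existsP => H.
    have : \sum_(i < n) w i = 0.
      by apply: big1 => i _; apply/eqP; rewrite eq_le w0 andbT leNgt; apply/negP/H.
    by move/eqP; rewrite w1 oner_eq0.
  suff -> : x = tnth z i by rewrite mem_tnth.
  have w1i : \sum_(j < n | j != i) w j = 1 - w i.
    by rewrite -w1 [in RHS](bigD1 i)//= addrAC subrr add0r.
  have [wi1|wi1] := eqVneq (w i) 1.
    rewrite xE (bigD1 i)//= wi1 scale1r big1 ?addr0// => j ji.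
    have /eqP := w1i; rewrite wi1 subrr psumr_eq0// => /allP /(_ j).
    by rewrite mem_index_enum ji => /(_ isT) /eqP ->; rewrite scale0r.
  have wl : w i < 1.
    by rewrite lt_neqAle wi1/= -subr_ge0 -w1i sumr_ge0.
  have n0 : 1 - w i != 0 by rewrite subr_eq0 eq_sym.
  pose y := \sum_(j < n) (if j == i then 0 else w j / (1 - w i)) *: tnth z j.
  have hy : convex_hull (tnth z) y.
    exists (fun j => if j == i then 0 else w j / (1 - w i)) => //; split.
      by move=> j; case: ifP => // _; rewrite divr_ge0// subr_ge0 ltW.
    rewrite (bigD1 i)//= eqxx add0r.
    rewrite (eq_bigr (fun j => w j / (1 - w i))); last by move=> j /negPf ->.
    by rewrite -mulr_suml w1i divff.
  have xE' : x = w i *: tnth z i + (1 - w i) *: y.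
    rewrite xE (bigD1 i)//=; congr (_ + _).
    rewrite /y scaler_sumr [RHS](bigD1 i)//= eqxx scale0r scaler0 add0r.
    by apply: eq_bigr => j /negPf ->; rewrite scalerA mulrC divfK.
  have zy := xv _ _ _ (convex_hull_point (tnth z) i) hy _ xE'.
  by rewrite xE' -zy ?wi// -scalerDl addrC subrK scale1r.
move=> xz; have [g gP] := ex _ xz.
have hx : convex_hull (tnth z) x.
  by move: xz => /tnthP[i ->]; exact: convex_hull_point.
have low a : convex_hull (tnth z) a ->
    cross g x <= cross g a /\ (cross g a = cross g x -> a = x).
  move=> [w [w0 w1] ->].
  have D : cross g (\sum_i w i *: tnth z i) - cross g x =
      \sum_i w i * (cross g (tnth z i) - cross g x).
    rewrite crossS -[X in _ - X]mul1r -w1 mulr_suml -sumrB.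
    by apply: eq_bigr => i _; rewrite [RHS]mulrBr.
  have T0 i : 0 <= w i * (cross g (tnth z i) - cross g x).
    rewrite mulr_ge0// subr_ge0; have [->//|ne] := eqVneq (tnth z i) x.
    by apply/ltW/gP; rewrite ?mem_tnth.
  split; first by rewrite -subr_ge0 D sumr_ge0.
  move=> E; move: D; rewrite E subrr => /esym/eqP; rewrite psumr_eq0// => /allP D.
  transitivity (\sum_i w i *: x); last by rewrite -scaler_suml w1 scale1r.
  apply: eq_bigr => i _; have := D i; rewrite mem_index_enum => /(_ isT).
  rewrite mulf_eq0 => /orP[/eqP ->|]; first by rewrite !scale0r.
  have [->//|ne] := eqVneq (tnth z i) x.
  by rewrite subr_eq0 gt_eqF// gP ?mem_tnth.
split=> // a b t ha hb /andP[t0 t1] E.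
have [la ea] := low _ ha; have [lb eb] := low _ hb.
have EE : cross g x = t * cross g a + (1 - t) * cross g b.
  by rewrite {1}E /cross/= /GRing.scale/=; ring.
have t1' : 0 < 1 - t by rewrite subr_gt0.
have p1 : 0 <= t * (cross g a - cross g x) by rewrite mulr_ge0 ?subr_ge0// ltW.
have p2 : 0 <= (1 - t) * (cross g b - cross g x) by rewrite mulr_ge0 ?subr_ge0// ltW.
have s0 : t * (cross g a - cross g x) + (1 - t) * (cross g b - cross g x) = 0.
  by move: EE; move: (cross g x) (cross g a) (cross g b) => X A B ->; ring.
move: s0 => /eqP; rewrite paddr_eq0// !mulf_eq0 !subr_eq0 (gt_eqF t0)/=.
rewrite [1 == t]eq_sym (lt_eqF t1)/= => /andP[/eqP /ea -> /eqP /eb ->].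
by [].
Qed.

End convex_hulls.

(** * Turns, cones of directions and angular order *)

Section orientation.
Context {R : realType}.
Implicit Types (x y z p q d e w : R * R) (s t : seq (R * R)).

Definition orient x y z : R := cross (y - x) (z - x).

(** Otherwise [y] would lie in the triangle [b x z]: the three quotients used as weights are its
    barycentric coordinates. *)
Lemma orient_conv3 x y z b (Z : seq (R * R)) : conv3_free Z ->
  b \in Z -> x \in Z -> y \in Z -> z \in Z ->
  0 < orient b x y -> 0 < orient b y z -> 0 < orient b x z -> 0 < orient x y z.
Proof.
move=> cf bZ xZ yZ zZ bxy byz bxz; rewrite ltNge; apply/negP => xyz.
pose T := orient b x z.
have T0 : T != 0 by rewrite gt_eqF.
have Tp : 0 < T by [].
apply: (cf y b x z (- orient x y z / T) (orient b y z / T) (orient b x y / T)) => //.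
- by apply: contraTneq bxy => ->; rewrite /orient /cross/= -leNgt; lra.
- by apply: contraTneq bxy => ->; rewrite /orient /cross/= -leNgt; lra.
- by apply: contraTneq byz => ->; rewrite /orient /cross/= -leNgt; lra.
- by rewrite divr_ge0 ?oppr_ge0// ltW.
- by rewrite divr_ge0// ltW.
- by rewrite divr_ge0// ltW.
- by move: T0; rewrite /T /orient /cross/= => T0; field.
- by move: T0; rewrite /T /orient /cross/= => T0; apply: plane_eqP;
    rewrite /= /GRing.scale/=; field.
Qed.

Definition left_turns s := forall i j k, (i < j < k)%N -> (k < size s)%N ->
  0 < orient (nth 0 s i) (nth 0 s j) (nth 0 s k).

(** The three-term Grassmann-Plücker relation. It makes turning left transitive inside a cone and
    stands in for any comparison of angles. *)
Lemma plucker d e u v : 0 < cross d e -> 0 < cross d u -> 0 < cross u e ->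
  0 < cross u v -> 0 < cross v e -> 0 < cross d v.
Proof.
move=> de du ue uv ve.
have E : cross d v * cross u e = cross d u * cross v e + cross u v * cross d e.
  by rewrite /cross; ring.
by rewrite -(pmulr_lgt0 _ ue) E addr_gt0// mulr_gt0.
Qed.

Lemma crossBr u v w : cross u (v - w) = cross u v - cross u w.
Proof. by rewrite /cross/=; ring. Qed.

(** The definition of [chain] constrains consecutive edges only. Since all edges lie in the cone
    between [d] and [e], where [plucker] makes turning transitive, the constraints extend to
    arbitrary triples and pairs of vertices. *)
Lemma chain_left_turns e p d t q : 0 < cross d e -> chain e p d t q ->
  let s := p :: rcons t q in
  [/\ left_turns s,
   forall i j, (i < j < size s)%N -> 0 < cross d (nth 0 s j - nth 0 s i) &
   forall i j, (i < j < size s)%N -> 0 < cross (nth 0 s j - nth 0 s i) e].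
Proof.
elim: t p d => [|w t IH] p d de /=.
  move=> /andP[h1 h2]; split.
  - by move=> i j k /=; lia.
  - by move=> i j ij; have [-> ->] : i = 0%N /\ j = 1%N by lia.
  - by move=> i j ij; have [-> ->] : i = 0%N /\ j = 1%N by lia.
move=> /and3P[dw we ch].
have [L D E] := IH _ _ we ch.
set s := w :: rcons t q in L D E *.
have D' i j : (i < j < size s)%N -> 0 < cross d (nth 0 s j - nth 0 s i).
  by move=> ij; apply: (plucker de dw we); [exact: D|exact: E].
have DP j : (j < size s)%N -> 0 < cross d (nth 0 s j - p).
  case: j => [//|j] js; rewrite -(subrKA w).
  have -> : cross d (nth 0 s j.+1 - w + (w - p)) =
    cross d (nth 0 s j.+1 - w) + cross d (w - p) by rewrite /cross/=; ring.
  by rewrite addr_gt0// (D' 0%N j.+1).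
have EP j : (j < size s)%N -> 0 < cross (nth 0 s j - p) e.
  case: j => [//|j] js; rewrite -(subrKA w).
  have -> : cross (nth 0 s j.+1 - w + (w - p)) e =
    cross (nth 0 s j.+1 - w) e + cross (w - p) e by rewrite /cross/=; ring.
  by rewrite addr_gt0// (E 0%N j.+1).
split.
- move=> i [|j] [|k] ijk ks'; [lia|lia|lia|].
  have /andP[ij jk'] := ijk.
  have jk : (j < k)%N by [].
  have ks : (k < size s)%N by [].
  case: i ij {ijk} => [|i] ij; last by apply: L => //; apply/andP.
    rewrite /= /orient.
    have jks : (j < k < size s)%N by apply/andP.
    have -> : cross (nth 0 s j - p) (nth 0 s k - p) =
      cross (w - p) (nth 0 s k - nth 0 s j) +
      cross (nth 0 s j - w) (nth 0 s k - nth 0 s j).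
      by rewrite /cross/=; ring.
    have h1 := D _ _ jks.
    case: j jk jks h1 {jk' ij} => [|j] jk jks h1.
      by rewrite subrr [X in _ + X](_ : _ = 0) ?addr0//; rewrite /cross/=; ring.
    rewrite addr_gt0//.
    have := L 0%N j.+1 k; rewrite jk ks => /(_ isT isT); rewrite /orient /=.
    by congr (_ < _); rewrite /cross/=; ring.
- move=> [|i] [|j]// ij; first by apply: DP; case/andP: ij.
  exact: D'.
- move=> [|i] [|j]// ij; first by apply: EP; case/andP: ij.
  exact: E.
Qed.

Lemma left_turns_chain e p d t q :
  let s := p :: rcons t q in
  left_turns s ->
  (forall j, (0 < j < size s)%N -> 0 < cross d (nth 0 s j - p)) ->
  (forall i j, (i < j < size s)%N -> 0 < cross (nth 0 s j - nth 0 s i) e) ->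
  chain e p d t q.
Proof.
elim: t p d => [|w t IH] p d /= L D E.
  by rewrite (D 1%N)//= (E 0%N 1%N).
rewrite (D 1%N)//= (E 0%N 1%N)//=; apply: IH => /=.
- by move=> i j k ijk ks; apply: (L i.+1 j.+1 k.+1).
- move=> [//|j] js; have := L 0%N 1%N j.+2; rewrite /= !ltnS.
  move: js => /= js /(_ isT js); rewrite /orient/=.
  by congr (_ < _); rewrite /cross/=; ring.
- by move=> i j ij; apply: (E i.+1 j.+1).
Qed.

(** All of [s] lies in an open half plane bounded by a line through [p], where comparing directions
    from [p] is a total and transitive relation. Convex position makes the resulting order
    strict. *)
Lemma angular_sort p e s (Z : seq (R * R)) : conv3_free Z ->
  p \in Z -> {subset s <= Z} -> uniq s ->
  {in s, forall x, 0 < cross e (x - p)} ->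
  exists t, perm_eq t s /\
   forall i j, (i < j < size t)%N -> 0 < orient p (nth 0 t i) (nth 0 t j).
Proof.
move=> cf pZ sZ us se.
pose le x y := 0 <= orient p x y.
have tot : {in mem s &, total le}.
  move=> x y _ _; rewrite /le /orient.
  have -> : cross (y - p) (x - p) = - cross (x - p) (y - p) by rewrite /cross; ring.
  by rewrite oppr_ge0 le_total.
have tr : {in mem s & &, transitive le}.
  move=> y x z ys xs zs; rewrite /le /orient => xy yz.
  have h1 := se _ ys; have h2 := se _ xs; have h3 := se _ zs.
  rewrite -(pmulr_lge0 _ h1).
  have -> : cross (x - p) (z - p) * cross e (y - p) =
     cross (x - p) (y - p) * cross e (z - p) + cross (y - p) (z - p) * cross e (x - p).
    by rewrite /cross; ring.
  by rewrite addr_ge0// mulr_ge0// ltW.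
exists (sort le s); split; first by rewrite perm_sort.
have al : all (mem s) (sort le s).
  by apply/allP => x; rewrite mem_sort.
have so : sorted le (sort le s).
  by apply: (sort_sorted_in tot); apply/allP.
rewrite (sorted_pairwise_in tr al) in so.
move=> i j /andP[ij js].
have is' := ltn_trans ij js.
have := so => /(pairwiseP 0) /(_ i j is' js ij).
set x := nth 0 (sort le s) i; set y := nth 0 (sort le s) j.
have xs : x \in s by rewrite -(mem_sort le) mem_nth.
have ys : y \in s by rewrite -(mem_sort le) mem_nth.
have xy : x != y by rewrite nth_uniq ?sort_uniq// ltn_eqF.
rewrite /le le_eqVlt => /orP[/eqP|//]; rewrite /orient => E0; exfalso.
have hx := se _ xs; have hy := se _ ys.
have xp : x != p.
  by apply: contraTneq hx => ->; rewrite subrr /cross/= !mulr0 subrr ltxx.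
have yp : y != p.
  by apply: contraTneq hy => ->; rewrite subrr /cross/= !mulr0 subrr ltxx.
pose a := cross e (x - p); pose b := cross e (y - p).
have coll : b *: (x - p) = a *: (y - p).
  have : 0 = cross (x - p) (y - p) by [].
  rewrite /a /b /cross => E; apply: plane_eqP; rewrite /= /GRing.scale/=.
    by move: E; rewrite /= => E; transitivity ((x.1 - p.1) * (e.1 * (y.2 - p.2) - e.2 * (y.1 - p.1)) - e.1 * 0); [ring|rewrite E; ring].
  by move: E; rewrite /= => E; transitivity ((x.2 - p.2) * (e.1 * (y.2 - p.2) - e.2 * (y.1 - p.1)) - e.2 * 0); [ring|rewrite E; ring].
have a0 : a != 0 by rewrite gt_eqF.
have b0 : b != 0 by rewrite gt_eqF.
(* Two points on one ray from [p]: the nearer one would lie between [p] and the farther one. *)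
have [ab|ba] := leP a b.
  apply: (cf x p y y (1 - a / b) (a / b) 0) => //; rewrite 1?eq_sym ?sZ//.
  - by rewrite subr_ge0 ler_pdivrMr// mul1r.
  - by rewrite divr_ge0// ltW.
  - by rewrite addr0 subrK.
  rewrite scale0r addr0; apply: (scalerI b0).
  have -> : b *: x = b *: (x - p) + b *: p by rewrite -scalerDr subrK.
  rewrite coll; apply: plane_eqP; rewrite /= /GRing.scale/=; field => //.
apply: (cf y p x x (1 - b / a) (b / a) 0) => //; rewrite 1?eq_sym ?sZ//.
- by rewrite subr_ge0 ler_pdivrMr// mul1r ltW.
- by rewrite divr_ge0// ltW.
- by rewrite addr0 subrK.
rewrite scale0r addr0; apply: (scalerI a0).
have -> : a *: y = a *: (y - p) + a *: p by rewrite -scalerDr subrK.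
rewrite -coll; apply: plane_eqP; rewrite /= /GRing.scale/=; field => //.
Qed.

End orientation.

(** * The circumscribed equiangular polygon *)

Ltac nlia := match goal with
  | R : realType |- _ => repeat match goal with H : ?T |- _ =>
      lazymatch T with context [R] => clear H end end; lia
  | |- _ => lia end.

(** The partial sums rise and then fall, so they are bounded below by their values at the two ends.
    Applied to the edges of a convex polygon, this locates the minimum of a linear functional on its
    vertices. *)
Lemma unimodal_sum (R : realType) (a : nat -> R) (M N n : nat) : (n <= N)%N ->
  (forall l, (l < M)%N -> 0 <= a l) ->
  (forall l, (M <= l < N)%N -> a l <= 0) ->
  Num.min 0 (\sum_(0 <= l < N) a l) <= \sum_(0 <= l < n) a l.
Proof.
move=> nN aM aN; rewrite ge_min.
have [nM|Mn] := leqP n M.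
  by rewrite big_nat_cond sumr_ge0// => l /andP[/andP[_ ln] _]; apply: aM; lia.
apply/orP; right; rewrite [X in X <= _](big_cat_nat (n := n))//= gerDl.
rewrite big_nat_cond sumr_le0// => l /andP[/andP[nl lN] _]; apply: aN; lia.
Qed.

Section directions.
Context {R : realType}.
Variables (k : nat) (phi : R).
Hypothesis k3 : (3 <= k)%N.

Definition step_angle : R := 2 * pi / k%:R.

Local Notation alpha := step_angle.

(** Angle of the outward normal of the side between the vertices [i] and [i + 1], hence the half
    step. A further quarter turn gives [side_dir], so the sides are traversed counterclockwise. *)
Definition side_angle (i : nat) : R := phi + (i%:R + 2^-1) * alpha.

Definition side_dir (i : nat) : R * R :=
  (- sin (side_angle i), cos (side_angle i)).

Definition sinm (m : nat) : R := sin (m%:R * alpha).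

Local Notation E := side_dir.

Let k0 : (0 < k%:R :> R). Proof. by rewrite ltr0n; lia. Qed.

Lemma step_angle_gt0 : 0 < alpha.
Proof. by rewrite divr_gt0// mulr_gt0// pi_gt0. Qed.

Lemma mul_step_angle : k%:R * alpha = pi *+ 2.
Proof. by rewrite /alpha mulrCA divff ?gt_eqF// mulr1 mulr2n; ring. Qed.

Lemma side_angleDk i : side_angle (i + k) = side_angle i + pi *+ 2.
Proof. by rewrite -mul_step_angle /side_angle natrD; ring. Qed.

Lemma side_dirDk i : E (i + k) = E i.
Proof. by rewrite /side_dir side_angleDk sinD2pi cosD2pi. Qed.

Lemma cross_side_dir i j : (i <= j)%N -> cross (E i) (E j) = sinm (j - i).
Proof.
move=> ij; rewrite /cross /sinm /= natrB//.
have -> : (j%:R - i%:R) * alpha = side_angle j - side_angle i.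
  by rewrite /side_angle; ring.
by rewrite sinB; ring.
Qed.

Lemma crossC (u v : R * R) : cross u v = - cross v u.
Proof. by rewrite /cross; ring. Qed.

Lemma cross_self (u : R * R) : cross u u = 0.
Proof. by rewrite /cross; ring. Qed.

Lemma sinm_ge0 m : (2 * m <= k)%N -> 0 <= sinm m.
Proof.
move=> mk; apply: sin_ge0_pi; rewrite mulr_ge0 ?ler0n ?(ltW step_angle_gt0)//=.
rewrite /alpha mulrA ler_pdivrMr// mulrA [_ * 2]mulrC -natrM mulrC ler_pM2l ?pi_gt0//.
by rewrite ler_nat.
Qed.

Lemma sinm_gt0 m : (0 < m)%N -> (2 * m < k)%N -> 0 < sinm m.
Proof.
move=> m0 mk; apply: sin_gt0_pi.
rewrite mulr_gt0 ?ltr0n ?step_angle_gt0//=.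
rewrite /alpha mulrA ltr_pdivrMr// mulrA [_ * 2]mulrC -natrM mulrC ltr_pM2l ?pi_gt0//.
by rewrite ltr_nat.
Qed.

Lemma sinm_sym m : (m <= k)%N -> sinm m = - sinm (k - m).
Proof.
move=> mk; rewrite /sinm natrB// mulrBl mul_step_angle.
by rewrite -sinN opprB -[RHS]sinD2pi subrK.
Qed.

Lemma sinm_le0 m : (m <= k)%N -> (k <= 2 * m)%N -> sinm m <= 0.
Proof. by move=> mk km; rewrite sinm_sym// oppr_le0 sinm_ge0//; lia. Qed.

Lemma sinm_lt0 m : (m < k)%N -> (k < 2 * m)%N -> sinm m < 0.
Proof. by move=> mk km; rewrite sinm_sym 1?ltnW// oppr_lt0 sinm_gt0//; lia. Qed.

Lemma sinm1_gt0 : 0 < sinm 1. Proof. by apply: sinm_gt0 => //; lia. Qed.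

Lemma cross_side_dirS i : cross (E i) (E i.+1) = sinm 1.
Proof. by rewrite cross_side_dir// subSn// subnn. Qed.

End directions.

Section polygon_chain.
Context {R : realType}.
Variables (k : nat) (phi : R).
Hypothesis k3 : (3 <= k)%N.
Local Notation E := (side_dir k phi).
Local Notation S := (@sinm R k).
Variables (P : nat -> R * R) (A B : nat -> R).
Hypothesis Pk : forall i, P (i + k) = P i.
Hypothesis A0 : forall i, 0 < A i.
Hypothesis B0 : forall i, 0 < B i.
Hypothesis PE : forall i, P i.+1 = P i + (A i *: E i + B i *: E i.+1).

(* Vertices of the equiangular polygon circumscribed to the points [P i]. *)
Let c i := P i + A i *: E i.
(** Length of side [i] of that polygon, which its contact point divides into [B i.-1] and [A i]. At
    [i = 0] the predecessor is truncated, so only positive indices carry this meaning. *)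
Let gam i := B i.-1 + A i.

Let cS i : c i.+1 = c i + gam i.+1 *: E i.+1.
Proof.
by rewrite /c PE /gam/= scalerDl !addrA.
Qed.

Let gam0 i : 0 < gam i. Proof. exact: addr_gt0. Qed.

Let crossD (g u v : R * R) : cross g (u + v) = cross g u + cross g v.
Proof. by rewrite /cross/=; ring. Qed.

Let crossZ (g u : R * R) a : cross g (a *: u) = a * cross g u.
Proof. by rewrite /cross/= /GRing.scale/=; ring. Qed.

Let Ak i : A (i + k) = A i.
Proof.
have h : cross (P (i + k).+1 - P (i + k)) (E i.+1) = cross (P i.+1 - P i) (E i.+1).
  by rewrite Pk -addSn Pk.
move: h; rewrite !PE -!(addrC (_ + _)) !addrK -addSn !side_dirDk//.
have e a b : cross (a *: E i + b *: E i.+1) (E i.+1) = a * S 1.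
  rewrite crossC crossD !crossZ cross_self mulr0 addr0 -mulrN -crossC.
  by rewrite cross_side_dirS.
by rewrite !e => /mulIf -> //; rewrite gt_eqF// sinm1_gt0.
Qed.

Let ck i : c (i + k) = c i.
Proof. by rewrite /c Pk Ak side_dirDk. Qed.

Let c_sum g i m : cross g (c (i + m)) =
  cross g (c i) + \sum_(0 <= l < m) gam (i + l.+1) * cross g (E (i + l.+1)).
Proof.
elim: m => [|m IH]; first by rewrite big_geq// addr0 addn0.
by rewrite addnS cS crossD IH big_nat_recr//= -addrA crossZ addnS.
Qed.

Let csum0 g i : \sum_(0 <= l < k) gam (i + l.+1) * cross g (E (i + l.+1)) = 0.
Proof. by have := c_sum g i k; rewrite ck => /eqP; rewrite -subr_eq0 opprD addrA subrr add0r oppr_eq0 => /eqP. Qed.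

Let crossEE i l : (l <= k)%N -> cross (E i) (E (i + l)) = S l.
Proof. by move=> _; rewrite cross_side_dir ?leq_addr// addKn. Qed.

(** On the way round the polygon from the corner [c i], the increments of [cross (E i)] have the
    signs of [sinm l]: nonnegative for half a turn, then nonpositive, with total zero. Thus
    [unimodal_sum] applies with both end values equal. *)
Let corner_ge i m : (m < k)%N ->
  cross (E i) (c i) <= cross (E i) (c (i + m)).
Proof.
move=> mk; rewrite c_sum lerDl.
have := @unimodal_sum R (fun l => gam (i + l.+1) * cross (E i) (E (i + l.+1)))
  (k %/ 2) k m (ltnW mk).
rewrite csum0 minxx; apply => l lk.
  by rewrite crossEE ?mulr_ge0 ?(ltW (gam0 _)) ?sinm_ge0//; nlia.
rewrite crossEE ?pmulr_rle0 ?gam0//; last nlia.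
by apply: sinm_le0; nlia.
Qed.

Let corner_gt i m : (0 < m)%N -> (m.+1 < k)%N ->
  cross (E i) (c i) < cross (E i) (c (i + m)).
Proof.
move=> m0 mk; rewrite c_sum ltrDl.
have [mh|mh] := leqP (2 * m) k.
  rewrite big_ltn// ltr_pwDl//.
    by rewrite crossEE ?mulr_gt0 ?gam0 ?sinm_gt0//; nlia.
  rewrite big_nat_cond sumr_ge0// => l /andP[/andP[_ ln] _].
  by rewrite crossEE ?mulr_ge0 ?(ltW (gam0 _)) ?sinm_ge0//; nlia.
have := csum0 (E i) i; rewrite (big_cat_nat (n := m)) ?(ltnW (ltnW mk))//=.
move=> /eqP; rewrite addr_eq0 => /eqP ->.
rewrite oppr_gt0.
rewrite big_ltn ?(ltnW mk)// ltr_nwDl//.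
  by rewrite crossEE ?pmulr_rlt0 ?gam0 ?sinm_lt0//; nlia.
rewrite big_nat_cond sumr_le0// => l /andP[/andP[ml ln] _].
rewrite crossEE ?pmulr_rle0 ?gam0//.
by apply: sinm_le0; nlia.
Qed.

Let cross_c_P i : cross (E i) (c i) = cross (E i) (P i).
Proof. by rewrite /c crossD crossZ cross_self mulr0 addr0. Qed.

(* [P j] lies inside the segment between the corners [c (j + k - 1)] and [c j]. *)
Let P_between g i : cross g (P i.+1) * gam i.+1 =
  A i.+1 * cross g (c i) + B i * cross g (c i.+1).
Proof.
rewrite cS /gam/= crossD crossZ.
have -> : P i.+1 = c i + B i *: E i.+1.
  by rewrite /c PE addrA.
by rewrite crossD crossZ; ring.
Qed.

(** Of the two corners around [P (i + m)], at least one is strictly off side [i]. *)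
Lemma contact_P i m : (0 < m < k)%N ->
  cross (E i) (P i) < cross (E i) (P (i + m)).
Proof.
move=> /andP[m0 mk].
rewrite -(ltr_pM2r (gam0 (i + m))) -cross_c_P.
case: m m0 mk => [//|m] _ mk; rewrite addnS P_between /gam/=.
have h1 : cross (E i) (c i) <= cross (E i) (c (i + m)) by apply: corner_ge; nlia.
have h2 : cross (E i) (c i) <= cross (E i) (c (i + m).+1).
  by rewrite -addnS; apply: corner_ge; nlia.
have h : cross (E i) (c i) < cross (E i) (c (i + m)) \/
         cross (E i) (c i) < cross (E i) (c (i + m).+1).
  case: m mk h1 h2 => [|m] mk h1 h2; last by left; apply: corner_gt; nlia.
  by right; rewrite -addnS; apply: corner_gt; nlia.
rewrite mulrDr addrC; have a0 := A0 (i + m).+1; have b0 := B0 (i + m).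
by case: h => h; [apply: ltr_leD|apply: ler_ltD]; rewrite mulrC ?ltr_pM2l ?ler_pM2l.
Qed.

(* Barycentric coordinates in the triangle [P j], [c j], [P j.+1]. *)
Let inner_comb g j a b : cross g (P j + (a *: E j + b *: E j.+1)) =
  (1 - a / A j) * cross g (P j) + (a / A j - b / B j) * cross g (c j) +
  b / B j * cross g (P j.+1).
Proof.
rewrite PE /c !crossD !crossZ; have := A0 j; have := B0 j.
move: (cross g (P j)) (cross g (E j)) (cross g (E j.+1)) (A j) (B j) => x y z u v v0 u0.
by field; rewrite !gt_eqF.
Qed.

(** The point has positive weights at both contact points next to it, at least one of which is
    strictly off side [i]; the corner between them may lie on that side. *)
Lemma contact_inner i m a b : (m < k)%N -> 0 < a < A (i + m) -> 0 < b < B (i + m) ->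
  b / B (i + m) <= a / A (i + m) ->
  cross (E i) (P i) <
  cross (E i) (P (i + m) + (a *: E (i + m) + b *: E (i + m).+1)).
Proof.
move=> mk /andP[a0 aA] /andP[b0 bB] ab; rewrite inner_comb.
set x := a / A _; set y := b / B _.
have x1 : 0 < 1 - x by rewrite subr_gt0 ltr_pdivrMr// mul1r.
have y0 : 0 < y by rewrite divr_gt0.
have xy : 0 <= x - y by rewrite subr_ge0.
have hc : cross (E i) (P i) <= cross (E i) (c (i + m)).
  by rewrite -cross_c_P corner_ge.
have h1 : cross (E i) (P i) <= cross (E i) (P (i + m)).
  by case: m mk {aA bB ab x1 y0 xy hc x y} => [|m] mk; rewrite ?addn0//; apply/ltW/contact_P; nlia.
have h2 : cross (E i) (P i) <= cross (E i) (P (i + m).+1).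
  have [e|ne] := eqVneq m.+1 k; first by rewrite -addnS e Pk.
  by rewrite -addnS; apply/ltW/contact_P; nlia.
have h : cross (E i) (P i) < cross (E i) (P (i + m)) \/
         cross (E i) (P i) < cross (E i) (P (i + m).+1).
  case: m mk {aA bB ab x1 y0 xy hc h1 h2 x y} => [|m] mk.
    by right; rewrite -addnS; apply: contact_P; nlia.
  by left; apply: contact_P; nlia.
rewrite -subr_gt0.
set X := cross (E i) (P i) in hc h1 h2 h *.
have -> : (1 - x) * cross (E i) (P (i + m)) + (x - y) * cross (E i) (c (i + m)) +
    y * cross (E i) (P (i + m).+1) - X =
    (1 - x) * (cross (E i) (P (i + m)) - X) + (x - y) * (cross (E i) (c (i + m)) - X)
   + y * (cross (E i) (P (i + m).+1) - X) by ring.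
rewrite -subr_ge0 in hc; rewrite -subr_ge0 in h1; rewrite -subr_ge0 in h2.
case: h => h; rewrite -subr_gt0 in h.
  apply: ltr_pwDl; last by rewrite mulr_ge0// ltW.
  by apply: ltr_pwDl; [exact: mulr_gt0|exact: mulr_ge0].
rewrite addrC; apply: ltr_pwDl; first exact: mulr_gt0.
by apply: addr_ge0; apply: mulr_ge0 => //; exact: ltW.
Qed.

Let chord j := P j.+1 - P j.

Let crossCE j u : cross (chord j) u = A j * cross (E j) u + B j * cross (E j.+1) u.
Proof.
rewrite /chord PE addrC addKr.
by rewrite /cross/= /GRing.scale/=; ring.
Qed.

Let chord_ends j : cross (chord j) (P j.+1) = cross (chord j) (P j).
Proof.
by rewrite -[in LHS](subrK (P j) (P j.+1)) -/(chord j) crossD cross_self add0r.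
Qed.

(** From [c j.+1] to [c (j + k.-1)] the increments of [cross (chord j)] are again first nonnegative,
    then nonpositive, so the minimum is at one of these two corners. Both lie strictly to the left
    of the chord because [A j] and [B j] are positive. *)
Let chord_corner j m : (0 < m < k)%N ->
  cross (chord j) (P j) < cross (chord j) (c (j + m)).
Proof.
move=> /andP[m0 mk].
have s1 := @sinm1_gt0 R k k3.
have F1 : cross (chord j) (P j) < cross (chord j) (c j.+1).
  rewrite /c crossD crossZ.
  rewrite chord_ends.
  by rewrite ltrDl mulr_gt0// crossCE cross_self mulr0 addr0 cross_side_dirS mulr_gt0.
have Fk : cross (chord j) (P j) < cross (chord j) (c (j + k.-1)).
  have -> : c (j + k.-1) = P j - B (j + k.-1) *: E j.
    have e : (j + k.-1).+1 = (j + k)%N by nlia.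
    by have := PE (j + k.-1); rewrite e Pk side_dirDk// /c => ->; rewrite addrA addrK.
  rewrite -scaleNr crossD crossZ ltrDl mulNr -mulrN mulr_gt0// crossCE cross_self mulr0 add0r.
  by rewrite -mulrN -crossC cross_side_dirS mulr_gt0.
pose a l := gam (j.+1 + l.+1) * cross (chord j) (E (j.+1 + l.+1)).
have e1 : (j.+1 + k.-2 = j + k.-1)%N by nlia.
have Fm : cross (chord j) (c (j + m)) = cross (chord j) (c j.+1) + \sum_(0 <= l < m.-1) a l.
  by rewrite -c_sum; congr (cross _ (c _)); nlia.
have FK : cross (chord j) (c (j + k.-1)) = cross (chord j) (c j.+1) + \sum_(0 <= l < k.-2) a l.
  by rewrite -c_sum e1.
have aE l : (l < k.-2)%N -> a l = gam (j.+1 + l.+1) * (A j * S l.+2 + B j * S l.+1).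
  move=> lk; rewrite /a crossCE !cross_side_dir; try nlia.
  by rewrite (_ : j.+1 + l.+1 - j = l.+2)%N 1?(_ : j.+1 + l.+1 - j.+1 = l.+1)%N; try nlia.
have apos l : (2 * l.+2 <= k)%N -> (l < k.-2)%N -> 0 <= a l.
  move=> h lk; rewrite aE// mulr_ge0 ?(ltW (gam0 _))// addr_ge0// mulr_ge0 ?(ltW (A0 _)) ?(ltW (B0 _))//;
   by apply: sinm_ge0 => //; nlia.
have aneg l : (k <= 2 * l.+1)%N -> (l < k.-2)%N -> a l <= 0.
  move=> h lk; rewrite aE// pmulr_rle0 ?gam0//.
  have := A0 j; have := B0 j.
  have : S l.+1 <= 0 by apply: sinm_le0; nlia.
  have : S l.+2 <= 0 by apply: sinm_le0; nlia.
  by nra.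
(* [S l.+1] and [S l.+2] can have opposite signs only at the index [M0] next to the half turn; the
   sign of [a M0] decides to which monotone part it belongs. *)
pose M0 := (k %/ 2).-1.
pose M := if 0 <= a M0 then M0.+1 else M0.
have H : Num.min 0 (\sum_(0 <= l < k.-2) a l) <= \sum_(0 <= l < m.-1) a l.
  apply: (@unimodal_sum R a (minn M k.-2) k.-2 m.-1); first nlia.
  - move=> l; rewrite leq_min => /andP[lM lk]; move: lM; rewrite /M; case: ifPn => h lM.
      have [->//|ne] := eqVneq l M0; apply: apos => //; rewrite /M0 in lM ne; nlia.
    by apply: apos => //; rewrite /M0 in lM; nlia.
  - move=> l /andP[Ml lk]; move: Ml; rewrite geq_min => /orP[Ml|]; last nlia.
    move: Ml; rewrite /M; case: ifPn => h Ml.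
      by apply: aneg => //; rewrite /M0 in Ml; nlia.
    have [e|ne] := eqVneq l M0; first by rewrite e ltW// ltNge.
    by apply: aneg => //; rewrite /M0 in Ml ne; nlia.
rewrite Fm; move: H; rewrite ge_min => /orP[H|H].
  by apply: (lt_le_trans F1); rewrite lerDl.
by apply: (lt_le_trans Fk); rewrite FK lerD2l.
Qed.

Lemma chord_P j m : (1 < m < k)%N ->
  cross (P j.+1 - P j) (P j) < cross (P j.+1 - P j) (P (j + m)).
Proof.
move=> /andP[m0 mk]; rewrite -/(chord j).
rewrite -(ltr_pM2r (gam0 (j + m))).
case: m m0 mk => [//|m] m0 mk; rewrite addnS P_between /gam/=.
have h1 : cross (chord j) (P j) < cross (chord j) (c (j + m)) by apply: chord_corner; nlia.
have h2 : cross (chord j) (P j) < cross (chord j) (c (j + m).+1).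
  by rewrite -addnS; apply: chord_corner; nlia.
rewrite mulrDr addrC; have a0 := A0 (j + m).+1; have b0 := B0 (j + m).
by apply: ltrD; rewrite mulrC ltr_pM2l.
Qed.

Lemma chord_inner j m a b : (0 < m < k)%N ->
  0 < a < A (j + m) -> 0 < b < B (j + m) ->
  b / B (j + m) <= a / A (j + m) ->
  cross (P j.+1 - P j) (P j) <
  cross (P j.+1 - P j) (P (j + m) + (a *: E (j + m) + b *: E (j + m).+1)).
Proof.
move=> /andP[m0 mk] /andP[a0 aA] /andP[b0 bB] ab; rewrite -/(chord j) inner_comb.
set x := a / A _; set y := b / B _.
have x1 : 0 < 1 - x by rewrite subr_gt0 ltr_pdivrMr// mul1r.
have y0 : 0 < y by rewrite divr_gt0.
have xy : 0 <= x - y by rewrite subr_ge0.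
have hc : cross (chord j) (P j) <= cross (chord j) (c (j + m)).
  by apply/ltW/chord_corner; nlia.
have g1 : (1 < m)%N -> cross (chord j) (P j) < cross (chord j) (P (j + m)).
  by move=> h; apply: chord_P; nlia.
have g2 : (m.+1 < k)%N -> cross (chord j) (P j) < cross (chord j) (P (j + m).+1).
  by move=> h; rewrite -addnS; apply: chord_P; nlia.
have h1 : cross (chord j) (P j) <= cross (chord j) (P (j + m)).
  have [e|ne] := eqVneq m 1%N; first by rewrite e addn1 chord_ends.
  by apply/ltW/g1; nlia.
have h2 : cross (chord j) (P j) <= cross (chord j) (P (j + m).+1).
  have [e|ne] := eqVneq m.+1 k; first by rewrite -addnS e Pk.
  by apply/ltW/g2; nlia.
have h : cross (chord j) (P j) < cross (chord j) (P (j + m)) \/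
         cross (chord j) (P j) < cross (chord j) (P (j + m).+1).
  by have [e|ne] := eqVneq m 1%N; [right; apply: g2; nlia|left; apply: g1; nlia].
rewrite -subr_gt0.
set X := cross (chord j) (P j) in hc h1 h2 h *.
have -> : (1 - x) * cross (chord j) (P (j + m)) + (x - y) * cross (chord j) (c (j + m)) +
    y * cross (chord j) (P (j + m).+1) - X =
    (1 - x) * (cross (chord j) (P (j + m)) - X) + (x - y) * (cross (chord j) (c (j + m)) - X)
   + y * (cross (chord j) (P (j + m).+1) - X) by ring.
rewrite -subr_ge0 in hc; rewrite -subr_ge0 in h1; rewrite -subr_ge0 in h2.
case: h => h; rewrite -subr_gt0 in h.
  apply: ltr_pwDl; last by rewrite mulr_ge0// ltW.
  by apply: ltr_pwDl; [exact: mulr_gt0|exact: mulr_ge0].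
rewrite addrC; apply: ltr_pwDl; first exact: mulr_gt0.
by apply: addr_ge0; apply: mulr_ge0 => //; exact: ltW.
Qed.

End polygon_chain.

(** * Chain configurations: convex position and uniqueness *)

Section configurations.
Context {R : realType}.
Variables (k : nat) (phi : R).
Hypothesis k3 : (3 <= k)%N.
Local Notation E := (side_dir k phi).
Local Notation S1 := (@sinm R k 1).
Implicit Types (ps rest : seq (R * R)) (ts : seq nat) (x y : R * R).

Definition cyc_nth ps i : R * R := nth 0 ps (i %% k).

Definition piece ts rest j : seq (R * R) := nth [::] (reshape ts rest) j.

(* [ps] lists the contact points with the [k] sides of the circumscribed
   equiangular polygon, [rest] the inner vertices of the [k] chains. *)
Definition config ps ts rest := [/\ size ps = k, size ts = k,
  size rest = sumn ts & forall j, (j < k)%N ->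
    chain (E j.+1) (cyc_nth ps j) (E j) (piece ts rest j) (cyc_nth ps j.+1)].

Lemma cyc_nthDk ps i : cyc_nth ps (i + k) = cyc_nth ps i.
Proof. by rewrite /cyc_nth modnDr. Qed.

Lemma side_dir_mod i : E (i %% k) = E i.
Proof.
rewrite [in RHS](divn_eq i k); elim: (i %/ k)%N => [//|m ->].
by rewrite mulSn -[in RHS]addnA [in RHS]addnC side_dirDk.
Qed.

Lemma cyc_nth_mod ps i : cyc_nth ps (i %% k) = cyc_nth ps i.
Proof. by rewrite /cyc_nth modn_mod. Qed.

Lemma cyc_nthS_mod ps i : cyc_nth ps (i %% k).+1 = cyc_nth ps i.+1.
Proof. by rewrite /cyc_nth -addn1 modnDml addn1. Qed.

Lemma side_dirS_mod i : E (i %% k).+1 = E i.+1.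
Proof. by rewrite -[LHS]side_dir_mod -[RHS]side_dir_mod -addn1 modnDml addn1. Qed.

Lemma subseq_nth_flatten (T : eqType) (ss : seq (seq T)) j :
  subseq (nth [::] ss j) (flatten ss).
Proof.
elim: ss j => [|s ss IH] [|j] //=; first exact: prefix_subseq.
by apply: (subseq_trans (IH j)); exact: suffix_subseq.
Qed.

Lemma piece_subseq ts rest j : size rest = sumn ts ->
  subseq (piece ts rest j) rest.
Proof.
by move=> sr; rewrite -[X in subseq _ X](@reshapeKr _ ts rest) ?sr// subseq_nth_flatten.
Qed.

Section one_config.
Variables (ps rest : seq (R * R)) (ts : seq nat).
Hypothesis cf : config ps ts rest.
Local Notation P := (cyc_nth ps).

Let A i := cross (P i.+1 - P i) (E i.+1) / S1.
Let B i := cross (E i) (P i.+1 - P i) / S1.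

Let s1 : 0 < S1. Proof. exact: sinm1_gt0. Qed.

Let EE i : 0 < cross (E i) (E i.+1). Proof. by rewrite cross_side_dirS. Qed.

Let chainE j : (j < k)%N ->
  chain (E j.+1) (P j) (E j) (piece ts rest j) (P j.+1).
Proof. by case: cf => _ _ _; apply. Qed.

Let last_nth j : nth 0 (P j :: rcons (piece ts rest j) (P j.+1)) (size (piece ts rest j)).+1 = P j.+1.
Proof. by rewrite /= nth_rcons ltnn eqxx. Qed.

Let mid_nth j l : (l < size (piece ts rest j))%N ->
  nth 0 (P j :: rcons (piece ts rest j) (P j.+1)) l.+1 = nth 0 (piece ts rest j) l.
Proof. by move=> h; rewrite /= nth_rcons h. Qed.

Let facts j (jk : (j < k)%N) := chain_left_turns (EE j) (chainE jk).

Let A0k j : (j < k)%N -> 0 < A j.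
Proof.
move=> jk; rewrite divr_gt0//; have [_ _ h] := facts jk.
have := h 0%N (size (piece ts rest j)).+1; rewrite last_nth; apply.
by rewrite /= size_rcons.
Qed.

Let B0k j : (j < k)%N -> 0 < B j.
Proof.
move=> jk; rewrite divr_gt0//; have [_ h _] := facts jk.
have := h 0%N (size (piece ts rest j)).+1; rewrite last_nth; apply.
by rewrite /= size_rcons.
Qed.

Let kpos : (0 < k)%N. Proof. by lia. Qed.

Let A0 i : 0 < A i.
Proof.
have <- : A (i %% k) = A i by rewrite /A side_dirS_mod cyc_nthS_mod cyc_nth_mod.
by apply: A0k; rewrite ltn_mod.
Qed.

Let B0 i : 0 < B i.
Proof.
have <- : B (i %% k) = B i by rewrite /B side_dir_mod cyc_nthS_mod cyc_nth_mod.
by apply: B0k; rewrite ltn_mod.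
Qed.

Let decomp i (u : R * R) :
  u = (cross u (E i.+1) / S1) *: E i + (cross (E i) u / S1) *: E i.+1.
Proof.
by rewrite -(cross_side_dirS k phi i); apply: cross_decomp; rewrite gt_eqF.
Qed.

Let PE i : P i.+1 = P i + (A i *: E i + B i *: E i.+1).
Proof. by rewrite /A /B -decomp addrC subrK. Qed.

Let Pk := cyc_nthDk ps.

Let Ak i : A (i + k) = A i.
Proof. by rewrite /A -addSn !Pk side_dirDk. Qed.

Let Bk i : B (i + k) = B i.
Proof. by rewrite /B -addSn !Pk side_dirDk. Qed.

Let offset i j : (i < k)%N -> (j < k)%N ->
  exists2 m, (m < k)%N & (i + m = j \/ i + m = j + k)%N.
Proof.
move=> ik jk; have [ij|ij] := leqP i j; first by exists (j - i)%N; lia.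
by exists (j + k - i)%N; lia.
Qed.

Lemma config_contact i j : (i < k)%N -> (j < k)%N -> i != j ->
  cross (E i) (P i) < cross (E i) (P j).
Proof.
move=> ik jk ij; have [m mk e] := offset ik jk.
have -> : P j = P (i + m) by case: e => ->; rewrite ?Pk.
by apply: (contact_P k3 Pk A0 B0 PE); case: e; lia.
Qed.

Lemma piece_coords j x : (j < k)%N -> x \in piece ts rest j -> exists a b,
  [/\ 0 < a < A j, 0 < b < B j, b / B j < a / A j &
      x = P j + (a *: E j + b *: E j.+1)].
Proof.
move=> jk /(nthP 0)[l lp lx]; have [h1 h2 h3] := facts jk.
set s := P j :: _ in h1 h2 h3.
have ss : size s = (size (piece ts rest j)).+2 by rewrite /s /= size_rcons.
have xs : nth 0 s l.+1 = x by rewrite -lx mid_nth.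
have qs : nth 0 s (size (piece ts rest j)).+1 = P j.+1 by rewrite last_nth.
have ps0 : nth 0 s 0 = P j by [].
have sl2 : (l.+2 < size s)%N by rewrite ss !ltnS.
have sl : (l.+1 < size s)%N by exact: ltnW.
have c1 : (0 < l.+1 < size s)%N by rewrite sl.
have c2 : (l.+1 < (size (piece ts rest j)).+1 < size s)%N by rewrite ss ltnS lp /=.
pose a := cross (x - P j) (E j.+1) / S1.
pose b := cross (E j) (x - P j) / S1.
have xE : x = P j + (a *: E j + b *: E j.+1) by rewrite -decomp addrC subrK.
have a0 : 0 < a by rewrite divr_gt0// -xs -ps0 h3.
have b0 : 0 < b by rewrite divr_gt0// -xs -ps0 h2.
have aA : a < A j.
  rewrite ltr_pM2r ?invr_gt0// -subr_gt0.
  have := h3 _ _ c2; rewrite xs qs.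
  have e (u v w e : R * R) : cross (v - u) e - cross (w - u) e = cross (v - w) e.
    by rewrite /cross/=; ring.
  by rewrite e.
have bB : b < B j.
  rewrite ltr_pM2r ?invr_gt0// -subr_gt0.
  have := h2 _ _ c2; rewrite xs qs.
  have e (u v w e : R * R) : cross e (v - u) - cross e (w - u) = cross e (v - w).
    by rewrite /cross/=; ring.
  by rewrite e.
exists a, b; split; rewrite ?a0 ?b0//.
rewrite ltr_pdivrMr// mulrAC ltr_pdivlMr//.
have /andP[c3 c4] := c2.
have := h1 0%N l.+1 (size (piece ts rest j)).+1; rewrite xs qs ps0 c3 c4.
move=> /(_ isT isT); rewrite /orient PE {1}xE.
have -> : cross (P j + (a *: E j + b *: E j.+1) - P j)
     (P j + (A j *: E j + B j *: E j.+1) - P j) =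
  (a * B j - b * A j) * cross (E j) (E j.+1).
  by rewrite /cross/= /GRing.scale/=; ring.
by rewrite pmulr_lgt0// subr_gt0.
Qed.

Lemma config_contact_inner i j x : (i < k)%N -> (j < k)%N ->
  x \in piece ts rest j -> cross (E i) (P i) < cross (E i) x.
Proof.
move=> ik jk /(piece_coords jk)[a [b [aA bB ab ->]]].
have [m mk e] := offset ik jk.
have := @contact_inner R k phi k3 P A B Pk A0 B0 PE i m a b mk.
by case: e => ->; rewrite ?Ak ?Bk ?Pk ?side_dirDk// -?addSn ?side_dirDk//; apply => //; exact: ltW.
Qed.

Lemma config_chord j l : (j < k)%N -> (l < k)%N -> l != j -> l != (j.+1 %% k)%N ->
  cross (P j.+1 - P j) (P j) < cross (P j.+1 - P j) (P l).
Proof.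
move=> jk lk lj lj1; have [m mk e] := offset jk lk.
have -> : P l = P (j + m) by case: e => ->; rewrite ?Pk.
apply: (chord_P k3 Pk A0 B0 PE); rewrite mk andbT.
have h : m != 1%N.
  apply: contra_neq lj1 => m1; move: e; rewrite m1 addn1 => -[e|e].
    by rewrite e modn_small.
  by rewrite e modnDr modn_small.
by case: e; lia.
Qed.

Lemma config_chord_inner j l x : (j < k)%N -> (l < k)%N -> l != j ->
  x \in piece ts rest l ->
  cross (P j.+1 - P j) (P j) < cross (P j.+1 - P j) x.
Proof.
move=> jk lk lj /(piece_coords lk)[a [b [aA bB ab ->]]].
have [m mk e] := offset jk lk.
have := @chord_inner R k phi k3 P A B Pk A0 B0 PE j m a b.
case: e => e; rewrite e ?Ak ?Bk ?Pk ?side_dirDk// -?addSn ?side_dirDk//; apply => //; try exact: ltW; lia.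
Qed.

Lemma config_piece_orient j x : (j < k)%N -> x \in piece ts rest j ->
  0 < orient (P j) x (P j.+1).
Proof.
move=> jk /(piece_coords jk)[a [b [/andP[a0 aA] /andP[b0 bB] ab ->]]].
move: ab; rewrite ltr_pdivrMr// mulrAC ltr_pdivlMr// => ab.
rewrite /orient PE.
have -> : cross (P j + (a *: E j + b *: E j.+1) - P j)
     (P j + (A j *: E j + B j *: E j.+1) - P j) =
  (a * B j - b * A j) * cross (E j) (E j.+1).
  by rewrite /cross/= /GRing.scale/=; ring.
by rewrite pmulr_lgt0// subr_gt0.
Qed.

Lemma config_piece_sorted j l m : (j < k)%N -> (l < m < size (piece ts rest j))%N ->
  0 < orient (P j) (nth 0 (piece ts rest j) l) (nth 0 (piece ts rest j) m).
Proof.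
move=> jk /andP[lm mp]; have [h _ _] := facts jk.
rewrite -!mid_nth//; last exact: ltn_trans mp.
by have := h 0%N l.+1 m.+1; apply => //; rewrite /= size_rcons; lia.
Qed.

Lemma config_piece_side j x : (j < k)%N -> x \in piece ts rest j ->
  0 < cross (E j) (x - P j).
Proof.
move=> jk /(piece_coords jk)[a [b [_ /andP[b0 _] _ ->]]].
have -> : cross (E j) (P j + (a *: E j + b *: E j.+1) - P j) = b * cross (E j) (E j.+1).
  by rewrite /cross/= /GRing.scale/=; ring.
exact: mulr_gt0.
Qed.

Lemma config_in x : x \in ps ++ rest ->
  (exists2 j, (j < k)%N & x = P j) \/ (exists2 j, (j < k)%N & x \in piece ts rest j).
Proof.
have [sps sts srest _] := cf.
rewrite mem_cat => /orP[/(nthP 0)[j jp <-]|xr].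
  by left; exists j; rewrite -?sps// /cyc_nth modn_small// -sps.
right; move: xr; rewrite -{1}(@reshapeKr _ ts rest) ?srest// => /flattenP[s /(nthP [::])[j jr <-] xs].
by exists j => //; rewrite -sts -(size_reshape ts rest).
Qed.

Lemma P_in j : P j \in ps ++ rest.
Proof.
have [sps _ _ _] := cf.
by rewrite mem_cat /cyc_nth mem_nth// sps ltn_mod.
Qed.

Lemma piece_in j x : x \in piece ts rest j -> x \in ps ++ rest.
Proof.
move=> xp; have [_ _ srest _] := cf; rewrite mem_cat -(@reshapeKr _ ts rest) ?srest//.
apply/orP; right; apply/flattenP; exists (piece ts rest j) => //.
rewrite /piece mem_nth// ltnNge; apply/negP => h.
by move: xp; rewrite /piece nth_default.
Qed.

Lemma config_contact_all i x : (i < k)%N -> x \in ps ++ rest -> x != P i ->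
  cross (E i) (P i) < cross (E i) x.
Proof.
move=> ik /config_in[[j jk ->] ne|[j jk xj] _]; last exact: (config_contact_inner ik jk).
by apply: config_contact => //; apply: contraNneq ne => ->.
Qed.

Lemma config_chord_all j x : (j < k)%N -> x \in ps ++ rest ->
  x \notin piece ts rest j ->
  x = P j \/ x = P j.+1 \/ cross (P j.+1 - P j) (P j) < cross (P j.+1 - P j) x.
Proof.
move=> jk /config_in[[l lk ->] _|[l lk xl] xnj].
  have [->|lj] := eqVneq l j; first by left.
  have [->|lj1] := eqVneq l (j.+1 %% k)%N; first by right; left; rewrite cyc_nth_mod.
  by right; right; exact: config_chord.
right; right; apply: (config_chord_inner jk lk) => //.
by apply: contraNneq xnj => <-.
Qed.

(** Recovers the inner vertices of a chain from the set of all points and two contact points,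
    without knowledge of the chain, as uniqueness requires. *)
Lemma config_pieceP j x : (j < k)%N ->
  (x \in piece ts rest j) = (x \in ps ++ rest) && (0 < orient (P j) x (P j.+1)).
Proof.
move=> jk; apply/idP/andP => [xj|[xw o]].
  by split; [exact: piece_in xj|exact: config_piece_orient].
apply: contraLR o => xj; rewrite -leNgt.
have [->|[->|h]] := config_chord_all jk xw xj.
- by rewrite /orient /cross/=; lra.
- by rewrite /orient cross_self.
have -> : orient (P j) x (P j.+1) =
    cross (P j.+1 - P j) (P j) - cross (P j.+1 - P j) x.
  by rewrite /orient /cross/=; ring.
by rewrite subr_le0 ltW.
Qed.

(** A contact point is the strict minimizer for the direction of its side. An inner vertex with
    neighbours [u] and [v] on its chain is the strict minimizer for [cross (v - u)]: the other
    vertices of the chain by the left turns, all further points because they lie beyond the chord of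
    the chain and inside the two sides adjacent to it. *)
Lemma config_functional x : x \in ps ++ rest -> exists g : R * R,
  forall y, y \in ps ++ rest -> y != x -> cross g x < cross g y.
Proof.
move=> /config_in[[j jk ->]|[j jk xj]].
  by exists (E j) => y yw yx; exact: config_contact_all.
have := xj => /(nthP 0)[l lp lx]; have [h1 h2 h3] := facts jk.
set s := P j :: _ in h1 h2 h3.
have ss : size s = (size (piece ts rest j)).+2 by rewrite /s /= size_rcons.
have xs : nth 0 s l.+1 = x by rewrite -lx mid_nth.
have qs : nth 0 s (size (piece ts rest j)).+1 = P j.+1 by rewrite last_nth.
have ps0 : nth 0 s 0 = P j by [].
have sl2 : (l.+2 < size s)%N by rewrite ss !ltnS.
have sl : (l.+1 < size s)%N by exact: ltnW.
have c1 : (0 < l.+1 < size s)%N by rewrite sl.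
have c2 : (l.+1 < (size (piece ts rest j)).+1 < size s)%N by rewrite ss ltnS lp /=.
set u := nth 0 s l; set v := nth 0 s l.+2.
exists (v - u).
have own m : (m < size s)%N -> m != l.+1 -> cross (v - u) x < cross (v - u) (nth 0 s m).
  move=> ms ml; rewrite -subr_gt0.
  have e y : cross (v - u) y - cross (v - u) x = orient u x y + orient x v y.
    by rewrite /orient /cross/=; ring.
  have cyc1 (a b c : R * R) : orient a b c = orient b c a.
    by rewrite /orient /cross/=; ring.
  rewrite e -xs.
  have o1 : 0 <= orient u (nth 0 s l.+1) (nth 0 s m).
    have [->|ne] := eqVneq m l; first by rewrite /orient /cross/=; lra.
    have [ml1|ml1] := ltnP m l; last by apply/ltW/h1; lia.
    by rewrite -cyc1; apply/ltW/h1; lia.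
  have o2 : 0 <= orient (nth 0 s l.+1) v (nth 0 s m).
    have [->|ne] := eqVneq m l.+2; first by rewrite /orient cross_self.
    have [ml1|ml1] := ltnP m l.+1; last by apply/ltW/h1; lia.
    by rewrite -cyc1; apply/ltW/h1; lia.
  have [ml'|ml'] := eqVneq m l.
    apply: ltr_wpDl => //; rewrite -cyc1 ml'; apply: h1; lia.
  apply: ltr_pwDl => //.
  have [ml1|ml1] := ltnP m l; last by apply: h1; lia.
  by rewrite -cyc1; apply: h1; lia.
move=> y yw yx.
have [ys|ys] := boolP (y \in s).
  move: ys => /(nthP 0)[m ms my]; rewrite -my; apply: own => //.
  by apply: contra_neq yx => ml; rewrite -my ml xs.
have yj : y \notin piece ts rest j.
  by apply: contra ys => h; rewrite inE mem_rcons inE h !orbT.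
have yp : y != P j by apply/eqP => yE; move: ys; rewrite yE inE eqxx.
have yq : y != P j.+1 by apply/eqP => yE; move: ys; rewrite yE inE mem_rcons inE eqxx orbT.
have [e|[e|ch]] := config_chord_all jk yw yj.
- by rewrite e eqxx in yp.
- by rewrite e eqxx in yq.
have cp : cross (v - u) x < cross (v - u) (P j).
  by have := own 0%N; rewrite ps0; apply; rewrite ?ss.
have cq : cross (v - u) x < cross (v - u) (P j.+1).
  rewrite -qs; apply: own; first by rewrite ss.
  by rewrite eqSS gtn_eqF.
pose a := cross (y - P j) (E j.+1) / S1.
pose b := cross (E j) (y - P j) / S1.
have yE : y = P j + (a *: E j + b *: E j.+1) by rewrite -decomp addrC subrK.
pose v1 := cross (v - u) (E j.+1) / S1.
pose v2 := cross (E j) (v - u) / S1.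
have vE : v - u = v1 *: E j + v2 *: E j.+1 by rewrite -decomp.
have c5 : (l < l.+2 < size s)%N by rewrite sl2 leqnSn.
have v10 : 0 < v1 by rewrite divr_gt0// h3.
have v20 : 0 < v2 by rewrite divr_gt0// h2.
have b0 : 0 < b.
  rewrite divr_gt0//.
  have -> : cross (E j) (y - P j) = cross (E j) y - cross (E j) (P j).
    by rewrite /cross/=; ring.
  by rewrite subr_gt0 config_contact_all.
have aA : a < A j.
  have j1k : (j.+1 %% k < k)%N by rewrite ltn_mod.
  have := @config_contact_all _ y j1k yw.
  rewrite cyc_nth_mod side_dir_mod => /(_ yq); rewrite yE PE -subr_gt0.
  have -> : cross (E j.+1) (P j + (a *: E j + b *: E j.+1)) -
    cross (E j.+1) (P j + (A j *: E j + B j *: E j.+1)) =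
    (A j - a) * cross (E j) (E j.+1).
    by rewrite /cross/= /GRing.scale/=; ring.
  by rewrite pmulr_lgt0// subr_gt0.
have D := EE j.
have Aj := A0 j. have Bj := B0 j.
have left : 0 < A j * b - B j * a.
  move: ch; rewrite -subr_gt0 PE yE.
  have -> : cross (P j + (A j *: E j + B j *: E j.+1) - P j) (P j + (a *: E j + b *: E j.+1)) -
    cross (P j + (A j *: E j + B j *: E j.+1) - P j) (P j) =
    (A j * b - B j * a) * cross (E j) (E j.+1).
    by rewrite /cross/= /GRing.scale/=; ring.
  by rewrite pmulr_lgt0.
have fy : cross (v - u) y = cross (v - u) (P j) + (v1 * b - v2 * a) * cross (E j) (E j.+1).
  by rewrite yE vE /cross/= /GRing.scale/=; ring.
have fq : cross (v - u) (P j.+1) = cross (v - u) (P j) + (v1 * B j - v2 * A j) * cross (E j) (E j.+1).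
  by rewrite PE vE /cross/= /GRing.scale/=; ring.
(* The functional increases along [E j.+1] and decreases along [E j]. So [y] is compared with [P j]
   if [a <= 0], and otherwise with the point of the chord that has the same coordinate [a]. *)
have [an|ap] := leP a 0.
  apply: (lt_le_trans cp); rewrite fy lerDl mulr_ge0 ?(ltW D)// subr_ge0.
  by apply: (@le_trans _ _ 0); [rewrite pmulr_rle0|rewrite mulr_ge0 ?ltW].
pose t := a / A j.
have t0 : 0 < t by rewrite divr_gt0.
have t1 : t < 1 by rewrite ltr_pdivrMr// mul1r.
have mid : cross (v - u) x <
    (1 - t) * cross (v - u) (P j) + t * cross (v - u) (P j.+1).
  have {1}-> : cross (v - u) x = (1 - t) * cross (v - u) x + t * cross (v - u) x by ring.
  by apply: ltrD; rewrite ltr_pM2l// subr_gt0.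
apply: (lt_le_trans mid); rewrite fq fy -subr_ge0.
have -> : cross (v - u) (P j) + (v1 * b - v2 * a) * cross (E j) (E j.+1) -
  ((1 - t) * cross (v - u) (P j) +
  t * (cross (v - u) (P j) + (v1 * B j - v2 * A j) * cross (E j) (E j.+1))) =
  v1 * (A j * b - B j * a) / A j * cross (E j) (E j.+1).
  by rewrite /t; move: (cross (v - u) (P j)) (cross (E j) (E j.+1)) => z w; field; rewrite gt_eqF.
by rewrite ltW// mulr_gt0// divr_gt0// mulr_gt0.
Qed.

Lemma config_uniq : uniq (ps ++ rest).
Proof.
have [sps sts srest _] := cf.
have pP x : x \in ps -> exists2 j, (j < k)%N & x = P j.
  move=> /(nthP 0)[j jp <-]; exists j; first by rewrite -sps.
  by rewrite /cyc_nth modn_small// -sps.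
rewrite cat_uniq; apply/and3P; split.
- apply/(uniqP 0) => i j; rewrite !inE sps => ik jk e.
  apply/eqP; apply: contraPT (config_contact ik jk) => ij /(_ ij).
  by rewrite /cyc_nth !modn_small// e ltxx.
- apply/hasPn => x xr; apply/negP => /pP[j jk xj].
  have : x \in ps ++ rest by rewrite mem_cat xr orbT.
  move: xr; rewrite -(@reshapeKr _ ts rest) ?srest// => /flattenP[s /(nthP [::])[l lr <-] xs] _.
  have lk : (l < k)%N by rewrite -sts -(size_reshape ts rest).
  by have := config_contact_inner jk lk xs; rewrite xj ltxx.
rewrite -(@reshapeKr _ ts rest) ?srest//.
have uf (ss : seq (seq (R * R))) : (forall i, (i < size ss)%N -> uniq (nth [::] ss i)) ->
    (forall i j x, (i < j < size ss)%N -> x \in nth [::] ss i -> x \in nth [::] ss j -> False) ->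
    uniq (flatten ss).
  elim: ss => [//|s ss IH] us dj /=; rewrite cat_uniq (us 0%N)//= IH ?andbT.
  - apply/hasPn => x /flattenP[s' /(nthP [::])[j jr <-] xs']; apply/negP => xs.
    by apply: (dj 0%N j.+1 x).
  - by move=> i is'; apply: (us i.+1).
  - by move=> i j x ij; apply: (dj i.+1 j.+1 x).
apply: uf => [j|i j x]; rewrite size_reshape sts; [move=> jk|].
  apply/(uniqP 0) => l m; rewrite !inE => lp mp e.
  have h := config_piece_sorted jk.
  case: (ltngtP l m) => // lm.
    by have := h _ _ (introT andP (conj lm mp)); rewrite /piece e /orient cross_self ltxx.
  by have := h _ _ (introT andP (conj lm lp)); rewrite /piece e /orient cross_self ltxx.
move=> /andP[ij jk] xi xj; have ik := ltn_trans ij jk.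
have := config_piece_orient ik xi.
have := config_chord_inner ik jk (_ : j != i) xj; rewrite gt_eqF// => /(_ isT).
rewrite -subr_gt0.
have -> : cross (P i.+1 - P i) x - cross (P i.+1 - P i) (P i) = - orient (P i) x (P i.+1).
  by rewrite /orient /cross/=; ring.
by rewrite oppr_gt0 => h1 h2; have := lt_trans h1 h2; rewrite ltxx.
Qed.

End one_config.

Lemma sorted_by_angle_unique p e (s t : seq (R * R)) : perm_eq s t ->
  {in s, forall x, 0 < cross e (x - p)} ->
  (forall i j, (i < j < size s)%N -> 0 < orient p (nth 0 s i) (nth 0 s j)) ->
  (forall i j, (i < j < size t)%N -> 0 < orient p (nth 0 t i) (nth 0 t j)) ->
  s = t.
Proof.
move=> st se hs ht.
pose lt x y := 0 < orient p x y.
have te : {in t, forall x, 0 < cross e (x - p)} by move=> x; rewrite -(perm_mem st); exact: se.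
have tr (u : seq (R * R)) : {in u, forall x, 0 < cross e (x - p)} -> {in mem u & &, transitive lt}.
  move=> ue y x z ys xs zs; rewrite /lt /orient => xy yz.
  have h1 := ue _ ys; have h2 := ue _ xs; have h3 := ue _ zs.
  rewrite -(pmulr_lgt0 _ h1).
  have -> : cross (x - p) (z - p) * cross e (y - p) =
     cross (x - p) (y - p) * cross e (z - p) + cross (y - p) (z - p) * cross e (x - p).
    by rewrite /cross; ring.
  by rewrite addr_gt0// mulr_gt0.
have pw (u : seq (R * R)) : (forall i j, (i < j < size u)%N -> 0 < orient p (nth 0 u i) (nth 0 u j)) ->
    pairwise lt u.
  by move=> hu; apply/(pairwiseP 0) => i j; rewrite !inE => iu ju ij; apply: hu; rewrite ij.
have so (u : seq (R * R)) : {in u, forall x, 0 < cross e (x - p)} ->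
   (forall i j, (i < j < size u)%N -> 0 < orient p (nth 0 u i) (nth 0 u j)) -> sorted lt u.
  move=> ue hu; rewrite (sorted_pairwise_in (tr u ue)); first exact: pw.
  exact/allP.
apply: (sorted_eq_in (leT := lt) (tr _ se) _ (so _ se hs) (so _ te ht) st).
move=> x y _ _ /andP[xy yx]; move: xy yx; rewrite /lt /orient => xy.
by rewrite crossC oppr_gt0 => yx; have := lt_trans xy yx; rewrite ltxx.
Qed.

(** The contact points are strict minimizers and hence determined by the set. By [config_pieceP]
    each chain is then determined as a set, and its order is the angular order around its first
    contact point. *)
Lemma config_unique ps ts rest ps' ts' rest' :
  config ps ts rest -> config ps' ts' rest' ->
  perm_eq (ps ++ rest) (ps' ++ rest') ->
  [/\ ps = ps', ts = ts' & rest = rest'].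
Proof.
move=> cf cf' pe.
have [sps sts srest hc] := cf; have [sps' sts' srest' hc'] := cf'.
have psE : ps = ps'.
  apply: (@eq_from_nth _ 0); rewrite ?sps ?sps'// => i ik.
  have e1 : nth 0 ps i = cyc_nth ps i by rewrite /cyc_nth modn_small.
  have e2 : nth 0 ps' i = cyc_nth ps' i by rewrite /cyc_nth modn_small.
  rewrite e1 e2; apply/eqP; apply: contraT => ne.
  have h1 := config_contact_all cf ik (x := cyc_nth ps' i).
  have h2 := config_contact_all cf' ik (x := cyc_nth ps i).
  have := lt_trans (h1 _ _) (h2 _ _); rewrite ltxx; apply => //.
  - by rewrite (perm_mem pe); exact: (P_in cf').
  - by rewrite eq_sym.
  - by rewrite -(perm_mem pe); exact: (P_in cf).
have pcE j : (j < k)%N -> piece ts rest j = piece ts' rest' j.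
  move=> jk; apply: (@sorted_by_angle_unique (cyc_nth ps j) (E j)).
  - apply: uniq_perm.
    + have := config_uniq cf; rewrite cat_uniq => /and3P[_ _].
      exact/subseq_uniq/piece_subseq.
    + have := config_uniq cf'; rewrite cat_uniq => /and3P[_ _].
      exact/subseq_uniq/piece_subseq.
    + move=> x; rewrite (config_pieceP cf x jk) (config_pieceP cf' x jk).
      by rewrite (perm_mem pe) psE.
  - by move=> x; exact: config_piece_side.
  - by move=> l m; exact: config_piece_sorted.
  - by move=> l m; rewrite psE; exact: config_piece_sorted.
have rE : reshape ts rest = reshape ts' rest'.
  apply: (@eq_from_nth _ [::]); rewrite !size_reshape sts ?sts'//.
split => //.
  by rewrite -(@reshapeKl _ ts rest) ?srest// rE reshapeKl ?srest'.
by rewrite -(@reshapeKr _ ts rest) ?srest// rE reshapeKr ?srest'.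
Qed.

End configurations.

Lemma perm_flatten_fibers (T : eqType) (f : T -> nat) (s : seq T) n :
  perm_eq (flatten [seq [seq x <- s | f x == j] | j <- iota 0 n])
          [seq x <- s | (f x < n)%N].
Proof.
elim: n => [|n IH]; first by rewrite /= (eq_filter (a2 := pred0)) ?filter_pred0.
rewrite -addn1 iotaD map_cat flatten_cat /= cats0 addn1.
rewrite perm_sym -(perm_filterC (fun x => (f x < n)%N)) -!filter_predI.
apply: perm_cat; last first.
  by rewrite (eq_filter (a2 := fun x => f x == n)) => // x /=; lia.
by rewrite perm_sym (permPl IH) (eq_filter (a2 := fun x => (f x < n)%N)) => // x /=; lia.
Qed.

(** * Existence of the circumscribed polygon of a sample without ties *)

Section circumscription.
Context {R : realType}.
Variables (k : nat) (phi : R).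
Hypothesis k3 : (3 <= k)%N.
Local Notation E := (side_dir k phi).
Implicit Types (x y p q : R * R).

Lemma side_dir_rec i : E i.+2 + E i = (2 * cos (step_angle k)) *: E i.+1.
Proof.
have e1 : side_angle k phi i.+2 = side_angle k phi i.+1 + step_angle k.
  by rewrite /side_angle -[i.+2]addn1 natrD; ring.
have e2 : side_angle k phi i = side_angle k phi i.+1 - step_angle k.
  by rewrite /side_angle -[i.+1]addn1 natrD; ring.
rewrite /side_dir e1 e2; apply: plane_eqP; rewrite /= /GRing.scale/=.
  by rewrite sinD sinB; ring.
by rewrite cosD cosB; ring.
Qed.

Lemma cos_step_lt1 : cos (step_angle k) < 1 :> R.
Proof.
have s : 0 < sin (step_angle k) :> R.
  by have := @sinm1_gt0 R k k3; rewrite /sinm mul1r.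
rewrite lt_neqAle cos_le1 andbT; apply: contraTneq s => c1.
rewrite -leNgt -(@ler_pXn2r _ 2)// ?nnegrE//; last first.
  by have := @sinm1_gt0 R k k3; rewrite /sinm mul1r => /ltW.
by rewrite sin2cos2 c1 !expr2 mulr0; lra.
Qed.

(** Summed over a period, the three-term recurrence [side_dir_rec] says that the sum is fixed by the
    scalar [2 cos alpha - 1], which differs from [1]. *)
Lemma sum_side_dir : \sum_(0 <= i < k) E i = 0.
Proof.
pose S := \sum_(0 <= i < k) E i.
have sh m : \sum_(0 <= i < k) E (i + m) = S.
  elim: m => [|m IH]; first by apply: eq_bigr => i _; rewrite addn0.
  rewrite -IH; case: k k3 @S IH (@side_dirDk R k phi k3) => [//|k'] _ S IH per.
  rewrite big_nat_recr//= [RHS]big_nat_recl//= addrC; congr (_ + _).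
    by rewrite addnC addSn -addnS per.
  by apply: eq_bigr => i _; rewrite addnS.
have : \sum_(0 <= i < k) (E i.+2 + E i) = (2 * cos (step_angle k)) *: S.
  rewrite -[in RHS](sh 1%N) scaler_sumr; apply: eq_bigr => i _.
  by rewrite side_dir_rec addn1.
have e : \sum_(0 <= i < k) E i.+2 = S.
  by rewrite -(sh 2); apply: eq_bigr => i _; rewrite addn2.
rewrite big_split/= e -/S => h.
have : (2 - 2 * cos (step_angle k)) *: S = 0.
  by rewrite scalerBl -h scaler_nat mulr2n subrr.
move/eqP; rewrite scaler_eq0 => /orP[|/eqP//].
by have := cos_step_lt1; rewrite subr_eq0; move: (cos _) => u u1 /eqP u2; exfalso; clear - u1 u2; lra.
Qed.

Section circumscribed.
Variable z : seq (R * R).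
Hypotheses (uz : uniq z) (cz : conv3_free z) (sz : (1 < size z)%N).
Hypothesis nt : forall i x y, (i < k)%N -> x \in z -> y \in z -> x != y ->
  cross (E i) x != cross (E i) y.

Let kpos : (0 < k)%N. Proof. by lia. Qed.

Lemma contact_exists i : exists p, p \in z /\
  forall y, y \in z -> y != p -> cross (E i) p < cross (E i) y.
Proof.
rewrite -(side_dir_mod phi k3).
have ik : (i %% k < k)%N by rewrite ltn_mod.
move: (i %% k)%N ik => {}i ik.
pose f (j : 'I_(size z)) := cross (E i) (nth 0 z j).
have i0 : 'I_(size z) by apply: (@Ordinal _ 0); lia.
case: (@Order.TotalTheory.arg_minP _ _ _ i0 predT f isT) => j _ jP.
exists (nth 0 z j); split; first by rewrite mem_nth.
move=> y yz yne; rewrite lt_neqAle eq_sym nt ?mem_nth//=.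
by move: yz => /(nthP 0)[l lz <-]; exact: (jP (Ordinal lz)).
Qed.

Variable P : nat -> R * R.
Hypothesis Pz : forall i, P i \in z.
Hypothesis Pmin : forall i y, y \in z -> y != P i -> cross (E i) (P i) < cross (E i) y.

Lemma contact_le i y : y \in z -> cross (E i) (P i) <= cross (E i) y.
Proof. by move=> yz; have [->//|/(Pmin yz)/ltW] := eqVneq y (P i). Qed.

Lemma contactDk i : P (i + k) = P i.
Proof.
apply/eqP; apply: contraT => ne.
have := Pmin (Pz (i + k)) ne; rewrite eq_sym in ne.
by have := Pmin (Pz i) ne; rewrite side_dirDk// => h1 h2; have := lt_trans h1 h2; rewrite ltxx.
Qed.

Lemma contact_unique i p : p \in z -> (forall y, y \in z -> cross (E i) p <= cross (E i) y) ->
  p = P i.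
Proof.
move=> pz pm; apply/eqP; apply: contraT => ne.
by have := lt_le_trans (Pmin pz ne) (pm _ (Pz i)); rewrite ltxx.
Qed.

Let crossEE i m (x : R * R) : sinm k m.+1 * cross (E i.+1) x =
  sinm k m * cross (E i) x + sinm k 1 * cross (E (i + m.+1)) x.
Proof.
have -> : sinm k m.+1 = cross (E i) (E (i + m.+1)).
  by rewrite cross_side_dir ?leq_addr// addKn.
have -> : sinm k m = cross (E i.+1) (E (i + m.+1)).
  by rewrite cross_side_dir ?addnS ?addSn ?ltnS ?leq_addr// -addSn addKn.
rewrite -(cross_side_dirS k phi i).
by rewrite /cross/=; ring.
Qed.

(** Less than half a turn away, [E i.+1] is a combination of [E i] and [E (i + m)] with nonnegative
    coefficients ([crossEE]), so a common minimizer of these two also minimizes [cross (E i.+1)]. *)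
Let contact_step i m : (0 < m)%N -> (2 * m < k)%N -> P i = P (i + m) -> P i = P i.+1.
Proof.
case: m => [//|m] _ mk e; apply: contact_unique => // y yz.
have s : 0 < sinm k m.+1 :> R by apply: sinm_gt0.
rewrite -(ler_pM2l s) !crossEE lerD//.
  by rewrite ler_wpM2l ?contact_le// sinm_ge0//; lia.
by rewrite ler_wpM2l ?(ltW (sinm1_gt0 k3))// e contact_le.
Qed.

(** Opposite sides have opposite directions: a common contact point would be both a strict minimizer
    and a strict maximizer. *)
Let contact_opposite i m : (2 * m = k)%N -> P i != P (i + m).
Proof.
move=> mk; apply/eqP => e.
have [y yz yne] : exists2 y, y \in z & y != P i.
  case: z uz sz => [|a [|b s]]//=; rewrite inE => /andP[/norP[ab _] _] _.
  have [aP|aP] := eqVneq a (P i); last by exists a; rewrite ?inE ?eqxx.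
  by exists b; rewrite ?inE ?eqxx ?orbT// -aP eq_sym.
have m2 : m = m.-1.+1 by nlia.
have s0 : sinm k m = 0 :> R.
  apply/eqP; rewrite eq_le sinm_le0 ?sinm_ge0//; nlia.
have F x : sinm k m.-1 * cross (E i) x + sinm k 1 * cross (E (i + m)) x = 0 :> R.
  by have := crossEE i m.-1 x; rewrite -m2 s0 mul0r => <-.
have h1 := Pmin yz yne.
have h2 : cross (E (i + m)) (P i) < cross (E (i + m)) y.
  by rewrite e; apply: Pmin => //; rewrite -e.
have s1 : 0 < sinm k 1 :> R := sinm1_gt0 k3.
have s2 : 0 < sinm k m.-1 :> R by apply: sinm_gt0; nlia.
have : sinm k m.-1 * cross (E i) (P i) + sinm k 1 * cross (E (i + m)) (P i) <
  sinm k m.-1 * cross (E i) y + sinm k 1 * cross (E (i + m)) y.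
  by apply: ltrD; rewrite ltr_pM2l.
by rewrite !F ltxx.
Qed.

(** One of the two arcs between the sides is shorter than half a turn, unless the sides are
    opposite, which is excluded; [contact_step] is applied along the short arc. This is why a
    repeated contact point always leaves a chain empty. *)
Lemma contact_consecutive i j : (i < j < k)%N -> P i = P j ->
  exists2 l, (l < k)%N & P l = P l.+1.
Proof.
move=> /andP[ij jk] e; have jE : j = (i + (j - i))%N by rewrite subnKC// ltnW.
have [m2|m2|m2] := ltngtP (2 * (j - i)) k.
- exists i; first exact: ltn_trans jk.
  by apply: (@contact_step i (j - i)); rewrite ?subn_gt0// -jE.
- exists j => //; apply: (@contact_step j (k - (j - i))); try nlia.
  have -> : (j + (k - (j - i)) = i + k)%N by nlia.
  by rewrite contactDk.
- by have := contact_opposite i m2; rewrite -jE e eqxx.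
Qed.

Let no_conv x i j l (a b c : R) : x \in z -> (forall i, P i != x) ->
  0 <= a -> 0 <= b -> 0 <= c -> 0 < a + b + c ->
  a *: (P i - x) + b *: (P j - x) + c *: (P l - x) = 0 -> False.
Proof.
move=> xz xP a0 b0 c0 abc e; have n0 : a + b + c != 0 by rewrite gt_eqF.
apply: (cz (y1 := P i) (y2 := P j) (y3 := P l) (a := a / (a + b + c))
   (b := b / (a + b + c)) (c := c / (a + b + c)) xz) => //.
- by rewrite divr_ge0// ltW.
- by rewrite divr_ge0// ltW.
- by rewrite divr_ge0// ltW.
- by rewrite -!mulrDl divff.
apply: (scalerI n0); rewrite !scalerDr !scalerA.
rewrite ![(a + b + c) * (_ / _)]mulrC !divfK//.
apply/eqP; rewrite -subr_eq0 -oppr_eq0 opprB; apply/eqP; rewrite -[RHS]e.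
by rewrite !scalerBr !scalerDl; move: (a *: x) (b *: x) (c *: x) (a *: P i) (b *: P j) (c *: P l) => *; apply: plane_eqP => /=; ring.
Qed.

(** A point on the inner side of every chord would lie in the hull of at most three contact points.
    The winding argument is made algebraic: [D i] records on which side of the line through [x] and
    [P 0] the contact [P i] lies. *)
Lemma contact_cover x : x \in z -> (forall i, P i != x) ->
  exists2 j, (j < k)%N & 0 < orient (P j) x (P j.+1).
Proof.
move=> xz xP; apply: contrapT => H.
pose y i := P i - x.
have C i : 0 <= cross (y i) (y i.+1).
  suff C0 j : (j < k)%N -> 0 <= cross (y j) (y j.+1).
    have := C0 (i %% k)%N; rewrite ltn_mod kpos => /(_ isT).
    have e j : P (j %% k)%N = P j.
      rewrite [in RHS](divn_eq j k); elim: (j %/ k)%N => [//|m ->].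
      by rewrite mulSn -[in RHS]addnA [in RHS]addnC contactDk.
    by rewrite /y e -(e (i %% k).+1) -addn1 modnDml addn1 e.
  move=> jk; rewrite leNgt; apply/negP => h; apply: H; exists j => //.
  have -> : orient (P j) x (P j.+1) = - cross (y j) (y j.+1).
    by rewrite /orient /y /cross/=; ring.
  by rewrite oppr_gt0.
pose D i := cross (y 0%N) (y i).
have D0 : D 0%N = 0 by rewrite /D cross_self.
have Dk : D k = 0 by rewrite /D /y -[k]add0n contactDk cross_self.
(* The linear dependence of three plane vectors. If its coefficients are nonnegative and not all
   zero, then [no_conv] is contradicted; hence [D] cannot become negative going forward nor positive
   going backward, and it vanishes at both ends of the period. *)
have id i : cross (y i) (y i.+1) *: y 0%N + (- D i.+1) *: y i + D i *: y i.+1 = 0.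
  by rewrite /D; move: (y _) (y _) (y _) => [a1 a2] [b1 b2] [c1 c2]; apply: plane_eqP;
    rewrite /cross/= /GRing.scale/=; ring.
have S i : D i.+1 <= 0 -> D i <= 0.
  move=> h; rewrite leNgt; apply/negP => h'.
  apply: (no_conv xz xP _ _ _ _ (id i)) => //; rewrite ?oppr_ge0// ?(ltW h')//.
  by rewrite ltr_wpDl// addr_ge0// oppr_ge0.
have T i : 0 <= D i -> 0 <= D i.+1.
  move=> h; rewrite leNgt; apply/negP => h'.
  apply: (no_conv xz xP _ _ _ _ (id i)) => //; rewrite ?oppr_ge0// ?(ltW h')//.
  by rewrite ltr_pwDl// ltr_wpDl// oppr_gt0.
have Dle i : (i <= k)%N -> D i <= 0.
  move=> ik; rewrite -(subKn ik); elim: (k - i)%N (leq_subr i k) => [_|m IH mk].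
    by rewrite subn0 Dk.
  apply: S; have -> : (k - m.+1).+1 = (k - m)%N by nlia.
  by apply: IH; nlia.
have Dge i : 0 <= D i by elim: i => [|i IH]; [rewrite D0|exact: T].
have DE i : (i <= k)%N -> D i = 0 by move=> ik; apply/eqP; rewrite eq_le Dle// Dge.
have Ey i : cross (E i) (y i) < 0.
  have xPi : x != P i by rewrite eq_sym.
  by rewrite /y crossBr subr_lt0; exact: Pmin.
have y0n : 0 < (y 0%N).1 ^+ 2 + (y 0%N).2 ^+ 2.
  rewrite lt_neqAle addr_ge0 ?sqr_ge0// andbT eq_sym paddr_eq0 ?sqr_ge0// !sqrf_eq0.
  apply/negP => /andP[/eqP h1 /eqP h2]; have := Ey 0%N.
  by rewrite /cross h1 h2 !mulr0 subrr ltxx.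
(* All [y i] are now collinear with [y 0], and positive multiples of it since [x] is not between two
   contact points. So every [cross (E i) (y 0)] is negative, although the directions [E i] sum to
   zero. *)
have Ey0 i : (i < k)%N -> cross (E i) (y 0%N) < 0.
  move=> ik; have := DE i (ltnW ik); rewrite /D => coll.
  set n0 := _ + _ in y0n.
  pose d := (y 0%N).1 * (y i).1 + (y 0%N).2 * (y i).2.
  have dE : d *: y 0%N = n0 *: y i.
    move: coll; rewrite /d /n0; move: (y 0%N) (y i) => [a1 a2] [b1 b2]; rewrite /cross/= => e.
    apply: plane_eqP; rewrite /= /GRing.scale/=.
      by transitivity ((a1 ^+ 2 + a2 ^+ 2) * b1 + a2 * (a1 * b2 - a2 * b1)); [ring|rewrite e; ring].
    by transitivity ((a1 ^+ 2 + a2 ^+ 2) * b2 - a1 * (a1 * b2 - a2 * b1)); [ring|rewrite e; ring].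
  have dx : d * cross (E i) (y 0%N) = n0 * cross (E i) (y i).
    have := congr1 (cross (E i)) dE.
    have cZ (a : R) u : cross (E i) (a *: u) = a * cross (E i) u.
      by rewrite /cross/= /GRing.scale/=; ring.
    by rewrite !cZ.
  have nn : n0 * cross (E i) (y i) < 0 by rewrite pmulr_rlt0.
  have [dp|dn|d0] := ltgtP d 0.
  - exfalso; apply: (@no_conv x 0%N i i (- d) n0 0 xz xP) => //.
    + by rewrite oppr_ge0 ltW.
    + exact: ltW.
    + by rewrite addr0 addr_gt0// oppr_gt0.
    + by rewrite scale0r addr0 scaleNr dE addNr.
  - by move: nn; rewrite -dx pmulr_rlt0.
  - by move: nn; rewrite -dx d0 mul0r ltxx.
have : \sum_(0 <= i < k) cross (E i) (y 0%N) = 0.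
  transitivity (cross (\sum_(0 <= i < k) E i) (y 0%N)).
    elim/big_rec2 : _ => [|i u v _ ->]; first by rewrite /cross/= !mul0r subrr.
    by rewrite /cross/=; ring.
  by rewrite sum_side_dir /cross/= !mul0r subrr.
rewrite big_ltn// => e.
have : \sum_(1 <= i < k) cross (E i) (y 0%N) <= 0.
  by rewrite big_nat_cond sumr_le0// => i /andP[/andP[_ ik] _]; exact/ltW/Ey0.
have := Ey0 0%N kpos; move: e; move: (\sum_(1 <= i < k) _) (cross _ _) => a b; lra.
Qed.

(** The points beyond the chord are sorted by angle around [P j]; convex position, through
    [orient_conv3], upgrades this order to left turns of all triples. *)
Lemma contact_chain j (t : seq (R * R)) : P j != P j.+1 -> uniq t ->
  {subset t <= z} -> {in t, forall x i, P i != x} ->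
  {in t, forall x, 0 < orient (P j) x (P j.+1)} ->
  exists t', perm_eq t' t /\ chain (E j.+1) (P j) (E j) t' (P j.+1).
Proof.
move=> ne ut tz tP to.
have dn x : x \in t -> 0 < cross (E j) (x - P j).
  by move=> xt; rewrite crossBr subr_gt0; apply: Pmin; rewrite ?tz// eq_sym tP.
have en x : x \in t -> 0 < cross (P j.+1 - x) (E j.+1).
  move=> xt; rewrite crossC crossBr opprB subr_gt0.
  by apply: Pmin; rewrite ?tz// eq_sym tP.
have dQ : 0 < cross (E j) (P j.+1 - P j).
  by rewrite crossBr subr_gt0; apply: Pmin => //; rewrite eq_sym.
have eQ : 0 < cross (P j.+1 - P j) (E j.+1).
  by rewrite crossC crossBr opprB subr_gt0; apply: Pmin.
have de : 0 < cross (E j) (E j.+1) by rewrite cross_side_dirS; exact: sinm1_gt0.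
have eP x : x \in t -> 0 < cross (x - P j) (E j.+1).
  move=> xt; rewrite -(pmulr_lgt0 _ dQ).
  have -> : cross (x - P j) (E j.+1) * cross (E j) (P j.+1 - P j) =
    orient (P j) x (P j.+1) * cross (E j) (E j.+1) +
    cross (P j.+1 - P j) (E j.+1) * cross (E j) (x - P j).
    by rewrite /orient /cross/=; ring.
  by rewrite addr_gt0// mulr_gt0 ?to ?dn.
have [t' [pe so]] := angular_sort cz (Pz j) tz ut dn.
exists t'; split => //.
have mt x : (x \in t') = (x \in t) := perm_mem pe x.
set s := P j :: rcons t' (P j.+1).
have ss : size s = (size t').+2 by rewrite /s/= size_rcons.
have s0 : nth 0 s 0 = P j by [].
have sl : nth 0 s (size t').+1 = P j.+1 by rewrite /s /= nth_rcons ltnn eqxx.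
have sm i : (i < size t')%N -> nth 0 s i.+1 = nth 0 t' i.
  by move=> h; rewrite /s /= nth_rcons h.
have smt i : (i < size t')%N -> nth 0 s i.+1 \in t.
  by move=> h; rewrite sm// -mt mem_nth.
have o2 i l : (i < l < size t')%N -> 0 < orient (P j) (nth 0 s i.+1) (nth 0 s l.+1).
  by move=> h; case/andP: (h) => h1 h2; rewrite !sm//; [exact: so|exact: ltn_trans h2].
have o3 i l : (i < l < size t')%N -> 0 < orient (nth 0 s i.+1) (nth 0 s l.+1) (P j.+1).
  move=> h; case/andP: (h) => h1 h2; have h3 := ltn_trans h1 h2.
  by apply: (orient_conv3 cz (Pz j));
    [exact/tz/smt|exact/tz/smt|exact: Pz|exact: o2|exact/to/smt|exact/to/smt].
have h_e i l : (i < l < size s)%N -> 0 < cross (nth 0 s l - nth 0 s i) (E j.+1).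
  rewrite ss; case: i l => [|i] [|l]//; rewrite ?ltnS ?s0 => /andP[il].
    rewrite leq_eqVlt => /orP[/eqP ->|lt]; first by rewrite sl.
    by rewrite eP// smt.
  rewrite leq_eqVlt => /orP[/eqP le|lt]; first by rewrite le sl en// smt// -le.
  have it := ltn_trans il lt.
  have T3 : 0 < orient (P j) (nth 0 s i.+1) (P j.+1) by rewrite to// smt.
  rewrite -(pmulr_lgt0 _ T3).
  have -> : cross (nth 0 s l.+1 - nth 0 s i.+1) (E j.+1) * orient (P j) (nth 0 s i.+1) (P j.+1) =
    orient (P j) (nth 0 s i.+1) (nth 0 s l.+1) * cross (P j.+1 - nth 0 s i.+1) (E j.+1) +
    cross (nth 0 s i.+1 - P j) (E j.+1) * orient (nth 0 s i.+1) (nth 0 s l.+1) (P j.+1).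
    by move: (nth 0 s i.+1) (nth 0 s l.+1) => u v; rewrite /orient /cross/=; ring.
  by rewrite addr_gt0// mulr_gt0 ?o2 ?o3 ?en ?eP ?smt// il.
apply: left_turns_chain => //.
- move=> i l m; rewrite -/s ss; case: l m => [|l] [|m]; rewrite ?ltnS ?ltn0 ?andbF// => /andP[il lm].
  case: i il => [|i] il; rewrite leq_eqVlt => /orP[/eqP me|mt'].
  + by rewrite me sl s0 to// smt// -me.
  + by rewrite s0 o2// lm.
  + by rewrite me sl; apply: o3; rewrite il -me.
  + have lt := ltn_trans lm mt'.
    have it : (i < size t')%N by apply: ltn_trans lt.
    apply: (orient_conv3 cz (Pz j)); try exact/tz/smt; apply: o2.
    * by rewrite lt andbT.
    * by rewrite mt' andbT.
    * by rewrite mt' andbT; exact: (ltn_trans il).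
- move=> [//|i]; rewrite -/s ss /= ltnS.
  rewrite ltnS leq_eqVlt => /orP[/eqP ->|lt]; first by have := sl; rewrite /s /= => ->.
  by have := dn _ (smt _ lt).
Qed.

End circumscribed.

(** Extends [config] to samples in which one point touches several sides: such a point is listed
    once per side in [ps] but counted once by [undup]. The disjunction records the conclusion of
    [contact_consecutive]. *)
Definition circumscription z ps ts rest := [/\ size ps = k, size ts = k,
  size rest = sumn ts,
  {subset ps <= z} & [/\
  (forall j, (j < k)%N ->
    if cyc_nth k ps j == cyc_nth k ps j.+1 then piece ts rest j = [::] else
    chain (E j.+1) (cyc_nth k ps j) (E j) (piece ts rest j) (cyc_nth k ps j.+1)),
  (uniq ps \/ exists2 j, (j < k)%N & cyc_nth k ps j == cyc_nth k ps j.+1) &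
  perm_eq z (undup ps ++ rest)]].

Lemma circumscription_exists (z : seq (R * R)) :
  uniq z -> conv3_free z -> (1 < size z)%N ->
  (forall i x y, (i < k)%N -> x \in z -> y \in z -> x != y ->
    cross (E i) x != cross (E i) y) ->
  exists ps ts rest, circumscription z ps ts rest.
Proof.
move=> uz cz sz nt.
have kpos : (0 < k)%N by nlia.
have [P PP] := choice (contact_exists uz sz nt).
have Pz i : P i \in z by have [] := PP i.
have Pmin i y : y \in z -> y != P i -> cross (E i) (P i) < cross (E i) y.
  by have [_ h] := PP i; exact: h.
pose ps := [seq P i | i <- iota 0 k].
have sps : size ps = k by rewrite size_map size_iota.
have psE i : cyc_nth k ps i = P i.
  have e j : P (j %% k)%N = P j.
    rewrite [in RHS](divn_eq j k); elim: (j %/ k)%N => [//|m ->].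
    by rewrite mulSn -[in RHS]addnA [in RHS]addnC (contactDk Pz Pmin).
  rewrite /cyc_nth (nth_map 0%N) ?size_iota ?ltn_mod//.
  by rewrite nth_iota ?ltn_mod// add0n e.
have psP x : x \notin ps -> forall i, P i != x.
  move=> xp i; apply: contraNneq xp => <-; rewrite -psE /cyc_nth mem_nth//.
  by rewrite sps ltn_mod.
pose w := [seq x <- z | x \notin ps].
have wz x : x \in w -> x \in z by rewrite mem_filter => /andP[].
have wP x : x \in w -> forall i, P i != x by rewrite mem_filter => /andP[/psP].
(* Each remaining point is assigned to the first chord that it lies beyond. *)
pose f x := find (fun j => 0 < orient (P j) x (P j.+1)) (iota 0 k).
have hx x : x \in w -> has (fun j => 0 < orient (P j) x (P j.+1)) (iota 0 k).
  move=> xw; have [j jk o] := contact_cover uz cz sz Pz Pmin (wz _ xw) (wP _ xw).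
  by apply/hasP; exists j => //; rewrite mem_iota add0n.
have fk x : x \in w -> (f x < k)%N.
  by move=> /hx; rewrite has_find size_iota.
have fo x : x \in w -> 0 < orient (P (f x)) x (P (f x).+1).
  move=> xw; have := nth_find 0%N (hx _ xw); rewrite -/(f x).
  by rewrite nth_iota ?fk.
have pieceP j : exists t, perm_eq t [seq x <- w | f x == j] /\
    if P j == P j.+1 then t = [::] else chain (E j.+1) (P j) (E j) t (P j.+1).
  have [e|ne] := eqVneq (P j) (P j.+1).
    exists [::]; split => //; rewrite (_ : [seq x <- w | f x == j] = [::])//.
    apply/eqP; rewrite -[_ == _]negbK -has_filter; apply/hasPn => x xw.
    apply: contraTneq (fo _ xw) => ->; rewrite -e -leNgt.
    by rewrite /orient subrr /cross/= !mulr0 subrr.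
  apply: (contact_chain cz Pz Pmin ne).
  - by rewrite filter_uniq// filter_uniq.
  - by move=> x; rewrite mem_filter => /andP[_ /wz].
  - by move=> x; rewrite mem_filter => /andP[_ /wP].
  - by move=> x; rewrite mem_filter => /andP[/eqP <- /fo].
have [t tP] := choice pieceP.
pose ss := [seq t j | j <- iota 0 k].
have sss : size ss = k by rewrite size_map size_iota.
have pE j : (j < k)%N -> piece (shape ss) (flatten ss) j = t j.
  by move=> jk; rewrite /piece flattenK (nth_map 0%N) ?size_iota// nth_iota// add0n.
exists ps, (shape ss), (flatten ss); split => //; last split.
- by rewrite size_map.
- by rewrite size_flatten.
- by move=> x /mapP[i _ ->].
- by move=> j jk; rewrite pE// !psE; have [_] := tP j.
- have [up|nup] := boolP (uniq ps); [by left|right].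
  have [i [j [ij jk e]]] : exists i j, [/\ (i < j)%N, (j < k)%N & P i = P j].
    apply: contrapT => h; move/negP: nup; apply.
    rewrite map_inj_in_uniq ?iota_uniq// => i j; rewrite !mem_iota !add0n => ik jk e.
    case: (ltngtP i j) => // ij; exfalso; apply: h; [exists i, j|exists j, i] => //.
  have ijk : (i < j < k)%N by rewrite ij.
  have [l lk le] := contact_consecutive uz sz Pz Pmin ijk e.
  by exists l => //; rewrite !psE le.
rewrite perm_sym; apply: (@perm_trans _ ([seq x <- z | x \in ps] ++ w)); last by rewrite perm_filterC.
apply: perm_cat.
  apply: uniq_perm; rewrite ?undup_uniq ?filter_uniq// => x.
  by rewrite mem_undup mem_filter; case: (boolP (x \in ps)) => // /mapP[i _ ->]; rewrite Pz.
have := perm_flatten_fibers f w k.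
have -> : [seq x <- w | (f x < k)%N] = w by apply/all_filterP/allP => x /fk.
apply: perm_trans.
rewrite /ss; elim: (iota 0 k) => [//|j s IH] /=.
by apply: perm_cat => //; have [] := tP j.
Qed.

End circumscription.

(** * The regular polygon *)

Lemma measurable_mem d (T : measurableType d) (A : set T) : measurable A ->
  measurable_fun setT (fun x => x \in A).
Proof.
move=> mA; apply: (measurable_fun_bool true); rewrite setTI.
by rewrite (_ : _ @^-1` _ = A)//; apply/seteqP; split => x; [exact: set_mem|exact: mem_set].
Qed.

Section regular_polygons.
Context {R : realType}.
Variables (k : nat) (c : R * R) (rho phi : R).
Hypotheses (k3 : (3 <= k)%N) (rho0 : 0 < rho).
Local Notation alpha := (@step_angle R k).
Local Notation E := (side_dir k phi).
Local Notation K := (regular_polygon k c rho phi).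
Implicit Types (x y z w : R * R).

Let kpos : (0 < k)%N. Proof. by lia. Qed.

Definition apothem : R := rho * cos (alpha / 2).

(** The vertices of the polygon are multiples of the side directions of a rotated copy, so all facts
    on [side_dir] apply to them. *)
Definition corner i : R * R := rho *: side_dir k (phi - alpha / 2 - pi / 2) i.
Local Notation V := corner.

Lemma half_step_angle : 0 < alpha / 2 < pi / 2.
Proof.
have p0 := pi_gt0 R.
rewrite divr_gt0 ?step_angle_gt0//= ltr_pM2r ?invr_gt0//.
rewrite /step_angle ltr_pdivrMr ?ltr0n// mulrC ltr_pM2l//.
by rewrite ltr_nat.
Qed.

Lemma cos_half_gt0 : 0 < cos (alpha / 2).
Proof.
apply: cos_gt0_pihalf; have /andP[h1 ->] := half_step_angle; rewrite andbT.
by apply: lt_trans h1; rewrite oppr_lt0 divr_gt0// pi_gt0.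
Qed.

Lemma sin_half_gt0 : 0 < sin (alpha / 2).
Proof.
have /andP[h1 h2] := half_step_angle; apply: sin_gt0_pi; rewrite h1/=.
by apply: lt_trans h2 _; rewrite ltr_pdivrMr// ltr_pMr ?pi_gt0// ltr1n.
Qed.

Lemma apothem_gt0 : 0 < apothem.
Proof. by rewrite mulr_gt0// cos_half_gt0. Qed.

Lemma cornerE i : V i = (rho * cos (phi + i%:R * alpha), rho * sin (phi + i%:R * alpha)).
Proof.
have e : side_angle k (phi - alpha / 2 - pi / 2) i = phi + i%:R * alpha - pi / 2.
  by rewrite /side_angle; field.
rewrite /corner /side_dir e; apply: plane_eqP; rewrite /= /GRing.scale/=.
  by rewrite sinB sin_pihalf cos_pihalf; ring.
by rewrite cosB sin_pihalf cos_pihalf; ring.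
Qed.

Lemma regular_vertexE (i : 'I_k) : regular_vertex c rho phi i = c + V i.
Proof.
rewrite cornerE /regular_vertex /step_angle.
have -> : phi + 2 * pi * i%:R / k%:R = phi + i%:R * (2 * pi / k%:R) by ring.
by [].
Qed.

Let two_sin : 0 < 2 * sin (alpha / 2).
Proof. by rewrite mulr_gt0// sin_half_gt0. Qed.

Definition side : R := rho * (2 * sin (alpha / 2)).

Lemma side_gt0 : 0 < side. Proof. exact: mulr_gt0. Qed.

Let half_up i : phi + i.+1%:R * alpha = side_angle k phi i + alpha / 2.
Proof. by rewrite /side_angle -[i.+1]addn1 natrD; field. Qed.

Let half_down i : phi + i%:R * alpha = side_angle k phi i - alpha / 2.
Proof. by rewrite /side_angle; field. Qed.

Lemma corner_side i : V i.+1 = V i + side *: E i.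
Proof.
rewrite !cornerE half_up half_down /side_dir /side.
by apply: plane_eqP; rewrite /= /GRing.scale/= !(cosB, sinB, cosD, sinD); ring.
Qed.

Lemma side_dir_corner i : E i.+1 = E i - (2 * sin (alpha / 2) / rho) *: V i.+1.
Proof.
have r0 : rho != 0 by rewrite gt_eqF.
have e0 : side_angle k phi i = phi + i.+1%:R * alpha - alpha / 2.
  by rewrite half_up addrK.
have e1 : side_angle k phi i.+1 = phi + i.+1%:R * alpha + alpha / 2.
  by rewrite half_down subrK.
rewrite cornerE /side_dir e0 e1; move: (phi + _) (alpha / 2) => u v.
apply: plane_eqP; rewrite /= /GRing.scale/= !(cosB, sinB, cosD, sinD); field => //.
Qed.

Lemma cross_side_corner i : cross (E i) (V i) = - apothem.
Proof.
rewrite cornerE half_down /side_dir /apothem /cross/= cosB sinB.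
move: (side_angle _ _ _) (alpha / 2) => u v.
transitivity (- (rho * cos v) * (cos u ^+ 2 + sin u ^+ 2)); first by ring.
by rewrite cos2Dsin2 mulr1.
Qed.

Lemma corner_mod i : V (i %% k)%N = V i.
Proof. by rewrite /corner side_dir_mod. Qed.

Lemma cornerDk i : V (i + k) = V i.
Proof. by rewrite /corner side_dirDk. Qed.

Lemma cross_corner i j : (i <= j)%N -> cross (V i) (V j) = rho ^+ 2 * sinm k (j - i).
Proof.
move=> ij; rewrite -(cross_side_dir k (phi - alpha / 2 - pi / 2) ij) /corner /cross/= /GRing.scale/=.
by ring.
Qed.

Lemma cross_cornerS i : cross (V i) (V i.+1) = rho ^+ 2 * sinm k 1.
Proof. by rewrite cross_corner// subSn// subnn. Qed.

Let cross_corner_gt0 i : 0 < cross (V i) (V i.+1).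
Proof. by rewrite cross_cornerS mulr_gt0 ?exprn_gt0// sinm1_gt0. Qed.

Let cornerD i m : cross (E i) (V (i + m)) =
  - apothem + \sum_(0 <= l < m) side * sinm k l.
Proof.
elim: m => [|m IH]; first by rewrite addn0 big_geq// addr0 cross_side_corner.
rewrite addnS corner_side big_nat_recr//= addrA -IH.
have <- : cross (E i) (E (i + m)) = sinm k m.
  by rewrite cross_side_dir ?leq_addr// addKn.
by rewrite /cross/= /GRing.scale/=; ring.
Qed.

Lemma corner_half_plane i j : - apothem <= cross (E i) (V j).
Proof.
suff H m : (m <= k)%N -> - apothem <= cross (E i) (V (i + m)).
  pose m := ((j + k - i %% k) %% k)%N.
  have mk : (m < k)%N by rewrite ltn_mod.
  have -> : V j = V (i + m).
    rewrite -corner_mod -[RHS]corner_mod; congr V.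
    rewrite -(modnDml i) /m modnDmr addnC subnK ?modnDr//.
    by rewrite (leq_trans (ltnW (ltn_pmod i kpos)))// leq_addl.
  by apply: H; exact: ltnW.
move=> mk; rewrite cornerD lerDl.
have := @unimodal_sum R (fun l => side * sinm k l) (k %/ 2).+1 k m mk.
have -> : \sum_(0 <= l < k) side * sinm k l = 0.
  by apply/eqP; rewrite -(inj_eq (addrI (- apothem))) addr0 -(cornerD i) cornerDk cross_side_corner.
rewrite minxx; apply => l lk.
  by rewrite mulr_ge0 ?(ltW side_gt0)// sinm_ge0//; nlia.
by rewrite pmulr_rle0 ?side_gt0// sinm_le0//; nlia.
Qed.

Lemma polygon_half_plane z i : K z -> - apothem <= cross (E i) (z - c).
Proof.
move=> [w [w0 w1] ->].
have -> : cross (E i) (\sum_j w j *: regular_vertex c rho phi j - c) =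
    \sum_j w j * cross (E i) (V j).
  transitivity (cross (E i) (\sum_j w j *: V j)).
    congr cross; under eq_bigr do rewrite regular_vertexE scalerDr.
    by rewrite big_split/= -scaler_suml w1 scale1r addrAC subrr add0r.
  elim/big_rec2 : _ => [|j u v _ <-]; first by rewrite /cross/= !mulr0 subrr.
  by rewrite /cross/= /GRing.scale/=; ring.
rewrite -[X in X <= _]mul1r -w1 mulr_suml; apply: ler_sum => j _.
by rewrite ler_wpM2l// corner_half_plane.
Qed.

Lemma polygon_corner i : K (c + V i).
Proof.
have ik : (i %% k < k)%N by rewrite ltn_mod.
rewrite -corner_mod -(regular_vertexE (Ordinal ik)).
exact: convex_hull_point.
Qed.

Lemma polygon_center : K c.
Proof.
have kn0 : k%:R != 0 :> R by rewrite pnatr_eq0; lia.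
exists (fun=> k%:R^-1).
  split=> [i|]; first by rewrite invr_ge0 ler0n.
  by rewrite sumr_const card_ord -[_ *+ _]mulr_natr mulVf.
rewrite -scaler_sumr; under eq_bigr do rewrite regular_vertexE.
rewrite big_split/= sumr_const card_ord -[c *+ k]scaler_nat.
rewrite scalerDr scalerA mulVf// scale1r.
rewrite (_ : \sum_(i < k) V i = 0) ?scaler0 ?addr0//.
by rewrite /corner -scaler_sumr -(big_mkord xpredT (side_dir k _)) sum_side_dir// scaler0.
Qed.

Lemma sector_coords i w : exists a b : R,
  [/\ w = a *: V i + b *: V i.+1,
     a * cross (V i) (V i.+1) = cross w (V i.+1),
     b * cross (V i) (V i.+1) = cross (V i) w &
     cross (E i) w = - ((a + b) * apothem)].
Proof.
have h := cross_corner_gt0 i.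
have h0 : cross (V i) (V i.+1) != 0 by rewrite gt_eqF.
exists (cross w (V i.+1) / cross (V i) (V i.+1)), (cross (V i) w / cross (V i) (V i.+1)).
split; rewrite ?divfK//; first exact: cross_decomp.
rewrite {1}(cross_decomp w h0).
have e : cross (E i) (V i.+1) = - apothem.
  by rewrite -addn1 cornerD big_nat1 /sinm mul0r sin0 mulr0 addr0.
move: (cross w _ / _) (cross _ w / _) => a b.
transitivity (a * cross (E i) (V i) + b * cross (E i) (V i.+1)).
  by rewrite /cross/= /GRing.scale/=; ring.
by rewrite e cross_side_corner; ring.
Qed.

Definition sector i w := (0 < cross (V i) w) && (0 < cross w (V i.+1)).

(** Take the side [i] that minimizes [cross (E i) w]. Differences between consecutive sides are
    positive multiples of [cross (V i.+1) w], so minimality against both neighbours places [w]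
    between two vertices. *)
Lemma closed_sector_exists w : exists2 i, (i < k)%N &
  0 <= cross (V i) w /\ 0 <= cross w (V i.+1).
Proof.
pose f (j : 'I_k) := cross (E j) w.
case: (@Order.TotalTheory.arg_minP _ _ _ (Ordinal kpos) predT f isT) => i _ iP.
have fmin j : cross (E i) w <= cross (E j) w.
  have jk : (j %% k < k)%N by rewrite ltn_mod.
  by have := iP (Ordinal jk) isT; rewrite /f /= side_dir_mod.
have step j : cross (E j) w - cross (E j.+1) w = (2 * sin (alpha / 2) / rho) * cross (V j.+1) w.
  by rewrite side_dir_corner /cross/= /GRing.scale/=; ring.
have p : 0 < 2 * sin (alpha / 2) / rho by rewrite divr_gt0.
exists i => //; split.
  rewrite -(cornerDk i) -(pmulr_rge0 _ p).
  have <- : (i + k.-1).+1 = (i + k)%N by rewrite -addnS prednK.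
  by rewrite -step -addnS prednK// side_dirDk// subr_ge0.
by rewrite crossC oppr_ge0 -(pmulr_rle0 _ p) -step subr_le0.
Qed.

(** In its sector the point is [a V_i + b V_(i+1)] with [a, b >= 0], and the inequality for that one
    side reads [a + b <= 1]. *)
Lemma polygonP z : (forall i, (i < k)%N -> - apothem <= cross (E i) (z - c)) -> K z.
Proof.
move=> H; pose w := z - c; have zE : z = c + w by rewrite /w addrC subrK.
have [i ik [h1 h2]] := closed_sector_exists w.
have [a [b [wE aE bE fE]]] := sector_coords i w.
have D := cross_corner_gt0 i.
have a0 : 0 <= a by rewrite -(pmulr_lge0 _ D) aE.
have b0 : 0 <= b by rewrite -(pmulr_lge0 _ D) bE.
have ab1 : a + b <= 1.
  by have := H i ik; rewrite -/w fE lerN2 -[X in _ <= X]mul1r ler_pM2r ?apothem_gt0.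
have [ab|ab] := eqVneq (a + b) 0.
  have a_0 : a = 0 by lra. have b_0 : b = 0 by lra.
  by rewrite zE wE a_0 b_0 !scale0r !addr0; exact: polygon_center.
have abp : 0 < a + b by rewrite lt_neqAle eq_sym ab addr_ge0.
pose t := a / (a + b).
have t01 : 0 <= t <= 1.
  by rewrite divr_ge0 ?(ltW abp)//= ler_pdivrMr// mul1r lerDl.
have Ky := convex_hull_convex (polygon_corner i) (polygon_corner i.+1) t01.
have ab01 : 0 <= a + b <= 1 by rewrite ltW.
have := convex_hull_convex Ky polygon_center ab01.
rewrite zE wE; congr K.
rewrite /t; apply: plane_eqP; rewrite /= /GRing.scale/=; field => //.
Qed.

Lemma sector_disjoint i j w : (i < j < k)%N -> sector i w -> sector j w -> False.
Proof.
move=> /andP[ij jk] /andP[i1 i2] /andP[j1 j2].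
have [a [b [wE aE bE _]]] := sector_coords i w.
have D := cross_corner_gt0 i.
have a0 : 0 < a by rewrite -(pmulr_lgt0 _ D) aE.
have b0 : 0 < b by rewrite -(pmulr_lgt0 _ D) bE.
have r2 : 0 < rho ^+ 2 by rewrite exprn_gt0.
have ij' := ltnW ij.
have [m2|m2] := leqP (2 * (j - i)) k.
  have : cross w (V j) < 0 by rewrite crossC oppr_lt0.
  rewrite wE.
  have -> : cross (a *: V i + b *: V i.+1) (V j) = a * cross (V i) (V j) + b * cross (V i.+1) (V j).
    by rewrite /cross/= /GRing.scale/=; ring.
  rewrite !cross_corner// ltNge addr_ge0// mulr_ge0 ?(ltW a0) ?(ltW b0)// mulr_ge0 ?(ltW r2)//;
    by apply: sinm_ge0; nlia.
move: j2; rewrite wE.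
have -> : cross (a *: V i + b *: V i.+1) (V j.+1) = a * cross (V i) (V j.+1) + b * cross (V i.+1) (V j.+1).
  by rewrite /cross/= /GRing.scale/=; ring.
rewrite !cross_corner ?ltnS//; last exact: leqW.
rewrite ltNge -oppr_ge0 opprD addr_ge0// -mulrN mulr_ge0 ?(ltW a0) ?(ltW b0)// -mulrN mulr_ge0 ?(ltW r2)//;
  rewrite oppr_ge0; apply: sinm_le0; nlia.
Qed.

Local Open Scope ereal_scope.

Lemma polygon_sector i z : sector i (z - c)%R ->
  K z <-> exists a b : R, [/\ 0 < a, 0 < b, a + b <= 1 & z = c + (a *: V i + b *: V i.+1)]%R.
Proof.
move=> /andP[h1 h2]; have [a [b [wE aE bE fE]]] := sector_coords i (z - c)%R.
have D := cross_corner_gt0 i.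
have a0 : (0 < a)%R by rewrite -(pmulr_lgt0 _ D) aE.
have b0 : (0 < b)%R by rewrite -(pmulr_lgt0 _ D) bE.
split=> [Kz|[a' [b' [a'0 b'0 ab ->]]]].
  exists a, b; split => //; last by rewrite -wE addrC subrK.
  have := polygon_half_plane i Kz; rewrite fE lerN2 -[X in (_ <= X)%R]mul1r.
  by rewrite ler_pM2r ?apothem_gt0.
have abp : (0 < a' + b')%R by rewrite addr_gt0.
have abn : (a' + b' != 0)%R by rewrite gt_eqF.
pose t := (a' / (a' + b'))%R.
have t01 : (0 <= t <= 1)%R.
  by rewrite divr_ge0 ?(ltW abp) ?(ltW a'0)//= ler_pdivrMr// mul1r lerDl ltW.
have Ky := convex_hull_convex (polygon_corner i) (polygon_corner i.+1) t01.
have ab01 : (0 <= a' + b' <= 1)%R by rewrite ltW.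
have := convex_hull_convex Ky polygon_center ab01.
by congr K; rewrite /t; apply: plane_eqP; rewrite /= /GRing.scale/=; field.
Qed.

Lemma line_null (u p : R * R) : u != 0%R ->
  \int[@leb2 R]_z (cross u ((z : R * R) - p)%R == 0%R)%:R%:E = 0.
Proof.
move=> u0; pose v : R * R := (- u.2, u.1)%R.
have uv : cross u v != 0%R.
  have -> : cross u v = (u.1 ^+ 2 + u.2 ^+ 2)%R by rewrite /cross/=; ring.
  rewrite paddr_eq0 ?sqr_ge0// !sqrf_eq0; apply: contra u0 => /andP[/eqP h1 /eqP h2].
  by apply/eqP/plane_eqP.
rewrite (integral_frame p uv)//; last first.
  apply/measurable_EFinP; apply: measurable_boolR.
  apply: measurable_fun_eqr => //.
  by apply: measurable_cross => //; apply: measurable_subpt.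
rewrite (_ : (fun z => _) = (fun z : plane R => (z.2 == 0%R)%:R%:E)); last first.
  apply/funext => z; congr (_%:R%:E); congr nat_of_bool.
  have -> : cross u ((frame p u v z : R * R) - p)%R = (z.2 * cross u v)%R.
    by rewrite /frame /cross/=; ring.
  by rewrite mulf_eq0 (negbTE uv) orbF.
rewrite /leb2 fubini_tonelli1//=.
  rewrite (_ : fubini_F _ _ = cst 0) ?integral0 ?mule0//.
  apply/funext => x; rewrite /fubini_F/=.
  transitivity (\int[@lebesgue_measure R]_y (\1_[set (0%R : measurableTypeR R)] y)%:E).
    by apply: eq_integral => y _; rewrite indicE in_set1.
  by rewrite integral_indic// setIT; exact: lebesgue_measure_set1.
by apply/measurable_EFinP; apply: measurable_boolR; apply: measurable_fun_eqr => //.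
Qed.

Let triangle_integral :
  \int[@leb2 R]_z ([&& 0 < z.1, 0 < z.2 & z.1 + z.2 <= 1])%R%:R%:E = (2^-1)%:E.
Proof.
rewrite /leb2 fubini_tonelli1//=; last first.
  by apply/measurable_EFinP; meas.
transitivity (\int[@lebesgue_measure R]_x ((0 < x < 1)%R%:R * (x ^+ 0 * (1 - x) ^+ 1))%:E); last first.
  by rewrite integral_beta//= expr1n mul1r !fact0 !factS fact0 div1r.
apply: eq_integral => x _; rewrite /fubini_F/=.
transitivity (\int[@lebesgue_measure R]_y
   ((0 < x)%R%:R%:E * (\1_(`]0%R, (1 - x)%R]%classic : set (measurableTypeR R)) y)%:E)).
  apply: eq_integral => y _; rewrite indicE mem_setE in_itv/= -EFinM -natrM mulnb.
  by rewrite lerBrDl; case: (0 < x)%R; case: (0 < y)%R.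
rewrite ge0_integralZl//; last first.
  by apply/measurable_EFinP; exact: measurable_indic.
rewrite integral_indic// setIT [X in _ * X]lebesgue_measure_itv/= lte_fin subr_gt0 expr0 expr1 mul1r.
case: (0 < x)%R; last by rewrite mul0r mul0e.
by case: (x < 1)%R; rewrite mul1e ?mul1r ?mul0r// oppr0 adde0.
Qed.

Let sum_bool_le (b : nat -> bool) (B : bool) : (forall i, (i < k)%N -> b i -> B) ->
  (forall i j, (i < j < k)%N -> b i -> b j -> False) ->
  (\sum_(i < k) (b i) <= B)%N.
Proof.
move=> bB bb; case: (pselect (exists i : 'I_k, b i)) => [[i bi]|H].
  rewrite (bigD1 i)//= bi (bB i)// big1// => j ji; apply/eqP; rewrite eqb0; apply/negP => bj.
  have := ltn_ord i; have := ltn_ord j => jk ik.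
  case: (ltngtP i j) => [ij|ij|ij]; [by apply: (bb i j); rewrite ?ij|by apply: (bb j i); rewrite ?ij|].
  by move/eqP : ji; apply; exact/val_inj.
by rewrite big1// => i _; apply/eqP; rewrite eqb0; apply/negP => bi; apply: H; exists i.
Qed.

(** The polygon is the disjoint union of [k] triangles, one in each open sector, up to the lines
    through the center and the vertices, which are null sets. *)
Lemma area_polygon :
  lebesgue_measure2 R K = (k%:R * (rho ^+ 2 * sinm k 1 / 2))%:E.
Proof.
have mK := measurable_regular_polygon k c rho phi.
pose b i (z : plane R) := (z \in K) && sector i ((z : R * R) - c)%R.
have mcr i : measurable_fun setT (fun z : plane R => cross (V i) ((z : R * R) - c)%R).
  by apply: measurable_cross => //; exact: measurable_subpt.
have mcr' i : measurable_fun setT (fun z : plane R => cross ((z : R * R) - c)%R (V i)).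
  by apply: measurable_cross => //; exact: measurable_subpt.
have mb i : measurable_fun setT (fun z : plane R => ((b i z)%:R : R)%:E).
  apply/measurable_EFinP; apply: measurable_boolR; apply: measurable_and.
    exact: measurable_mem.
  by apply: measurable_and; apply: measurable_fun_ltr.
have bI i : \int[@leb2 R]_z ((b i z)%:R : R)%:E = (rho ^+ 2 * sinm k 1 / 2)%:E.
  have D := cross_corner_gt0 i.
  rewrite (@integral_frame _ c (V i) (V i.+1))//; last by rewrite gt_eqF.
  rewrite gtr0_norm// cross_cornerS [RHS]EFinM -triangle_integral; congr (_ * _).
  apply: eq_integral => z _; congr (_%:R%:E); congr nat_of_bool.
  have fE : frame c (V i) (V i.+1) z = (c + (z.1 *: V i + z.2 *: V i.+1))%R.
    by rewrite /frame; apply: plane_eqP => /=; rewrite /GRing.scale/= addrA.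
  have s1 : cross (V i) (c + (z.1 *: V i + z.2 *: V i.+1) - c)%R = (z.2 * cross (V i) (V i.+1))%R.
    by rewrite /cross/= /GRing.scale/=; ring.
  have s2 : cross (c + (z.1 *: V i + z.2 *: V i.+1) - c)%R (V i.+1) = (z.1 * cross (V i) (V i.+1))%R.
    by rewrite /cross/= /GRing.scale/=; ring.
  have sE : sector i (c + (z.1 *: V i + z.2 *: V i.+1) - c)%R = (0 < z.2)%R && (0 < z.1)%R.
    by rewrite /sector s1 s2 !pmulr_lgt0.
  rewrite /b fE sE andbC; case: (ltrP 0%R z.2) => z2; last by rewrite andbF.
  case: (ltrP 0%R z.1) => z1 //=.
  have sec : sector i (c + (z.1 *: V i + z.2 *: V i.+1) - c)%R by rewrite sE z1 z2.
  apply/idP/idP => [/set_mem/(polygon_sector sec)[a' [b' [a'0 b'0 ab]]]|ab].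
    move/eqP; rewrite -subr_eq0 => /eqP e.
    have e' : ((z.1 - a') *: V i + (z.2 - b') *: V i.+1 = 0)%R.
      rewrite -e; apply: plane_eqP; rewrite /= /GRing.scale/=; ring.
    have c1 : ((z.1 - a') * cross (V i) (V i.+1) = 0)%R.
      transitivity (cross ((z.1 - a') *: V i + (z.2 - b') *: V i.+1) (V i.+1))%R.
        by rewrite /cross/= /GRing.scale/=; ring.
      by rewrite e' /cross/= !mul0r subrr.
    have c2 : ((z.2 - b') * cross (V i) (V i.+1) = 0)%R.
      transitivity (cross (V i) ((z.1 - a') *: V i + (z.2 - b') *: V i.+1))%R.
        by rewrite /cross/= /GRing.scale/=; ring.
      by rewrite e' /cross/= !mulr0 subrr.
    move: c1 c2 => /eqP; rewrite mulf_eq0 (gt_eqF D) orbF subr_eq0 => /eqP -> /eqP.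
    by rewrite mulf_eq0 (gt_eqF D) orbF subr_eq0 => /eqP ->.
  by apply/mem_set/(polygon_sector sec); exists z.1, z.2; split.
have V0 i : V i != 0%R.
  by apply: contraTneq (cross_corner_gt0 i) => ->; rewrite /cross/= !mul0r subrr ltxx.
have sumI : \int[@leb2 R]_z (\sum_(i < k) (b i z)%:R%:E) =
    (k%:R * (rho ^+ 2 * sinm k 1 / 2))%:E.
  rewrite ge0_integral_sum//.
  under eq_bigr do rewrite bI.
  by rewrite sumEFin sumr_const card_ord [in RHS]mulr_natl.
have null i : \int[@leb2 R]_z (cross (V i) ((z : R * R) - c)%R == 0%R)%:R%:E = 0 by exact: line_null.
have mn i : measurable_fun setT (fun z : plane R => ((cross (V i) ((z : R * R) - c)%R == 0%R)%:R : R)%:E).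
  by apply/measurable_EFinP; apply: measurable_boolR; apply: measurable_fun_eqr.
have KE : lebesgue_measure2 R K = \int[@leb2 R]_z ((z \in K)%:R)%:E.
  by rewrite -[LHS]/(leb2 K) -[K in LHS]setIT -integral_indic//.
rewrite KE -sumI; apply/eqP; rewrite eq_le; apply/andP; split; last first.
  apply: ge0_le_integralT => z; first by rewrite sumEFin lee_fin sumr_ge0.
  rewrite sumEFin lee_fin -natr_sum ler_nat; apply: (@sum_bool_le (fun i => b i z)) => [i _ /andP[]//|i j ij].
  by move=> /andP[_ si] /andP[_ sj]; exact: (sector_disjoint ij si sj).
apply: (@le_trans _ _ (\int[@leb2 R]_z (\sum_(i < k) (b i z)%:R%:E +
    \sum_(i < k) (cross (V i) ((z : R * R) - c)%R == 0%R)%:R%:E))).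
  apply: ge0_le_integralT => z; first by rewrite lee_fin.
  rewrite !sumEFin -EFinD lee_fin -!natr_sum -natrD ler_nat.
  case: (boolP (z \in K)) => //= zK.
  have [i ik [h1 h2]] := closed_sector_exists ((z : R * R) - c)%R.
  have [v0|v0] := eqVneq (cross (V i) ((z : R * R) - c)%R) 0%R.
    by rewrite addnC (bigD1 (Ordinal ik))//= v0 eqxx.
  have [v1|v1] := eqVneq (cross ((z : R * R) - c)%R (V i.+1)) 0%R.
    have jk : (i.+1 %% k < k)%N by rewrite ltn_mod.
    by rewrite addnC (bigD1 (Ordinal jk))//= corner_mod crossC v1 oppr0 eqxx.
  rewrite (bigD1 (Ordinal ik))//= /b zK /sector /=.
  by rewrite !lt_neqAle h1 h2 !andbT !(eq_sym 0%R) v0 v1.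
rewrite ge0_integralD//; last 4 first.
- by move=> z _; rewrite sumEFin lee_fin sumr_ge0.
- exact: emeasurable_sum.
- by move=> z _; rewrite sumEFin lee_fin sumr_ge0.
- exact: emeasurable_sum.
rewrite [X in _ + X]ge0_integral_sum//.
by rewrite [X in _ + X]big1 ?adde0// => i _; exact: null.
Qed.

End regular_polygons.

Lemma mnormalize1 d (T : measurableType d) (R : realType)
    (m : {measure set T -> \bar R}) (P : probability T R) A :
  m setT = 1%E -> mnormalize m P A = m A.
Proof. by move=> m1; rewrite /mnormalize/= m1 onee_eq0/= invr1 mule1. Qed.

(** * The uniform law on a set of area one *)

Section uniform_law.
Context {R : realType}.
Variables (K : set (plane R)) (mK : measurable K).
Hypothesis K1 : lebesgue_measure2 R K = 1%E.
Local Notation U := (uniform_law mK).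
Local Open Scope ereal_scope.

Lemma uniform_lawE (A : set (plane R)) : measurable A -> U A = leb2 (A `&` K).
Proof. by move=> mA; apply: mnormalize1; rewrite /= /mrestr setTI. Qed.

Lemma integral_uniform (f : plane R -> \bar R) :
  measurable_fun setT f -> (forall x, 0 <= f x) ->
  \int[U]_x f x = \int[leb2]_x ((x \in K)%:R%:E * f x).
Proof.
move=> mf f0; have mKC := measurableC mK.
have dis : [disjoint K & ~` K] by apply/disj_setPS => x [].
rewrite -[X in \int[U]_(x in X) _](setvU K) setUC ge0_integral_setU//; last exact: measurable_funTS.
rewrite [X in _ + X]null_set_integral//; last 2 first.
- exact: measurable_funTS.
- by apply: (etrans (uniform_lawE mKC)); rewrite setICl measure0.
rewrite adde0; transitivity (\int[leb2]_(x in K) f x).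
  apply: eq_measure_integral => A mA AK.
  by apply: (etrans (uniform_lawE mA)); rewrite setIidl.
rewrite integral_mkcond; apply: eq_integral => x _.
by rewrite patchE; case: ifPn => _; rewrite ?mul1e ?mul0e.
Qed.

Lemma iint_uniform n (F : seq (plane R) -> \bar R) :
  (forall t, 0 <= F t) -> mseqF n F ->
  iint U n F = iint leb2 n (fun t => (all (mem K) t)%:R%:E * F t).
Proof.
elim: n F => [|n IH] F F0 mF /=; first by rewrite mul1e.
have mF1 := mseqF_cons mF.
rewrite integral_uniform; last 2 first.
- by apply: measurable_iint.
- by move=> x; apply: iint_ge0.
apply: eq_integral => x _; rewrite IH//; last exact: (mseq_sec _ mF1).
have [xK|xK] := boolP (x \in K).
  by rewrite mul1e.
rewrite mul0e -[LHS](iint0 (@leb2 R) n); apply: eq_iint => t _.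
by rewrite /= mul0e.
Qed.

End uniform_law.

Lemma measurable_seq_comp d (T : measurableType d) dY (Y : measurableType dY)
    m dP (P : measurableType dP) dQ (Q : measurableType dQ)
    (x0 : T) (F : P -> seq T -> Y) (h : Q -> P) (g : Q -> seq T) :
  measurable_fun setT h -> (forall q, size (g q) = m) ->
  (forall i, (i < m)%N -> measurable_fun setT (fun q => nth x0 (g q) i)) ->
  mseq m F -> measurable_fun setT (fun q => F (h q) (g q)).
Proof.
move=> mh sg mg mF.
suff /mseq0 : mseq 0 (fun q (_ : seq T) => F (h q) (g q)) by [].
apply: (@mseq_map _ T _ _ 0 m _ _ _ _ _ T x0 F h (fun q _ => g q)) => //.
by move=> i im; apply/mseq0; exact: mg.
Qed.

(** * Volumes of families of chains *)

Section chains_volume.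
Context {R : realType}.
Variables (k : nat) (phi : R).
Hypothesis k3 : (3 <= k)%N.
Local Notation E := (side_dir k phi).

(** An inactive index stands for two sides with the same contact point, where the chain must be
    empty. The flag lets main and degenerate configurations share one volume computation. *)
Fixpoint chains (act : nat -> bool) (P : nat -> R * R) i ts rest : bool :=
  match ts with
  | [::] => true
  | t :: ts' =>
      (if act i then chain (E i.+1) (P i) (E i) (take t rest) (P i.+1)
       else t == 0%N) && chains act P i.+1 ts' (drop t rest)
  end.

Lemma chainsP act P i ts rest : reflect
  (forall j, (j < size ts)%N -> if act (i + j)%N then
     chain (E (i + j).+1) (P (i + j)%N) (E (i + j)) (piece ts rest j) (P (i + j).+1)
     else nth 0%N ts j == 0%N)
  (chains act P i ts rest).
Proof.
elim: ts i rest => [|t ts IH] i rest /=; first by constructor.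
apply: (iffP andP) => [[h1 /IH h2] [|j] jt|h].
- by rewrite addn0; exact: h1.
- by have := h2 j jt; rewrite addSnnS.
split; first by have := h 0%N isT; rewrite addn0.
by apply/IH => j jt; have := h j.+1 jt; rewrite addSnnS.
Qed.

Definition chains_vol (act : nat -> bool) (P : nat -> R * R) i ts : R :=
  \prod_(j < size ts) (if act (i + j)%N then
    chain_vol (nth 0%N ts j) (E (i + j).+1) (P (i + j)%N) (E (i + j)) (P (i + j).+1)
    else (nth 0%N ts j == 0%N)%:R).

Lemma chain_vol_ge0 m (e p d q : R * R) : 0 < cross d e -> 0 <= chain_vol m e p d q.
Proof.
move=> de; rewrite /chain_vol; case: (boolP (_ && _)) => [/andP[h1 h2]|_]; last by rewrite mul0r.
rewrite mul1r mulr_ge0 ?chain_const_ge0// exprn_ge0// divr_ge0 ?(ltW de)//.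
by rewrite mulr_ge0// ltW.
Qed.

Let EE i : 0 < cross (E i) (E i.+1).
Proof. by rewrite cross_side_dirS; exact: sinm1_gt0. Qed.

Lemma chains_vol_ge0 act P i ts : 0 <= chains_vol act P i ts.
Proof.
apply: prodr_ge0 => j _; case: ifP => _; last exact: ler0n.
exact: chain_vol_ge0.
Qed.

Lemma measurable_chains d (Q : measurableType d) act (P : Q -> nat -> plane R) i ts
    (g : Q -> seq (plane R)) :
  (forall j, measurable_fun setT (fun q => P q j)) ->
  (forall q, size (g q) = sumn ts) ->
  (forall j, (j < sumn ts)%N -> measurable_fun setT (fun q => nth 0 (g q) j : plane R)) ->
  measurable_fun setT (fun q => chains act (P q) i ts (g q)).
Proof.
move=> mP; elim: ts i g => [|t ts IH] i g sg mg /=; first exact: measurable_cst.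
apply: measurable_and; last first.
  apply: IH => [q|j jt]; first by rewrite size_drop sg/= addKn.
  rewrite (_ : (fun _ => _) = (fun q => nth 0 (g q) (t + j) : plane R)).
    by apply: mg; rewrite /= ltn_add2l.
  by apply/funext => q; rewrite nth_drop.
case: (act i); last exact: measurable_cst.
apply: (@measurable_seq_comp _ (plane R) _ _ t _ _ _ _ (0 : R * R)
  (fun (q : Q) s => chain (E i.+1) (P q i) (E i) s (P q i.+1)) id (fun q => take t (g q))) => //.
- by move=> q; rewrite size_takel// sg leq_addr.
- move=> j jt; rewrite (_ : (fun _ => _) = (fun q => nth 0 (g q) j : plane R)).
    by apply: mg; rewrite /= ltn_addr.
  by apply/funext => q; rewrite nth_take.
by apply: mseq_chain => //; exact: measurable_cst.
Qed.

Local Open Scope ereal_scope.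

Lemma iint_chains act (P : nat -> R * R) i ts :
  iint (@leb2 R) (sumn ts) (fun rest => (chains act P i ts rest)%:R%:E) =
  (chains_vol act P i ts)%:E.
Proof.
elim: ts i => [|t ts IH] i /=; first by rewrite /chains_vol big_ord0.
pose F1 (s : seq (plane R)) : \bar R := (if act i then chain (E i.+1) (P i) (E i) s (P i.+1)
       else t == 0%N)%:R%:E.
pose G1 (s : seq (plane R)) : \bar R := (chains act P i.+1 ts s)%:R%:E.
transitivity (iint (@leb2 R) (t + sumn ts) (fun s => F1 (take t s) * G1 (drop t s))).
  apply: eq_iint => s _; rewrite /F1 /G1 -EFinM -natrM mulnb; congr (_%:R%:E).
have F10 s : 0 <= F1 s by rewrite lee_fin.
have G10 s : 0 <= G1 s by rewrite lee_fin.
rewrite iint_cat_prod//; last 2 first.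
- apply/measurable_EFinP; apply: measurable_boolR.
  case: (act i); last exact: measurable_cst.
  exact: (@mseq_chain R _ unit t (fun=> E i.+1) (fun=> P i) (fun=> E i) (fun=> P i.+1)).
- apply/measurable_EFinP; apply: measurable_boolR.
  apply: measurable_chains => //.
  + by move=> q; rewrite size_tuple.
  + by move=> j _; exact: mseq_nth.
rewrite IH /chains_vol /= big_ord_recl/= addn0 EFinM; congr (_ * _); last first.
  congr EFin; apply: eq_bigr => j _.
  by rewrite /bump /= add1n addSnnS.
rewrite /F1; case: (act i); first by rewrite iint_chain.
have [->//|t0] := eqVneq t 0%N.
by rewrite mulr0n iint0.
Qed.

End chains_volume.

(** * Sandwiching convex position between chain configurations *)

Section boxes.

Fixpoint boxes m n : seq (seq nat) :=
  if m is m'.+1 then [seq a :: s | a <- iota 0 n, s <- boxes m' n]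
  else [:: [::]].

Lemma mem_boxes m n s : (s \in boxes m n) = (size s == m) && all (fun a => (a < n)%N) s.
Proof.
elim: m s => [|m IH] [|a s] //=.
  by apply/allpairsP => -[[b u] [_ _ //]].
rewrite eqSS andbCA -IH; apply/allpairsP/andP => [[[b u] [/= bn us [-> ->]]]|[an us]].
  by rewrite us; move: bn; rewrite mem_iota add0n.
by exists (a, s); split => //=; rewrite mem_iota add0n.
Qed.

Lemma boxes_uniq m n : uniq (boxes m n).
Proof.
elim: m => [//|m IH]; apply: allpairs_uniq; rewrite ?iota_uniq//.
by move=> [a s] [b u] _ _ [-> ->].
Qed.

Definition comps m n := [seq s <- boxes m n.+1 | sumn s == n].

Lemma mem_comps m n s : (s \in comps m n) = (size s == m) && (sumn s == n).
Proof.
rewrite mem_filter mem_boxes andbC; case: eqVneq => //= sm.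
case: eqVneq => //= [<-|]; last by rewrite andbF.
rewrite andbT; elim: s {sm} => [//|a s IH] /=; rewrite ltnS leq_addr/=.
by apply: sub_all IH => b; lia.
Qed.

Lemma comps_uniq m n : uniq (comps m n).
Proof. by rewrite filter_uniq// boxes_uniq. Qed.

Lemma sum_bool_uniq (T : eqType) (s : seq T) (b : T -> bool) (B : bool) :
  uniq s -> (forall x, x \in s -> b x -> B) ->
  (forall x y, x \in s -> y \in s -> b x -> b y -> x = y) ->
  (\sum_(x <- s) b x <= B)%N.
Proof.
elim: s => [|x s IH] /=; first by rewrite big_nil.
move=> /andP[xs us] bB bb; rewrite big_cons.
have [bx|/negPf bx] := boolP (b x).
  rewrite (bB _ _ bx) ?inE ?eqxx//= big1_seq// => y /= ys.
  apply/eqP; rewrite eqb0; apply/negP => bY.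
  by move/negP: xs; apply; rewrite (bb x y)// ?inE ?eqxx// ys orbT.
rewrite add0n; apply: IH => // [y ys|y z ys zs].
  by apply: bB; rewrite inE ys orbT.
by apply: bb; rewrite inE ?ys ?zs orbT.
Qed.

Lemma leq_sum_mem (T : eqType) (s : seq T) (F : T -> nat) x :
  x \in s -> (F x <= \sum_(y <- s) F y)%N.
Proof. by move=> xs; rewrite (big_rem _ xs)/= leq_addr. Qed.

End boxes.

Section sandwich.
Context {R : realType}.
Variables (k : nat) (c : R * R) (rho phi : R).
Hypotheses (k3 : (3 <= k)%N) (rho0 : 0 < rho).
Local Notation E := (side_dir k phi).
Local Notation K := (regular_polygon k c rho phi).
Local Notation h := (apothem k rho).
Implicit Types (x y : R * R) (t w ps rest : seq (R * R)) (ts pi : seq nat).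

Definition cpos t := uniq t /\
  exists (m : nat) (p : 'I_m -> R * R), vertices (convex_hull p) = [set` t].

(** In a configuration the contact point of side [i] is the one closest to that side, so these [k]
    inequalities already place the whole sample in the polygon ([config_polygon]). *)
Definition contacts_in ps := all (fun i => - h <= cross (E i) (nth 0 ps i - c)) (iota 0 k).

Definition main_config ts w := contacts_in (take k w) &&
  chains k phi xpredT (cyc_nth k (take k w)) 0 ts (drop k w).

(** [pi] gives for each side the index of its contact point in the list of the distinct ones; the
    chain from side [j] to the next is active when this index changes. *)
Definition moves pi j := nth 0%N pi (j %% k) != nth 0%N pi (j.+1 %% k).

Definition pattern_nth pi (w : seq (R * R)) j : R * R := nth 0 w (nth 0%N pi (j %% k)).

Definition deg_config r pi ts w := all (mem K) (take r w) &&
  chains k phi (moves pi) (pattern_nth pi (take r w)) 0 ts (drop r w).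

(** Patterns with [r] contact points in which some chain is inactive, as [contact_consecutive]
    guarantees. *)
Definition deg_patterns r :=
  [seq pi <- boxes k r | has (fun j => ~~ moves pi j) (iota 0 k)].

Definition tie i a b t := (a != b) && (cross (E i) (nth 0 t a - nth 0 t b) == 0).

Definition ties n t := (\sum_(i < k) \sum_(a < n) \sum_(b < n) tie i a b t)%N.

Let kpos : (0 < k)%N. Proof. by lia. Qed.

Lemma main_configP n ts w : size w = (k + n)%N -> ts \in comps k n ->
  main_config ts w -> config k phi (take k w) ts (drop k w).
Proof.
rewrite mem_comps => sw /andP[/eqP st /eqP su] /andP[_ /chainsP H]; split => //.
- by rewrite size_takel// sw leq_addr.
- by rewrite size_drop sw addKn.
- by move=> j jk; have := H j; rewrite st jk add0n; exact.
Qed.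

Let config_polygon n ts w : size w = (k + n)%N -> ts \in comps k n ->
  main_config ts w -> all (mem K) w.
Proof.
move=> sw tc mc; have cf := main_configP sw tc mc.
apply/allP => x xw; apply/mem_set/(polygonP k3 rho0) => i ik.
have := mc => /andP[/allP/(_ i)]; rewrite mem_iota add0n ik => /(_ isT) hi _.
have [->|ne] := eqVneq x (cyc_nth k (take k w) i).
  by rewrite /cyc_nth modn_small.
have xw' : x \in take k w ++ drop k w by rewrite cat_take_drop.
have := config_contact_all k3 cf ik xw' ne.
move: hi; rewrite !crossBr /cyc_nth modn_small//.
move: (cross _ _) (cross _ c) (cross _ x) => u v z h1 h2.
by apply: (le_trans h1); rewrite lerD2r ltW.
Qed.

(** By [config_unique] at most one pair of an ordering and a composition contributes, so the sum is
    zero or one, and [config_functional] supplies convex position when it is one. *)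
Lemma sum_main_config_le n t : size t = (k + n)%N ->
  (\sum_(w <- allperms t) \sum_(ts <- comps k n) main_config ts w <=
   all (mem K) t && `[< cpos t >])%N.
Proof.
move=> st.
case: (pselect (exists w ts, [/\ w \in allperms t, ts \in comps k n & main_config ts w])); last first.
  move=> H; rewrite big1_seq// => w /= wt; rewrite big1_seq// => ts /= tc.
  by apply/eqP; rewrite eqb0; apply/negP => mc; apply: H; exists w, ts.
move=> [w [ts [wt tc mc]]]; have pw := allperms_perm wt.
have sw w' : perm_eq w' t -> size w' = (k + n)%N by move=> /perm_size ->.
have cf := main_configP (sw _ pw) tc mc.
have uw : uniq w by have := config_uniq k3 cf; rewrite cat_take_drop.
have ut : uniq t by rewrite -(perm_uniq pw).
have -> : all (mem K) t by rewrite -(perm_all _ pw) (config_polygon (sw _ pw) tc mc).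
have -> : `[< cpos t >].
  apply/asboolP; have := @convex_position_functional R (size t) (in_tuple t) ut.
  apply => x xt; have xw : x \in take k w ++ drop k w by rewrite cat_take_drop (perm_mem pw).
  have [g gP] := config_functional k3 cf xw; exists g => y yt; apply: gP.
  by rewrite cat_take_drop (perm_mem pw).
have <- : (\sum_(p <- [seq (w, ts) | w <- allperms t, ts <- comps k n]) main_config p.2 p.1 =
  \sum_(w <- allperms t) \sum_(ts <- comps k n) main_config ts w)%N by rewrite big_allpairs.
apply: (@sum_bool_uniq _ _ (fun p => main_config p.2 p.1) true) => //.
  apply: allpairs_uniq; rewrite ?allperms_uniq ?comps_uniq//.
  by move=> [? ?] [? ?] _ _ [-> ->].
move=> p q /allpairsP[[w1 ts1] [/= w1t t1 ->]] /allpairsP[[w2 ts2] [/= w2t t2 ->]] /= m1 m2.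
have p1 := allperms_perm w1t; have p2 := allperms_perm w2t.
have c1 := main_configP (sw _ p1) t1 m1; have c2 := main_configP (sw _ p2) t2 m2.
have [] := config_unique k3 c1 c2.
  by rewrite !cat_take_drop (permPl p1) perm_sym.
by move=> e1 -> e2; congr pair; rewrite -(cat_take_drop k w1) e1 e2 cat_take_drop.
Qed.

(** The existence half: a sample without ties contributes at least one term, main or degenerate
    according to whether its contact points are distinct. Several degenerate terms may describe the
    same sample, which an upper bound tolerates. *)
Lemma cpos_le_configs n t : size t = (k + n)%N ->
  (all (mem K) t && `[< cpos t >] <=
   \sum_(w <- allperms t) (\sum_(ts <- comps k n) main_config ts w +
     \sum_(r < k) \sum_(pi <- deg_patterns r) \sum_(ts <- comps k (k + n - r)) deg_config r pi ts w) +
   ties (k + n) t)%N.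
Proof.
move=> st; case: andP => //= -[/allP tK /asboolP cp].
have [tie0|nt] := posnP (ties (k + n) t); last by rewrite -[1%N]add0n leq_add.
rewrite tie0 addn0.
have ut : uniq t by case: cp.
have cz : conv3_free t := @convex_position_conv3_free R (size t) (in_tuple t) cp.
have sz : (1 < size t)%N by rewrite st; lia.
have nt i x y : (i < k)%N -> x \in t -> y \in t -> x != y -> cross (E i) x != cross (E i) y.
  move=> ik /(nthP 0)[a at_ <-] /(nthP 0)[b bt <-] ab.
  have ab' : a != b by apply: contra_neq ab => ->.
  rewrite st in at_ bt.
  move: tie0 => /eqP; rewrite sum_nat_eq0 => /forallP/(_ (Ordinal ik))/=.
  rewrite sum_nat_eq0 => /forallP/(_ (Ordinal at_))/=.
  rewrite sum_nat_eq0 => /forallP/(_ (Ordinal bt))/=.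
  by rewrite /tie ab' eqb0 crossBr subr_eq0.
have [ps [ts [rest [sps sts srest pst [ch ex pe]]]]] := circumscription_exists k3 ut cz sz nt.
have sumE : (size (undup ps) + sumn ts = k + n)%N.
  by rewrite -srest -size_cat -(perm_size pe).
have wt : undup ps ++ rest \in allperms t by apply: mem_allperms; rewrite perm_sym.
apply: leq_trans (leq_sum_mem _ wt).
have [ups|nups] := boolP (uniq ps).
  apply: leq_trans (leq_addr _ _).
  have uE := undup_id ups; rewrite uE sps in sumE *.
  have tc : ts \in comps k n by rewrite mem_comps sts eqxx/=; apply/eqP; lia.
  apply: leq_trans (leq_sum_mem _ tc).
  rewrite lt0b /main_config take_size_cat// drop_size_cat//; apply/andP; split.
    apply/allP => i; rewrite mem_iota add0n => /= ik.
    apply: polygon_half_plane => //; apply/set_mem/tK/pst.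
    by rewrite mem_nth// sps.
  apply/chainsP => j; rewrite sts add0n => jk; have := ch j jk.
  rewrite /cyc_nth nth_uniq ?sps ?ltn_mod//.
  have -> : (j %% k == j.+1 %% k)%N = false.
    rewrite modn_small//; have [jk'|jk'] := ltnP j.+1 k; first by rewrite modn_small// ltn_eqF.
    have -> : j.+1 = k by apply/eqP; rewrite eqn_leq jk jk'.
    by rewrite modnn; apply/negbTE; lia.
  by [].
have rk : (size (undup ps) < k)%N by rewrite -sps ltn_size_undup.
apply: leq_trans (leq_addl _ _).
rewrite (bigD1 (Ordinal rk))//=; apply: leq_trans (leq_addr _ _).
set qs := undup ps in rk sumE wt *.
pose pi := [seq index p qs | p <- ps].
have spi : size pi = k by rewrite size_map.
have cin j : cyc_nth k ps j \in qs by rewrite mem_undup /cyc_nth mem_nth// sps ltn_mod.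
have piE j : nth 0%N pi (j %% k) = index (cyc_nth k ps j) qs.
  by rewrite (nth_map 0) // sps ltn_mod.
have PE j : pattern_nth pi qs j = cyc_nth k ps j by rewrite /pattern_nth piE nth_index.
have mE j : moves pi j = (cyc_nth k ps j != cyc_nth k ps j.+1).
  rewrite /moves !piE; congr (~~ _); apply/eqP/eqP => [e|->//].
  by rewrite -(nth_index 0 (cin j)) e nth_index.
have [j jk je] : exists2 j, (j < k)%N & cyc_nth k ps j == cyc_nth k ps j.+1.
  by case: ex => // up; rewrite up in nups.
have pid : pi \in deg_patterns (size qs).
  rewrite mem_filter mem_boxes spi eqxx/=; apply/andP; split.
    by apply/hasP; exists j; [rewrite mem_iota add0n|rewrite mE negbK].
  by apply/allP => _ /mapP[p pp ->]; rewrite index_mem mem_undup.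
apply: leq_trans (leq_sum_mem _ pid).
have tc : ts \in comps k (k + n - size qs)%N by rewrite mem_comps sts eqxx/= -sumE addKn.
apply: leq_trans (leq_sum_mem _ tc).
rewrite lt0b /deg_config take_size_cat// drop_size_cat//; apply/andP; split.
  by apply/allP => x; rewrite mem_undup => /pst/tK.
apply/chainsP => l; rewrite sts add0n => lk; have := ch l lk.
rewrite mE !PE; case: eqP => //= _ pl0.
have : size (piece ts rest l) = nth 0%N ts l.
  rewrite -[in RHS](@reshapeKl _ ts rest) ?srest// /shape (nth_map [::])//.
  by rewrite size_reshape sts.
by rewrite pl0 => <-.
Qed.

End sandwich.

Section measurable_sequences.

Lemma measurable_all d (T : measurableType d) (f : nat -> T -> bool) (s : seq nat) :
  (forall i, i \in s -> measurable_fun setT (f i)) ->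
  measurable_fun setT (fun q => all (fun i => f i q) s).
Proof.
elim: s => [|i s IH] mf /=; first exact: measurable_cst.
apply: measurable_and; first by apply: mf; rewrite inE eqxx.
by apply: IH => j js; apply: mf; rewrite inE js orbT.
Qed.

Lemma all_nth_iota (T : Type) (x0 : T) (P : pred T) s n : size s = n ->
  all P s = all (fun i => P (nth x0 s i)) (iota 0 n).
Proof. by move=> <-; rewrite -[in LHS](mkseq_nth x0 s) all_map. Qed.

Lemma mseq_nth_take d (T : measurableType d) n dP (P : measurableType dP) (x0 : T) r i :
  mseq n (fun (_ : P) t => nth x0 (take r t) i).
Proof.
have [ir|ir] := ltnP i r; last first.
  rewrite /mseq [X in measurable_fun _ X](_ : _ = cst x0); first exact: measurable_cst.
  by apply/funext => q; rewrite nth_default// size_take_min geq_min ir.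
rewrite /mseq [X in measurable_fun _ X](_ : _ = (fun q : P * n.-tuple T => nth x0 q.2 i)).
  exact: mseq_nth.
by apply/funext => q; rewrite nth_take.
Qed.

Lemma mseq_nth_drop d (T : measurableType d) n dP (P : measurableType dP) (x0 : T) r i :
  mseq n (fun (_ : P) t => nth x0 (drop r t) i).
Proof.
rewrite /mseq [X in measurable_fun _ X](_ : _ = (fun q : P * n.-tuple T => nth x0 q.2 (r + i))).
  exact: mseq_nth.
by apply/funext => q; rewrite nth_drop.
Qed.

End measurable_sequences.

Section finite_sums.
Context d (T : measurableType d) (R : realType).
Variable mu : {sigma_finite_measure set T -> \bar R}.
Local Open Scope ereal_scope.

Lemma mseq_sum_seq n dP (P : measurableType dP) (I : eqType) (r : seq I)
    (F : I -> P -> seq T -> \bar R) :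
  (forall i, i \in r -> mseq n (F i)) ->
  mseq n (fun p t => \sum_(i <- r) F i p t).
Proof.
elim: r => [|i r IH] mF.
  by rewrite /mseq; under eq_fun do rewrite big_nil; exact: measurable_cst.
rewrite /mseq; under eq_fun do rewrite big_cons.
apply: emeasurable_funD; first by apply: mF; rewrite inE eqxx.
by apply: IH => j jr; apply: mF; rewrite inE jr orbT.
Qed.

Lemma iint_sum_seq n (I : eqType) (r : seq I) (F : I -> seq T -> \bar R) :
  (forall i t, 0 <= F i t) -> (forall i, i \in r -> mseqF n (F i)) ->
  iint mu n (fun t => \sum_(i <- r) F i t) = \sum_(i <- r) iint mu n (F i).
Proof.
move=> F0 mF; pose G i t := if i \in r then F i t else 0.
transitivity (iint mu n (fun t => \sum_(i <- r) G i t)).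
  by apply: eq_iint => t _; apply: eq_big_seq => i ir; rewrite /G ir.
rewrite iint_sum; last 2 first.
- by move=> i t; rewrite /G; case: ifP.
- move=> i; have [ir|ir] := boolP (i \in r).
    by rewrite (_ : G i = F i); [exact: mF|apply/funext => t; rewrite /G ir].
  rewrite (_ : G i = cst 0); first exact: measurable_cst.
  by apply/funext => t; rewrite /G (negbTE ir).
by apply: eq_big_seq => i ir; apply: eq_iint => t _; rewrite /G ir.
Qed.

End finite_sums.

(** * The probability between two sums of volumes *)

Section probability_bounds.
Context {R : realType}.
Variables (k : nat) (c : R * R) (rho phi : R).
Hypotheses (k3 : (3 <= k)%N) (rho0 : 0 < rho).
Local Notation E := (side_dir k phi).
Local Notation K := (regular_polygon k c rho phi).
Local Notation mK := (measurable_regular_polygon k c rho phi).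
Hypothesis K1 : lebesgue_measure2 R K = 1%E.
Local Notation U := (uniform_law mK).
Local Notation main_config := (main_config k c rho phi).
Local Notation deg_config := (deg_config k c rho phi).
Local Open Scope ereal_scope.

Let mseq_contacts n dP (P : measurableType dP) :
  mseq n (fun (_ : P) w => contacts_in k c rho phi (take k w) : bool).
Proof.
apply: measurable_all => i _; apply: measurable_fun_ler => //.
apply: measurable_cross => //; apply: measurable_subpt => //.
exact: mseq_nth_take.
Qed.

Lemma mseq_main_config n ts : (k + sumn ts = n)%N ->
  mseqF n (fun w => (main_config ts w)%:R%:E : \bar R).
Proof.
move=> sn; apply/measurable_EFinP; apply: measurable_boolR.
apply: measurable_and; first exact: mseq_contacts.
apply: measurable_chains => // [j|q|j _]; [exact: mseq_nth_take| |exact: mseq_nth_drop].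
by rewrite size_drop size_tuple -sn addKn.
Qed.

Lemma mseq_deg_config n r pi ts : (r + sumn ts = n)%N ->
  mseqF n (fun w => (deg_config r pi ts w)%:R%:E : \bar R).
Proof.
move=> sn; apply/measurable_EFinP; apply: measurable_boolR.
have rn : (r <= n)%N by rewrite -sn leq_addr.
apply: measurable_and.
  rewrite [X in measurable_fun _ X](_ : _ = (fun q : unit * n.-tuple (plane R) =>
      all (fun i => nth 0%R (take r q.2) i \in K) (iota 0 r))).
    apply: measurable_all => i _.
    exact: (measurableT_comp (measurable_mem mK)
      (@mseq_nth_take _ (plane R) n _ unit (0%R : R * R) r i)).
  by apply/funext => q; rewrite (@all_nth_iota _ (0%R : R * R) _ _ r) ?size_takel ?size_tuple.
apply: measurable_chains => // [j|q|j _]; [exact: mseq_nth_take| |exact: mseq_nth_drop].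
by rewrite size_drop size_tuple -sn addKn.
Qed.

Let mseq_tie n i a b : mseqF n (fun t : seq (plane R) => (tie k phi i a b t)%:R%:E : \bar R).
Proof.
apply/measurable_EFinP; apply: measurable_boolR; apply: measurable_and => //.
apply: measurable_fun_eqr => //; apply: measurable_cross => //.
by apply: measurable_subpt; exact: mseq_nth.
Qed.

Let side_dir_neq0 i : E i != 0%R.
Proof.
apply: contraTneq (@sinm1_gt0 R k k3) => e.
by rewrite -(cross_side_dirS k phi i) e /cross/= !mul0r subrr ltxx.
Qed.

(** With the other points fixed, a tie confines the point of index [b] to a line parallel to side
    [i]. *)
Lemma iint_tie n i a b : (a < n)%N -> (b < n)%N ->
  iint (@leb2 R) n (fun t => (tie k phi i a b t)%:R%:E) = 0.
Proof.
case: n => [//|n] an bn.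
rewrite -(iint_insert (@leb2 R) (bn : (b <= n)%N) (fun t => (_ : 0 <= (tie k phi i a b t)%:R%:E)))//.
have [->|ab] := eqVneq a b.
  rewrite (_ : (fun x => _) = cst 0) ?integral0//.
  apply/funext => x; rewrite -[RHS](iint0 (@leb2 R) n).
  by apply: eq_iint => t _; rewrite /tie eqxx.
rewrite integral_iint_swap//; last first.
  have h := @mseq_insert_at _ (plane R) R _ unit n b (fun _ t => (tie k phi i a b t)%:R%:E : \bar R) bn (@mseq_tie n.+1 i a b).
  apply: (mseq_param (h := fun x : plane R => (tt, x)) _ h).
  exact: measurable_fun_pair.
rewrite -[RHS](iint0 (@leb2 R) n); apply: eq_iint => t st.
rewrite -(@line_null R (E i) (nth 0 (insert_at b 0 t) a)%R (side_dir_neq0 i)).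
apply: eq_integral => x _; rewrite /tie ab/=; congr (_%:R%:E); congr nat_of_bool.
have sb : size (take b t) = b by rewrite size_takel// st.
have -> : nth 0%R (take b t ++ x :: drop b t) b = x by rewrite nth_cat sb ltnn subnn.
have -> : nth 0%R (take b t ++ x :: drop b t) a = nth 0%R (insert_at b 0%R t) a.
  rewrite /insert_at !nth_cat sb; case: ltngtP ab => //= ab _.
  by rewrite -subn_gt0 in ab; case: (a - b)%N ab.
by rewrite !crossBr !subr_eq0 eq_sym.
Qed.

Let sum_natE (I : Type) (s : seq I) (F : I -> nat) :
  ((\sum_(i <- s) F i)%N%:R : R)%:E = \sum_(i <- s) (F i)%:R%:E.
Proof. by rewrite sumEFin natr_sum. Qed.

Definition main_volume n ts := iint (@leb2 R) (k + n) (fun w => (main_config ts w)%:R%:E).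

Definition deg_volume n r pi ts :=
  iint (@leb2 R) (k + n) (fun w => (deg_config r pi ts w)%:R%:E).

Let comps_sum n ts : ts \in comps k n -> (k + sumn ts = k + n)%N.
Proof. by rewrite mem_comps => /andP[_ /eqP ->]. Qed.

Let mainsum n (w : seq (plane R)) : \bar R :=
  \sum_(ts <- comps k n) (main_config ts w)%:R%:E.

Let degsum n (w : seq (plane R)) : \bar R :=
  \sum_(r < k) \sum_(pi <- deg_patterns k r) \sum_(ts <- comps k (k + n - r)%N)
    (deg_config r pi ts w)%:R%:E.

Let mseq_mainsum n : mseqF (k + n) (mainsum n).
Proof.
by apply: mseq_sum_seq => ts tc; apply: mseq_main_config; exact: comps_sum.
Qed.

Let deg_sum n (r : 'I_k) ts : ts \in comps k (k + n - r)%N -> (r + sumn ts = k + n)%N.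
Proof.
rewrite mem_comps => /andP[_ /eqP ->].
by rewrite subnKC// (leq_trans (ltnW (ltn_ord r)))// leq_addr.
Qed.

Let mseq_degsum n : mseqF (k + n) (degsum n).
Proof.
apply: mseq_sum_seq => r _; apply: mseq_sum_seq => pi _; apply: mseq_sum_seq => ts tc.
by apply: mseq_deg_config; exact: deg_sum.
Qed.

Let mainsum0 n w : 0 <= mainsum n w. Proof. by apply: sume_ge0 => ts _; rewrite lee_fin. Qed.

Let degsum0 n w : 0 <= degsum n w.
Proof.
by apply: sume_ge0 => r _; apply: sume_ge0 => pi _; apply: sume_ge0 => ts _; rewrite lee_fin.
Qed.

Let tiesum n (t : seq (plane R)) : \bar R :=
  \sum_(i < k) \sum_(a < n) \sum_(b < n) (tie k phi i a b t)%:R%:E.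

Let tiesum0 n t : 0 <= tiesum n t.
Proof.
by apply: sume_ge0 => i _; apply: sume_ge0 => a _; apply: sume_ge0 => b _; rewrite lee_fin.
Qed.

Let mseq_tiesum n : mseqF n (tiesum n).
Proof.
apply: mseq_sum_seq => i _; apply: mseq_sum_seq => a _; apply: mseq_sum_seq => b _.
exact: mseq_tie.
Qed.

Let iint_tiesum n : iint (@leb2 R) n (tiesum n) = 0.
Proof.
rewrite iint_sum_seq; last 2 first.
- by move=> i t; apply: sume_ge0 => a _; apply: sume_ge0 => b _; rewrite lee_fin.
- by move=> i _; apply: mseq_sum_seq => a _; apply: mseq_sum_seq => b _; exact: mseq_tie.
rewrite big1// => i _; rewrite iint_sum_seq; last 2 first.
- by move=> a t; apply: sume_ge0 => b _; rewrite lee_fin.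
- by move=> a _; apply: mseq_sum_seq => b _; exact: mseq_tie.
rewrite big1// => a _; rewrite iint_sum_seq; last 2 first.
- by move=> b t; rewrite lee_fin.
- by move=> b _; exact: mseq_tie.
by rewrite big1// => b _; exact: iint_tie.
Qed.

Let iint_mainsum n : iint (@leb2 R) (k + n) (mainsum n) =
  \sum_(ts <- comps k n) main_volume n ts.
Proof.
rewrite iint_sum_seq//.
by move=> ts tc; apply: mseq_main_config; exact: comps_sum.
Qed.

Let iint_degsum n : iint (@leb2 R) (k + n) (degsum n) =
  \sum_(r < k) \sum_(pi <- deg_patterns k r) \sum_(ts <- comps k (k + n - r)%N)
    deg_volume n r pi ts.
Proof.
rewrite iint_sum_seq; last 2 first.
- by move=> r t; apply: sume_ge0 => pi _; apply: sume_ge0 => ts _; rewrite lee_fin.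
- move=> r _; apply: mseq_sum_seq => pi _; apply: mseq_sum_seq => ts tc.
  by apply: mseq_deg_config; exact: deg_sum.
apply: eq_bigr => r _; rewrite iint_sum_seq; last 2 first.
- by move=> pi t; apply: sume_ge0 => ts _; rewrite lee_fin.
- move=> pi _; apply: mseq_sum_seq => ts tc.
  by apply: mseq_deg_config; exact: deg_sum.
apply: eq_bigr => pi _; rewrite iint_sum_seq//.
by move=> ts tc; apply: mseq_deg_config; exact: deg_sum.
Qed.

Let proba n := iid_law U (k + n) [set z | convex_position z].

Let probaE n : proba n = iint U (k + n) (fun t => (\1_[set t | cpos t] t)%:E).
Proof. by rewrite -iid_lawE /proba; congr (iid_law _ _ _); apply/seteqP; split. Qed.

Lemma main_volume_le_proba n :
  ((k + n)`!%:R)%:E * (\sum_(ts <- comps k n) main_volume n ts) <= proba n.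
Proof.
rewrite -iint_mainsum -iint_allperms// probaE.
pose G t := \sum_(w <- allperms t) mainsum n w.
have GE t : G t = ((\sum_(w <- allperms t) \sum_(ts <- comps k n) main_config ts w)%N%:R : R)%:E.
  by rewrite /G sum_natE; apply: eq_bigr => w _; rewrite sum_natE.
have G0 t : 0 <= G t by rewrite GE lee_fin.
have mG : mseqF (k + n) G.
  apply: (@mseq_sum_allperms _ (plane R) R _ unit (k + n)%N (fun _ w => mainsum n w)) => //.
(* [G] vanishes unless all points lie in [K], which has area one, so its Lebesgue integral is
   bounded by its integral under the uniform law. *)
apply: (@le_trans _ _ (iint U (k + n) G)).
  rewrite (iint_uniform mK K1)//; apply: le_iint => // t st.
  have := @sum_main_config_le R k c rho phi k3 rho0 n t st; rewrite -/(G t).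
  case: (boolP (all (mem K) t)) => [_ _|_ /=]; first by rewrite mul1e.
  by rewrite leqn0 => /eqP h; rewrite GE h mule0.
apply: le_iint => // t st; rewrite GE lee_fin indicE.
have := @sum_main_config_le R k c rho phi k3 rho0 n t st.
rewrite -(ler_nat R) => /le_trans; apply.
rewrite ler_nat; case: (all _ _) => //=.
Qed.

Lemma proba_le_volumes n : proba n <= ((k + n)`!%:R)%:E *
  (\sum_(ts <- comps k n) main_volume n ts +
   \sum_(r < k) \sum_(pi <- deg_patterns k r) \sum_(ts <- comps k (k + n - r)%N)
    deg_volume n r pi ts).
Proof.
pose G w := mainsum n w + degsum n w.
have G0 t : 0 <= G t by rewrite adde_ge0.
have mG : mseqF (k + n) G by apply: emeasurable_funD; [exact: mseq_mainsum|exact: mseq_degsum].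
have addE (F1 F2 : seq (plane R) -> \bar R) : (forall t, 0 <= F1 t) -> (forall t, 0 <= F2 t) ->
    mseqF (k + n) F1 -> mseqF (k + n) F2 ->
    iint (@leb2 R) (k + n) (fun t => F1 t + F2 t) =
    iint (@leb2 R) (k + n) F1 + iint (@leb2 R) (k + n) F2.
  move=> F10 F20 mF1 mF2.
  transitivity (iint (@leb2 R) (k + n) (fun t => \sum_(b <- [:: true; false]) (if b then F1 t else F2 t))).
    by apply: eq_iint => t _; rewrite big_cons big_seq1.
  by rewrite iint_sum_seq ?big_cons ?big_nil ?adde0// => -[].
have -> : \sum_(ts <- comps k n) main_volume n ts +
   \sum_(r < k) \sum_(pi <- deg_patterns k r) \sum_(ts <- comps k (k + n - r)%N)
    deg_volume n r pi ts = iint (@leb2 R) (k + n) G.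
  by rewrite addE// iint_mainsum iint_degsum.
rewrite -iint_allperms// probaE.
pose H t := \sum_(w <- allperms t) G w + tiesum (k + n) t.
have SG0 t : 0 <= \sum_(w <- allperms t) G w by apply: sume_ge0.
have H0 t : 0 <= H t by rewrite adde_ge0.
have mSG : mseqF (k + n) (fun t => \sum_(w <- allperms t) G w).
  exact: (@mseq_sum_allperms _ (plane R) R _ unit (k + n)%N (fun _ w => G w)).
have mH : mseqF (k + n) H by apply: emeasurable_funD; [exact: mSG|exact: mseq_tiesum].
have mall : mseqF (k + n) (fun t : seq (plane R) => (~~ all (mem K) t)%:R%:E : \bar R).
  apply/measurable_EFinP; apply: measurable_boolR; apply: measurable_neg.
  rewrite [X in measurable_fun _ X](_ : _ = (fun q : unit * (k + n).-tuple (plane R) =>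
      all (fun i => nth 0%R q.2 i \in K) (iota 0 (k + n)))).
    apply: measurable_all => i _.
    exact: (measurableT_comp (measurable_mem mK)
      (@mseq_nth _ (plane R) (k + n) _ unit (0%R : R * R) i)).
  by apply/funext => q; rewrite (@all_nth_iota _ (0%R : R * R) _ _ (k + n)) ?size_tuple.
(* The bound by configurations is known for samples inside [K]. Adding the indicator of the other
   samples, which have probability zero, makes it hold everywhere. *)
apply: (@le_trans _ _ (iint U (k + n) (fun t => (~~ all (mem K) t)%:R%:E + H t))).
  apply: le_iint => [t|t st]; first by rewrite lee_fin.
  rewrite indicE; case: (boolP (all (mem K) t)) => tK; last first.
    by rewrite -[X in X <= _]adde0 leeD// lee_fin; case: (_ \in _).
  rewrite /= add0e.
  have -> : H t = ((\sum_(w <- allperms t) (\sum_(ts <- comps k n) main_config ts w +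
     \sum_(r < k) \sum_(pi <- deg_patterns k r) \sum_(ts <- comps k (k + n - r)) deg_config r pi ts w) +
   ties k phi (k + n) t)%N%:R : R)%:E.
    rewrite /H natrD EFinD; congr (_ + _); last first.
      rewrite /tiesum /ties sum_natE; apply: eq_bigr => i _; rewrite sum_natE.
      by apply: eq_bigr => a _; rewrite sum_natE.
    rewrite sum_natE; apply: eq_bigr => w _; rewrite natrD EFinD; congr (_ + _).
      by rewrite sum_natE.
    rewrite /degsum sum_natE; apply: eq_bigr => r _; rewrite sum_natE.
    by apply: eq_bigr => pi _; rewrite sum_natE.
  rewrite lee_fin ler_nat; apply: leq_trans (@cpos_le_configs R k c rho phi k3 rho0 n t st).
  by rewrite tK.
rewrite (iint_uniform mK K1); last 2 first.
- by move=> t; rewrite adde_ge0// lee_fin.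
- exact: emeasurable_funD.
apply: (@le_trans _ _ (iint (@leb2 R) (k + n) H)).
  apply: le_iint => t; first by rewrite mule_ge0// adde_ge0// lee_fin.
  by case: (all _ _) => _ /=; rewrite ?mul1e ?mul0e// add0e.
by rewrite addE// iint_tiesum adde0.
Qed.

End probability_bounds.

(** * Volume of the main configurations *)

Section product_integrals.
Context {R : realType}.
Local Notation mu := (@lebesgue_measure R).
Local Open Scope ereal_scope.

Lemma mseq_prod_nth n dP (P : measurableType dP) (f : nat -> measurableTypeR R -> R) m :
  (forall i, measurable_fun setT (f i)) ->
  mseq n (fun (_ : P) (t : seq (measurableTypeR R)) => (\prod_(i < m) f i (nth 0%R t i))%R).
Proof.
move=> mf; apply: measurable_prod => i _.
exact: (measurableT_comp (mf i) (@mseq_nth _ (measurableTypeR R) n _ P 0%R i)).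
Qed.

Lemma iint_prod n (f : nat -> measurableTypeR R -> R) (v : nat -> R) :
  (forall i, measurable_fun setT (f i)) -> (forall i x, (0 <= f i x)%R) ->
  (forall i, (i < n)%N -> \int[mu]_x (f i x)%:E = (v i)%:E) ->
  iint mu n (fun t => (\prod_(i < n) f i (nth 0%R t i))%:E) = (\prod_(i < n) v i)%:E.
Proof.
elim: n f v => [|n IH] f v mf f0 fv /=; first by rewrite !big_ord0.
transitivity (\int[mu]_x ((f 0%N x)%:E * (\prod_(i < n) v i.+1)%:E)).
  apply: eq_integral => x _.
  rewrite -(IH (fun i => f i.+1) (fun i => v i.+1))//; last first.
    by move=> i ni; exact: fv.
  rewrite -iintZl ?lee_fin//; last 2 first.
  - by move=> t; rewrite lee_fin prodr_ge0.
  - by apply/measurable_EFinP;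
      exact: (@mseq_prod_nth n _ unit (fun i => f i.+1) n (fun i => mf i.+1)).
  by apply: eq_iint => t _; rewrite big_ord_recl.
have v0 i : (i < n.+1)%N -> (0 <= v i)%R.
  by move=> ni; rewrite -lee_fin -fv// integral_ge0// => x _; rewrite lee_fin.
rewrite ge0_integralZr//; last 3 first.
- exact/measurable_EFinP.
- by move=> x _; rewrite lee_fin.
- by rewrite lee_fin; apply: prodr_ge0 => i _; apply: v0; rewrite ltnS.
by rewrite fv// -EFinM big_ord_recl.
Qed.

(** Truncated power. It absorbs the positivity conditions of [chain_vol], also for exponent zero,
    and makes [integral_pos_pow] valid for all real [X] and [Y]. *)
Definition pos_pow (x : R) m : R := (0 < x)%R%:R * x ^+ m.

Lemma pos_pow_ge0 x m : (0 <= pos_pow x m)%R.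
Proof.
by rewrite /pos_pow; case: ltrP => [/ltW x0|_]; rewrite ?mul0r// mul1r exprn_ge0.
Qed.

Lemma measurable_pos_pow m : measurable_fun setT (fun x : measurableTypeR R => pos_pow x m).
Proof. by apply: measurable_funM; meas. Qed.

Lemma integral_pos_pow (X Y : R) a b :
  \int[mu]_x (pos_pow (X - x) a * pos_pow (Y + x) b)%:E =
  (pos_pow (X + Y) (a + b).+1 * ((a`! * b`!)%:R / (a + b).+1`!%:R))%:E.
Proof.
rewrite -(@ge0_integral_translation _ (- Y)%R
  (fun x => (pos_pow (X - x) a * pos_pow (Y + x) b)%:E))//; last 2 first.
- apply/measurable_EFinP; apply: measurable_funM.
    by apply: (measurableT_comp (measurable_pos_pow a)); meas.
  by apply: (measurableT_comp (measurable_pos_pow b)); meas.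
- by move=> x; rewrite lee_fin mulr_ge0// pos_pow_ge0.
rewrite (_ : (fun x => _) = (fun x => ((0 < x < X + Y)%R%:R * (x ^+ b * (X + Y - x) ^+ a))%:E)); last first.
  apply/funext => x; congr EFin.
  have -> : (X - (x + - Y) = X + Y - x)%R by ring.
  have -> : (Y + (x + - Y) = x)%R by ring.
  rewrite /pos_pow subr_gt0; case: (0 < x)%R; rewrite ?mul0r ?mulr0//=.
  by case: (x < X + Y)%R; rewrite ?mul0r ?mulr0// !mul1r mulrC.
have [XY|XY] := ltP 0%R (X + Y)%R.
  by rewrite integral_beta// /pos_pow XY mul1r [(b + a)%N]addnC [(b`! * _)%N]mulnC.
rewrite (_ : (fun x => _) = cst 0).
  by rewrite integral0 /pos_pow ltNge XY mul0r mul0r.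
apply/funext => x; congr EFin; case: (boolP (0 < x < X + Y)%R) => [/andP[h1 h2]|_].
  by have := lt_trans h1 h2; rewrite ltNge XY.
by rewrite mul0r.
Qed.

Lemma prod_ordS k (g : nat -> R) : (0 < k)%N ->
  (\prod_(j < k) g (j.+1 %% k)%N = \prod_(j < k) g j)%R.
Proof.
case: k => [//|k] _; rewrite big_ord_recr big_ord_recl/= modnn mulrC; congr (_ * _)%R.
by apply: eq_bigr => i _; rewrite modn_small// ltnS.
Qed.

End product_integrals.

Section frames.
Context {R : realType}.
Variables (p u v : nat -> R * R).
Hypothesis uv : forall i, `|cross (u i) (v i)| = 1.
Local Open Scope ereal_scope.

Fixpoint frames i (t : seq (plane R)) : seq (plane R) :=
  if t is x :: t' then frame (p i) (u i) (v i) x :: frames i.+1 t' else [::].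

Lemma size_frames i t : size (frames i t) = size t.
Proof. by elim: t i => [//|x t IH] i /=; rewrite IH. Qed.

Lemma nth_frames i t j : (j < size t)%N ->
  nth 0%R (frames i t) j = frame (p (i + j)) (u (i + j)) (v (i + j)) (nth 0%R t j).
Proof.
elim: t i j => [//|x t IH] i [|j] /= jt; first by rewrite addn0.
by rewrite IH// addSnnS.
Qed.

Lemma mseq_frames n i dP (P : measurableType dP) dY (Y : measurableType dY)
    (F : P -> seq (plane R) -> Y) : mseq n F -> mseq n (fun p t => F p (frames i t)).
Proof.
move=> mF; apply: (@mseq_map _ (plane R) _ _ n n _ _ _ _ _ _ (0%R : R * R) F id (fun _ => frames i)) => //.
  by move=> q t st; rewrite size_frames.
move=> j jn; rewrite /mseq [X in measurable_fun _ X](_ : _ = (fun q : P * n.-tuple (plane R) =>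
   frame (p (i + j)) (u (i + j)) (v (i + j)) (nth (0%R : R * R) q.2 j))); last first.
  by apply/funext => q; rewrite nth_frames// size_tuple.
by apply: measurable_frame_param => //; exact: mseq_nth.
Qed.

Lemma iint_frames n i (F : seq (plane R) -> \bar R) :
  (forall t, 0 <= F t) -> mseqF n F ->
  iint (@leb2 R) n F = iint (@leb2 R) n (fun t => F (frames i t)).
Proof.
elim: n i F => [//|n IH] i F F0 mF /=.
have mF1 := mseqF_cons mF.
rewrite (@integral_frame _ (p i) (u i) (v i)); last 3 first.
- by rewrite -normr_eq0 uv oner_eq0.
- by apply: measurable_iint.
- by move=> z; exact: iint_ge0.
rewrite uv mul1e; apply: eq_integral => x _; apply: IH => //.
exact: (mseq_sec _ mF1).
Qed.

End frames.

Lemma natr_all (R : realType) (p : pred nat) n :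
  (all p (iota 0 n))%:R = \prod_(i < n) (p i)%:R :> R.
Proof.
rewrite -(big_mkord xpredT (fun i => (p i)%:R)) /index_iota subn0.
elim: (iota 0 n) => [|i s IH]; first by rewrite big_nil.
by rewrite big_cons -IH -natrM mulnb.
Qed.

Section main_volume_formula.
Context {R : realType}.
Variables (k : nat) (c : R * R) (rho phi : R).
Hypotheses (k3 : (3 <= k)%N) (rho0 : 0 < rho).
Local Notation mu := (@lebesgue_measure R).
Local Notation E := (side_dir k phi).
Local Notation h := (apothem k rho).
Local Notation S1 := (@sinm R k 1).
Local Notation cosa := (cos (@step_angle R k)).

Let kpos : (0 < k)%N. Proof. by lia. Qed.

Definition inner_normal i : R * R := (- (E i).2, (E i).1).
Local Notation u := inner_normal.

Lemma side_dir_norm i : (E i).1 ^+ 2 + (E i).2 ^+ 2 = 1.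
Proof. by rewrite /= sqrrN addrC cos2Dsin2. Qed.

Lemma side_dir_dot i : (E i).1 * (E i.+1).1 + (E i).2 * (E i.+1).2 = cosa.
Proof.
rewrite /= mulrNN addrC -cosB; have -> : side_angle k phi i - side_angle k phi i.+1 = - step_angle k.
  by rewrite /side_angle -[i.+1]addn1 natrD; ring.
by rewrite cosN.
Qed.

(** [l] is the distance inwards from side [i] of the polygon, and [t] the position along that side,
    measured from the foot of the perpendicular from the center. *)
Definition contact_point i (l t : R) : R * R := c + ((l - h) *: u i + t *: E i).

Lemma contact_point_mod i l t : contact_point (i %% k) l t = contact_point i l t.
Proof. by rewrite /contact_point /inner_normal side_dir_mod. Qed.

Let cross_base i l t : cross (E i) (contact_point i l t - c) = l - h.
Proof.
rewrite /contact_point /inner_normal; have := side_dir_norm i; move: (E i) (h) => [e1 e2] h' /= e.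
transitivity ((l - h') * (e1 ^+ 2 + e2 ^+ 2)); last by rewrite e mulr1.
by rewrite /cross/= /GRing.scale/=; ring.
Qed.

Let cross_left i l t l' t' :
  cross (E i) (contact_point i.+1 l' t' - contact_point i l t) =
  S1 * (((h - l) - (h - l') * cosa) / S1 + t').
Proof.
have s0 : S1 != 0 by rewrite gt_eqF// sinm1_gt0.
rewrite mulrDr mulrCA divff// mulr1.
have := side_dir_dot i; have := side_dir_norm i; have := cross_side_dirS k phi i.
rewrite /contact_point /inner_normal.
move: (E i) (E i.+1) (h) => [e1 e2] [f1 f2] h' /= s n d.
transitivity ((h' - l) * (e1 ^+ 2 + e2 ^+ 2) - (h' - l') * (e1 * f1 + e2 * f2) + t' * cross (e1, e2) (f1, f2)).
  by rewrite /cross/= /GRing.scale/=; ring.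
by rewrite s n d; ring.
Qed.

Let cross_right i l t l' t' :
  cross (contact_point i.+1 l' t' - contact_point i l t) (E i.+1) =
  S1 * (((h - l') - (h - l) * cosa) / S1 - t).
Proof.
have s0 : S1 != 0 by rewrite gt_eqF// sinm1_gt0.
rewrite mulrBr mulrCA divff// mulr1.
have := side_dir_dot i; have := side_dir_norm i.+1; have := cross_side_dirS k phi i.
rewrite /contact_point /inner_normal.
move: (E i) (E i.+1) (h) => [e1 e2] [f1 f2] h' /= s n d.
transitivity ((h' - l') * (f1 ^+ 2 + f2 ^+ 2) - (h' - l) * (e1 * f1 + e2 * f2) - t * cross (e1, e2) (f1, f2)).
  by rewrite /cross/= /GRing.scale/=; ring.
by rewrite s n d; ring.
Qed.

Lemma chain_vol_scaled m (e p d q : R * R) x y s : 0 < s ->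
  cross d e = s -> cross d (q - p) = s * y -> cross (q - p) e = s * x ->
  chain_vol m e p d q = chain_const m * s ^+ m * (pos_pow x m * pos_pow y m).
Proof.
move=> s0 sE yE xE; rewrite /chain_vol yE xE sE !pmulr_rgt0// /pos_pow.
have sn : s != 0 by rewrite gt_eqF.
have -> : s * y * (s * x) / s = s * (x * y) by field.
case: (0 < y); case: (0 < x); rewrite ?mul0r ?mulr0// !mul1r !exprMn; ring.
Qed.

Definition side_next i := (i.+1 %% k)%N.
Definition side_prev i := ((i + k.-1) %% k)%N.

Lemma side_prev_next i : (i < k)%N -> side_prev (side_next i) = i.
Proof.
move=> ik; rewrite /side_prev /side_next modnDml addSnnS prednK// modnDr modn_small//.
Qed.

(** Along side [i], with the foot of the perpendicular from the center as origin, the corners with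
    the next and the previous side are at [gap_next] and [- gap_prev]. *)
Definition gap_next (l : seq R) i : R :=
  ((h - nth 0 l (side_next i)) - (h - nth 0 l i) * cosa) / S1.
Definition gap_prev (l : seq R) i : R :=
  ((h - nth 0 l (side_prev i)) - (h - nth 0 l i) * cosa) / S1.

(* Length of the side [i] of the equiangular polygon whose sides are moved
   inwards by [l]. *)
Definition side_at (l : seq R) i : R := gap_next l i + gap_prev l i.

(** Exponent of the length of side [i]: its contact point enters one power from each of the two
    adjacent chains, and the beta integral over its position adds one. *)
Definition degree ts i := (nth 0%N ts i + nth 0%N ts (side_prev i)).+1.

Let fr := frames (fun i => c - h *: u i) u E.

Let uE1 i : `|cross (u i) (E i)| = 1.
Proof.
have -> : cross (u i) (E i) = - ((E i).1 ^+ 2 + (E i).2 ^+ 2).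
  by rewrite /inner_normal /cross/=; ring.
by rewrite side_dir_norm normrN normr1.
Qed.

Let nth_fr (l t : seq R) i : size l = k -> size t = k -> (i < k)%N ->
  nth 0 (fr 0 (zip l t)) i = contact_point i (nth 0 l i) (nth 0 t i).
Proof.
move=> sl st ik; rewrite nth_frames ?size_zip ?sl ?st ?minnn//.
rewrite nth_zip ?sl ?st// /frame /contact_point/= add0n.
by apply: plane_eqP; rewrite /= /GRing.scale/=; ring.
Qed.

Let G ts (ps : seq (plane R)) : R := (contacts_in k c rho phi ps)%:R *
  chains_vol k phi xpredT (cyc_nth k ps) 0 ts.

Let G_frames ts (l t : seq R) : size l = k -> size t = k -> size ts = k ->
  G ts (fr 0 (zip l t)) =
  (\prod_(i < k) (0 <= nth 0 l i)%R%:R) * (\prod_(j < k) (chain_const (nth 0%N ts j) * S1 ^+ nth 0%N ts j)) *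
  \prod_(i < k) (pos_pow (gap_next l i - nth 0 t i) (nth 0%N ts i) *
                 pos_pow (gap_prev l i + nth 0 t i) (nth 0%N ts (side_prev i))).
Proof.
move=> sl st sts; rewrite /G -mulrA; congr (_ * _).
  rewrite -(@natr_all R (fun i => 0 <= nth 0 l i)) /contacts_in; congr (_%:R); congr nat_of_bool.
  apply: eq_in_all => i; rewrite mem_iota add0n => /= ik.
  by rewrite nth_fr// cross_base lerBrDr addNr.
rewrite /chains_vol sts [X in _ = _ * X]big_split/=.
have -> : \prod_(i < k) pos_pow (gap_prev l i + nth 0 t i) (nth 0%N ts (side_prev i)) =
  \prod_(i < k) pos_pow (gap_prev l (side_next i) + nth 0 t (side_next i)) (nth 0%N ts i).
  rewrite -(prod_ordS (fun i => pos_pow (gap_prev l i + nth 0 t i) (nth 0%N ts (side_prev i))) kpos).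
  by apply: eq_bigr => i _; rewrite side_prev_next.
rewrite -!big_split/=; apply: eq_bigr => j _; rewrite add0n.
have jk := ltn_ord j.
have nk : (side_next j < k)%N by rewrite ltn_mod.
have c0 : cyc_nth k (fr 0 (zip l t)) j = contact_point j (nth 0 l j) (nth 0 t j).
  by rewrite /cyc_nth modn_small// nth_fr.
have c1 : cyc_nth k (fr 0 (zip l t)) j.+1 = contact_point j.+1 (nth 0 l (side_next j)) (nth 0 t (side_next j)).
  by rewrite /cyc_nth nth_fr// contact_point_mod.
rewrite c0 c1 (@chain_vol_scaled _ _ _ _ _ (gap_next l j - nth 0 t j) (gap_prev l (side_next j) + nth 0 t (side_next j)) S1).
- by ring.
- exact: sinm1_gt0.
- exact: cross_side_dirS.
- by rewrite cross_left /gap_prev side_prev_next.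
- exact: cross_right.
Qed.

Local Open Scope ereal_scope.

Let mseq_G n ts : mseqF n (fun ps => (G ts ps)%:E : \bar R).
Proof.
apply/measurable_EFinP; apply: measurable_funM.
  apply: measurable_boolR; apply: measurable_all => i _; apply: measurable_fun_ler => //.
  by apply: measurable_cross => //; apply: measurable_subpt => //; exact: mseq_nth.
apply: measurable_prod => j _; rewrite /chain_vol.
have mc i : measurable_fun setT (fun q : unit * n.-tuple (plane R) => cyc_nth k q.2 i : plane R).
  exact: mseq_nth.
have md := measurable_subpt (mc (0 + j).+1) (mc (0 + j)%N).
have mce (e : R * R) : measurable_fun setT (fun _ : unit * n.-tuple (plane R) => e : plane R) by [].
have m1 := measurable_cross (mce (E (0 + j))) md.
have m2 := measurable_cross md (mce (E (0 + j).+1)).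
apply: measurable_funM; first by apply: measurable_boolR; apply: measurable_and; exact: measurable_fun_ltr.
apply: measurable_funM => //; apply: measurable_funX; apply: measurable_funM => //.
exact: measurable_funM.
Qed.

Let G0 ts ps : (0 <= G ts ps)%R.
Proof. by rewrite mulr_ge0// ?ler0n ?chains_vol_ge0. Qed.

Lemma mseq_side_at n dP (P : measurableType dP) i :
  mseq n (fun (_ : P) (l : seq (measurableTypeR R)) => side_at l i : R).
Proof.
have mn j := @mseq_nth _ (measurableTypeR R) n _ P 0%R j.
rewrite /side_at /gap_next /gap_prev /mseq.
by repeat first [exact: mn|exact: measurable_cst|apply: measurable_funB|apply: measurable_funD|apply: measurable_funM].
Qed.

Lemma mseq_side_factor n dP (P : measurableType dP) i m (v : R) :
  mseq n (fun (_ : P) (l : seq (measurableTypeR R)) =>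
    ((0 <= nth 0 l i)%R%:R * (pos_pow (side_at l i) m / v))%R).
Proof.
have mn := @mseq_nth _ (measurableTypeR R) n _ P 0%R i.
apply: measurable_funM; first by apply: measurable_boolR; apply: measurable_fun_ler.
by apply: measurable_funM => //; apply: (measurableT_comp (measurable_pos_pow m)); exact: mseq_side_at.
Qed.

(** For fixed distances the position of contact point [i] enters only the chains on its two sides,
    so the integral over the positions is a product of [k] beta integrals. The factorials in their
    numerators cancel both factors [m]! of each [chain_const], and only [(m + 1)]! remains. *)
Lemma main_volumeE n ts : ts \in comps k n ->
  main_volume k c rho phi n ts = (S1 ^+ n / \prod_(i < k) ((nth 0%N ts i).+1)`!%:R)%:E *
  iint mu k (fun l => (\prod_(i < k) ((0 <= nth 0 l i)%R%:R *
     (pos_pow (side_at l i) (degree ts i) / (degree ts i)`!%:R)))%:E).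
Proof.
rewrite mem_comps => /andP[/eqP sts /eqP sn].
rewrite /main_volume iint_cat.
transitivity (iint (@leb2 R) k (fun ps => (G ts ps)%:E)).
  apply: eq_iint => ps sps; rewrite -sn /G EFinM -iint_chains// -iintZl ?lee_fin//; last first.
    apply/measurable_EFinP; apply: measurable_boolR; apply: measurable_chains => //.
      by move=> q; rewrite size_tuple.
    by move=> j _; exact: mseq_nth.
  apply: eq_iint => w _; rewrite /main_config take_size_cat// drop_size_cat//.
  by rewrite -EFinM -natrM mulnb.
rewrite (iint_frames (fun i => (c - h *: u i)%R) uE1 0%N)//; last first.
  by move=> t; rewrite lee_fin.
rewrite iint_zip; last 2 first.
- by move=> t; rewrite lee_fin.
- have := @mseq_frames R (fun i => (c - h *: u i)%R) u E k 0 _ unit _ _ (fun _ ps => (G ts ps)%:E).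
  by apply; exact: mseq_G.
rewrite -/fr.
rewrite -iintZl//; last 3 first.
- rewrite lee_fin divr_ge0//; first by rewrite exprn_ge0// ltW// sinm1_gt0.
  by apply: prodr_ge0 => i _; rewrite ler0n.
- move=> l; rewrite lee_fin; apply: prodr_ge0 => i _.
  by rewrite mulr_ge0 ?ler0n// divr_ge0 ?pos_pow_ge0 ?ler0n.
- apply/measurable_EFinP; apply: measurable_prod => i _; exact: mseq_side_factor.
apply: eq_iint => l sl.
pose C := (\prod_(j < k) (chain_const (nth 0%N ts j) * S1 ^+ nth 0%N ts j) : R)%R.
pose f i (x : measurableTypeR R) : R := (pos_pow (gap_next l i - x) (nth 0%N ts i) *
                 pos_pow (gap_prev l i + x) (nth 0%N ts (side_prev i)))%R.
have mf i : measurable_fun setT (f i).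
  apply: measurable_funM.
    by apply: (measurableT_comp (measurable_pos_pow _)); meas.
  by apply: (measurableT_comp (measurable_pos_pow _)); meas.
have f0 i x : (0 <= f i x)%R by rewrite mulr_ge0 ?pos_pow_ge0.
have C0 : (0 <= C)%R.
  apply: prodr_ge0 => i _; rewrite mulr_ge0 ?chain_const_ge0// exprn_ge0// ltW//.
  exact: sinm1_gt0.
have ind0 : (0 <= \prod_(i < k) ((0 <= nth 0 l i)%R%:R : R))%R.
  by apply: prodr_ge0 => i _; rewrite ler0n.
transitivity (((\prod_(i < k) (0 <= nth 0 l i)%R%:R) * C)%R%:E *
    iint mu k (fun t => (\prod_(i < k) f i (nth 0%R t i))%:E)).
  rewrite -iintZl//; last 3 first.
  - by rewrite lee_fin mulr_ge0.
  - by move=> t; rewrite lee_fin; apply: prodr_ge0.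
  - by apply/measurable_EFinP; exact: (@mseq_prod_nth _ k _ unit f k mf).
  by apply: eq_iint => t st; rewrite G_frames// -EFinM.
rewrite (@iint_prod _ k f (fun i => (pos_pow (side_at l i) (degree ts i) *
   (((nth 0%N ts i)`! * (nth 0%N ts (side_prev i))`!)%:R / (degree ts i)`!%:R))%R))//; last first.
  by move=> i _; rewrite /f integral_pos_pow.
rewrite -!EFinM; congr EFin.
rewrite [in RHS]big_split/= mulrCA -[in LHS]mulrA; congr (_ * _)%R.
rewrite (eq_bigr (fun i : 'I_k => (pos_pow (side_at l i) (degree ts i) / (degree ts i)`!%:R) *
   ((nth 0%N ts i)`!%:R * (nth 0%N ts (side_prev i))`!%:R))%R); last first.
  by move=> i _; rewrite natrM; ring.
rewrite big_split/= mulrCA [RHS]mulrC; congr (_ * _)%R.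
rewrite [X in (_ * X)%R]big_split/=.
rewrite -(prod_ordS (fun i => (nth 0%N ts (side_prev i))`!%:R : R) kpos).
have -> : (\prod_(j < k) (nth 0%N ts (side_prev (j.+1 %% k)))`!%:R = \prod_(j < k) (nth 0%N ts j)`!%:R :> R)%R.
  by apply: eq_bigr => j _; rewrite -/(side_next j) side_prev_next.
have SE : (S1 ^+ n = \prod_(j < k) S1 ^+ nth 0%N ts j :> R)%R.
  rewrite prodrXr -sn; congr (_ ^+ _)%R.
  by rewrite sumnE (big_nth 0%N) sts big_mkord.
rewrite SE -prodfV /C -!big_split/=; apply: eq_bigr => j _.
rewrite /chain_const !natrM !invfM.
have h1 : ((nth 0%N ts j)`!%:R != 0 :> R)%R by rewrite pnatr_eq0 -lt0n fact_gt0.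
by move: (_.+1%:R^-1)%R (_`!%:R) (S1 ^+ _)%R h1 => w y z h1; field.
Qed.

End main_volume_formula.

(** * Degenerate configurations *)

Section multinomial_bound.
Context {R : realType}.

(** Up to a factorial, the left-hand side is a single term of the binomial expansion on the
    right. *)
Lemma fact_exp_le (x y : R) a b : 0 <= x -> 0 <= y ->
  (x ^+ a / a`!%:R) * (y ^+ b / b`!%:R) <= (x + y) ^+ (a + b) / (a + b)`!%:R.
Proof.
move=> x0 y0.
have fp m : 0 < m`!%:R :> R by rewrite ltr0n fact_gt0.
rewrite ler_pdivlMr// exprDn.
have ab : (b < (a + b).+1)%N by rewrite ltnS leq_addl.
rewrite (bigD1 (Ordinal ab))//= addnK.
rewrite (_ : x ^+ a / a`!%:R * (y ^+ b / b`!%:R) * (a + b)`!%:R = x ^+ a * y ^+ b *+ 'C(a + b, b)); last first.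
  have e : (a + b)`!%:R = 'C(a + b, b)%:R * (b`!%:R * a`!%:R) :> R.
    by rewrite -!natrM -(bin_fact (leq_addl a b)) addnK.
  rewrite e -[RHS]mulr_natr; have := fp a; have := fp b.
  move: (a`!%:R) (b`!%:R) => u v v0 u0; field.
  by rewrite !gt_eqF.
rewrite lerDl; apply: sumr_ge0 => i _; rewrite mulrn_wge0// mulr_ge0// exprn_ge0//.
Qed.

Lemma prod_exp_fact_le m (x : nat -> R) (a : nat -> nat) : (forall i, (i < m)%N -> 0 <= x i) ->
  \prod_(i < m) (x i ^+ a i / (a i)`!%:R) <=
  (\sum_(i < m) x i) ^+ (\sum_(i < m) a i) / (\sum_(i < m) a i)`!%:R.
Proof.
elim: m => [|m IH] x0; first by rewrite !big_ord0 expr0 fact0 divr1.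
have xm i : (i < m)%N -> 0 <= x i by move=> im; apply: x0; exact: ltnW.
rewrite !big_ord_recr/=; apply: le_trans (fact_exp_le _ _ _ _) => //; last exact: x0.
  by apply: ler_wpM2r; rewrite ?divr_ge0 ?exprn_ge0 ?ler0n ?x0 ?IH.
by apply: sumr_ge0 => i _; exact: xm.
Qed.

End multinomial_bound.

Section degenerate_bound.
Context {R : realType}.
Variables (k : nat) (c : R * R) (rho phi : R).
Hypotheses (k3 : (3 <= k)%N) (rho0 : 0 < rho).
Local Notation E := (side_dir k phi).
Local Notation K := (regular_polygon k c rho phi).
Local Notation mK := (measurable_regular_polygon k c rho phi).
Local Notation h := (apothem k rho).
Local Notation S1 := (@sinm R k 1).
Local Notation cosa := (cos (@step_angle R k)).
Hypothesis K1 : lebesgue_measure2 R K = 1%E.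

Let kpos : (0 < k)%N. Proof. by lia. Qed.

Let S10 : 0 < S1. Proof. exact: sinm1_gt0. Qed.

Lemma side_apothem : (2 - 2 * cosa) * h = S1 * side k rho.
Proof.
rewrite /side /apothem /sinm mul1r.
set x := step_angle k / 2.
have -> : step_angle k = x + x by rewrite /x; field.
rewrite cosD sinD; have := cos2Dsin2 x; move: (cos x) (sin x) => C S e.
transitivity ((2 * (C ^+ 2 + S ^+ 2) - 2 * (C * C - S * S)) * (rho * C)).
  by rewrite e mulr1.
ring.
Qed.

Section perimeter.
Variable P : nat -> R * R.
Hypothesis Pk : forall i, P (i + k) = P i.
Hypothesis PK : forall i, (i < k)%N -> - h <= cross (E i) (P i - c).

Let sum_shift (f : nat -> R) : (forall i, f (i + k)%N = f i) ->
  \sum_(i < k) f i.+1 = \sum_(i < k) f i.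
Proof.
case: k kpos => [//|k'] _ fk; rewrite big_ord_recr big_ord_recl/= addrC; congr (_ + _).
by rewrite -(fk 0%N) add0n.
Qed.

(** For contact points the left-hand side is [S1] times the perimeter of the equiangular polygon
    around them. Summation by parts with [side_dir_rec] makes it a multiple of the sum of the terms
    [cross (P j) (E j)], each bounded by the half plane of its side. *)
Lemma perimeter_le :
  \sum_(j < k) (cross (P j.+1 - P j) (E j.+1) + cross (E j) (P j.+1 - P j)) <=
  S1 * (k%:R * side k rho).
Proof.
have crossk (i j : nat) : cross (P (i + k)) (E (j + k)) = cross (P i) (E j).
  by rewrite Pk side_dirDk.
have -> : \sum_(j < k) (cross (P j.+1 - P j) (E j.+1) + cross (E j) (P j.+1 - P j)) =
    (2 - 2 * cosa) * \sum_(j < k) cross (P j) (E j).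
  transitivity (\sum_(j < k) cross (P j.+1) (E j.+1) - \sum_(j < k) cross (P j.+1) (E j)
     - \sum_(j < k) cross (P j) (E j.+1) + \sum_(j < k) cross (P j) (E j)).
    rewrite -!sumrB -big_split/=; apply: eq_bigr => j _.
    by rewrite /cross/=; ring.
  rewrite (sum_shift (f := fun j => cross (P j) (E j)))//.
  rewrite -(sum_shift (f := fun j => cross (P j) (E j.+1))); last first.
    by move=> i; rewrite -addSn crossk.
  rewrite -(sum_shift (f := fun j => cross (P j) (E j)))//.
  rewrite -!sumrB -big_split/= mulr_sumr; apply: eq_bigr => j _.
  have e : cross (P j.+1) (E j) + cross (P j.+1) (E j.+2) = 2 * cosa * cross (P j.+1) (E j.+1).
    transitivity (cross (P j.+1) (E j.+2 + E j)); first by rewrite /cross/=; ring.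
    by rewrite side_dir_rec /cross/= /GRing.scale/=; ring.
  rewrite mulrBl -e; ring.
have c1 := @cos_step_lt1 R k k3.
apply: (@le_trans _ _ ((2 - 2 * cosa) * (k%:R * h))); last first.
  by rewrite mulrCA side_apothem mulrCA.
apply: ler_wpM2l; first by move: c1; move: (cos _) => C; lra.
have -> : k%:R * h = \sum_(j < k) (cross c (E j) + h).
  rewrite big_split/= sumr_const card_ord -[h *+ k]mulr_natl.
  rewrite (_ : \sum_(j < k) cross c (E j) = 0) ?add0r//.
  transitivity (cross c (\sum_(0 <= j < k) E j)).
    rewrite big_mkord; elim/big_rec2 : _ => [|j x y _ ->]; first by rewrite /cross/= !mulr0 subrr.
    by rewrite /cross/=; ring.
  by rewrite (sum_side_dir phi k3) /cross/= !mulr0 subrr.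
apply: ler_sum => j _; have := PK (ltn_ord j).
by rewrite /cross/=; lra.
Qed.

End perimeter.

(** The first factor is the multinomial bound for the powers of the two parts of each side, whose
    sum is at most the perimeter of the polygon. The second is the same bound for the product of the
    [1 / (t_j + 1)]!, with [k - 1] in place of [k] because one chain is empty. *)
Definition deg_const M : R := S1 ^+ M * (k%:R * side k rho) ^+ (2 * M) / (2 * M)`!%:R *
  (k.-1%:R ^+ (M + k.-1) / (M + k.-1)`!%:R).

Let L0 : 0 <= k%:R * side k rho.
Proof. by rewrite mulr_ge0// ltW// side_gt0. Qed.

Lemma deg_const_ge0 M : 0 <= deg_const M.
Proof.
rewrite /deg_const !mulr_ge0 ?invr_ge0 ?ler0n ?exprn_ge0 ?(ltW S10)//.
Qed.

Lemma chains_vol_deg_le r pi ts M qs : pi \in deg_patterns k r -> ts \in comps k M ->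
  size qs = r -> all (mem K) qs ->
  chains_vol k phi (moves k pi) (pattern_nth k pi qs) 0 ts <= deg_const M.
Proof.
rewrite mem_filter mem_boxes mem_comps => /andP[/hasP[j0]]; rewrite mem_iota add0n => /= j0k mj0.
move=> /andP[/eqP spi pir] /andP[/eqP sts /eqP sM] sqs qK.
pose P j := pattern_nth k pi qs j.
have Pk i : P (i + k)%N = P i by rewrite /P /pattern_nth modnDr.
have PK i : (i < k)%N -> - h <= cross (E i) (P i - c).
  move=> ik; apply: polygon_half_plane => //; apply/set_mem; apply: (allP qK).
  rewrite mem_nth// sqs modn_small//; apply: (allP pir); rewrite mem_nth ?spi//.
pose A j := cross (P j.+1 - P j) (E j.+1) / S1.
pose B j := cross (E j) (P j.+1 - P j) / S1.
have inactive j : ~~ moves k pi j -> A j = 0 /\ B j = 0.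
  rewrite /moves negbK => /eqP e; have PE : P j.+1 = P j by rewrite /P /pattern_nth e.
  by rewrite /A /B PE subrr /cross/= !(mul0r, mulr0) subrr mul0r.
(* An active chain whose chord leaves its cone has volume zero. In the remaining case all [A j] and
   [B j] are nonnegative, as the multinomial bounds require. *)
have [/existsP[j /andP[mj nj]]|] :=
    boolP [exists j : 'I_k, moves k pi j && ~~ ((0 < A j) && (0 < B j))].
  rewrite (_ : chains_vol _ _ _ _ _ _ = 0) ?deg_const_ge0//.
  have jt : (j < size ts)%N by rewrite sts.
  rewrite /chains_vol (bigD1 (Ordinal jt))//= add0n mj.
  rewrite (@chain_vol_scaled _ _ _ _ _ _ (A j) (B j) S1)//; last 3 first.
  - exact: cross_side_dirS.
  - by rewrite mulrC divfK// gt_eqF.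
  - by rewrite mulrC divfK// gt_eqF.
  by move: nj; rewrite /pos_pow; case: (0 < A j); case: (0 < B j); rewrite // ?mul0r ?mulr0 mul0r.
rewrite negb_exists => /forallP pos.
have pos' j : (j < k)%N -> moves k pi j -> 0 < A j /\ 0 < B j.
  by move=> jk mj; have := pos (Ordinal jk); rewrite negb_and mj/= negbK => /andP.
have AB0 j : (j < k)%N -> 0 <= A j /\ 0 <= B j.
  move=> jk; have [mj|/inactive[-> ->]//] := boolP (moves k pi j).
  by have [/ltW ? /ltW ?] := pos' j jk mj.
have [t0|tn0] := eqVneq (nth 0%N ts j0) 0%N; last first.
  rewrite (_ : chains_vol _ _ _ _ _ _ = 0) ?deg_const_ge0//.
  have jt : (j0 < size ts)%N by rewrite sts.
  by rewrite /chains_vol (bigD1 (Ordinal jt))//= add0n (negbTE mj0) (negbTE tn0) mul0r.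
pose t j := nth 0%N ts j.
apply: (@le_trans _ _ (\prod_(j < k) (S1 ^+ t j * ((A j ^+ t j / (t j)`!%:R) * (B j ^+ t j / (t j)`!%:R)) *
   ((t j).+1)`!%:R^-1))).
  rewrite /chains_vol sts; apply: ler_prod => j _; rewrite add0n.
  have jk := ltn_ord j; have [A0 B0] := AB0 _ jk.
  apply/andP; split.
    by case: ifP => _; [apply: chain_vol_ge0; rewrite cross_side_dirS; exact: sinm1_gt0|rewrite ler0n].
  case: ifPn => mj.
    rewrite (@chain_vol_scaled _ _ _ _ _ _ (A j) (B j) S1)//; last 3 first.
    - exact: cross_side_dirS.
    - by rewrite mulrC divfK// gt_eqF.
    - by rewrite mulrC divfK// gt_eqF.
    have [Ap Bp] := pos' _ jk mj.
    rewrite /pos_pow Ap Bp !mul1r /chain_const -/(t j) le_eqVlt; apply/orP; left; apply/eqP.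
    by move: ((t j).+1)`! (t j)`! => u v; rewrite !natrM !invfM; ring.
  have [A_0 B_0] := inactive _ mj; rewrite -/(t j).
  have [->|tj] := eqVneq (t j) 0%N; first by rewrite !expr0 !fact0 !factS !fact0 !(mulr1,divr1,invr1).
  by rewrite !mulr_ge0 ?invr_ge0 ?ler0n ?exprn_ge0// ltW.
rewrite (_ : \prod_(j < k) _ = (\prod_(j < k) S1 ^+ t j) *
  ((\prod_(j < k) (A j ^+ t j / (t j)`!%:R)) * (\prod_(j < k) (B j ^+ t j / (t j)`!%:R))) *
  \prod_(j < k) ((t j).+1)`!%:R^-1); last by rewrite -!big_split.
rewrite /deg_const.
have sumt : (\sum_(j < k) t j)%N = M.
  by rewrite -sM sumnE (big_nth 0%N) sts big_mkord.
rewrite prodrXr sumt -!mulrA; apply: ler_wpM2l; first by rewrite exprn_ge0// ltW.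
rewrite [leLHS]mulrA [leRHS]mulrA; apply: ler_pM.
- by rewrite mulr_ge0//; apply: prodr_ge0 => j _;
    rewrite divr_ge0 ?ler0n ?exprn_ge0//; have [] := AB0 _ (ltn_ord j).
- by apply: prodr_ge0 => j _; rewrite invr_ge0 ler0n.
- have A0 j : (j < k)%N -> 0 <= A j by move=> /AB0[].
  have B0 j : (j < k)%N -> 0 <= B j by move=> /AB0[].
  have := prod_exp_fact_le t A0; have := prod_exp_fact_le t B0.
  rewrite sumt => hB hA.
  have SA0 : 0 <= \sum_(j < k) A j by apply: sumr_ge0 => j _; have [] := AB0 _ (ltn_ord j).
  have SB0 : 0 <= \sum_(j < k) B j by apply: sumr_ge0 => j _; have [] := AB0 _ (ltn_ord j).
  apply: le_trans (ler_pM _ _ hA hB) _.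
  + by apply: prodr_ge0 => j _; rewrite divr_ge0 ?ler0n ?exprn_ge0//; have [] := AB0 _ (ltn_ord j).
  + by apply: prodr_ge0 => j _; rewrite divr_ge0 ?ler0n ?exprn_ge0//; have [] := AB0 _ (ltn_ord j).
  apply: le_trans (fact_exp_le _ _ _ _) _ => //.
  rewrite addnn -mul2n; apply: ler_wpM2r; first by rewrite invr_ge0 ler0n.
  apply: lerXn2r; rewrite ?nnegrE ?addr_ge0//.
  rewrite -(ler_pM2l S10) -big_split/= mulr_sumr; apply: le_trans (perimeter_le Pk PK).
  apply: ler_sum => j _; rewrite mulrDr /A /B ![S1 * (_ / _)]mulrCA divff ?mulr1//.
  by rewrite gt_eqF.
(* The factor with [t j0 = 0] is 1: only [k - 1] factors remain. *)
have := @prod_exp_fact_le R k (fun j => (j != j0)%:R) (fun j => if j == j0 then 0%N else (t j).+1) (fun _ _ => ler0n _ _).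
have -> : (\sum_(i < k) (if i == j0 :> nat then 0 else (t i).+1) = M + k.-1)%N.
  have -> : (M + k.-1 = \sum_(i < k) (t i + (i != j0 :> nat)))%N.
    rewrite big_split/= sumt; congr (_ + _)%N.
    rewrite (bigD1 (Ordinal j0k))//= eqxx/= add0n (eq_bigr (fun=> 1%N)); last by move=> i ->.
    by rewrite sum1_card cardC1 card_ord.
  by apply: eq_bigr => i _; case: eqP => [->|_]; rewrite /t ?t0//= addn1.
have -> : \sum_(i < k) ((i : nat) != j0)%:R = k.-1%:R :> R.
  rewrite (bigD1 (Ordinal j0k))//= eqxx/= add0r (eq_bigr (fun=> 1)); last by move=> i ->.
  by rewrite sumr_const cardC1 card_ord.
apply: le_trans; rewrite le_eqVlt; apply/orP; left; apply/eqP.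
apply: eq_bigr => i _; case: eqP => [->|_]/=.
  by rewrite /t t0 expr0 mul1r.
by rewrite expr1n div1r.
Qed.

Local Open Scope ereal_scope.

Lemma iint_all_polygon r : iint (@leb2 R) r (fun qs => (all (mem K) qs)%:R%:E) = 1.
Proof.
transitivity (iint (uniform_law mK) r (fun=> 1)).
  rewrite (iint_uniform mK K1)//; first by apply: eq_iint => t _; rewrite mule1.
  exact: measurable_cst.
elim: r => [//|r IH] /=; under eq_integral do rewrite IH.
by rewrite integral_cst// mul1e; exact: probability_setT.
Qed.

Lemma deg_volume_le n r pi ts : (r < k)%N -> pi \in deg_patterns k r ->
  ts \in comps k (k + n - r)%N ->
  deg_volume k c rho phi n r pi ts <= (deg_const (k + n - r))%:E.
Proof.
move=> rk pid tc; have := tc; rewrite mem_comps => /andP[/eqP sts /eqP sM].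
have e : (k + n = r + sumn ts)%N by rewrite sM subnKC// (leq_trans (ltnW rk))// leq_addr.
rewrite /deg_volume {1}e iint_cat.
apply: (@le_trans _ _ (iint (@leb2 R) r (fun qs => (deg_const (k + n - r))%:E * (all (mem K) qs)%:R%:E))).
  apply: le_iint => [qs|qs sqs].
    by apply: iint_ge0 => w; rewrite lee_fin ler0n.
  apply: (@le_trans _ _ ((all (mem K) qs)%:R%:E *
    (chains_vol k phi (moves k pi) (pattern_nth k pi qs) 0 ts)%:E)).
    rewrite -iint_chains// -iintZl ?lee_fin//; last first.
      apply/measurable_EFinP; apply: measurable_boolR; apply: measurable_chains => //.
        by move=> q; rewrite size_tuple.
      by move=> j _; exact: mseq_nth.
    apply: le_iint => [w|w _]; first by rewrite lee_fin ler0n.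
    by rewrite /deg_config take_size_cat// drop_size_cat// -EFinM -natrM mulnb.
  case: (boolP (all (mem K) qs)) => qK; last by rewrite mul0e mule0.
  by rewrite mul1e mule1 lee_fin; exact: (chains_vol_deg_le pid tc sqs qK).
rewrite iintZl ?lee_fin ?deg_const_ge0//; last first.
  apply/measurable_EFinP; apply: measurable_boolR.
  rewrite [X in measurable_fun _ X](_ : _ = (fun q : unit * r.-tuple (plane R) =>
      all (fun i => nth 0%R q.2 i \in K) (iota 0 r))).
    apply: measurable_all => i _.
    exact: (measurableT_comp (measurable_mem mK)
      (@mseq_nth _ (plane R) r _ unit (0%R : R * R) i)).
  by apply/funext => q; rewrite (@all_nth_iota _ (0%R : R * R) _ _ r) ?size_tuple.
by rewrite iint_all_polygon mule1.
Qed.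

End degenerate_bound.

(** * Gaussian and exponential integrals *)

Lemma measurable_fun_exp d (T : measurableType d) (R : realType) (f : T -> R) :
  measurable_fun setT f -> measurable_fun setT (fun x => expR (f x)).
Proof. by move=> mf; apply: measurableT_comp. Qed.

Section line_integrals.
Context {R : realType}.
Local Notation mu := (@lebesgue_measure R).
Local Open Scope ereal_scope.

Lemma integral_ge0_gt0 (f : measurableTypeR R -> R) : measurable_fun setT f ->
  \int[mu]_x ((0 <= x)%R%:R * f x)%:E = \int[mu]_x ((0 < x)%R%:R * f x)%:E.
Proof.
move=> mf.
transitivity (\int[mu]_(x in `[0%R, +oo[) (f x)%:E).
  rewrite [RHS]integral_mkcond; apply: eq_integral => x _.
  by rewrite patchE mem_setE in_itv/= andbT; case: (0 <= x)%R; rewrite ?mul1r ?mul0r.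
rewrite -integral_itv_obnd_cbnd; last by apply/measurable_EFinP; exact: measurable_funTS.
rewrite integral_mkcond; apply: eq_integral => x _.
by rewrite patchE mem_setE in_itv/= andbT; case: (0 < x)%R; rewrite ?mul1r ?mul0r.
Qed.

Lemma measurable_expRN a : measurable_fun setT (fun x : measurableTypeR R => expR (- (a * x)))%R.
Proof.
by apply: measurable_fun_exp; apply: measurable_funN; apply: measurable_funM.
Qed.

Lemma integral_expN a : (0 < a)%R ->
  \int[mu]_x ((0 < x)%R%:R * expR (- (a * x)))%:E = (a^-1)%:E.
Proof.
move=> a0; have m := measurable_expRN a.
rewrite -integral_ge0_gt0//.
have := @integral_exponential_pdf R a a0.
rewrite (_ : (fun x => _) = (fun x => a%:E * ((0 <= x)%R%:R * expR (- (a * x)))%:E)); last first.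
  apply/funext => x; rewrite /exponential_pdf patchE mem_setE in_itv/= andbT.
  by case: ifP => _; rewrite ?mul1r ?mul0r ?mule0// -EFinM mulNr.
rewrite ge0_integralZl//.
- move=> h; have := congr1 (fun z => (a^-1)%:E * z) h.
  by rewrite muleA -EFinM mulVf ?gt_eqF// mul1e mule1.
- apply/measurable_EFinP; apply: measurable_funM => //.
  by apply: measurable_boolR; apply: measurable_fun_ler.
- by rewrite lee_fin ltW.
Qed.

(** [x ^+ n.+1] is [n.+1] times the integral of [y ^+ n] from [0] to [x]; after an exchange of
    integrals the inner one is an exponential tail, evaluated by [tail]. *)
Lemma integral_Gamma n :
  \int[mu]_x ((0 < x)%R%:R * (x ^+ n * expR (- x)))%:E = (n`!%:R)%:E.
Proof.
have mE : measurable_fun setT (fun x : measurableTypeR R => expR (- x))%R.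
  by apply: measurable_fun_exp; exact: oppr_measurable.
have tail (s : R) : \int[mu]_x ((s < x)%R%:R * expR (- x))%:E = (expR (- s))%:E.
  rewrite -(@ge0_integral_translation _ s (fun x => ((s < x)%R%:R * expR (- x))%:E))//; last first.
    by apply/measurable_EFinP; apply: measurable_funM => //; meas.
  transitivity (\int[mu]_x ((expR (- s))%:E * ((0 < x)%R%:R * expR (- (1 * x)))%:E)).
    apply: eq_integral => x _; rewrite -EFinM; congr EFin.
    by rewrite -subr_gt0 addrK mul1r opprD expRD; ring.
  rewrite ge0_integralZl//.
  - by rewrite integral_expN// invr1 mule1.
  - apply/measurable_EFinP; apply: measurable_funM; first by meas.
    exact: measurable_expRN.
elim: n => [|n IH].
  have := tail 0%R; rewrite oppr0 expR0 fact0 => <-.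
  by apply: eq_integral => x _; rewrite expr0 !mul1r.
pose F (q : measurableTypeR R * measurableTypeR R) : \bar R :=
  ((0 < q.2 < q.1)%R%:R * q.2 ^+ n * expR (- q.1))%:E.
have mF : measurable_fun setT F.
  apply/measurable_EFinP; apply: measurable_funM; first by meas.
  by apply: (measurableT_comp mE); exact: measurable_fst.
have F0 q : 0 <= F q.
  rewrite lee_fin /F mulr_ge0 ?expR_ge0//.
  by case: (boolP (0 < q.2 < q.1)%R) => [/andP[/ltW h _]|_]; rewrite ?mul0r// mul1r exprn_ge0.
have n0 : (n.+1%:R != 0 :> R)%R by rewrite pnatr_eq0.
transitivity (\int[mu]_x (n.+1%:R%:E * \int[mu]_y F (x, y))).
  apply: eq_integral => x _.
  transitivity (n.+1%:R%:E * ((expR (- x))%:E *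
     \int[mu]_y ((0 < y < x)%R%:R * (y ^+ n * (x - y) ^+ 0))%:E)).
    have [x0|x0] := ltP 0%R x.
      rewrite integral_beta// addn0 muln1 -!EFinM; congr EFin.
      rewrite factS natrM; have := @fact_gt0 n; rewrite -(ltr0n R) => /gt_eqF/negbT.
      by rewrite mul1r; move: (n`!%:R)%R (n.+1%:R)%R (x ^+ n.+1)%R n0 => u w z w0 u0; field; rewrite u0 w0.
    rewrite mul0r (_ : (fun y => _) = cst 0) ?integral0 ?mule0//.
    apply/funext => y; rewrite (_ : (0 < y < x)%R = false) ?mul0r//.
    by apply/negbTE/negP => /andP[h1 h2]; have := lt_trans h1 h2; rewrite ltNge x0.
  congr (_ * _); rewrite -ge0_integralZl//.
  - by apply: eq_integral => y _; rewrite /F /= -EFinM expr0; congr EFin; ring.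
  - by apply/measurable_EFinP; meas.
  - move=> y _; rewrite lee_fin expr0 mulr1.
    by case: (boolP (0 < y < x)%R) => [/andP[/ltW h _]|_]; rewrite ?mul0r// mul1r exprn_ge0.
rewrite ge0_integralZl//; last 2 first.
- exact: (measurable_fun_fubini_tonelli_F F).
- by move=> x _; exact: integral_ge0.
rewrite (fubini_tonelli F)// factS natrM EFinM -IH; congr (_ * _).
apply: eq_integral => s _; rewrite /F/=.
transitivity (\int[mu]_x (((0 < s)%R%:R * s ^+ n)%:E * ((s < x)%R%:R * expR (- x))%:E)).
  apply: eq_integral => x _; rewrite -EFinM; congr EFin.
  by case: (0 < s)%R; case: (s < x)%R; rewrite /= ?mul0r ?mul1r ?mulr0 ?mul0r.
rewrite ge0_integralZl//.
- by rewrite tail -EFinM mulrA.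
- by apply/measurable_EFinP; apply: measurable_funM => //; meas.
- by rewrite lee_fin; case: ltrP => [/ltW h|_]; rewrite ?mul0r// mul1r exprn_ge0.
Qed.

Lemma integral_gaussian a : (0 < a)%R ->
  \int[mu]_x (expR (- (a * x ^+ 2)))%:E = (Num.sqrt (pi / a))%:E.
Proof.
move=> a0; have s0 : (0 < Num.sqrt a)%R by rewrite sqrtr_gt0.
have sn : (Num.sqrt a != 0)%R by rewrite gt_eqF.
have V0 : (Num.sqrt a)^-1%R != 0%R by rewrite invr_eq0.
have m : measurable_fun setT (fun x : measurableTypeR R => (expR (- (a * x ^+ 2)))%:E).
  apply/measurable_EFinP; apply: measurable_fun_exp.
  by apply: measurable_funN; meas.
rewrite (ge0_integral_affine 0%R V0 m); last by move=> x; rewrite lee_fin expR_ge0.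
rewrite gtr0_norm ?invr_gt0// (_ : (fun x => _) = (fun x => (gauss_fun x)%:E)); last first.
  apply/funext => x; congr EFin; rewrite /gauss_fun addr0 exprMn exprVn sqr_sqrtr ?(ltW a0)//.
  by congr expR; field; rewrite gt_eqF.
rewrite integralT_gauss -EFinM; congr EFin.
by rewrite sqrtrM ?pi_ge0// sqrtrV ?ltW// mulrC.
Qed.

Lemma integral_cauchy_lty : \int[mu]_x ((1 + x ^+ 2)^-1)%:E < +oo.
Proof.
pose f (x : measurableTypeR R) : R := ((1 + x ^+ 2)^-1)%R.
have mf : measurable_fun setT f by rewrite /f; meas.
have f0 x : (0 <= f x)%R by rewrite invr_ge0 addr_ge0// sqr_ge0.
have half : \int[mu]_x ((0 <= x)%R%:R * f x)%:E = (pi / 2)%:E.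
  rewrite -integral0y_oneDsqr [RHS]integral_mkcond; apply: eq_integral => x _.
  rewrite patchE mem_setE in_itv/= andbT; case: (0 <= x)%R; rewrite ?mul1r ?mul0r//.
apply: (@le_lt_trans _ _ (\int[mu]_x (((0 <= x)%R%:R * f x)%:E + ((x <= 0)%R%:R * f x)%:E))).
  apply: ge0_le_integralT => x; first by rewrite lee_fin f0.
  rewrite -EFinD lee_fin -/(f x) -mulrDl -[X in (X <= _)%R]mul1r ler_wpM2r//.
  by case: (ltrgtP x 0%R) => _ /=; rewrite ?addr0 ?add0r// lerDl ler01.
rewrite ge0_integralD//; last 4 first.
- by move=> x _; rewrite lee_fin mulr_ge0.
- by apply/measurable_EFinP; apply: measurable_funM => //; meas.
- by move=> x _; rewrite lee_fin mulr_ge0.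
- by apply/measurable_EFinP; apply: measurable_funM => //; meas.
have N1 : (-1 != 0 :> R)%R by rewrite oppr_eq0 oner_eq0.
rewrite [X in _ + X](ge0_integral_affine 0%R N1); last 2 first.
- by apply/measurable_EFinP; apply: measurable_funM => //; meas.
- by move=> x; rewrite lee_fin mulr_ge0.
rewrite normrN normr1 mul1e (_ : (fun x => ((_ * x + 0 <= 0)%R%:R * _)%:E) = (fun x => ((0 <= x)%R%:R * f x)%:E)); last first.
  by apply/funext => x; rewrite addr0 mulN1r oppr_le0 /f sqrrN.
by rewrite half -EFinD ltry.
Qed.

End line_integrals.

Section iterated_dominated_convergence.
Context {R : realType}.
Local Notation mu := (@lebesgue_measure R).
Local Open Scope ereal_scope.
Implicit Types (t : seq (measurableTypeR R)).

Variables (g : nat -> measurableTypeR R -> R) (v : nat -> R).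
Hypothesis mg : forall i, measurable_fun setT (g i).
Hypothesis g0 : forall i x, (0 <= g i x)%R.
Hypothesis gv : forall i, \int[mu]_x (g i x)%:E = (v i)%:E.

Let v0 i : (0 <= v i)%R.
Proof. by rewrite -lee_fin -gv integral_ge0// => x _; rewrite lee_fin. Qed.

Lemma iint_le_prod m i (F : seq (measurableTypeR R) -> R) C : (0 <= C)%R ->
  (forall t, (0 <= F t)%R) ->
  (forall t, size t = m -> (F t <= C * \prod_(j < m) g (i + j)%N (nth 0%R t j))%R) ->
  iint mu m (fun t => (F t)%:E) <= (C * \prod_(j < m) v (i + j)%N)%:E.
Proof.
move=> C0 F0 Fg.
have m1 : mseqF m (fun t : seq (measurableTypeR R) => (\prod_(j < m) g (i + j)%N (nth 0%R t j))%:E : \bar R).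
  apply/measurable_EFinP; exact: (@mseq_prod_nth _ m _ unit (fun j => g (i + j)%N) m (fun j => mg (i + j)%N)).
apply: (@le_trans _ _ (iint mu m (fun t => C%:E * (\prod_(j < m) g (i + j)%N (nth 0%R t j))%:E))).
  apply: le_iint => [t|t st]; first by rewrite lee_fin.
  by rewrite -EFinM lee_fin Fg.
rewrite iintZl ?lee_fin//; last by move=> t; rewrite lee_fin; apply: prodr_ge0.
by rewrite (@iint_prod _ m (fun j => g (i + j)%N) (fun j => v (i + j)%N)).
Qed.

(** The dominating function is a product of integrable functions of one variable each, so dominated
    convergence applies one variable at a time: [C * g i x] serves as the constant for the variables
    after [x]. *)
Lemma iint_dominated_convergence m i (F : nat -> seq (measurableTypeR R) -> R)
    (f : seq (measurableTypeR R) -> R) C : (0 <= C)%R ->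
  (forall n, mseqF m (fun t => (F n t)%:E : \bar R)) -> mseqF m (fun t => (f t)%:E : \bar R) ->
  (forall n t, (0 <= F n t)%R) -> (forall t, (0 <= f t)%R) ->
  (forall n t, size t = m -> (F n t <= C * \prod_(j < m) g (i + j)%N (nth 0%R t j))%R) ->
  (forall t, size t = m -> F n t @[n --> \oo] --> f t) ->
  iint mu m (fun t => (F n t)%:E) @[n --> \oo] --> iint mu m (fun t => (f t)%:E).
Proof.
elim: m i F f C => [|m IH] i F f C C0 mF mf F0 f0 Fg Ff /=.
  by apply: cvg_EFin; [near=> n|exact: Ff].
pose V := (\prod_(j < m) v (i.+1 + j)%N)%R.
have bnd n x : iint mu m (fun t => (F n (x :: t))%:E) <= (C * g i x * V)%:E.
  apply: iint_le_prod => [|t|t st]; [by rewrite mulr_ge0|by []|].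
  apply: le_trans (Fg n (x :: t) _) _; first by rewrite /= st.
  rewrite big_ord_recl/= addn0 mulrA; apply: ler_wpM2l; first by rewrite mulr_ge0.
  by apply: ler_prod => j _; rewrite g0 /bump/= add1n addSnnS.
have mI n : measurable_fun setT (fun x => iint mu m (fun t => (F n (x :: t))%:E)).
  apply: (measurable_iint mu (F := fun x t => (F n (x :: t))%:E)) => [x t|]; first by rewrite lee_fin.
  exact: (mseqF_cons (mF n)).
have mi : measurable_fun setT (fun x => iint mu m (fun t => (f (x :: t))%:E)).
  apply: (measurable_iint mu (F := fun x t => (f (x :: t))%:E)) => [x t|]; first by rewrite lee_fin.
  exact: (mseqF_cons mf).
have V0 : (0 <= V)%R by apply: prodr_ge0.
have mh : measurable_fun setT (fun x => (C * g i x * V)%:E).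
  by apply/measurable_EFinP; apply: measurable_funM => //; apply: measurable_funM.
have [] := @dominated_convergence _ _ R mu setT measurableT
  (fun n x => iint mu m (fun t => (F n (x :: t))%:E))
  (fun x => iint mu m (fun t => (f (x :: t))%:E)) (fun x => (C * g i x * V)%:E) mI mi.
- apply: aeW => x _; apply: (IH i.+1 (fun n t => F n (x :: t)) (fun t => f (x :: t)) (C * g i x)%R).
  + by rewrite mulr_ge0.
  + by move=> n; exact: (mseq_sec _ (mseqF_cons (mF n))).
  + exact: (mseq_sec _ (mseqF_cons mf)).
  + by move=> n t.
  + by move=> t.
  + move=> n t st; apply: le_trans (Fg n (x :: t) _) _; first by rewrite /= st.
    rewrite big_ord_recl/= addn0 mulrA; apply: ler_wpM2l; first by rewrite mulr_ge0.
    by apply: ler_prod => j _; rewrite g0 /bump/= add1n addSnnS.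
  + by move=> t st; apply: Ff; rewrite /= st.
- apply/integrableP; split => //.
  rewrite (_ : (fun x => _) = (fun x => (C * V)%:E * (g i x)%:E)); last first.
    apply/funext => x; rewrite gee0_abs ?lee_fin ?mulr_ge0// -EFinM; congr EFin; ring.
  rewrite ge0_integralZl//.
  + by rewrite gv -EFinM ltry.
  + exact/measurable_EFinP.
  + by move=> x _; rewrite lee_fin.
  + by rewrite lee_fin mulr_ge0.
- apply: aeW => x n _; rewrite gee0_abs; first exact: bnd.
  by apply: iint_ge0 => t; rewrite lee_fin.
by move=> _ _; exact.
Unshelve. all: by end_near. Qed.

End iterated_dominated_convergence.

(** * Stirling's formula and Poisson weights *)

Section stirling.
Context {R : realType}.
Local Notation mu := (@lebesgue_measure R).

Lemma expR_ge_quad (q : R) : 0 <= q -> 1 + q + q ^+ 2 / 4 <= expR q.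
Proof.
move=> q0; have h := expR_ge1Dx (q / 2).
have -> : expR q = expR (q / 2) ^+ 2 by rewrite expr2 -expRD -splitr.
apply: (@le_trans _ _ ((1 + q / 2) ^+ 2)); first by rewrite le_eqVlt; apply/orP; left; apply/eqP; field.
by rewrite ler_pXn2r// nnegrE ?expR_ge0// addr_ge0// divr_ge0.
Qed.

(** Passes from differences of square roots to plain deviations. With [d = s - l] one has
    [(s^2 - l^2) / l = d (2 + d / l)], which is polynomial in [d] as [l >= 1] and so is absorbed by
    the exponential of [d^2]. *)
Lemma gap_bound_large (s l : R) : 0 <= s -> 1 <= l ->
  1 + ((s ^+ 2 - l ^+ 2) / l) ^+ 2 <= 8 * expR ((s - l) ^+ 2).
Proof.
move=> s0 l1; have l0 : 0 < l by apply: lt_le_trans l1.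
have ln : l != 0 by rewrite gt_eqF.
set d := s - l; have := expR_ge_quad (sqr_ge0 d); set q := d ^+ 2 => hq.
have q0 : 0 <= q by rewrite sqr_ge0.
have e : ((s ^+ 2 - l ^+ 2) / l) ^+ 2 = q * (2 + d / l) ^+ 2.
  by rewrite /q /d; field.
have h : (2 + d / l) ^+ 2 <= 8 + 2 * q.
  have dl : (d / l) ^+ 2 <= q.
    by rewrite expr_div_n ler_pdivrMr ?exprn_gt0// ler_peMr// exprn_ege1.
  apply: (@le_trans _ _ (8 + 2 * (d / l) ^+ 2)); last by move: dl; lra.
  rewrite -subr_ge0; have -> : 8 + 2 * (d / l) ^+ 2 - (2 + d / l) ^+ 2 = (d / l - 2) ^+ 2 by ring.
  exact: sqr_ge0.
have := ler_wpM2l q0 h; rewrite e; move: hq; move: (expR q) => X; rewrite expr2 => h1 h2.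
have : q * (8 + 2 * q) = 8 * q + 2 * (q * q) by ring.
move: (q * (8 + 2 * q)) (q * (2 + d / l) ^+ 2) (q * q) h1 h2 => a b e' h1 h2 h3; lra.
Qed.

Lemma gap_bound_small (s l : R) : 1 <= s -> 0 <= l ->
  (l / s) ^+ 2 + ((s ^+ 2 - l ^+ 2) / s) ^+ 2 <= 10 * expR ((s - l) ^+ 2).
Proof.
move=> s1 l0; have s0 : 0 < s by apply: lt_le_trans s1.
have sn : s != 0 by rewrite gt_eqF.
set d := s - l; have := expR_ge_quad (sqr_ge0 d); set q := d ^+ 2 => hq.
have q0 : 0 <= q by rewrite sqr_ge0.
pose x := d / s.
have xq : x ^+ 2 <= q by rewrite expr_div_n ler_pdivrMr ?exprn_gt0// ler_peMr// exprn_ege1.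
have e1 : l / s = 1 - x by rewrite /x /d; field.
have e2 : ((s ^+ 2 - l ^+ 2) / s) ^+ 2 = q * (2 - x) ^+ 2 by rewrite /x /q /d; field.
rewrite e1 e2.
have h1 : (1 - x) ^+ 2 <= 2 + 2 * q.
  apply: (@le_trans _ _ (2 + 2 * x ^+ 2)); last by move: xq; lra.
  rewrite -subr_ge0; have -> : 2 + 2 * x ^+ 2 - (1 - x) ^+ 2 = (x + 1) ^+ 2 by ring.
  exact: sqr_ge0.
have h2 : (2 - x) ^+ 2 <= 8 + 2 * q.
  apply: (@le_trans _ _ (8 + 2 * x ^+ 2)); last by move: xq; lra.
  rewrite -subr_ge0; have -> : 8 + 2 * x ^+ 2 - (2 - x) ^+ 2 = (x + 2) ^+ 2 by ring.
  exact: sqr_ge0.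
have := ler_wpM2l q0 h2; have := mulr_ge0 q0 q0; move: hq h1; rewrite [q ^+ 2]expr2.
have : q * (8 + 2 * q) = 8 * q + 2 * (q * q) by ring.
move: (q * (8 + 2 * q)) (q * (2 - x) ^+ 2) ((1 - x) ^+ 2) (q * q) (expR q) => a b e' f X h3 h4 h5 h6 h7; lra.
Qed.

(* Ratio of the Poisson weight [x ^+ k * expR (- x) / k`!] to its maximum,
   which is attained at [x = k]. *)
Definition poisson_ratio (k : nat) (x : R) : R :=
  x ^+ k * expR (- x) / (k%:R ^+ k * expR (- k%:R)).

Lemma poisson_ratio_ge0 k x : 0 <= x -> 0 <= poisson_ratio k x.
Proof.
move=> x0; rewrite divr_ge0// mulr_ge0 ?exprn_ge0 ?expR_ge0//.
Qed.

(** With [s^2 = k] and [l^2 = x], the inequality [l / s <= expR (l / s - 1)] raised to the power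
    [2 k] gives the exponent [2 s l - 2 s^2], and the factors [expR (- x)] and [expR k] complete the
    square. *)
Lemma poisson_ratio_le k x : (0 < k)%N -> 0 <= x ->
  poisson_ratio k x <= expR (- (Num.sqrt k%:R - Num.sqrt x) ^+ 2).
Proof.
move=> k0 x0; have kp : 0 < k%:R :> R by rewrite ltr0n.
set s := Num.sqrt k%:R; set l := Num.sqrt x.
have s0 : 0 < s by rewrite sqrtr_gt0.
have sE : k%:R = s ^+ 2 by rewrite sqr_sqrtr// ltW.
have lE : x = l ^+ 2 by rewrite sqr_sqrtr.
have l0 : 0 <= l := sqrtr_ge0 _.
rewrite /poisson_ratio ler_pdivrMr; last by rewrite mulr_gt0 ?expR_gt0 ?exprn_gt0.
have h : l ^+ 2 <= s ^+ 2 * expR (2 * (l / s - 1)).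
  have h1 : l / s <= expR (l / s - 1).
    by have := expR_ge1Dx (l / s - 1); rewrite addrC subrK.
  have -> : expR (2 * (l / s - 1)) = expR (l / s - 1) ^+ 2.
    by rewrite expr2 -expRD; congr expR; ring.
  rewrite -exprMn ler_pXn2r ?nnegrE ?mulr_ge0 ?expR_ge0 ?(ltW s0)//.
  by rewrite mulrC -ler_pdivrMr.
apply: (@le_trans _ _ ((s ^+ 2 * expR (2 * (l / s - 1))) ^+ k * expR (- x))).
  rewrite ler_wpM2r ?expR_ge0// {1}lE lerXn2r ?nnegrE ?exprn_ge0//.
  by rewrite mulr_ge0 ?exprn_ge0 ?expR_ge0// ltW.
rewrite exprMn -{1}sE -expRM_natl -!mulrA [leRHS]mulrCA ler_wpM2l ?exprn_ge0 ?ler0n//.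
rewrite -!expRD ler_expR le_eqVlt; apply/orP; left; apply/eqP.
have -> : x = l ^+ 2 by [].
by rewrite sE; field; rewrite gt_eqF.
Qed.

Lemma poisson_ratio_le1 k x : (0 < k)%N -> 0 <= x -> poisson_ratio k x <= 1.
Proof.
move=> k0 x0; apply: le_trans (poisson_ratio_le k0 x0) _.
by rewrite -expR0 ler_expR oppr_le0 sqr_ge0.
Qed.

Let le_frac (a b c d : R) : 0 < d -> a <= expR (- b) -> 0 <= c -> d <= c * expR b -> a <= c / d.
Proof.
move=> d0 ab c0 h; apply: le_trans ab _; rewrite ler_pdivlMr//.
by rewrite expRN mulrC ler_pdivrMr ?expR_gt0.
Qed.

Lemma poisson_ratio_cauchy n t : (0 < n)%N -> 0 <= t ->
  poisson_ratio n t <= 8 / (1 + (t - n%:R) ^+ 2 / n%:R).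
Proof.
move=> n0 t0; have np : 0 < n%:R :> R by rewrite ltr0n.
have e : (t - n%:R) ^+ 2 / n%:R =
    ((Num.sqrt t ^+ 2 - Num.sqrt n%:R ^+ 2) / Num.sqrt n%:R) ^+ 2.
  by rewrite !sqr_sqrtr ?(ltW np)// expr_div_n sqr_sqrtr// ltW.
apply: (le_frac _ (poisson_ratio_le n0 t0)) => //.
  by rewrite ltr_pwDl// divr_ge0 ?sqr_ge0// ltW.
rewrite e -(sqrrN (_ - _)) opprB; apply: gap_bound_large; first exact: sqrtr_ge0.
by rewrite -[X in X <= _]sqrtr1 ler_sqrt// ler1n.
Qed.

(** The mean is fixed and the index varies. The factor [x / k] arises from the normalizations of two
    weights with index at least [k]; it stays under control even when [k] is far below the mean. *)
Lemma poisson_ratio_cauchy_mean k x : (0 < k)%N -> 0 < x ->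
  x / k%:R * poisson_ratio k x <= 10 / (1 + (k%:R - x) ^+ 2 / x).
Proof.
move=> k0 x0; have kp : 0 < k%:R :> R by rewrite ltr0n.
have d0 : 0 < 1 + (k%:R - x) ^+ 2 / x by rewrite ltr_pwDl// divr_ge0 ?sqr_ge0// ltW.
have xk : 0 < x / k%:R by rewrite divr_gt0.
rewrite mulrC -ler_pdivlMr// mulrAC -mulrA -invfM.
apply: (le_frac _ (poisson_ratio_le k0 (ltW x0))) => //; first by rewrite mulr_gt0.
have -> : x / k%:R * (1 + (k%:R - x) ^+ 2 / x) =
  (Num.sqrt x / Num.sqrt k%:R) ^+ 2 +
  ((Num.sqrt k%:R ^+ 2 - Num.sqrt x ^+ 2) / Num.sqrt k%:R) ^+ 2.
  rewrite !expr_div_n !sqr_sqrtr ?ltW//; field.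
  by rewrite !gt_eqF.
apply: gap_bound_small; last exact: sqrtr_ge0.
by rewrite -[X in X <= _]sqrtr1 ler_sqrt// ler1n.
Qed.

(** The function on the left vanishes at [0] and has derivative [y^2 / (1 + y)], at most [2 x^2] in
    absolute value between [0] and [x]; the mean value theorem supplies the third power. *)
Lemma ln_taylor (x : R) : `|x| <= 2^-1 -> `|ln (1 + x) - x + x ^+ 2 / 2| <= 2 * `|x| ^+ 3.
Proof.
move=> xh; have /andP[xl xu] : - 2^-1 <= x <= 2^-1 by rewrite -ler_norml.
pose f (y : R) := ln (1 + y) - y + y ^+ 2 / 2.
pose df (y : R) := y ^+ 2 / (1 + y).
have pos (y : R) : - 2^-1 <= y -> 0 < 1 + y by move=> ?; lra.
have fd (y : R) : - 2^-1 <= y -> is_derive y 1 f (df y).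
  move=> yl; have y0 := pos _ yl.
  have d1 : is_derive y (1:R) (fun z : R => 1 + z) 1.
    by have := @is_deriveD R R R (cst 1) id y 1 0 1 (is_derive_cst _ _ _) (is_derive_id _ _); rewrite add0r.
  have d2 := is_derive1_ln y0.
  have d3 : is_derive y (1:R) (fun z : R => ln (1 + z)) ((1 + y)^-1).
    have := @is_derive1_comp R (@ln R) (fun z : R => 1 + z) y _ _ d2 d1.
    by rewrite mulr1.
  apply: is_derive_eq; rewrite /df.
  by rewrite !scaler0 add0r /GRing.scale/=; field; rewrite gt_eqF.
have f0 : f 0 = 0 by rewrite /f addr0 ln1; ring.
have dfb (y : R) : `|y| <= `|x| -> `|df y| <= 2 * `|x| ^+ 2.
  move=> yx; have yl : - 2^-1 <= y.
    by have : `|y| <= 2^-1 by [exact: le_trans xh]; rewrite ler_norml => /andP[].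
  rewrite /df normrM normfV (gtr0_norm (pos _ yl)) normrX ler_pdivrMr ?pos//.
  have h : `|y| ^+ 2 <= `|x| ^+ 2 by rewrite lerXn2r ?nnegrE.
  apply: le_trans h _; rewrite -mulrA mulrCA ler_peMr ?exprn_ge0//.
  by move: yl; lra.
have fc (a b : R) : - 2^-1 <= a -> {within `[a, b], continuous f}.
  move=> al; apply: derivable_within_continuous => y; rewrite in_itv/= => /andP[ay _].
  by have [] := fd y (le_trans al ay).
have key (c : R) : `|c| <= `|x| -> f x = df c * x -> `|f x| <= 2 * `|x| ^+ 3.
  move=> cx ->; rewrite normrM exprSr mulrA ler_wpM2r//.
  exact: dfb.
have [x0|x0] := leP 0 x.
  have fd' y : y \in `]0, x[ -> is_derive y 1 f (df y).
    by rewrite in_itv/= => /andP[y0 _]; apply: fd; lra.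
  have l0 : - 2^-1 <= 0 :> R by lra.
  have [c] := MVT_segment x0 fd' (fc _ _ l0).
  rewrite in_itv/= => /andP[c0 cx]; rewrite f0 !subr0 => e.
  by apply: (key c) => //; rewrite !ger0_norm.
have fd' y : y \in `]x, 0[ -> is_derive y 1 f (df y).
  by rewrite in_itv/= => /andP[xy _]; apply: fd; lra.
have [c] := MVT_segment (ltW x0) fd' (fc _ _ xl).
rewrite in_itv/= => /andP[xc c0]; rewrite f0 !sub0r => e.
apply: (key c); first by rewrite !ler0_norm ?(ltW x0)// lerN2.
by apply/eqP; rewrite -eqr_opp e mulrN.
Qed.

(** With [e = x / k - 1] the logarithm of the ratio is [k (ln (1 + e) - e)], which is [- k e^2 / 2]
    up to an error of order [k |e|^3]; this error tends to zero because [k e^2] converges and [e]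
    vanishes. *)
Lemma cvg_poisson_ratio (k_ : nat -> nat) (x_ : nat -> R) (v : R) :
  (\forall n \near \oo, (0 < k_ n)%N) ->
  (x_ n / (k_ n)%:R - 1) @[n --> \oo] --> (0 : R) ->
  (k_ n)%:R * (x_ n / (k_ n)%:R - 1) ^+ 2 @[n --> \oo] --> v ->
  poisson_ratio (k_ n) (x_ n) @[n --> \oo] --> expR (- (v / 2)).
Proof.
move=> k0; pose e n := x_ n / (k_ n)%:R - 1.
rewrite -/(e _) => e0 ev.
have eh : \forall n \near \oo, `|e n| <= 2^-1.
  have h2 : 0 < 2^-1 :> R by rewrite invr_gt0.
  have := @cvgr_dist_le _ _ _ _ _ (fun n => e n) 0 e0 _ h2; move=> /(_ _).
  by apply: filterS => n; rewrite sub0r normrN.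
pose w n := (k_ n)%:R * (ln (1 + e n) - e n).
have we : (\forall n \near \oo, expR (w n) = poisson_ratio (k_ n) (x_ n)).
  near=> n.
  have kn : (0 < k_ n)%N by near: n.
  have kp : 0 < (k_ n)%:R :> R by rewrite ltr0n.
  have ehn : `|e n| <= 2^-1.
    by near: n; exact: eh.
  have e1 : 0 < 1 + e n by move: ehn; rewrite ler_norml => /andP[]; lra.
  have xE : x_ n = (k_ n)%:R * (1 + e n).
    by rewrite /e addrC subrK mulrCA divff ?mulr1// gt_eqF.
  rewrite /poisson_ratio /w mulrBr expRD expRM_natl lnK ?posrE//.
  rewrite {1}xE exprMn; apply/eqP.
  have kk : (k_ n)%:R ^+ k_ n != 0 :> R by rewrite expf_neq0// gt_eqF.
  have -> : expR (- x_ n) = expR (- (k_ n)%:R) * expR (- ((k_ n)%:R * e n)).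
    by rewrite -expRD xE; congr expR; ring.
  have ek : expR (- (k_ n)%:R) != 0 :> R by rewrite gt_eqF// expR_gt0.
  move: (expR _) (expR _) ek kk => d u; move: (_ ^+ k_ n) (_ ^+ k_ n) => a b d0 b0.
  by apply/eqP; field; rewrite ?b0 ?d0.
apply: cvg_trans (near_eq_cvg we) _.
suff wl : w n @[n --> \oo] --> - (v / 2).
  by apply: (cvg_comp _ _ wl); exact: continuous_expR.
pose r n := (k_ n)%:R * (ln (1 + e n) - e n + e n ^+ 2 / 2).
have -> : w = (fun n => r n - (k_ n)%:R * e n ^+ 2 / 2).
  by apply/funext => n; rewrite /w /r; field.
rewrite -[X in _ --> X]add0r; apply: cvgB; last by apply: cvgMl.
apply/norm_cvg0P; apply: (@squeeze_cvgr _ _ _ R (fun=> 0) (fun n => 2 * ((k_ n)%:R * e n ^+ 2) * `|e n|)).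
- near=> n; rewrite normr_ge0/=.
  have ehn : `|e n| <= 2^-1.
    by near: n; exact: eh.
  rewrite /r normrM (ger0_norm (ler0n _ _)).
  have -> : 2 * ((k_ n)%:R * e n ^+ 2) * `|e n| = (k_ n)%:R * (2 * `|e n| ^+ 3).
    by rewrite -(real_normK (num_real (e n))); ring.
  by rewrite ler_wpM2l ?ler0n// ln_taylor.
- exact: cvg_cst.
- rewrite -[X in _ --> X](mulr0 (2 * v)); apply: cvgM; first exact: cvgMr.
  exact/norm_cvg0P.
Unshelve. all: by end_near. Qed.

(** The quotient of [n]! by Stirling's main term without its constant. By [stir_integral] it is the
    integral of [stir_fun], the integrand of the Gamma integral centred at its maximum [n] and
    scaled by the square root of [n]. *)
Definition stir (n : nat) : R := n`!%:R / (Num.sqrt n%:R * (n%:R ^+ n * expR (- n%:R))).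

Definition stir_fun n (x : measurableTypeR R) : R :=
  (0 < Num.sqrt n%:R * x + n%:R)%R%:R * poisson_ratio n (Num.sqrt n%:R * x + n%:R).

Lemma measurable_stir_fun n : measurable_fun setT (stir_fun n).
Proof.
rewrite /stir_fun /poisson_ratio; apply: measurable_funM; first by meas.
apply: measurable_funM => //; apply: measurable_funM; first by meas.
by apply: measurable_fun_exp; apply: measurable_funN; meas.
Qed.

Lemma stir_fun_ge0 n x : 0 <= stir_fun n x.
Proof.
rewrite /stir_fun; case: ltrP => [/ltW h|_]; last by rewrite mul0r.
by rewrite mul1r poisson_ratio_ge0.
Qed.

Lemma stir_integral n : (0 < n)%N -> (\int[mu]_x (stir_fun n x)%:E)%E = (stir n)%:E.
Proof.
move=> n0; have np : 0 < n%:R :> R by rewrite ltr0n.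
have s0 : 0 < Num.sqrt n%:R :> R by rewrite sqrtr_gt0.
have sn : Num.sqrt n%:R != 0 :> R by rewrite gt_eqF.
have K0 : 0 < n%:R ^+ n * expR (- n%:R) :> R by rewrite mulr_gt0 ?expR_gt0 ?exprn_gt0.
have mG : measurable_fun setT (fun x : measurableTypeR R => ((0 < x)%R%:R * (x ^+ n * expR (- x)))%:E).
  apply/measurable_EFinP; apply: measurable_funM; first by meas.
  apply: measurable_funM; first by meas.
  by apply: measurable_fun_exp; exact: oppr_measurable.
have G0 (x : R) : (0 <= ((0 < x)%R%:R * (x ^+ n * expR (- x)))%:E)%E.
  by rewrite lee_fin; case: ltrP => [/ltW h|_]; rewrite ?mul0r// mul1r mulr_ge0 ?exprn_ge0 ?expR_ge0.
have := @integral_Gamma R n.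
rewrite (ge0_integral_affine n%:R sn mG)// (gtr0_norm s0).
rewrite (_ : (fun x => _) = (fun x => ((n%:R ^+ n * expR (- n%:R))%:E * (stir_fun n x)%:E)%E)); last first.
  apply/funext => x; rewrite -EFinM; congr EFin; rewrite /stir_fun /poisson_ratio.
  move: K0; move: (n%:R ^+ n * expR (- n%:R)) => K K0.
  by field; rewrite gt_eqF.
rewrite ge0_integralZl//; last 2 first.
- by apply/measurable_EFinP; exact: measurable_stir_fun.
- by move=> x _; rewrite lee_fin stir_fun_ge0.
move=> h; rewrite /stir; move: K0 h; move: (n%:R ^+ n * expR (- n%:R)) => K K0.
have c0 : Num.sqrt n%:R * K != 0 by rewrite mulf_neq0// gt_eqF.
rewrite muleA -EFinM => h.
have := congr1 (fun z => ((Num.sqrt n%:R * K)^-1)%:E * z)%E h.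
by rewrite muleA -EFinM mulVf// mul1e => ->; rewrite -EFinM mulrC.
Qed.

Lemma stir_gt0 n : (0 < n)%N -> 0 < stir n.
Proof.
move=> n0; have np : 0 < n%:R :> R by rewrite ltr0n.
by rewrite divr_gt0 ?ltr0n ?fact_gt0// mulr_gt0 ?sqrtr_gt0// mulr_gt0 ?exprn_gt0 ?expR_gt0.
Qed.

Lemma stir_fun_le n x : (0 < n)%N -> stir_fun n x <= 8 * (1 + x ^+ 2)^-1.
Proof.
move=> n0; have np : 0 < n%:R :> R by rewrite ltr0n.
rewrite /stir_fun; case: ltrP => [/ltW h|_]; last by rewrite mul0r mulr_ge0// invr_ge0 addr_ge0// sqr_ge0.
rewrite mul1r; apply: le_trans (poisson_ratio_cauchy n0 h) _.
by rewrite addrK exprMn sqr_sqrtr ?(ltW np)// [n%:R * _]mulrC mulfK// gt_eqF.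
Qed.

Lemma cvg_sqrt_nat : (Num.sqrt n%:R : R)^-1 @[n --> \oo] --> (0 : R).
Proof.
apply/cvgrPdist_le => e e0; near=> n.
rewrite sub0r normrN ger0_norm ?invr_ge0 ?sqrtr_ge0//.
have h : (e ^+ 2)^-1 <= n%:R by near: n; exact: nbhs_infty_ger.
have n0 : 0 < n%:R :> R by apply: lt_le_trans h; rewrite invr_gt0 exprn_gt0.
rewrite -ler_sqr ?nnegrE ?invr_ge0 ?sqrtr_ge0 ?(ltW e0)// exprVn sqr_sqrtr ?(ltW n0)//.
by rewrite -[leRHS]invrK lef_pV2 ?posrE ?invr_gt0 ?exprn_gt0.
Unshelve. all: by end_near. Qed.

(** Laplace's method: the scaled integrand tends to [expR (- x^2 / 2)] and is dominated by a Cauchy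
    density, so the constant of Stirling's formula is the Gaussian integral. *)
Lemma cvg_stir : stir n.+1 @[n --> \oo] --> Num.sqrt (2 * pi).
Proof.
pose F n x := (stir_fun n.+1 x)%:E.
have mF n : measurable_fun setT (F n) by apply/measurable_EFinP; exact: measurable_stir_fun.
have mf : measurable_fun setT (fun x : measurableTypeR R => (expR (- (2^-1 * x ^+ 2)))%:E).
  by apply/measurable_EFinP; apply: measurable_fun_exp; apply: measurable_funN; meas.
have mh : measurable_fun setT (fun x : measurableTypeR R => (8 * (1 + x ^+ 2)^-1)%:E).
  by apply/measurable_EFinP; meas.
have [] := @dominated_convergence _ _ R mu setT measurableT F _ (fun x => (8 * (1 + x ^+ 2)^-1)%:E) mF mf.
- apply: aeW => x _; rewrite /F; apply: cvg_EFin; first exact: nearW.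
  have -> : fine \o F ^~ x = fun n => stir_fun n.+1 x by [].
  have e1 : (Num.sqrt n.+1%:R : R)^-1 @[n --> \oo] --> (0 : R).
    by have := cvg_sqrt_nat; rewrite -cvg_shiftS.
  have e2 : x * (Num.sqrt n.+1%:R : R)^-1 @[n --> \oo] --> (0 : R).
    by rewrite -[X in _ --> X](mulr0 x); apply: cvgM; [exact: cvg_cst|exact: e1].
  have sE n : n.+1%:R = Num.sqrt n.+1%:R ^+ 2 :> R by rewrite sqr_sqrtr.
  have s0 n : Num.sqrt n.+1%:R != 0 :> R by rewrite gt_eqF// sqrtr_gt0.
  have rE n : (Num.sqrt n.+1%:R * x + n.+1%:R) / n.+1%:R - 1 = x * (Num.sqrt n.+1%:R : R)^-1.
    by rewrite {2 3}sE; field; rewrite s0.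
  have c : poisson_ratio n.+1 (Num.sqrt n.+1%:R * x + n.+1%:R) @[n --> \oo] --> expR (- (x ^+ 2 / 2)).
    apply: cvg_poisson_ratio.
    + exact: nearW.
    + by under eq_fun do rewrite rE.
    + under eq_fun do rewrite rE {1}sE exprMn exprVn mulrCA divff ?mulr1 ?expf_neq0//.
      exact: cvg_cst.
  rewrite [2^-1 * _]mulrC; apply: cvg_trans c; apply: near_eq_cvg.
  have h2 : 0 < 1 :> R by [].
  have := @cvgr_dist_lt _ _ _ _ _ (fun n => x * (Num.sqrt n.+1%:R : R)^-1) 0 e2 _ h2; move=> /(_ _).
  apply: filterS => n; rewrite sub0r normrN ltr_norml => /andP[h _].
  rewrite /stir_fun (_ : (0 < _)%R = true) ?mul1r//.
  rewrite -(@pmulr_lgt0 _ n.+1%:R^-1) ?invr_gt0//.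
  by have := rE n; move: h; move: (_ / n.+1%:R) => z; lra.
- apply/integrableP; split => //.
  rewrite (_ : (fun x => _) = (fun x => (8%:E * ((1 + x ^+ 2)^-1)%:E)%E)); last first.
    apply/funext => x; rewrite gee0_abs ?lee_fin ?mulr_ge0 ?invr_ge0 ?addr_ge0 ?sqr_ge0//.
  rewrite ge0_integralZl//.
  + by apply: lte_mul_pinfty => //; exact: integral_cauchy_lty.
  + by apply/measurable_EFinP; meas.
  + by move=> x _; rewrite lee_fin invr_ge0 addr_ge0// sqr_ge0.
- apply: aeW => x n _; rewrite gee0_abs; first by rewrite lee_fin stir_fun_le.
  by rewrite lee_fin stir_fun_ge0.
move=> _ _; rewrite integral_gaussian// invrK [pi * 2]mulrC => h.
rewrite -[Num.sqrt _]/(fine (Num.sqrt (2 * pi))%:E).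
rewrite (_ : (fun n => stir n.+1) = (fun n => fine (\int[mu]_x (F n x))%E)); last first.
  by apply/funext => n; rewrite stir_integral.
exact: fine_cvg.
Unshelve. all: by end_near. Qed.

Lemma stir_inv_bound : exists2 C : R, 0 < C & forall n, (0 < n)%N -> (stir n)^-1 <= C.
Proof.
have s0 : Num.sqrt (2 * pi) != 0 :> R by rewrite gt_eqF// sqrtr_gt0 mulr_gt0// pi_gt0.
have c : (stir n.+1)^-1 @[n --> \oo] --> (Num.sqrt (2 * pi))^-1 by apply: cvgV cvg_stir.
have [M [_ hM]] := cvg_seq_bounded (cvgP _ c).
exists (`|M| + 1); first by rewrite ltr_wpDl.
case=> // n _; apply: le_trans (ler_norm _) _.
by have := hM (`|M| + 1); apply => //; rewrite (le_lt_trans (ler_norm M))// ltrDl.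
Qed.

Definition pois (m : nat) (q : R) : R := pos_pow q m * expR (- q) / m`!%:R.

Lemma pois_ge0 m q : 0 <= pois m q.
Proof. by rewrite divr_ge0// mulr_ge0 ?expR_ge0// pos_pow_ge0. Qed.

Lemma pois_le0 m q : q <= 0 -> pois m q = 0.
Proof. by move=> h; rewrite /pois /pos_pow ltNge h !mul0r. Qed.

Lemma poisE m q : (0 < m)%N -> 0 < q ->
  pois m q = poisson_ratio m q / (Num.sqrt m%:R * stir m).
Proof.
move=> m0 q0; have mp : 0 < m%:R :> R by rewrite ltr0n.
rewrite /pois /pos_pow q0 mul1r /stir /poisson_ratio.
have : m`!%:R != 0 :> R by rewrite pnatr_eq0 -lt0n fact_gt0.
have : Num.sqrt m%:R != 0 :> R by rewrite gt_eqF// sqrtr_gt0.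
have : m%:R ^+ m * expR (- m%:R) != 0 :> R by rewrite mulf_neq0 ?expf_neq0 ?gt_eqF ?expR_gt0.
move: (m%:R ^+ m * expR (- m%:R)) (Num.sqrt m%:R) (m`!%:R) => a b f a0 b0 f0.
by field; rewrite a0 b0 f0.
Qed.

Lemma pois_bounds : exists2 C : R, 0 < C & forall m, (0 < m)%N ->
  (forall q, pois m q <= C / Num.sqrt m%:R) /\
  (forall q, 0 < q -> q / Num.sqrt m%:R * pois m q <= C / (1 + (m%:R - q) ^+ 2 / q)).
Proof.
have [C C0 hC] := stir_inv_bound; exists (10 * C); first by rewrite mulr_gt0.
move=> m m0; have mp : 0 < m%:R :> R by rewrite ltr0n.
have sm : 0 < Num.sqrt m%:R :> R by rewrite sqrtr_gt0.
have st := stir_gt0 m0; have := hC _ m0; split=> q.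
  have [q0|q0] := leP q 0; first by rewrite pois_le0// divr_ge0 ?mulr_ge0 ?ltW.
  rewrite poisE// invfM mulrA mulrAC ler_pM2r ?invr_gt0//.
  apply: (@le_trans _ _ (1 * C)); last by rewrite ler_pM2r// ler1n.
  by apply: ler_pM; rewrite ?poisson_ratio_ge0 ?poisson_ratio_le1 ?invr_ge0 ?(ltW st) ?(ltW q0)//; exact: hC.
move=> q0; rewrite poisE//.
have -> : q / Num.sqrt m%:R * (poisson_ratio m q / (Num.sqrt m%:R * stir m)) =
  (q / m%:R * poisson_ratio m q) * (stir m)^-1.
  rewrite -{3}(@sqr_sqrtr _ m%:R) ?ltW//; field.
  by rewrite !gt_eqF.
rewrite [leRHS]mulrAC; apply: ler_pM; rewrite ?poisson_ratio_cauchy_mean ?invr_ge0 ?(ltW st)//.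
  by rewrite mulr_ge0 ?poisson_ratio_ge0 ?divr_ge0 ?(ltW q0)//.
Qed.

(** A local limit theorem: index and mean are both asymptotic to [a N] and differ by about [z] times
    the square root of [N]; the limit is the normal density of variance [a] at [z]. *)
Lemma cvg_pois (N_ : nat -> R) (k_ : nat -> nat) (q_ : nat -> R) (a z : R) :
  0 < a -> (forall n, 0 < N_ n) -> (Num.sqrt (N_ n))^-1 @[n --> \oo] --> (0 : R) ->
  (k_ n)%:R / N_ n @[n --> \oo] --> a ->
  (q_ n - (k_ n)%:R) / Num.sqrt (N_ n) @[n --> \oo] --> z ->
  Num.sqrt (N_ n) * pois (k_ n) (q_ n) @[n --> \oo] -->
    expR (- (z ^+ 2 / a / 2)) / (Num.sqrt a * Num.sqrt (2 * pi)).
Proof.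
move=> a0 N0 hN hk hz.
have an : a != 0 by rewrite gt_eqF.
have sN n : N_ n = Num.sqrt (N_ n) ^+ 2 by rewrite sqr_sqrtr// ltW.
have sn n : Num.sqrt (N_ n) != 0 by rewrite gt_eqF// sqrtr_gt0.
have k_pos : \forall n \near \oo, (0 < k_ n)%N.
  have := @cvgr_dist_lt _ _ _ _ _ (fun n => (k_ n)%:R / N_ n) a hk _ a0; move=> /(_ _).
  apply: filterS => n h; rewrite lt0n; apply/negP => /eqP k0; move: h.
  by rewrite k0 mul0r subr0 gtr0_norm// ltxx.
have k_oo : k_ n @[n --> \oo] --> \oo.
  apply/cvgnyPge => M.
  have e0 : 0 < Num.sqrt (a / (2 * M.+1%:R)) by rewrite sqrtr_gt0 divr_gt0// mulr_gt0.
  have a2 : 0 < a / 2 by rewrite divr_gt0.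
  near=> n.
  have h1 : `|(Num.sqrt (N_ n))^-1| <= Num.sqrt (a / (2 * M.+1%:R)).
    near: n; have := @cvgr_dist_le _ _ _ _ _ (fun n => (Num.sqrt (N_ n))^-1) 0 hN _ e0; move=> /(_ _).
    by apply: filterS => n; rewrite sub0r normrN.
  have h2 : `|a - (k_ n)%:R / N_ n| <= a / 2.
    by near: n; have := @cvgr_dist_le _ _ _ _ _ (fun n => (k_ n)%:R / N_ n) a hk _ a2; move=> /(_ _); apply.
  have h3 : (N_ n)^-1 <= a / (2 * M.+1%:R).
    move: h1; rewrite ger0_norm ?invr_ge0 ?sqrtr_ge0// -ler_sqr ?nnegrE ?invr_ge0 ?sqrtr_ge0//.
    by rewrite exprVn -sN sqr_sqrtr// divr_ge0 ?mulr_ge0// ltW.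
  have h4 : a / 2 * N_ n <= (k_ n)%:R.
    by rewrite -ler_pdivlMr//; move: h2; rewrite ler_norml => /andP[_]; lra.
  have h5 : M.+1%:R <= a / 2 * N_ n.
    have m0 : 0 < M.+1%:R :> R by [].
    move: h3; rewrite -[X in _ <= X]invrK lef_pV2 ?posrE ?invr_gt0 ?divr_gt0 ?mulr_gt0//.
    move=> h; have := ler_wpM2l (ltW a2) h; congr (_ <= _).
    by move: m0; move: (M.+1%:R) => w w0; field; rewrite an gt_eqF.
  by rewrite -(ler_nat R) (le_trans _ h4)// (le_trans _ h5)// ler_nat.
have kVa : (k_ n)%:R^-1 * N_ n @[n --> \oo] --> a^-1.
  have : ((k_ n)%:R / N_ n)^-1 @[n --> \oo] --> a^-1 by apply: cvgV hk.
  by apply: cvg_trans; apply: near_eq_cvg; apply: nearW => n; rewrite invf_div mulrC.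
have eE : \forall n \near \oo, (q_ n - (k_ n)%:R) / Num.sqrt (N_ n) * ((k_ n)%:R^-1 * N_ n) * (Num.sqrt (N_ n))^-1
    = q_ n / (k_ n)%:R - 1.
  apply: filterS k_pos => n kn; rewrite {2}sN; field.
  by rewrite sn pnatr_eq0 -lt0n kn.
have e0 : q_ n / (k_ n)%:R - 1 @[n --> \oo] --> (0 : R).
  apply: cvg_trans (near_eq_cvg eE) _; rewrite -(mulr0 (z * a^-1)).
  by apply: cvgM => //; exact: cvgM.
have vE : \forall n \near \oo, ((q_ n - (k_ n)%:R) / Num.sqrt (N_ n)) ^+ 2 * ((k_ n)%:R^-1 * N_ n)
    = (k_ n)%:R * (q_ n / (k_ n)%:R - 1) ^+ 2.
  apply: filterS k_pos => n kn; rewrite {2}sN; field.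
  by rewrite sn pnatr_eq0 -lt0n kn.
have ev : (k_ n)%:R * (q_ n / (k_ n)%:R - 1) ^+ 2 @[n --> \oo] --> z ^+ 2 / a.
  apply: cvg_trans (near_eq_cvg vE) _; apply: cvgM => //.
  by rewrite expr2; under eq_fun do rewrite expr2; exact: cvgM.
have cr := cvg_poisson_ratio k_pos e0 ev.
have cs : stir (k_ n) @[n --> \oo] --> Num.sqrt (2 * pi).
  have st : stir n @[n --> \oo] --> Num.sqrt (2 * pi).
    by rewrite -cvg_shiftS; exact: cvg_stir.
  exact: cvg_comp k_oo st.
have ck : Num.sqrt ((k_ n)%:R / N_ n) @[n --> \oo] --> Num.sqrt a.
  by apply: (cvg_comp _ _ hk); exact: sqrt_continuous.
have pE : \forall n \near \oo, poisson_ratio (k_ n) (q_ n) / (Num.sqrt ((k_ n)%:R / N_ n) * stir (k_ n))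
   = Num.sqrt (N_ n) * pois (k_ n) (q_ n).
  have h2 : 0 < 1 :> R by [].
  have := @cvgr_dist_lt _ _ _ _ _ (fun n => q_ n / (k_ n)%:R - 1) 0 e0 _ h2; move=> /(_ _) h1.
  near=> n; have kn : (0 < k_ n)%N by near: n.
  have kp : 0 < (k_ n)%:R :> R by rewrite ltr0n.
  have h : `|0 - (q_ n / (k_ n)%:R - 1)| < 1 by near: n; exact: h1.
  have q0 : 0 < q_ n.
    rewrite -(@pmulr_lgt0 _ (k_ n)%:R^-1) ?invr_gt0//.
    by move: h; rewrite sub0r normrN ltr_norml => /andP[+ _]; move: (q_ n / _) => y; lra.
  rewrite poisE// sqrtrM ?ler0n// sqrtrV ?(ltW (N0 n))//.
  have st := stir_gt0 kn; field.
  by rewrite sn !gt_eqF// ?sqrtr_gt0.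
apply: cvg_trans (near_eq_cvg pE) _; apply: cvgM => //; apply: cvgV; last exact: cvgM.
by rewrite mulf_neq0// gt_eqF// sqrtr_gt0// mulr_gt0// pi_gt0.
Unshelve. all: by end_near. Qed.

End stirling.

(** * Sums over compositions as integrals *)

Section lattice_sums.
Context {R : realType}.
Local Notation mu := (@lebesgue_measure R).
Local Open Scope ereal_scope.

Lemma mseqF_affine n (a b : R) dY (Y : measurableType dY) (F : seq (measurableTypeR R) -> Y) :
  mseqF n F -> mseqF n (fun t => F [seq (a * x + b)%R | x <- t]).
Proof.
move=> mF; apply: (@mseq_map _ (measurableTypeR R) _ _ n n _ unit _ unit _ (measurableTypeR R) 0%R
  (fun _ => F) id (fun _ t => [seq (a * x + b)%R | x <- t])) => //.
  by move=> q t <-; rewrite size_map.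
move=> i ni; rewrite /mseq [X in measurable_fun _ X](_ : _ =
    fun q : unit * n.-tuple (measurableTypeR R) => (a * nth 0 q.2 i + b)%R); last first.
  by apply/funext => q; rewrite (nth_map 0%R)// size_tuple.
by apply: measurable_funD => //; apply: measurable_funM => //; exact: mseq_nth.
Qed.

Lemma iint_affine n (a b : R) (F : seq (measurableTypeR R) -> \bar R) : a != 0%R ->
  (forall t, 0 <= F t) -> mseqF n F ->
  iint mu n F = (`|a| ^+ n)%:E * iint mu n (fun t => F [seq (a * x + b)%R | x <- t]).
Proof.
move=> a0; elim: n F => [|n IH] F F0 mF; first by rewrite mul1e.
have mF1 := mseqF_cons mF; rewrite [LHS]/=.
rewrite (ge0_integral_affine b a0)//; last 2 first.
- exact: measurable_iint.
- by move=> x; exact: iint_ge0.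
have mG := mseqF_cons (mseqF_affine a b mF).
rewrite exprS EFinM -muleA; congr (_ * _); rewrite /= -ge0_integralZl//.
- apply: eq_integral => x _; apply: IH => //.
  exact: (mseq_sec _ mF1).
- by apply: measurable_iint.
- by move=> x _; apply: iint_ge0.
Qed.

(** Indicator of the unit cube with lower corner [s]. It spreads each term of a lattice sum over a
    set of measure one, so that sums become integrals of step functions. *)
Definition cell m (s : seq nat) (x : nat -> R) : R :=
  (\prod_(j < m) ((nth 0%N s j)%:R <= x j < (nth 0%N s j).+1%:R)%R%:R)%R.

Lemma cellE m s x : cell m s x = [forall j : 'I_m, ((nth 0%N s j)%:R <= x j < (nth 0%N s j).+1%:R)%R]%:R.
Proof.
rewrite /cell; case: forallP => [h|/forallP].
  by rewrite big1// => j _; rewrite h.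
by rewrite negb_forall => /existsP[j /negbTE hj]; rewrite (bigD1 j)//= hj mul0r.
Qed.

Lemma integral_unit_interval (a : R) :
  \int[mu]_x (a <= x < a + 1)%R%:R%:E = 1.
Proof.
transitivity (\int[mu]_(x in setT) (\1_(`[a, (a + 1)%R[%classic) x)%:E).
  by apply: eq_integral => x _; rewrite indicE mem_setE in_itv.
rewrite integral_indic// setIT; apply: etrans (lebesgue_measure_itv _) _.
by rewrite /= lte_fin ltrDl ltr01 -EFinB [(a + 1)%R]addrC addrK.
Qed.

Lemma measurable_cell_factor (a b : R) :
  measurable_fun setT (fun x : measurableTypeR R => (a <= x < b)%R%:R : R).
Proof.
apply: measurable_boolR; apply: measurable_and; first by apply: measurable_fun_ler.
by apply: measurable_fun_ltr.
Qed.

Lemma mseq_cell n dP (P : measurableType dP) m s :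
  mseq n (fun (_ : P) (t : seq (measurableTypeR R)) => cell m s (nth 0%R t)).
Proof.
apply: (@mseq_prod_nth _ n _ P (fun j (x : R) => ((nth 0%N s j)%:R <= x < (nth 0%N s j).+1%:R)%R%:R)%R m).
by move=> j; exact: measurable_cell_factor.
Qed.

Lemma iint_cell m s : iint mu m (fun t => (cell m s (nth 0%R t))%:E) = 1.
Proof.
pose f j (x : R) := (((nth 0%N s j)%:R <= x < (nth 0%N s j).+1%:R)%R%:R)%R : R.
rewrite (@iint_prod _ m f (fun=> 1%R)).
- by rewrite big1.
- by move=> j; exact: measurable_cell_factor.
- by move=> j x; rewrite /f ler0n.
- by move=> j _; rewrite -(integral_unit_interval (nth 0%N s j)%:R); apply: eq_integral => x _; rewrite /f natr1.
Qed.

Definition in_cell m (s : seq nat) (x : nat -> R) : Prop :=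
  forall j, (j < m)%N -> ((nth 0%N s j)%:R <= x j < (nth 0%N s j).+1%:R)%R.

Lemma cell1 m s x : in_cell m s x -> cell m s x = 1%R.
Proof.
by move=> h; rewrite cellE (_ : [forall j : 'I_m, _] = true)//; apply/forallP => j; exact: h.
Qed.

Lemma cell0 m s x : cell m s x = 0%R \/ in_cell m s x.
Proof.
rewrite cellE; case: forallP => [h|_]; last by left.
by right => j jm; exact: (h (Ordinal jm)).
Qed.

Lemma in_cell_inj m s u x : size s = m -> size u = m -> in_cell m s x -> in_cell m u x -> s = u.
Proof.
move=> sm um sP uP; apply: (@eq_from_nth _ 0%N); first by rewrite sm um.
rewrite sm => j jm; have /andP[a1 b1] := sP _ jm; have /andP[a2 b2] := uP _ jm.
have := le_lt_trans a1 b2; have := le_lt_trans a2 b1; rewrite !ltr_nat !ltnS /= => h1 h2.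
by apply/eqP; rewrite eqn_leq h1 h2.
Qed.

Lemma sum_cells_mem m (r : seq (seq nat)) (G : seq nat -> R) (x : nat -> R) s :
  uniq r -> {in r, forall u, size u = m} -> s \in r -> in_cell m s x ->
  (\sum_(u <- r) cell m u x * G u)%R = G s.
Proof.
move=> ur sr sin sP; rewrite (bigD1_seq s)//= cell1// mul1r big1_seq ?addr0// => u /andP[us ru].
have [->|uP] := cell0 m u x; first by rewrite mul0r.
by case/eqP: us; apply: (in_cell_inj (x := x)) uP sP; exact: sr.
Qed.

Lemma sum_cells m (r : seq (seq nat)) (G : seq nat -> R) (x : nat -> R) :
  uniq r -> {in r, forall u, size u = m} ->
  (\sum_(u <- r) cell m u x * G u)%R = 0%R \/
  exists s, [/\ s \in r, in_cell m s x & (\sum_(u <- r) cell m u x * G u)%R = G s].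
Proof.
move=> ur sr.
have [h|/hasPn h] := boolP (has (fun s => cell m s x != 0)%R r); last first.
  by left; rewrite big1_seq// => u /= /h; rewrite negbK => /eqP ->; rewrite mul0r.
right; have /hasP[s sin s0] := h; have [e|sP] := cell0 m s x; first by rewrite e eqxx in s0.
by exists s; split => //; exact: sum_cells_mem.
Qed.

Lemma cell_ge0 m s x : (0 <= cell m s x)%R.
Proof. by rewrite cellE ler0n. Qed.

(** The [m] lattice variables come before the [b] continuous ones. Each term is spread over its
    cell, then the lattice variables are centred at [tr] and scaled by [sc], whose [m]-th power is
    the Jacobian. *)
Lemma lattice_sum m b (r : seq (seq nat)) (g : seq nat -> seq (measurableTypeR R) -> R) (sc tr : R) :
  (0 < sc)%R -> (forall s t, (0 <= g s t)%R) -> (forall s, mseqF b (fun t => (g s t)%:E : \bar R)) ->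
  \sum_(s <- r) iint mu b (fun t => (g s t)%:E) =
  (sc ^+ m)%:E * iint mu (m + b) (fun t =>
    (\sum_(s <- r) cell m s (fun j => sc * nth 0 t j + tr) * g s (drop m t))%:E)%R.
Proof.
move=> sc0 g0 mg.
pose F t := (\sum_(s <- r) cell m s (nth 0 t) * g s (drop m t))%:E%R : \bar R.
have mc s : mseqF m (fun t => (cell m s (nth 0%R t))%:E : \bar R).
  by apply/measurable_EFinP; exact: (@mseq_cell m _ unit m s).
have mFr s : mseqF (m + b) (fun t => (cell m s (nth 0 t) * g s (drop m t))%R : R).
  apply: measurable_funM.
    exact: (@mseq_cell (m + b) _ unit m s).
  have := @mseq_map _ (measurableTypeR R) _ _ (m + b) b _ unit _ unit _ (measurableTypeR R) 0%R
    (fun _ => g s) id (fun _ t => drop m t); apply => //.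
  - by move=> q t st; rewrite size_drop st addKn.
  - by move=> i ib; exact: mseq_nth_drop.
  - by rewrite /mseq; apply/measurable_EFinP; exact: mg.
have mFs s : mseqF (m + b) (fun t => (cell m s (nth 0 t) * g s (drop m t))%:E%R : \bar R).
  by apply/measurable_EFinP; exact: mFr.
have F0 t : 0 <= F t by rewrite lee_fin sumr_ge0// => s _; rewrite mulr_ge0// cell_ge0.
have mF : mseqF (m + b) F.
  by apply/measurable_EFinP; apply: measurable_sum => s; exact: mFr.
transitivity (iint mu (m + b) F).
  transitivity (iint mu (m + b) (fun t => \sum_(s <- r) (cell m s (nth 0 t) * g s (drop m t))%:E%R)).
    rewrite iint_sum//; last by move=> s t; rewrite lee_fin mulr_ge0// cell_ge0.
    apply: eq_bigr => s _; rewrite -[LHS]mul1e -(iint_cell m s).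
    have h1 t : 0 <= (cell m s (nth 0%R t))%:E by rewrite lee_fin cell_ge0.
    have h2 t : 0 <= (g s t)%:E by rewrite lee_fin.
    rewrite -(iint_cat_prod mu h1 h2 (mc s) (mg s)).
    apply: eq_iint => t _; rewrite -EFinM; congr (_ * _)%:E%R; apply: eq_bigr => j _.
    by rewrite nth_take.
  by apply: eq_iint => t _; rewrite sumEFin.
have mFm : mseqF m (fun x => iint mu b (fun y => F (x ++ y))).
  apply: (@mseq_iint _ _ R mu _ _ m b _ unit (fun _ q y => F (q ++ y))) => //.
  exact: (@mseq_catl _ _ _ _ m b _ unit (fun _ => F) mF).
rewrite [LHS]iint_cat (iint_affine tr (lt0r_neq0 sc0))//; last first.
  by move=> x; exact: iint_ge0.
rewrite gtr0_norm//; congr (_ * _); rewrite iint_cat; apply: eq_iint => x sx.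
apply: eq_iint => y _; congr EFin; apply: eq_bigr => s _.
rewrite !drop_size_cat ?size_map//; congr (_ * _)%R; apply: eq_bigr => j _.
by rewrite !nth_cat size_map sx ltn_ord (nth_map 0%R) ?sx.
Qed.

(** The last part is determined by the others, so only [k - 1] lattice variables remain; the limit
    inherits this as a hyperplane. *)
Lemma comps_split k n : (0 < k)%N -> perm_eq (comps k n)
  [seq rcons s (n - sumn s)%N | s <- boxes k.-1 n.+1 & (sumn s <= n)%N].
Proof.
move=> k0; apply: uniq_perm; first exact: comps_uniq.
  rewrite map_inj_in_uniq ?filter_uniq ?boxes_uniq// => s t _ _ e.
  by have [] := rcons_inj e.
move=> ts; rewrite mem_comps; apply/andP/mapP => [[/eqP sk /eqP sn]|[s + ->]].
  case/lastP: ts sk sn => [|s a]; first by move=> /= e; lia.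
  rewrite size_rcons sumn_rcons => sk sn; exists s; last by congr rcons; lia.
  rewrite mem_filter mem_boxes -sk eqxx/=; apply/andP; split; first by lia.
  apply/allP => b bs; have : (b <= sumn s)%N by elim: (s) bs => //= c u IH; rewrite inE => /orP[/eqP ->|/IH]; lia.
  lia.
rewrite mem_filter mem_boxes => /andP[sn /andP[/eqP sk _]].
by rewrite size_rcons sk prednK// eqxx sumn_rcons subnKC.
Qed.

End lattice_sums.

(** * The Gaussian limit *)

Section slices.
Context {R : realType}.
Variables (k : nat) (c : R * R) (rho phi : R).
Hypotheses (k3 : (3 <= k)%N) (rho0 : 0 < rho).
Local Notation mu := (@lebesgue_measure R).
Local Notation h := (apothem k rho).
Local Notation r := (side k rho).
Local Notation S1 := (@sinm R k 1).
Local Notation cosa := (cos (@step_angle R k)).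

Let kpos : (0 < k)%N. Proof. by lia. Qed.
Let kp : 0 < k%:R :> R. Proof. by rewrite ltr0n. Qed.
Let S10 : 0 < S1. Proof. exact: sinm1_gt0. Qed.
Let r0 : 0 < r. Proof. exact: side_gt0. Qed.

(** [n] counts the inner vertices of the chains; with the [k] contact points the sample has [k + n]
    points. *)
Definition npts n : R := (k + n)%:R.
Definition mean n : R := npts n / k%:R.
(** Chosen so that side [i], for distances [y / npts n], has length [r / (2 * mean n)] times
    [mean_side] ([side_at_mean]). A variable [y i] moves side [i] and its two neighbours, and
    [decay] collects the three coefficients. *)
Definition slope : R := 2 / (k%:R * r * S1).
Definition decay : R := 2 * slope * (1 - cosa).

(* Twice the mean [mean n], corrected by the change of the [i]-th side when
   the sides are moved inwards by [y / npts n]. *)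
Definition mean_side n (y : nat -> R) i : R :=
  2 * mean n - slope * (y (side_next k i) + y (side_prev k i) - 2 * cosa * y i).

(* The integrand of [main_volume] with every [a ^+ m / m`!] written as a Poisson
   weight; the exponential factors combine into [decay]. *)
Definition slice n ts (y : nat -> R) : R :=
  \prod_(i < k) (Num.sqrt (npts n) * pois (nth 0%N ts i).+1 (mean n) *
    ((0 <= y i)%R%:R * expR (- (decay * y i)) *
     (Num.sqrt (npts n) * pois (degree k ts i) (mean_side n y i)))).

(** One factor [expR (npts n)] comes from the factorials of the parts, two from those of the
    degrees. In the power [2 * k] of [npts n], one half undoes the square roots in [slice], and the
    other half is the Jacobian of the scaling of the distances. *)
Definition slice_const n : R :=
  S1 ^+ n * expR (npts n) ^+ 3 / mean n ^+ (k + n) *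
  (r / (2 * mean n)) ^+ (k + 2 * n) / npts n ^+ (2 * k).

Lemma npts_gt0 n : 0 < npts n.
Proof. by rewrite ltr0n addn_gt0 kpos. Qed.

Lemma mean_gt0 n : 0 < mean n.
Proof. by rewrite divr_gt0// npts_gt0. Qed.

Lemma slope_gt0 : 0 < slope.
Proof. by rewrite divr_gt0// mulr_gt0// mulr_gt0. Qed.

Lemma decay_gt0 : 0 < decay.
Proof.
by rewrite /decay mulr_gt0 ?subr_gt0 ?cos_step_lt1// mulr_gt0// slope_gt0.
Qed.

Lemma slice_ge0 n ts y : 0 <= slice n ts y.
Proof.
apply: prodr_ge0 => i _; have s0 := sqrtr_ge0 (npts n).
by rewrite mulr_ge0 ?(mulr_ge0 s0) ?pois_ge0// mulr_ge0 ?(mulr_ge0 s0) ?pois_ge0// mulr_ge0// expR_ge0.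
Qed.

Lemma slice_const_gt0 n : 0 < slice_const n.
Proof.
have := npts_gt0 n; have := mean_gt0 n => ? ?.
by rewrite divr_gt0 ?mulr_gt0 ?invr_gt0 ?exprn_gt0 ?expR_gt0// divr_gt0// mulr_gt0.
Qed.

Lemma measurable_pois m : measurable_fun setT (fun x : measurableTypeR R => pois m x).
Proof.
apply: measurable_funM => //; apply: measurable_funM; first exact: measurable_pos_pow.
by apply: measurable_fun_exp; exact: oppr_measurable.
Qed.

Lemma mseq_slice a n ts dP (P : measurableType dP) b :
  mseq a (fun (_ : P) (t : seq (measurableTypeR R)) => slice n ts (fun i => nth 0 t (b + i)%N)).
Proof.
have mn j : mseq a (fun (_ : P) (t : seq (measurableTypeR R)) => nth 0 t (b + j)%N : R) by exact: mseq_nth.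
apply: measurable_prod => i _; apply: measurable_funM => //; apply: measurable_funM; last first.
  apply: measurable_funM => //; apply: (measurableT_comp (measurable_pois _)).
  apply: measurable_funB => //; apply: measurable_funM => //.
  by apply: measurable_funB; [apply: measurable_funD; exact: mn|apply: measurable_funM => //; exact: mn].
apply: measurable_funM.
  by apply: measurable_boolR; apply: measurable_fun_ler; [exact: measurable_cst|exact: mn].
by apply: measurable_fun_exp; apply: measurable_funN; apply: measurable_funM => //; exact: mn.
Qed.

Lemma next_lt i : (side_next k i < k)%N. Proof. by rewrite ltn_mod. Qed.
Lemma prev_lt i : (side_prev k i < k)%N. Proof. by rewrite ltn_mod. Qed.

Lemma side_at_mean n (l : seq R) i : size l = k -> (i < k)%N ->
  side_at k rho [seq (npts n)^-1 * x + 0 | x <- l] i =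
  r / (2 * mean n) * mean_side n (nth 0 l) i.
Proof.
move=> sl ik; rewrite /side_at /gap_next /gap_prev.
rewrite !(nth_map 0) ?sl ?next_lt ?prev_lt// !addr0.
have e : h = S1 * r / (2 - 2 * cosa).
  rewrite -(@side_apothem R k rho) mulrAC divff ?mul1r//.
  by have := @cos_step_lt1 R k k3; move: (cos _) => C ?; apply/eqP; lra.
have h2 : S1 * r = (2 - 2 * cosa) * h by rewrite side_apothem.
transitivity (((2 - 2 * cosa) * h - (npts n)^-1 *
   (nth 0 l (side_next k i) + nth 0 l (side_prev k i) - 2 * cosa * nth 0 l i)) / S1).
  by rewrite -mulrDl; congr (_ / _); ring.
rewrite -h2 /mean_side /mean /slope; have N0 := npts_gt0 n.
move: (nth 0 l (side_next k i) + _ - _) (npts n) N0 => Y N N0; field.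
by rewrite !gt_eqF.
Qed.

Lemma inv_fact_pois m (q : R) : 0 < q -> (m`!%:R)^-1 = pois m q * expR q / q ^+ m.
Proof.
move=> q0; rewrite /pois /pos_pow q0 mul1r expRN.
have := @fact_gt0 m; rewrite -(ltr0n R); move: (expR_gt0 q) (exprn_gt0 m q0).
move: (m`!%:R) (expR q) (q ^+ m) => f e p e0 p0 f0; field.
by rewrite !gt_eqF.
Qed.

Lemma pos_pow_pois m (a q : R) : 0 < a ->
  pos_pow (a * q) m / m`!%:R = a ^+ m * (pois m q * expR q).
Proof.
move=> a0; rewrite /pois /pos_pow pmulr_rgt0// expRN exprMn.
have := @fact_gt0 m; rewrite -(ltr0n R); move: (expR_gt0 q).
move: (m`!%:R) (expR q) (q ^+ m) (a ^+ m) ((0 < q)%R%:R) => f e p b s e0 f0; field.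
by rewrite !gt_eqF.
Qed.

Lemma prod_expR_mean_side n y :
  \prod_(i < k) expR (mean_side n y i) = expR (npts n) ^+ 2 * \prod_(i < k) expR (- (decay * y i)).
Proof.
transitivity (\prod_(i < k) expR (2 * mean n) * \prod_(i < k) expR (- slope * y (side_next k i)) *
  \prod_(i < k) expR (- slope * y (side_prev k i)) * \prod_(i < k) expR (2 * slope * cosa * y i)).
  rewrite -!big_split/=; apply: eq_bigr => i _; rewrite -!expRD; congr expR.
  by rewrite /mean_side; ring.
have -> : \prod_(i < k) expR (- slope * y (side_next k i)) = \prod_(i < k) expR (- slope * y i).
  exact: (@prod_ordS _ k (fun i => expR (- slope * y i))).
have -> : \prod_(i < k) expR (- slope * y (side_prev k i)) = \prod_(i < k) expR (- slope * y i).
  rewrite -(@prod_ordS _ k (fun i => expR (- slope * y (side_prev k i))))//.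
  by apply: eq_bigr => i _; rewrite -/(side_next k i) (side_prev_next k3 rho0).
have -> : \prod_(i < k) expR (2 * mean n) = expR (npts n) ^+ 2.
  rewrite prodr_const card_ord -!expRM_natl; congr expR; rewrite /mean; field.
  by rewrite gt_eqF.
rewrite -[_ * _ * _ * _]mulrA -[_ * _ * _]mulrA; congr (_ * _).
rewrite -!big_split/=; apply: eq_bigr => i _; rewrite -!expRD; congr expR.
by rewrite /decay; ring.
Qed.

Lemma sum_degree ts n : ts \in comps k n -> (\sum_(i < k) degree k ts i = k + 2 * n)%N.
Proof.
rewrite mem_comps => /andP[/eqP sk /eqP sn].
have e : (\sum_(i < k) nth 0 ts i = n)%N.
  by rewrite -sn sumnE (big_nth 0%N) sk big_mkord.
have e' : (\sum_(i < k) nth 0 ts (side_prev k i) = n)%N.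
  rewrite -e [RHS](reindex_inj (h := fun i : 'I_k => Ordinal (prev_lt i)))//.
  move=> i j /(congr1 val)/= ij; apply: val_inj => /=.
  have nx x : (x < k)%N -> side_next k (side_prev k x) = x.
    by move=> xk; rewrite /side_next /side_prev -addn1 modnDml -addnA addn1 prednK// modnDr modn_small.
  by rewrite -(nx i)// ij nx.
transitivity (\sum_(i < k) (nth 0 ts i + nth 0 ts (side_prev k i) + 1))%N.
  by apply: eq_bigr => i _; rewrite addn1.
by rewrite !big_split/= e e' sum_nat_const card_ord; lia.
Qed.

Lemma sum_parts ts n : ts \in comps k n -> (\sum_(i < k) (nth 0 ts i).+1 = k + n)%N.
Proof.
rewrite mem_comps => /andP[/eqP sk /eqP sn].
transitivity (\sum_(i < k) (nth 0 ts i + 1))%N; first by apply: eq_bigr => i _; rewrite addn1.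
have e : (\sum_(i < k) nth 0 ts i = n)%N by rewrite -sn sumnE (big_nth 0%N) sk big_mkord.
by rewrite big_split/= e sum_nat_const card_ord muln1 addnC.
Qed.

Lemma prodr_exp (x : R) (a : nat -> nat) : \prod_(i < k) x ^+ a i = x ^+ (\sum_(i < k) a i).
Proof. by rewrite (big_morph _ (exprD x) (expr0 x)). Qed.

Lemma main_volume_slice n ts : ts \in comps k n ->
  (main_volume k c rho phi n ts =
  (slice_const n)%:E * iint mu k (fun l => (slice n ts (nth 0 l))%:E))%E.
Proof.
move=> tsn; have N0 := npts_gt0 n; have m0 := mean_gt0 n.
rewrite main_volumeE//.
have Vn : (npts n)^-1 != 0 by rewrite invr_eq0 gt_eqF.
have mG : mseqF k (fun l : seq (measurableTypeR R) => (\prod_(i < k) ((0 <= nth 0 l i)%R%:R *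
     (pos_pow (side_at k rho l i) (degree k ts i) / (degree k ts i)`!%:R)))%:E : \bar R).
  by apply/measurable_EFinP; apply: measurable_prod => i _; exact: mseq_side_factor.
have G0 (l : seq (measurableTypeR R)) : (0 <= (\prod_(i < k) ((0 <= nth 0 l i)%R%:R *
     (pos_pow (side_at k rho l i) (degree k ts i) / (degree k ts i)`!%:R)))%:E)%E.
  by rewrite lee_fin; apply: prodr_ge0 => i _; rewrite mulr_ge0// divr_ge0 ?pos_pow_ge0.
rewrite (iint_affine 0 Vn G0 mG) gtr0_norm ?invr_gt0// muleA -EFinM.
have f0 : 0 <= S1 ^+ n / \prod_(i < k) ((nth 0%N ts i).+1)`!%:R.
  by rewrite divr_ge0 ?exprn_ge0 ?(ltW S10)//; apply: prodr_ge0.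
transitivity (iint mu k (fun l => (slice_const n)%:E * (slice n ts (nth 0 l))%:E)%E); last first.
  apply: iintZl; first by rewrite lee_fin ltW// slice_const_gt0.
    by move=> t; rewrite lee_fin slice_ge0.
  by apply/measurable_EFinP; exact: (@mseq_slice k n ts _ unit 0%N).
have c0 : (0 <= (S1 ^+ n / \prod_(i < k) ((nth 0%N ts i).+1)`!%:R * (npts n)^-1 ^+ k)%:E)%E.
  by rewrite lee_fin mulr_ge0// exprn_ge0// invr_ge0 ltW.
rewrite -(iintZl mu c0 _ (mseqF_affine (npts n)^-1 0 mG)); last by move=> t; exact: G0.
apply: eq_iint => l sl; rewrite -!EFinM; congr EFin.
have a0 : 0 < r / (2 * mean n) by rewrite divr_gt0// mulr_gt0.
have -> : \prod_(i < k) ((0 <= nth 0 [seq (npts n)^-1 * x + 0 | x <- l] i)%R%:R *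
     (pos_pow (side_at k rho [seq (npts n)^-1 * x + 0 | x <- l] i) (degree k ts i) / (degree k ts i)`!%:R)) =
  (r / (2 * mean n)) ^+ (k + 2 * n) * expR (npts n) ^+ 2 * \prod_(i < k) ((0 <= nth 0 l i)%R%:R *
    expR (- (decay * nth 0 l i)) * pois (degree k ts i) (mean_side n (nth 0 l) i)).
  rewrite -(sum_degree tsn) -prodr_exp -[RHS]mulrA.
  rewrite (_ : \prod_(i < k) (_ * _ * _) = (\prod_(i < k) expR (- (decay * nth 0 l i))) *
    \prod_(i < k) ((0 <= nth 0 l i)%R%:R * pois (degree k ts i) (mean_side n (nth 0 l) i))); last first.
    by rewrite -big_split/=; apply: eq_bigr => i _; ring.
  rewrite [expR _ ^+ 2 * _]mulrA -prod_expR_mean_side -!big_split/=; apply: eq_bigr => i _.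
  rewrite side_at_mean// pos_pow_pois// (nth_map 0) ?sl// addr0 pmulr_rge0 ?invr_gt0//.
  ring.
have -> : (\prod_(i < k) ((nth 0%N ts i).+1)`!%:R)^-1 =
  expR (npts n) / mean n ^+ (k + n) * \prod_(i < k) pois (nth 0%N ts i).+1 (mean n).
  rewrite -prodfV -(sum_parts tsn) -(prodr_exp (mean n) (fun i => (nth 0%N ts i).+1)).
  have -> : expR (npts n) = \prod_(i < k) expR (mean n).
    rewrite prodr_const card_ord -expRM_natl; congr expR; rewrite /mean; field.
    by rewrite gt_eqF.
  rewrite -prodfV -!big_split/=; apply: eq_bigr => i _.
  rewrite (inv_fact_pois _ m0); ring.
have -> : slice n ts (nth 0 l) = npts n ^+ k * ((\prod_(i < k) pois (nth 0%N ts i).+1 (mean n)) *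
   \prod_(i < k) ((0 <= nth 0 l i)%R%:R *
    expR (- (decay * nth 0 l i)) * pois (degree k ts i) (mean_side n (nth 0 l) i))).
  have -> : npts n ^+ k = \prod_(i < k) (Num.sqrt (npts n) * Num.sqrt (npts n)).
    by rewrite prodr_const card_ord -expr2 sqr_sqrtr// ltW.
  by rewrite -!big_split/=; apply: eq_bigr => i _; ring.
rewrite /slice_const; have -> : npts n ^+ (2 * k) = npts n ^+ k * npts n ^+ k by rewrite -exprD addnn mul2n.
rewrite exprVn.
have Nk : npts n ^+ k != 0 by rewrite expf_neq0// gt_eqF.
have Mk : mean n ^+ (k + n) != 0 by rewrite expf_neq0// gt_eqF.
move: (\prod_(i < k) _) (\prod_(i < k) _) (_ ^+ (k + 2 * n)) (S1 ^+ n) (npts n ^+ k) Nk (mean n ^+ (k + n)) Mk (expR _).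
move=> P1 P2 A B N' Nk M' Mk e; field.
by rewrite Nk Mk.
Qed.

(** The first [k - 1] entries of [t] are the normalized parts, on which the dependence is through
    cells only; the last [k] entries are the scaled distances. *)
Definition partial_slice n (t : seq R) : R :=
  \sum_(s <- [seq s <- boxes k.-1 n.+1 | (sumn s <= n)%N])
    cell k.-1 s (fun j => Num.sqrt (npts n) * nth 0 t j + mean n) *
    slice n (rcons s (n - sumn s)%N) (fun i => nth 0 t (k.-1 + i)).

Lemma sum_main_volume n :
  (\sum_(ts <- comps k n) main_volume k c rho phi n ts =
   (slice_const n * Num.sqrt (npts n) ^+ k.-1)%:E *
   iint mu (k.-1 + k) (fun t => (partial_slice n t)%:E))%E.
Proof.
rewrite (eq_big_seq (fun ts => (slice_const n)%:E * iint mu k (fun l => (slice n ts (nth 0 l))%:E))%E); last first.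
  by move=> ts tsn; exact: main_volume_slice.
rewrite -ge0_sume_distrr; last first.
  by move=> ts _; apply: iint_ge0 => t; rewrite lee_fin slice_ge0.
rewrite [in RHS]EFinM -muleA; congr (_ * _)%E.
rewrite (perm_big _ (comps_split n kpos))/= big_map.
rewrite (@lattice_sum _ k.-1 k _ (fun s l => slice n (rcons s (n - sumn s)%N) (nth 0 l))
  (Num.sqrt (npts n)) (mean n)).
- congr (_ * _)%E; apply: eq_iint => t _; congr EFin; apply: eq_bigr => s _; congr (_ * _).
  by rewrite /slice; apply: eq_bigr => i _; rewrite /mean_side !nth_drop.
- by rewrite sqrtr_gt0 npts_gt0.
- by move=> s t; exact: slice_ge0.
- by move=> s; apply/measurable_EFinP; exact: (@mseq_slice k n _ _ unit 0%N).
Qed.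

End slices.

Lemma prod_pred (R : pzSemiRingType) k (f : nat -> R) : (0 < k)%N ->
  \prod_(i < k) (if (i < k.-1)%N then f i else 1) = \prod_(i < k.-1) f i.
Proof.
case: k => [//|k] _ /=; rewrite big_ord_recr/= ltnn mulr1.
by apply: eq_bigr => i _; rewrite ltn_ord.
Qed.

(** * Domination and pointwise limit of the slices *)

Section slice_limit.
Context {R : realType}.
Variables (k : nat) (rho : R).
Hypotheses (k3 : (3 <= k)%N) (rho0 : 0 < rho).
Local Notation mu := (@lebesgue_measure R).
Local Notation npts := (@npts R k).
Local Notation mean := (@mean R k).
Local Notation slope := (@slope R k rho).
Local Notation decay := (@decay R k rho).
Local Notation mean_side := (@mean_side R k rho).
Local Notation slice := (@slice R k rho).
Local Notation partial_slice := (@partial_slice R k rho).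

Let kpos : (0 < k)%N. Proof. by lia. Qed.
Let kp : 0 < k%:R :> R. Proof. by rewrite ltr0n. Qed.
Let k1 : 1 <= k%:R :> R. Proof. by rewrite ler1n. Qed.
Let N0 n : 0 < npts n. Proof. exact: npts_gt0. Qed.
Let m0 n : 0 < mean n. Proof. by rewrite /mean divr_gt0. Qed.
Let s0 n : 0 < Num.sqrt (npts n). Proof. by rewrite sqrtr_gt0. Qed.
Let sN n : Num.sqrt (npts n) ^+ 2 = npts n. Proof. by rewrite sqr_sqrtr// ltW. Qed.
Let mN n : mean n = npts n / k%:R. Proof. by []. Qed.

(** Decay is extracted from the weight of the part alone. The weight of the degree [m > T] is
    bounded by its maximum, of order one over the square root of [T.+1], which is the factor that
    [pois_bounds] asks for. *)
Lemma slice_factor_le : exists2 D : R, 0 < D & forall n T m q, (T < m)%N ->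
  Num.sqrt (npts n) * pois T.+1 (mean n) * (Num.sqrt (npts n) * pois m q) <=
  D / (1 + (T.+1%:R - mean n) ^+ 2 / mean n).
Proof.
have [C C0 hC] := @pois_bounds R; exists (k%:R * C * C); first by rewrite !mulr_gt0.
move=> n T m q Tm.
have [_ hT] := hC T.+1 isT; have [hm _] := hC m (leq_ltn_trans (leq0n _) Tm).
have sT : 0 < Num.sqrt T.+1%:R :> R by rewrite sqrtr_gt0.
have sm : 0 < Num.sqrt m%:R :> R by rewrite sqrtr_gt0 ltr0n (leq_ltn_trans _ Tm).
apply: (@le_trans _ _ (npts n * pois T.+1 (mean n) * (C / Num.sqrt T.+1%:R))).
  have -> : Num.sqrt (npts n) * pois T.+1 (mean n) * (Num.sqrt (npts n) * pois m q) =
      npts n * pois T.+1 (mean n) * pois m q.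
    by rewrite mulrACA -expr2 sN mulrA.
  apply: ler_wpM2l; first by rewrite mulr_ge0 ?pois_ge0// ltW.
  apply: le_trans (hm q) _; rewrite ler_pM2l// lef_pV2 ?posrE//.
  by rewrite ler_sqrt// ler_nat.
have -> : npts n * pois T.+1 (mean n) * (C / Num.sqrt T.+1%:R) =
   k%:R * C * (mean n / Num.sqrt T.+1%:R * pois T.+1 (mean n)).
  move: (pois _ _) => P; rewrite mN; move: (npts n) => N; field.
  by rewrite !gt_eqF.
by rewrite -[leRHS]mulrA ler_pM2l ?mulr_gt0//; exact: hT.
Qed.

Let sqr_near (a z : R) : `|a - z| <= 1 -> z ^+ 2 <= 2 * a ^+ 2 + 2.
Proof.
move=> az; have h : (a - z) ^+ 2 <= 1.
  by rewrite -(real_normK (num_real (a - z))) exprn_ile1.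
apply: (@le_trans _ _ (2 * a ^+ 2 + 2 * (a - z) ^+ 2)); last by move: h; lra.
rewrite -subr_ge0; have -> : 2 * a ^+ 2 + 2 * (a - z) ^+ 2 - z ^+ 2 = (z - 2 * a) ^+ 2 by ring.
exact: sqr_ge0.
Qed.

(** Within a cell the coordinate is at most one lattice step from [T.+1], and [1 <= npts n] and
    [mean n <= npts n]; so the bound at the lattice point passes to [x] at the cost of the factor
    [3]. *)
Lemma cell_spread n T x : T%:R <= Num.sqrt (npts n) * x + mean n < T.+1%:R ->
  (1 + (T.+1%:R - mean n) ^+ 2 / mean n)^-1 <= 3 * (1 + x ^+ 2)^-1.
Proof.
move=> /andP[h1 h2]; set e := T.+1%:R - mean n; set l := mean n.
have e2 : 0 <= e ^+ 2 / l by rewrite divr_ge0 ?sqr_ge0// (ltW (m0 n)).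
have d1 : 0 < 1 + e ^+ 2 / l by rewrite ltr_pwDl.
have d2 : 0 < 1 + x ^+ 2 by rewrite ltr_pwDl// sqr_ge0.
rewrite -[_^-1]mul1r ler_pdivrMr// mulrAC ler_pdivlMr// mul1r.
have h3 : npts n * x ^+ 2 <= 2 * e ^+ 2 + 2.
  rewrite -sN -exprMn; set z := _ * x in h1 h2 *.
  by apply: sqr_near; rewrite /e ler_norml; move: h1 h2; rewrite -natr1; lra.
have N1 : 1 <= npts n by rewrite ler1n addn_gt0 kpos.
have h4 : x ^+ 2 <= 2 * (e ^+ 2 / npts n) + 2.
  rewrite -(ler_pM2l (N0 n)); apply: le_trans h3 _.
  have -> : npts n * (2 * (e ^+ 2 / npts n) + 2) = 2 * e ^+ 2 + 2 * npts n.
    by have := N0 n; move: (npts n) => N ?; field; rewrite gt_eqF.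
  by move: N1; lra.
have h5 : e ^+ 2 / npts n <= e ^+ 2 / l.
  have lN : l <= npts n by rewrite /l mN ler_pdivrMr// ler_peMr// ltW.
  have lp : 0 < l := m0 n; have Np := N0 n.
  by rewrite ler_wpM2l ?sqr_ge0// lef_pV2 ?posrE.
move: h4 h5 e2; lra.
Qed.

Definition slice_dom j (x : measurableTypeR R) : R :=
  if (j < k.-1)%N then (1 + x ^+ 2)^-1 else (0 <= x)%R%:R * expR (- (decay * x)).

Lemma slice_dom_ge0 j x : 0 <= slice_dom j x.
Proof.
rewrite /slice_dom; case: ifP => _; first by rewrite invr_ge0 addr_ge0// sqr_ge0.
by rewrite mulr_ge0// expR_ge0.
Qed.

Lemma measurable_slice_dom j : measurable_fun setT (slice_dom j).
Proof.
rewrite /slice_dom; case: (j < k.-1)%N; first by meas.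
apply: measurable_funM; last exact: measurable_expRN.
by apply: measurable_boolR; apply: measurable_fun_ler.
Qed.

Lemma integral_slice_dom j : (\int[mu]_x (slice_dom j x)%:E =
  (if (j < k.-1)%N then fine (\int[mu]_x ((1 + x ^+ 2)^-1)%:E) else decay^-1)%:E)%E.
Proof.
rewrite /slice_dom; case: ifP => _.
  rewrite fineK// ge0_fin_numE; last first.
    by apply: integral_ge0 => x _; rewrite lee_fin invr_ge0 addr_ge0// sqr_ge0.
  exact: integral_cauchy_lty.
rewrite integral_ge0_gt0; last exact: measurable_expRN.
by rewrite integral_expN// decay_gt0.
Qed.

Lemma prod_slice_dom (t : seq R) : \prod_(j < k.-1 + k) slice_dom j (nth 0 t j) =
  \prod_(i < k) ((if (i < k.-1)%N then (1 + nth 0 t i ^+ 2)^-1 else 1) *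
    ((0 <= nth 0 t (k.-1 + i))%R%:R * expR (- (decay * nth 0 t (k.-1 + i))))).
Proof.
rewrite big_split_ord big_split/= (prod_pred (fun i => (1 + nth 0 t i ^+ 2)^-1))//; congr (_ * _).
  by apply: eq_bigr => i _; rewrite /slice_dom ltn_ord.
by apply: eq_bigr => i _; rewrite /slice_dom ltnNge leq_addr.
Qed.

Lemma partial_slice_le : exists2 C : R, 0 <= C & forall n t,
  partial_slice n t <= C * \prod_(j < k.-1 + k) slice_dom j (nth 0 t j).
Proof.
have [D D0 hD] := slice_factor_le; exists ((3 * D) ^+ k).
  by rewrite exprn_ge0// mulr_ge0// ltW.
move=> n t.
have sz : {in [seq s <- boxes k.-1 n.+1 | (sumn s <= n)%N], forall u : seq nat, size u = k.-1}.
  by move=> u; rewrite mem_filter mem_boxes => /andP[_ /andP[/eqP]].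
have ur : uniq [seq s <- boxes k.-1 n.+1 | (sumn s <= n)%N] by rewrite filter_uniq// boxes_uniq.
rewrite /partial_slice.
have [->|[s [sin sP ->]]] := sum_cells (fun s => slice n (rcons s (n - sumn s)%N) (fun i => nth 0 t (k.-1 + i)))
   (fun j => Num.sqrt (npts n) * nth 0 t j + mean n) ur sz.
  by rewrite mulr_ge0 ?exprn_ge0 ?mulr_ge0 ?(ltW D0)//; apply: prodr_ge0 => j _; exact: slice_dom_ge0.
have ss := sz _ sin.
rewrite prod_slice_dom -[k in _ ^+ k]card_ord -prodr_const -big_split/=.
set ts := rcons _ _.
apply: ler_prod => i _; apply/andP; split.
  by rewrite mulr_ge0 ?(mulr_ge0 (ltW (s0 n))) ?pois_ge0// mulr_ge0 ?(mulr_ge0 (ltW (s0 n))) ?pois_ge0// mulr_ge0 ?expR_ge0.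
rewrite [leRHS]mulrA mulrCA [leLHS]mulrC; apply: ler_wpM2r; first by rewrite mulr_ge0// expR_ge0.
apply: le_trans (hD n _ _ _ _) _; first by rewrite ltnS leq_addr.
rewrite [3 * D]mulrC -[leRHS]mulrA ler_pM2l//.
case: ifP => ik; last first.
  rewrite mulr1 (@le_trans _ _ 1) ?ler1n// invf_le1; last by rewrite ltr_pwDl// divr_ge0 ?sqr_ge0// ltW.
  by rewrite lerDl divr_ge0 ?sqr_ge0// ltW.
by apply: cell_spread; rewrite /ts nth_rcons ss ik; exact: sP.
Qed.

Lemma mseq_partial_slice n : mseqF (k.-1 + k) (fun t : seq (measurableTypeR R) => partial_slice n t).
Proof.
apply: measurable_sum => s; apply: measurable_funM; last exact: (@mseq_slice R k rho (k.-1 + k) n _ _ unit k.-1).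
apply: (@mseq_prod_nth _ (k.-1 + k) _ unit (fun j (x : R) =>
  ((nth 0%N s j)%:R <= Num.sqrt (npts n) * x + mean n < (nth 0%N s j).+1%:R)%R%:R) k.-1) => j.
apply: (@measurableT_comp _ _ _ _ _ _ (fun x : measurableTypeR R => ((nth 0%N s j)%:R <= x < (nth 0%N s j).+1%:R)%R%:R : R)).
  exact: measurable_cell_factor.
by meas.
Qed.

Lemma partial_slice_ge0 n t : 0 <= partial_slice n t.
Proof.
by apply: sumr_ge0 => s _; rewrite mulr_ge0 ?cell_ge0// slice_ge0.
Qed.

(* Since the parts sum to [n], the last normalized deviation is minus the sum
   of the others. *)
Definition closed_coord (t : seq R) i : R :=
  if (i < k.-1)%N then nth 0 t i else - \sum_(j < k.-1) nth 0 t j.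

Definition gauss_factor (a z : R) : R := expR (- (z ^+ 2 / a / 2)) / (Num.sqrt a * Num.sqrt (2 * pi)).

Definition limit_slice (t : seq R) : R :=
  \prod_(i < k) (gauss_factor k%:R^-1 (closed_coord t i) *
    ((0 <= nth 0 t (k.-1 + i))%R%:R * expR (- (decay * nth 0 t (k.-1 + i))) *
     gauss_factor (2 / k%:R) (closed_coord t i + closed_coord t (side_prev k i)))).

Lemma gauss_factor_ge0 a z : 0 <= gauss_factor a z.
Proof. by rewrite divr_ge0 ?expR_ge0// mulr_ge0 ?sqrtr_ge0. Qed.

Lemma limit_slice_ge0 t : 0 <= limit_slice t.
Proof.
apply: prodr_ge0 => i _; rewrite !mulr_ge0 ?gauss_factor_ge0 ?expR_ge0//.
Qed.

Lemma mseq_closed_coord n dP (P : measurableType dP) i :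
  mseq n (fun (_ : P) (t : seq (measurableTypeR R)) => closed_coord t i : R).
Proof.
rewrite /mseq /closed_coord; case: (i < k.-1)%N; first exact: mseq_nth.
by apply: measurable_funN; apply: measurable_sum => j; exact: mseq_nth.
Qed.

Lemma measurable_gauss_factor a : measurable_fun setT (fun z : measurableTypeR R => gauss_factor a z).
Proof.
apply: measurable_funM => //; apply: measurable_fun_exp; apply: measurable_funN.
by apply: measurable_funM => //; apply: measurable_funM => //; exact: measurable_funX.
Qed.

Lemma mseq_limit_slice : mseqF (k.-1 + k) (fun t : seq (measurableTypeR R) => limit_slice t).
Proof.
have mc i := @mseq_closed_coord (k.-1 + k) _ unit i.
have mn j := @mseq_nth _ (measurableTypeR R) (k.-1 + k) _ unit 0%R j.
apply: measurable_prod => i _; apply: measurable_funM.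
  exact: (measurableT_comp (measurable_gauss_factor _) (mc i)).
apply: measurable_funM.
  apply: measurable_funM.
    by apply: measurable_boolR; apply: measurable_fun_ler; [exact: measurable_cst|exact: mn].
  by apply: measurable_fun_exp; apply: measurable_funN; apply: measurable_funM => //; exact: mn.
apply: (measurableT_comp (measurable_gauss_factor _)); apply: measurable_funD; exact: mc.
Qed.

Lemma cvg_sqrt_npts : (Num.sqrt (npts n))^-1 @[n --> \oo] --> (0 : R).
Proof.
have := @cvg_sqrt_nat R; rewrite -(cvg_shiftn k).
by apply: cvg_trans; apply: near_eq_cvg; apply: nearW => n; rewrite /npts addnC.
Qed.

Let cvg_ext (f g : nat -> R) (l : R) : (forall n, f n = g n) ->
  f n @[n --> \oo] --> l -> g n @[n --> \oo] --> l.
Proof. by move=> /funext ->. Qed.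

Section pointwise.
Variable t : seq R.
Local Notation x := (nth 0 t).
Local Notation y := (fun i => nth 0 t (k.-1 + i)).
Let m := k.-1.

Let pt n j : R := Num.sqrt (npts n) * x j + mean n.
Let part n := [seq Num.truncn (pt n j) | j <- iota 0 m].
Let parts n := rcons (part n) (n - sumn (part n))%N.
Let dev n i : R := ((nth 0%N (parts n) i).+1%:R - mean n) / Num.sqrt (npts n).

Let size_part n : size (part n) = m. Proof. by rewrite size_map size_iota. Qed.

Let nth_part n j : (j < m)%N -> nth 0%N (part n) j = Num.truncn (pt n j).
Proof. by move=> jm; rewrite (nth_map 0%N) ?size_iota// nth_iota. Qed.

(** Once the square root of [npts n] exceeds this threshold, every [pt n j] is nonnegative and the
    first [k - 1] parts sum to at most [n], so the point lies in the cell of an admissible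
    composition. *)
Let M : R := 1 + k%:R * (\sum_(j < m) `|x j| + k%:R).

Let M1 : 1 <= M.
Proof. by rewrite lerDl mulr_ge0 ?addr_ge0 ?sumr_ge0. Qed.

Let near_M : \forall n \near \oo, M <= Num.sqrt (npts n).
Proof.
near=> n; have h : M ^+ 2 <= n%:R by near: n; exact: nbhs_infty_ger.
rewrite -ler_sqr ?nnegrE ?sqrtr_ge0 ?(le_trans ler01 M1)// sN (le_trans h)//.
by rewrite ler_nat leq_addl.
Unshelve. all: by end_near. Qed.

Let pt_ge0 n j : M <= Num.sqrt (npts n) -> (j < m)%N -> 0 <= pt n j.
Proof.
move=> Mn jm; rewrite /pt mN -[X in _ + X / _]sN.
have -> : Num.sqrt (npts n) * x j + Num.sqrt (npts n) ^+ 2 / k%:R =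
  Num.sqrt (npts n) * (x j + Num.sqrt (npts n) / k%:R) by rewrite expr2; ring.
rewrite mulr_ge0// -lerBlDl sub0r.
apply: (@le_trans _ _ (\sum_(j < m) `|x j| + k%:R)).
  rewrite (le_trans (ler_norm _))// normrN (bigD1 (Ordinal jm))//= -addrA lerDl.
  by rewrite addr_ge0// sumr_ge0.
by rewrite ler_pdivlMr// mulrC (le_trans _ Mn)// lerDr.
Qed.

Let part_cell n : M <= Num.sqrt (npts n) -> in_cell m (part n) (pt n).
Proof. by move=> Mn j jm; rewrite nth_part//; apply: truncn_itv; exact: pt_ge0. Qed.

Let sum_part n : M <= Num.sqrt (npts n) -> (sumn (part n) <= n)%N.
Proof.
move=> Mn; rewrite -(ler_nat R) sumnE (big_nth 0%N) size_part big_mkord natr_sum.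
apply: (@le_trans _ _ (\sum_(j < m) pt n j)).
  by apply: ler_sum => j _; have /andP[] := part_cell Mn (ltn_ord j).
rewrite big_split/= -mulr_sumr sumr_const card_ord -[mean n *+ m]mulr_natl.
have -> : m%:R * mean n = npts n - mean n.
  have -> : m%:R = k%:R - 1 :> R by rewrite /m -[in RHS](prednK kpos) -natr1 addrK.
  by rewrite mN; move: (npts n) => N; field; rewrite gt_eqF.
have -> : n%:R = npts n - k%:R :> R by rewrite /npts natrD [k%:R + _]addrC addrK.
rewrite -subr_ge0.
have -> : npts n - k%:R - (Num.sqrt (npts n) * (\sum_(i < m) x i) + (npts n - mean n)) =
  mean n - k%:R - Num.sqrt (npts n) * (\sum_(i < m) x i) by ring.
rewrite mN -[X in X / _]sN; set s := Num.sqrt (npts n).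
have s1 : 1 <= s by apply: le_trans Mn.
set A := \sum_(i < m) x i; have hA : A <= \sum_(i < m) `|x i| by apply: ler_sum => i _; exact: ler_norm.
have -> : s ^+ 2 / k%:R - k%:R - s * A = (s - 1) * k%:R + s * (s / k%:R - k%:R - A) by rewrite expr2; ring.
rewrite addr_ge0// mulr_ge0 ?subr_ge0// ?(le_trans ler01 s1)//.
rewrite lerBrDr ler_pdivlMr// mulrC (le_trans _ Mn)// /M.
apply: (@le_trans _ _ (k%:R * (\sum_(j < m) `|x j| + k%:R))); last by rewrite lerDr.
by rewrite ler_pM2l// lerD2r.
Qed.

Let partial_sliceE n : M <= Num.sqrt (npts n) -> partial_slice n t = slice n (parts n) y.
Proof.
move=> Mn; apply: (@sum_cells_mem _ _ _ (fun s => slice n (rcons s (n - sumn s)%N) y) (pt n)).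
- by rewrite filter_uniq// boxes_uniq.
- by move=> u; rewrite mem_filter mem_boxes => /andP[_ /andP[/eqP]].
- rewrite mem_filter mem_boxes sum_part// size_part eqxx/=; apply/allP => b bs.
  rewrite ltnS (leq_trans _ (sum_part Mn))//.
  by elim: (part n) bs => //= c u IH; rewrite inE => /orP[/eqP ->|/IH]; lia.
- exact: part_cell.
Qed.

Let cvg_dev i : (i < k)%N -> dev n i @[n --> \oo] --> closed_coord t i.
Proof.
have small j : (j < m)%N -> dev n j @[n --> \oo] --> x j.
  move=> jm; apply/cvgrPdistC_le => e e0.
  have c := @cvg_sqrt_npts.
  have := @cvgr_dist_le _ _ _ _ _ (fun n => (Num.sqrt (npts n))^-1) 0 c _ e0; move=> /(_ _) h.
  near=> n; have Mn : M <= Num.sqrt (npts n) by near: n; exact: near_M.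
  have he : `|0 - (Num.sqrt (npts n))^-1| <= e by near: n; exact: h.
  have sV : 0 < (Num.sqrt (npts n))^-1 by rewrite invr_gt0.
  apply: le_trans he; rewrite sub0r normrN (gtr0_norm sV).
  have -> : dev n j - x j = ((nth 0%N (part n) j).+1%:R - pt n j) / Num.sqrt (npts n).
    rewrite /dev /parts nth_rcons size_part jm /pt; move: (mean n) (x j) (_.+1%:R) => a b d.
    by move: (gt_eqF (s0 n)); move: (Num.sqrt _) => z /negbT z0; field.
  rewrite normrM (gtr0_norm sV) ler_piMl ?(ltW sV)//.
  have := part_cell Mn jm; move: (pt n j) (nth 0%N (part n) j) => p q; rewrite -natr1 => /andP[h1 h2].
  by rewrite ler_norml; apply/andP; split; move: h1 h2; lra.
move=> ik; have [im|im] := boolP (i < m)%N.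
  by rewrite /closed_coord im; exact: small.
have im' : i = m by rewrite /m; move: im; rewrite /m; lia.
rewrite /closed_coord (negbTE im).
have c : - (\sum_(j < m) dev n j) @[n --> \oo] --> - (\sum_(j < m) x j).
  by apply: cvgN; apply: cvg_big => [|j _]; [exact: add_continuous|exact: small].
apply: cvg_trans c; apply: near_eq_cvg; apply: filterS near_M => n Mn.
have sp := sum_part Mn.
rewrite /dev -mulr_suml -mulNr; congr (_ / _).
rewrite im' /parts nth_rcons size_part ltnn eqxx.
have -> : \sum_(j < m) ((nth 0%N (rcons (part n) (n - sumn (part n))%N) j).+1%:R - mean n) =
   (sumn (part n))%:R + m%:R - m%:R * mean n.
  rewrite sumrB sumr_const card_ord -[mean n *+ m]mulr_natl; congr (_ - _).
  transitivity (\sum_(j < m) ((nth 0%N (part n) j)%:R + 1 : R)).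
    by apply: eq_bigr => j _; rewrite nth_rcons size_part ltn_ord natr1.
  by rewrite big_split/= sumr_const card_ord sumnE (big_nth 0%N) size_part big_mkord natr_sum.
rewrite -natr1 natrB//.
have -> : m%:R = k%:R - 1 :> R by rewrite /m -[in RHS](prednK kpos) -natr1 addrK.
have -> : n%:R = npts n - k%:R :> R by rewrite /npts natrD [k%:R + _]addrC addrK.
rewrite mN; move: (npts n) (_%:R) => N a; field.
by rewrite gt_eqF.
Unshelve. all: by end_near. Qed.

Lemma cvg_partial_slice : partial_slice n t @[n --> \oo] --> limit_slice t.
Proof.
suff c : slice n (parts n) y @[n --> \oo] --> limit_slice t.
  by apply: cvg_trans c; apply: near_eq_cvg; apply: filterS near_M => n Mn; rewrite partial_sliceE.
have cV := cvg_sqrt_npts.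
have cVV : (npts n)^-1 @[n --> \oo] --> (0 : R).
  have : (Num.sqrt (npts n))^-1 * (Num.sqrt (npts n))^-1 @[n --> \oo] --> (0 * 0 : R) by apply: cvgM.
  by rewrite mulr0; apply: cvg_trans; apply: near_eq_cvg; apply: nearW => n; rewrite -invfM -expr2 sN.
have sn n : Num.sqrt (npts n) != 0 by rewrite gt_eqF.
have devE n i : (nth 0%N (parts n) i).+1%:R = mean n + Num.sqrt (npts n) * dev n i.
  by rewrite /dev mulrCA divff// mulr1 addrC subrK.
have mV n : mean n / npts n = k%:R^-1 by rewrite mN mulrAC divff ?mul1r// gt_eqF.
have NV n i : Num.sqrt (npts n) * dev n i / npts n = dev n i * (Num.sqrt (npts n))^-1.
  by rewrite -[X in _ / X]sN; move: (sn n) (dev n i); move: (Num.sqrt _) => s s' d; field.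
have ca i : (i < k)%N -> dev n i * (Num.sqrt (npts n))^-1 @[n --> \oo] --> (0 : R).
  by move=> ik; rewrite -[X in _ --> X](mulr0 (closed_coord t i)); apply: cvgM => //; exact: cvg_dev.
have cA i : (i < k)%N -> Num.sqrt (npts n) * pois (nth 0%N (parts n) i).+1 (mean n) @[n --> \oo] -->
    gauss_factor k%:R^-1 (closed_coord t i).
  move=> ik; rewrite /gauss_factor -[closed_coord t i ^+ 2]sqrrN; apply: cvg_pois => //.
  - by rewrite invr_gt0.
  - have e n : k%:R^-1 + dev n i * (Num.sqrt (npts n))^-1 = (nth 0%N (parts n) i).+1%:R / npts n.
      by rewrite devE mulrDl NV mV.
    by apply: (cvg_ext e); rewrite -[X in _ --> X]addr0; apply: cvgD; [exact: cvg_cst|exact: ca].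
  - have e n : - dev n i = (mean n - (nth 0%N (parts n) i).+1%:R) / Num.sqrt (npts n).
      by rewrite /dev -mulNr opprB.
    by apply: (cvg_ext e); apply: cvgN; exact: cvg_dev.
have cB i : (i < k)%N -> Num.sqrt (npts n) * pois (degree k (parts n) i) (mean_side n y i) @[n --> \oo] -->
    gauss_factor (2 / k%:R) (closed_coord t i + closed_coord t (side_prev k i)).
  move=> ik; have pk : (side_prev k i < k)%N by rewrite ltn_mod.
  have dE n : (degree k (parts n) i)%:R = (nth 0%N (parts n) i).+1%:R + (nth 0%N (parts n) (side_prev k i)).+1%:R - 1 :> R.
    by rewrite /degree -!natr1 natrD; ring.
  rewrite /gauss_factor -[(_ + _) ^+ 2]sqrrN; apply: cvg_pois => //.
  - by rewrite divr_gt0.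
  - have e n : 2 / k%:R + dev n i * (Num.sqrt (npts n))^-1 + dev n (side_prev k i) * (Num.sqrt (npts n))^-1
       - (npts n)^-1 = (degree k (parts n) i)%:R / npts n.
      rewrite dE !devE -!NV mN; move: (npts n) (gt_eqF (N0 n)) (Num.sqrt _) => N /negbT N' s; field.
      by rewrite N' gt_eqF.
    apply: (cvg_ext e); rewrite -[X in _ --> X]addr0 -oppr0; apply: cvgB => //.
    rewrite -[X in _ --> X]addr0; apply: cvgD; last exact: ca.
    by rewrite -[X in _ --> X]addr0; apply: cvgD; [exact: cvg_cst|exact: ca].
  - pose Y : R := slope * (y (side_next k i) + y (side_prev k i) - 2 * cos (step_angle k) * y i).
    have e n : - (dev n i + dev n (side_prev k i)) + (1 - Y) * (Num.sqrt (npts n))^-1 =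
        (mean_side n y i - (degree k (parts n) i)%:R) / Num.sqrt (npts n).
      rewrite dE !devE /mean_side -/Y; move: (Num.sqrt _) (sn n) (mean n) => s s' a; field.
      by [].
    apply: (cvg_ext e); rewrite -[X in _ --> X]addr0; apply: cvgD.
      by apply: cvgN; apply: cvgD; exact: cvg_dev.
    by rewrite -(mulr0 (1 - Y)); apply: cvgM => //; exact: cvg_cst.
rewrite /slice /limit_slice; apply: cvg_big => [|i _]; first exact: mul_continuous.
apply: cvgM; first exact: cA.
by apply: cvgM; [exact: cvg_cst|exact: cB].
Qed.

End pointwise.

Lemma cvg_iint_partial_slice :
  iint mu (k.-1 + k) (fun t => (partial_slice n t)%:E) @[n --> \oo] -->
  iint mu (k.-1 + k) (fun t => (limit_slice t)%:E).
Proof.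
have [C C0 hC] := partial_slice_le.
apply: (@iint_dominated_convergence R slice_dom _ measurable_slice_dom slice_dom_ge0 integral_slice_dom
  (k.-1 + k) 0%N partial_slice limit_slice C C0).
- by move=> n; apply/measurable_EFinP; exact: mseq_partial_slice.
- by apply/measurable_EFinP; exact: mseq_limit_slice.
- exact: partial_slice_ge0.
- exact: limit_slice_ge0.
- by move=> n t _; exact: hC.
- by move=> t _; exact: cvg_partial_slice.
Qed.

End slice_limit.

(** * Gaussian integrals over a cycle *)

Section surd_sequence.
Context {R : realType}.
Local Notation w := (Num.sqrt 3 : R).

Let w0 : 0 < w. Proof. by rewrite sqrtr_gt0. Qed.
Let w2 : w ^+ 2 = 3. Proof. by rewrite sqr_sqrtr. Qed.
Let wlt2 : w < 2.
Proof. by rewrite -ltr_sqr ?nnegrE ?sqrtr_ge0// w2; lra. Qed.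

Definition surd m : R := ((2 + w) ^+ m - (2 - w) ^+ m) / (2 * w).

Lemma surd1 : surd 1 = 1.
Proof. by rewrite /surd !expr1; field; rewrite gt_eqF. Qed.

Lemma surdSS m : surd m.+2 = 4 * surd m.+1 - surd m.
Proof.
rewrite /surd !exprS; move: ((2 + w) ^+ m) ((2 - w) ^+ m) => u v.
have -> : (2 + w) * ((2 + w) * u) - (2 - w) * ((2 - w) * v) =
    4 * ((2 + w) * u - (2 - w) * v) - (u - v) + (w ^+ 2 - 3) * (u - v) by ring.
by rewrite w2; field; rewrite gt_eqF.
Qed.

Lemma surd2 : surd 2 = 4.
Proof. by rewrite surdSS surd1 /surd !expr0 subrr mul0r subr0 mulr1. Qed.

Lemma surd_gt0 m : 0 < surd m.+1.
Proof.
have h : 2 - w < 2 + w by move: w0; move: w => v; lra.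
rewrite divr_gt0 ?mulr_gt0// subr_gt0 ltrXn2r// ?nnegrE.
by move: wlt2; move: w => v; lra.
Qed.

(** The quadratic form [a^2 - 4 a b + b^2] in two consecutive terms is invariant under the
    recurrence [surdSS]. *)
Lemma surd_inv m : surd m.+1 ^+ 2 - 4 * surd m.+1 * surd m + surd m ^+ 2 = 1.
Proof.
elim: m => [|m IH]; first by rewrite surd1 /surd !expr0 subrr mul0r; ring.
rewrite -[RHS]IH surdSS; move: (surd m.+1) (surd m) => a b; ring.
Qed.

Lemma surd_sub2 m : surd m.+1 - 2 * surd m = ((2 + w) ^+ m + (2 - w) ^+ m) / 2.
Proof.
by rewrite /surd !exprS; move: ((2 + w) ^+ m) ((2 - w) ^+ m) => u v; field; rewrite gt_eqF.
Qed.

End surd_sequence.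

Section gaussian_paths.
Context {R : realType}.
Local Notation mu := (@lebesgue_measure R).
Variable lam : R.
Hypothesis lam0 : 0 < lam.

(** Each square is shared between the two edges at its vertex. Summed over a cycle this is twice the
    limiting form divided by [k], hence the later choice [lam = k / 2]. *)
Definition edge_energy (x y : R) : R := x ^+ 2 + y ^+ 2 + x * y.

Fixpoint path_energy (x : R) (t : seq R) (y : R) : R :=
  if t is z :: t' then edge_energy x z + path_energy z t' y else edge_energy x y.

Lemma path_energyE x t y : path_energy x t y =
  \sum_(i < (size t).+1) edge_energy (nth 0 (x :: t) i) (nth 0 (rcons t y) i).
Proof.
elim: t x => [|z t IH] x; first by rewrite big_ord_recl big_ord0 addr0.
by rewrite [LHS]/= IH [RHS]big_ord_recl.
Qed.

Lemma integral_gaussian_linear (A B : R) : 0 < A ->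
  (\int[mu]_x (expR (- (A * x ^+ 2 + B * x)))%:E = (Num.sqrt (pi / A) * expR (B ^+ 2 / (4 * A)))%:E)%E.
Proof.
move=> A0; have mg : measurable_fun setT (fun x : measurableTypeR R => (expR (- (A * x ^+ 2)))%:E).
  by apply/measurable_EFinP; apply: measurable_fun_exp; apply: measurable_funN; meas.
transitivity (\int[mu]_x ((expR (B ^+ 2 / (4 * A)))%:E * (expR (- (A * (x + B / (2 * A)) ^+ 2)))%:E))%E.
  apply: eq_integral => x _; rewrite -EFinM -expRD; congr (expR _)%:E.
  by field; rewrite gt_eqF.
rewrite ge0_integralZl//.
- rewrite (ge0_integral_translation (B / (2 * A)) mg); last by move=> x; rewrite lee_fin expR_ge0.
  by rewrite integral_gaussian// -EFinM mulrC.
- apply/measurable_EFinP; apply: measurable_fun_exp; apply: measurable_funN; meas.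
Qed.

(** Integrating out the [m] inner vertices of a path leaves a Gaussian in its two ends, with
    coefficient [path_diag] at the squares and [2 * path_cross] at the product. For [m = 0] these
    are [1] and [1], the coefficients of [edge_energy]. *)
Definition path_diag m : R := surd m.+2 / (2 * surd m.+1) - 1.
Definition path_cross m : R := (-1) ^+ m / (2 * surd m.+1).
Definition path_mass m : R := Num.sqrt ((2 * pi / lam) ^+ m / surd m.+1).

Lemma path_diagS_gt0 m : 0 < path_diag m + 1.
Proof. by rewrite /path_diag subrK divr_gt0 ?surd_gt0// mulr_gt0// surd_gt0. Qed.

Lemma path_massS m : path_mass m.+1 = path_mass m * Num.sqrt (pi / (lam * (path_diag m + 1))).
Proof.
have h1 := @surd_gt0 R m; have h2 := @surd_gt0 R m.+1.
rewrite /path_mass -sqrtrM; last first.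
  by rewrite divr_ge0 ?(ltW h1)// exprn_ge0// divr_ge0 ?(ltW lam0)// mulr_ge0// pi_ge0.
congr Num.sqrt; rewrite exprS /path_diag subrK.
move: (_ ^+ m) (surd m.+2) (surd m.+1) h1 h2 => u v z z0 v0; field.
by rewrite !gt_eqF.
Qed.

Lemma mseq_path_energy n dP (P : measurableType dP) (f g : P -> measurableTypeR R) :
  measurable_fun setT f -> measurable_fun setT g ->
  mseq n (fun p (t : seq (measurableTypeR R)) => path_energy (f p) t (g p) : R).
Proof.
elim: n dP P f g => [|n IH] dP P f g mf mg.
  apply/mseq0; rewrite /= /edge_energy; apply: measurable_funD; last exact: measurable_funM.
  by apply: measurable_funD; exact: measurable_funX.
apply/mseqS => /=.
have m1 : measurable_fun setT (fun q : P * measurableTypeR R => f q.1).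
  by apply: (measurableT_comp mf); exact: measurable_fst.
have m2 : measurable_fun setT (fun q : P * measurableTypeR R => g q.1).
  by apply: (measurableT_comp mg); exact: measurable_fst.
have m3 : measurable_fun setT (fun q : P * measurableTypeR R => q.2) by exact: measurable_snd.
apply: measurable_funD; last exact: (IH _ _ (fun q => q.2) (fun q => g q.1) m3 m2).
apply: (mseq_cst (f := fun q : P * measurableTypeR R => edge_energy (f q.1) q.2)).
rewrite /edge_energy; apply: measurable_funD; last exact: measurable_funM.
by apply: measurable_funD; exact: measurable_funX.
Qed.

Lemma iint_path m x y :
  iint mu m (fun t => (expR (- (lam * path_energy x t y)))%:E) =
  (path_mass m * expR (- (lam * (path_diag m * (x ^+ 2 + y ^+ 2) + 2 * path_cross m * x * y))))%:E.
Proof.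
elim: m x => [|m IH] x.
  rewrite /= /path_mass /path_diag /path_cross surd1 surd2 !expr0 divr1 sqrtr1 mul1r.
  by rewrite mul1r; congr (_%:E); congr expR; rewrite /edge_energy; field.
have D0 := path_diagS_gt0 m; have s1 := @surd_gt0 R m; have s2 := @surd_gt0 R m.+1.
rewrite /=; set A := lam * (path_diag m + 1); set B := lam * (x + 2 * path_cross m * y).
have A0 : 0 < A by rewrite mulr_gt0.
transitivity (\int[mu]_z ((path_mass m * expR (- (lam * (x ^+ 2 + path_diag m * y ^+ 2))))%:E *
   (expR (- (A * z ^+ 2 + B * z)))%:E))%E.
  apply: eq_integral => z _.
  transitivity (iint mu m (fun t => (expR (- (lam * edge_energy x z)))%:E * (expR (- (lam * path_energy z t y)))%:E)%E).
    by apply: eq_iint => t _; rewrite -EFinM -expRD mulrDr opprD.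
  rewrite iintZl ?lee_fin ?expR_ge0//; last first.
    apply/measurable_EFinP; apply: measurable_fun_exp; apply: measurable_funN; apply: measurable_funM => //.
    exact: (@mseq_path_energy m _ unit (fun=> z) (fun=> y)).
  rewrite IH -!EFinM mulrCA -[in RHS]mulrA -!expRD; congr (_ * expR _)%:E.
  by rewrite /edge_energy /A /B; ring.
rewrite ge0_integralZl//; last 2 first.
- apply/measurable_EFinP; apply: measurable_fun_exp; apply: measurable_funN; meas.
- by rewrite lee_fin mulr_ge0 ?sqrtr_ge0 ?expR_ge0.
rewrite integral_gaussian_linear// -EFinM path_massS; congr EFin.
rewrite mulrACA -expRD; congr (_ * expR _).
have inv := @surd_inv R m.+1.
rewrite /A /B /path_diag /path_cross !subrK [(-1) ^+ m.+1]exprS.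
have sg : (-1 : R) ^+ m * (-1) ^+ m = 1 by rewrite -exprD addnn -signr_odd odd_double.
move: (surdSS (R := R) m.+1) => ->; move: inv s1 s2 sg.
move: (surd m.+2) (surd m.+1) ((-1) ^+ m) => b a s inv a0 b0 sg.
have an : a != 0 by rewrite gt_eqF.
have bn : b != 0 by rewrite gt_eqF.
have ln : lam != 0 by rewrite gt_eqF.
apply/eqP; rewrite -subr_eq0.
(* After completion of the square the two exponents differ by a multiple of the relation
   [surd_inv]. *)
set Z := (X in X == 0).
have -> : Z = lam * y ^+ 2 / (2 * a * b) * (s * s - (b ^+ 2 - 4 * b * a + a ^+ 2)).
  by rewrite /Z; field; rewrite an bn ln.
by rewrite sg inv subrr mulr0.
Qed.

Lemma path_sum m : path_diag m + path_cross m =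
  (((2 + Num.sqrt 3) ^+ m.+1 + (2 - Num.sqrt 3) ^+ m.+1) / 2 + (-1) ^+ m) / (2 * surd m.+1).
Proof.
rewrite -surd_sub2 /path_diag /path_cross; have := @surd_gt0 R m.
by move: (surd m.+2) (surd m.+1) ((-1) ^+ m) => b a s a0; field; rewrite gt_eqF.
Qed.

Lemma path_sum_gt0 m : 0 < path_diag m + path_cross m.
Proof.
rewrite path_sum divr_gt0//; last by rewrite mulr_gt0// surd_gt0.
set a : R := 2 + Num.sqrt 3; have a2 : 2 <= a by rewrite lerDl sqrtr_ge0.
have h1 : 2 <= a ^+ m.+1.
  by rewrite exprS (le_trans a2)// ler_peMr ?(le_trans _ a2)// exprn_ege1// (le_trans _ a2)// ler1n.
have h2 : 0 < (2 - Num.sqrt 3 : R) ^+ m.+1.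
  by rewrite exprn_gt0// subr_gt0 -ltr_sqr ?nnegrE ?sqrtr_ge0// sqr_sqrtr//; lra.
have h3 : -1 <= (-1 : R) ^+ m.
  by rewrite -signr_odd; case: (odd _); rewrite ?expr1// expr0; lra.
move: h1 h2 h3; move: (a ^+ m.+1) ((2 - Num.sqrt 3 : R) ^+ m.+1) ((-1 : R) ^+ m) => u v s; lra.
Qed.

Definition cycle_energy k (z : nat -> R) : R := \sum_(i < k) edge_energy (z i) (z (side_next k i)).

Lemma path_energy_cycle k x t : size t = k.-1 -> (0 < k)%N ->
  path_energy x t x = cycle_energy k (nth 0 (x :: t)).
Proof.
move=> st k0; rewrite path_energyE st prednK// /cycle_energy; apply: eq_bigr => i _; congr edge_energy.
rewrite nth_rcons st /side_next; case: ltngtP => h.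
- by rewrite modn_small//; lia.
- by have := ltn_ord i; lia.
- by rewrite h prednK// modnn.
Qed.

(** The cycle is cut at its first vertex into a path from [x] to [x] with [k - 1] inner vertices,
    after which a single Gaussian integral in [x] is left. *)
Lemma iint_cycle k : (0 < k)%N ->
  iint mu k (fun z => (expR (- (lam * cycle_energy k (nth 0 z))))%:E) =
  (path_mass k.-1 * Num.sqrt (pi / (lam * (2 * (path_diag k.-1 + path_cross k.-1)))))%:E.
Proof.
move=> k0; rewrite -[k in iint _ k](prednK k0) /=.
have D0 := path_sum_gt0 k.-1.
transitivity (\int[mu]_x ((path_mass k.-1)%:E *
    (expR (- (lam * (2 * (path_diag k.-1 + path_cross k.-1)) * x ^+ 2)))%:E))%E.
  apply: eq_integral => x _.
  transitivity (iint mu k.-1 (fun t => (expR (- (lam * path_energy x t x)))%:E)).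
    by apply: eq_iint => t st; rewrite (path_energy_cycle x st k0).
  by rewrite iint_path EFinM; congr (_ * (expR _)%:E)%E; ring.
rewrite ge0_integralZl//; last 2 first.
- apply/measurable_EFinP; apply: measurable_fun_exp; apply: measurable_funN; meas.
- by rewrite lee_fin sqrtr_ge0.
by rewrite integral_gaussian// mulr_gt0// mulr_gt0.
Qed.

Lemma eq_cycle_energy k (z z' : nat -> R) : (forall i, (i < k)%N -> z i = z' i) ->
  cycle_energy k z = cycle_energy k z'.
Proof.
move=> zz; apply: eq_bigr => i _; rewrite !zz//.
by rewrite ltn_mod (leq_ltn_trans _ (ltn_ord i)).
Qed.

Lemma sum_side_next k (z : nat -> R) : (0 < k)%N -> \sum_(i < k) z (side_next k i) = \sum_(i < k) z i.
Proof.
case: k => [//|k] _; rewrite big_ord_recr big_ord_recl/= {2}/side_next modnn addrC; congr (_ + _).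
by apply: eq_bigr => i _; rewrite /side_next modn_small// ltnS.
Qed.

(** On the hyperplane of sum zero the linear term disappears, so the mean separates from the other
    variables. *)
Lemma cycle_energy_shift k (z : nat -> R) s : (0 < k)%N ->
  cycle_energy k (fun i => z i + s) =
  cycle_energy k z + 6 * s * \sum_(i < k) z i + 3 * k%:R * s ^+ 2.
Proof.
move=> k0; transitivity (cycle_energy k z + (3 * s * \sum_(i < k) z i + 3 * s * \sum_(i < k) z (side_next k i)) +
    \sum_(i < k) 3 * s ^+ 2).
  rewrite !mulr_sumr -!big_split/=; apply: eq_bigr => i _; rewrite /edge_energy; ring.
by rewrite sum_side_next// sumr_const card_ord -[_ *+ k]mulr_natl; ring.
Qed.

Lemma mseq_cycle_energy k n dP (P : measurableType dP) (z : P -> seq (measurableTypeR R) -> nat -> R) :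
  (forall i, mseq n (fun p t => z p t i : measurableTypeR R)) ->
  mseq n (fun p t => cycle_energy k (z p t) : R).
Proof.
move=> mz; apply: measurable_sum => i; rewrite /edge_energy; apply: measurable_funD.
  by apply: measurable_funD; apply: measurable_funX; exact: mz.
by apply: measurable_funM; exact: mz.
Qed.

Lemma sum_closed_coord k (t : seq R) : (0 < k)%N -> \sum_(i < k) closed_coord k t i = 0.
Proof.
case: k => [//|k] _; rewrite big_ord_recr/= {2}/closed_coord/= ltnn.
rewrite (eq_bigr (fun j : 'I_k => nth 0 t j)) ?subrr// => j _.
by rewrite /closed_coord/= ltn_ord.
Qed.

(* The last variable is replaced by the mean of all of them, then the others
   are translated by it. *)
Lemma iint_closed_cycle k : (0 < k)%N ->
  (iint mu k (fun z => (expR (- (lam * cycle_energy k (nth 0 z))))%:E) =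
  (k%:R * Num.sqrt (pi / (lam * (3 * k%:R))))%:E *
  iint mu k.-1 (fun t => (expR (- (lam * cycle_energy k (closed_coord k t))))%:E))%E.
Proof.
move=> k0; have kp : 0 < k%:R :> R by rewrite ltr0n.
have kn : k%:R != 0 :> R by rewrite gt_eqF.
set J := iint mu k.-1 _.
have J0 : (0 <= J)%E by apply: iint_ge0 => t; rewrite lee_fin expR_ge0.
pose z (tau : measurableTypeR R) (s : seq (measurableTypeR R)) i : R :=
  if (i < k.-1)%N then nth 0 s i else k%:R * tau - \sum_(j < k.-1) nth 0 s j.
pose G (tau : measurableTypeR R) (s : seq (measurableTypeR R)) : \bar R :=
  (k%:R * expR (- (lam * cycle_energy k (z tau s))))%:E.
have mG : mseq k.-1 G.
  apply/measurable_EFinP; apply: measurable_funM => //; apply: measurable_fun_exp.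
  apply: measurable_funN; apply: measurable_funM => //; apply: mseq_cycle_energy => i.
  rewrite /mseq /z; case: (i < k.-1)%N; first exact: mseq_nth.
  apply: measurable_funB; first by apply: measurable_funM.
  by apply: measurable_sum => j; exact: mseq_nth.
have G0 tau s : (0 <= G tau s)%E by rewrite lee_fin mulr_ge0// expR_ge0.
transitivity (iint mu k.-1 (fun s => \int[mu]_tau G tau s))%E.
  have ek : k = (k.-1 + 1)%N by rewrite addn1 prednK.
  rewrite [in LHS]ek iint_cat; apply: eq_iint => s ss /=.
  have mF : measurable_fun setT (fun u : measurableTypeR R => (expR (- (lam * cycle_energy (k.-1 + 1) (nth 0 (s ++ [:: u])))))%:E).
    apply/measurable_EFinP; apply: measurable_fun_exp; apply: measurable_funN; apply: measurable_funM => //.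
    have := @mseq_cycle_energy (k.-1 + 1) 0 _ (measurableTypeR R) (fun u _ => nth 0 (s ++ [:: u])).
    move=> /(_ _)/mseq0; apply => i; apply/mseq0.
    have [is_|is_] := ltnP i (size s).
      by rewrite (_ : (fun _ => _) = cst (nth 0 s i))//; apply/funext => u; rewrite nth_cat is_.
    case e : (i - size s)%N => [|j].
      by rewrite (_ : (fun _ => _) = id)//; apply/funext => u; rewrite nth_cat ltnNge is_ e.
    by rewrite (_ : (fun _ => _) = cst 0)//; apply/funext => u; rewrite nth_cat ltnNge is_ e /= nth_nil.
  rewrite (ge0_integral_affine (- \sum_(j < k.-1) nth 0 s j) kn mF); last by move=> u; rewrite lee_fin expR_ge0.
  rewrite gtr0_norm// -ge0_integralZl//; last first.
    exact: (measurableT_comp mF (measurable_affine k%:R (- \sum_(j < k.-1) nth 0 s j))).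
  apply: eq_integral => u _; rewrite -EFinM /G -ek; congr (_ * expR (- (_ * _)))%:E.
  apply: eq_cycle_energy => i ik; rewrite /z nth_cat ss; case: ltnP => // ik'.
  by rewrite (_ : i - k.-1 = 0)%N//; lia.
rewrite -integral_iint_swap//.
transitivity (\int[mu]_tau ((k%:R * expR (- (lam * (3 * k%:R) * tau ^+ 2)))%:E * J))%E.
  apply: eq_integral => tau _.
  rewrite (iint_affine tau (oner_neq0 R))//; last exact: (mseq_sec _ mG).
  have c0 : (0 <= (k%:R * expR (- (lam * (3 * k%:R) * tau ^+ 2)))%:E)%E by rewrite lee_fin mulr_ge0// expR_ge0.
  have f0 (s : seq (measurableTypeR R)) : (0 <= (expR (- (lam * cycle_energy k (closed_coord k s))))%:E)%E.
    by rewrite lee_fin expR_ge0.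
  rewrite normr1 expr1n mul1e -(iintZl _ c0 f0); last first.
    apply/measurable_EFinP; apply: measurable_fun_exp; apply: measurable_funN; apply: measurable_funM => //.
    by apply: (@mseq_cycle_energy k k.-1 _ unit (fun _ => closed_coord k)) => i; exact: mseq_closed_coord.
  apply: eq_iint => s ss; rewrite -EFinM; congr EFin; rewrite -[RHS]mulrA -expRD; congr (_ * expR _).
  rewrite (@eq_cycle_energy _ _ (fun i => closed_coord k s i + tau)); last first.
    move=> i ik; rewrite /z /closed_coord; case: ifP => ik'.
      by rewrite (nth_map 0) ?ss// mul1r.
    rewrite (eq_bigr (fun j : 'I_k.-1 => nth 0 s j + tau)); last first.
      by move=> j _; rewrite (nth_map 0) ?ss// mul1r.
    rewrite big_split/= sumr_const card_ord -[tau *+ _]mulr_natl -subn1 natrB//; ring.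
  rewrite cycle_energy_shift// sum_closed_coord//.
  ring.
have mE : measurable_fun setT (fun x : measurableTypeR R => (expR (- (lam * (3 * k%:R) * x ^+ 2)))%:E).
  by apply/measurable_EFinP; apply: measurable_fun_exp; apply: measurable_funN; meas.
rewrite ge0_integralZr//; last first.
  by apply/measurable_EFinP; apply: measurable_funM => //; exact/measurable_EFinP.
congr (_ * _)%E; under eq_integral do rewrite EFinM.
rewrite ge0_integralZl//.
by rewrite integral_gaussian ?EFinM// mulr_gt0// mulr_gt0.
Qed.

End gaussian_paths.

(** * Value of the limiting integral *)

Section limit_value.
Context {R : realType}.
Variables (k : nat) (rho : R).
Hypotheses (k3 : (3 <= k)%N) (rho0 : 0 < rho).
Local Notation mu := (@lebesgue_measure R).
Local Notation decay := (@decay R k rho).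

Let kpos : (0 < k)%N. Proof. by lia. Qed.
Let kp : 0 < k%:R :> R. Proof. by rewrite ltr0n. Qed.

Definition gauss_norm (a : R) : R := (Num.sqrt a * Num.sqrt (2 * pi))^-1.
Definition joint_norm : R := gauss_norm k%:R^-1 * gauss_norm (2 / k%:R).

(** The exponent of the first factor at vertex [i] is halved between the two edges there. Together
    with [(z + z')^2] from the second factor, each edge receives [k / 2] times [edge_energy]. *)
Lemma prod_gauss_factors (z : nat -> R) :
  \prod_(i < k) (gauss_factor k%:R^-1 (z i) * gauss_factor (2 / k%:R) (z i + z (side_prev k i))) =
  joint_norm ^+ k * expR (- (k%:R / 2 * cycle_energy k z)).
Proof.
pose f i := expR (- (k%:R / 4 * z i ^+ 2)).
pose g i := expR (- (k%:R / 4 * (z i + z (side_prev k i)) ^+ 2)).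
transitivity (joint_norm ^+ k * (\prod_(i < k) f i * \prod_(i < k) f i * \prod_(i < k) g i)).
  have -> : joint_norm ^+ k = \prod_(i < k) joint_norm by rewrite prodr_const card_ord.
  rewrite -!big_split/=; apply: eq_bigr => i _; rewrite /f /g /gauss_factor /joint_norm /gauss_norm.
  have -> : z i ^+ 2 / k%:R^-1 / 2 = k%:R / 4 * z i ^+ 2 + k%:R / 4 * z i ^+ 2.
    by field; rewrite gt_eqF.
  have -> : (z i + z (side_prev k i)) ^+ 2 / (2 / k%:R) / 2 = k%:R / 4 * (z i + z (side_prev k i)) ^+ 2.
    by field; rewrite gt_eqF.
  rewrite opprD expRD; ring.
congr (_ * _).
rewrite -{2}(prod_ordS f kpos) -(prod_ordS g kpos) -!big_split/=.
rewrite /cycle_energy mulr_sumr -sumrN (big_morph _ (@expRD R) (@expR0 R)).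
apply: eq_bigr => i _; rewrite /f /g -/(side_next k i) (side_prev_next k3 rho0)// -!expRD.
by congr expR; rewrite /edge_energy; field.
Qed.

Lemma closed_coord_take (t : seq R) i : closed_coord k (take k.-1 t) i = closed_coord k t i.
Proof.
rewrite /closed_coord; case: ifP => ik; first by rewrite nth_take.
by congr (- _); apply: eq_bigr => j _; rewrite nth_take.
Qed.

Lemma iint_limit_slice_closed : (iint mu (k.-1 + k) (fun t => (limit_slice k rho t)%:E) =
  (joint_norm ^+ k * (decay^-1) ^+ k)%:E *
  iint mu k.-1 (fun t => (expR (- (k%:R / 2 * cycle_energy k (closed_coord k t))))%:E))%E.
Proof.
pose F (t : seq (measurableTypeR R)) : \bar R :=
  (joint_norm ^+ k * expR (- (k%:R / 2 * cycle_energy k (closed_coord k t))))%:E.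
pose h (i : nat) (y : measurableTypeR R) : R := (0 <= y)%R%:R * expR (- (decay * y)).
pose G (t : seq (measurableTypeR R)) : \bar R := (\prod_(i < k) h i (nth 0 t i))%:E.
have mh i : measurable_fun setT (h i).
  apply: measurable_funM; last exact: measurable_expRN.
  by apply: measurable_boolR; apply: measurable_fun_ler.
have h0 i y : 0 <= h i y by rewrite mulr_ge0// expR_ge0.
have n0 a : 0 <= gauss_norm a by rewrite invr_ge0 mulr_ge0 ?sqrtr_ge0.
have j0 : 0 <= joint_norm by rewrite mulr_ge0.
have mE : mseqF k.-1 (fun t => (expR (- (k%:R / 2 * cycle_energy k (closed_coord k t))))%:E : \bar R).
  apply/measurable_EFinP; apply: measurable_fun_exp; apply: measurable_funN; apply: measurable_funM => //.
  by apply: (@mseq_cycle_energy R k k.-1 _ unit (fun _ => closed_coord k)) => i; exact: mseq_closed_coord.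
have mF : mseqF k.-1 F.
  by apply/measurable_EFinP; apply: measurable_funM => //; exact/measurable_EFinP.
have mG : mseqF k G by apply/measurable_EFinP; exact: (@mseq_prod_nth _ k _ unit h k mh).
transitivity (iint mu (k.-1 + k) (fun t => (F (take k.-1 t) * G (drop k.-1 t))%E)).
  apply: eq_iint => t _; rewrite /F /G -EFinM; congr EFin.
  rewrite -prod_gauss_factors /limit_slice -big_split/=; apply: eq_bigr => i _.
  by rewrite !closed_coord_take nth_drop mulrCA mulrA mulrC mulrCA /h; ring.
have F0 t : (0 <= F t)%E by rewrite lee_fin mulr_ge0 ?expR_ge0// exprn_ge0.
have G0 t : (0 <= G t)%E by rewrite lee_fin; apply: prodr_ge0.
rewrite (iint_cat_prod mu F0 G0 mF mG).
have -> : iint mu k G = ((decay^-1) ^+ k)%:E.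
  have -> : (decay^-1) ^+ k = \prod_(i < k) decay^-1 by rewrite prodr_const card_ord.
  apply: (@iint_prod R k h (fun=> decay^-1)) => // i _.
  rewrite /h integral_ge0_gt0; last exact: measurable_expRN.
  by rewrite integral_expN// decay_gt0.
have -> : iint mu k.-1 F = ((joint_norm ^+ k)%:E *
    iint mu k.-1 (fun t => (expR (- (k%:R / 2 * cycle_energy k (closed_coord k t))))%:E))%E.
  by rewrite -iintZl// lee_fin exprn_ge0.
by rewrite [in RHS]EFinM -!muleA; congr (_ * _)%E; rewrite muleC.
Qed.

Definition cycle_det : R := (2 + Num.sqrt 3) ^+ k + (2 - Num.sqrt 3) ^+ k + 2 * (-1) ^+ k.-1.

Lemma cycle_det_gt0 : 0 < cycle_det.
Proof.
have := @path_sum_gt0 R k.-1; rewrite path_sum pmulr_lgt0; last first.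
  by rewrite invr_gt0 mulr_gt0// surd_gt0.
rewrite prednK// /cycle_det; move: (_ ^+ k) ((2 - _) ^+ k) (_ ^+ k.-1) => u v s; lra.
Qed.

(** The integral over all of the cycle variables divided by the contribution of their mean, which is
    the square root of [2 * pi / 3] whatever [k] is. *)
Definition closed_mass : R := Num.sqrt ((4 * pi / k%:R) ^+ k / cycle_det * (3 / (2 * pi))).

Lemma iint_closed_value :
  (iint mu k.-1 (fun t => (expR (- (k%:R / 2 * cycle_energy k (closed_coord k t))))%:E) = closed_mass%:E)%E.
Proof.
have l0 : 0 < k%:R / 2 :> R by rewrite divr_gt0.
have := iint_closed_cycle l0 kpos; rewrite (iint_cycle l0 kpos).
set J := iint mu k.-1 _; set c := k%:R * Num.sqrt _; set I := path_mass _ _ * _.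
have p0 := @pi_gt0 R; have E0 := cycle_det_gt0.
have s0 := @surd_gt0 R k.-1.
have c0 : c != 0.
  by rewrite gt_eqF// mulr_gt0// sqrtr_gt0 divr_gt0// mulr_gt0// mulr_gt0.
have cE : c = Num.sqrt (2 * pi / 3).
  have kE : k%:R = Num.sqrt (k%:R ^+ 2) :> R by rewrite sqrtr_sqr gtr0_norm.
  rewrite /c {1}kE -sqrtrM ?exprn_ge0//; congr Num.sqrt; move: (pi : R) => p; field.
  by rewrite gt_eqF.
have IE : I = c * closed_mass.
  have u0 : 0 <= (2 * (pi : R) / (k%:R / 2)) ^+ k.-1 / surd k.-1.+1.
    by rewrite divr_ge0 ?(ltW s0)// exprn_ge0// divr_ge0 ?(ltW l0)// mulr_ge0// ltW.
  rewrite /I cE /path_mass /closed_mass -!sqrtrM//; last by rewrite divr_ge0// mulr_ge0// ltW.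
  congr Num.sqrt; rewrite path_sum prednK//.
  have -> : ((2 + Num.sqrt 3) ^+ k + (2 - Num.sqrt 3) ^+ k) / 2 + (-1) ^+ k.-1 = cycle_det / 2.
    by rewrite /cycle_det; move: (_ ^+ k) ((2 - _) ^+ k) (_ ^+ k.-1) => u v s; field.
  have -> : 2 * (pi : R) / (k%:R / 2) = 4 * pi / k%:R by move: (pi : R) => p; field; rewrite gt_eqF.
  rewrite -[in (4 * pi / k%:R) ^+ k](prednK kpos) [(_ / _) ^+ k.-1.+1]exprS.
  rewrite prednK// in s0 *; move: s0 E0 p0.
  move: (surd k) => s; move: cycle_det => E; move: ((4 * pi / k%:R) ^+ k.-1) => u.
  move: (@pi R) => p s0 E0 p0; field.
  by rewrite !gt_eqF.
rewrite IE EFinM => h; have := congr1 (fun z => (c^-1)%:E * z)%E h.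
by rewrite ![((c^-1)%:E * (_ * _))%E]muleA -[((c^-1)%:E * c%:E)%E]EFinM mulVf// !mul1e.
Qed.

Lemma iint_limit_slice : (iint mu (k.-1 + k) (fun t => (limit_slice k rho t)%:E) =
  (joint_norm ^+ k * (decay^-1) ^+ k * closed_mass)%:E)%E.
Proof. by rewrite iint_limit_slice_closed iint_closed_value -EFinM. Qed.

End limit_value.

(** * Asymptotics of the probability *)

Section constants.
Context {R : realType}.
Variables (k : nat) (c : R * R) (rho phi : R).
Hypotheses (k3 : (3 <= k)%N) (rho0 : 0 < rho).
Local Notation K := (regular_polygon k c rho phi).
Local Notation r := (side k rho).
Local Notation S1 := (@sinm R k 1).
Local Notation cosa := (cos (@step_angle R k)).
Hypothesis K1 : lebesgue_measure2 R K = 1%E.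

Let kpos : (0 < k)%N. Proof. by lia. Qed.
Let kp : 0 < k%:R :> R. Proof. by rewrite ltr0n. Qed.
Let S10 : 0 < S1. Proof. exact: sinm1_gt0. Qed.
Let r0 : 0 < r. Proof. exact: side_gt0. Qed.

Lemma half_step : step_angle k / 2 = pi / k%:R :> R.
Proof. by rewrite /step_angle; field; rewrite gt_eqF. Qed.

(** Area one fixes the circumradius [rho] and thereby the side. *)
Lemma side_lengthE : side_length R k = r.
Proof.
have := area_polygon c phi k3 rho0; rewrite K1 => -[].
have -> : S1 = 2 * sin (step_angle k / 2) * cos (step_angle k / 2).
  rewrite /sinm mul1r; set x := step_angle k / 2; have -> : step_angle k = x + x by rewrite /x; field.
  by rewrite sinD; ring.
have := sin_half_gt0 k3 rho0; have := cos_half_gt0 k3 rho0.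
rewrite /side_length /tan /side -half_step; move: (sin _) (cos _) => s q q0 s0 e.
have h : rho * (2 * s) = Num.sqrt ((rho * (2 * s)) ^+ 2).
  by rewrite sqrtr_sqr gtr0_norm// !mulr_gt0.
rewrite h; congr Num.sqrt.
have -> : (rho * (2 * s)) ^+ 2 = (k%:R * (rho ^+ 2 * (2 * s * q) / 2)) * (4 * (s / q) / k%:R).
  by field; rewrite !gt_eqF.
by rewrite -e mul1r.
Qed.

Lemma thetaE : theta R k = pi - step_angle k.
Proof. by rewrite /theta /step_angle; field; rewrite gt_eqF. Qed.

Lemma sin_theta : sin (theta R k) = S1.
Proof. by rewrite thetaE sinB sinpi cospi /sinm mul1r; ring. Qed.

Lemma cos_theta : cos (theta R k) = - cosa.
Proof. by rewrite thetaE cosB sinpi cospi; ring. Qed.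

(** The part of [equivalent_seq] that depends on the sample size, with the real power of [N] split
    into an integer power and a power of its square root. *)
Definition growth N : R := expR (2 * N%:R) / 4 ^+ N *
  (k%:R ^+ (3 * N) * r ^+ (2 * N) * S1 ^+ N / (N%:R ^+ (2 * N) * Num.sqrt N%:R ^+ k)).

Lemma growth_gt0 N : (0 < N)%N -> 0 < growth N.
Proof.
move=> N0; have Np : 0 < N%:R :> R by rewrite ltr0n.
have h0 : 0 < 4 :> R by [].
rewrite /growth mulr_gt0 ?divr_gt0 ?expR_gt0 ?exprn_gt0//.
  by apply: mulr_gt0; [apply: mulr_gt0|]; rewrite exprn_gt0.
by apply: mulr_gt0; rewrite exprn_gt0 ?sqrtr_gt0.
Qed.

Lemma equivalent_seqE N : (0 < N)%N -> equivalent_seq R k N = C_const R k * growth N.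
Proof.
move=> N0; have Np : 0 < N%:R :> R by rewrite ltr0n.
rewrite /equivalent_seq -mulrA side_lengthE sin_theta; congr (_ * (_ * (_ / _))).
rewrite powRD; last by rewrite (gt_eqF Np) implybT.
congr (_ * _); first by rewrite -natrM powR_mulrn// ltW.
by rewrite mulrC powRrM powR12_sqrt ?(ltW Np)// powR_mulrn// sqrtr_ge0.
Qed.

(** An exact identity: the factorial is [stir] times Stirling's main term, and the rest is algebra
    once everything is expressed by powers of [s], the square root of the sample size, and [e]. *)
Lemma fact_slice_const n :
  (k + n)`!%:R * (slice_const k rho n * Num.sqrt (npts k n) ^+ k.-1) =
  (2 / (S1 * r * k%:R)) ^+ k * stir (k + n) * growth (k + n).
Proof.
have N0 : (0 < k + n)%N by rewrite addn_gt0 kpos.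
have Np : 0 < (k + n)%:R :> R by rewrite ltr0n.
set s := Num.sqrt (k + n)%:R : R; have s0 : 0 < s by rewrite sqrtr_gt0.
have XE : (k + n)%:R = s ^+ 2 :> R by rewrite sqr_sqrtr// ltW.
set e := expR (k + n)%:R : R; have e0 : 0 < e := expR_gt0 _.
have ss m : s ^+ 2 ^+ m = s ^+ m * s ^+ m by rewrite -exprM mul2n -addnn exprD.
have F : (k + n)`!%:R = stir (k + n) * (s * (s ^+ k * s ^+ k * (s ^+ n * s ^+ n) / e)) :> R.
  rewrite /stir -/s expRN -/e exprD -!exprMn -expr2 -XE -exprD divfK//.
  by rewrite gt_eqF// !mulr_gt0 ?invr_gt0 ?exprn_gt0.
have SC : slice_const k rho n = S1 ^+ n * e ^+ 3 / ((s ^+ k * s ^+ k * (s ^+ n * s ^+ n)) / (k%:R ^+ k * k%:R ^+ n)) *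
   (r ^+ k * k%:R ^+ k / (2 ^+ k * (s ^+ k * s ^+ k)) * (r ^+ n * k%:R ^+ n / (2 ^+ n * (s ^+ n * s ^+ n))) ^+ 2) / (s ^+ k * s ^+ k) ^+ 2.
  rewrite /slice_const /mean /npts -/e !XE; congr (_ / _ * _ / _).
  - by rewrite expr_div_n !exprD !ss.
  - have -> : r / (2 * (s ^+ 2 / k%:R)) = r * k%:R / (2 * s ^+ 2) by field; rewrite !gt_eqF.
    by rewrite exprD mulnC exprM !expr_div_n !exprMn ?ss.
  - by rewrite mulnC exprM ss.
have G : growth (k + n) = e ^+ 2 / (2 ^+ k * 2 ^+ n) ^+ 2 * ((k%:R ^+ k * k%:R ^+ n) ^+ 3 * (r ^+ k * r ^+ n) ^+ 2 *
   (S1 ^+ k * S1 ^+ n) / ((s ^+ k * s ^+ k * (s ^+ n * s ^+ n)) ^+ 2 * s ^+ k)).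
  rewrite /growth -/s !XE; congr (_ / _ * (_ * _ * _ / (_ * _))).
  - by rewrite -XE expRM_natl.
  - by rewrite -exprD -exprM mulnC exprM; congr (_ ^+ _); ring.
  - by rewrite -exprD mulnC exprM.
  - by rewrite -exprD mulnC exprM.
  - by rewrite exprD.
  - by rewrite mulnC exprM exprD !ss.
rewrite /npts -/s F SC G.
have -> : (2 / (S1 * r * k%:R)) ^+ k = 2 ^+ k / (S1 ^+ k * r ^+ k * k%:R ^+ k).
  by rewrite expr_div_n !exprMn.
have sk : s ^+ k = s * s ^+ k.-1 by rewrite -exprS prednK.
rewrite sk.
have p1 := exprn_gt0 k.-1 s0; have p2 := exprn_gt0 n s0.
have p3 := exprn_gt0 k S10; have p4 := exprn_gt0 k r0; have p5 := exprn_gt0 k kp.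
have p6 := exprn_gt0 n kp.
have p7 : 0 < 2 ^+ k :> R by rewrite exprn_gt0.
have p8 : 0 < 2 ^+ n :> R by rewrite exprn_gt0.
clear F SC G sk XE.
move: p1 p2 p3 p4 p5 p6 p7 p8; move: (stir _) => st.
move: (s ^+ k.-1) (s ^+ n) (S1 ^+ k) (S1 ^+ n) (r ^+ k) (r ^+ n) (k%:R ^+ k) (k%:R ^+ n) (2 ^+ k) (2 ^+ n).
move=> a b d f g h i j l m p1 p2 p3 p4 p5 p6 p7 p8; move: s0 e0; move: (s) (e) => s' e' s0 e0.
field.
by rewrite !gt_eqF.
Qed.

Lemma d_constE : d_const R k = k%:R / (3 * 2 ^+ k) * cycle_det k.
Proof. by rewrite /d_const /cycle_det; congr (_ * _); ring. Qed.

Lemma C_constE : Num.sqrt (2 * pi) * (2 / (S1 * r * k%:R)) ^+ k *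
  (joint_norm k ^+ k * (decay k rho)^-1 ^+ k * closed_mass k) = C_const R k.
Proof.
have p0 := @pi_gt0 R; have E0 : 0 < cycle_det k :> R := cycle_det_gt0 k3 rho0.
set C1 : R := 1 - cosa; have C10 : 0 < C1 by rewrite subr_gt0; exact: cos_step_lt1.
have -> : Num.sqrt (2 * pi) * (2 / (S1 * r * k%:R)) ^+ k *
  (joint_norm k ^+ k * (decay k rho)^-1 ^+ k * closed_mass k) =
  (Num.sqrt (2 * pi) * joint_norm k ^+ k * closed_mass k * 2 ^+ k) / (4 ^+ k * C1 ^+ k).
  have -> : Num.sqrt (2 * pi) * (2 / (S1 * r * k%:R)) ^+ k * (joint_norm k ^+ k * (decay k rho)^-1 ^+ k * closed_mass k) =
    Num.sqrt (2 * pi) * joint_norm k ^+ k * closed_mass k * ((2 / (S1 * r * k%:R)) ^+ k * (decay k rho)^-1 ^+ k) by ring.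
  rewrite -[RHS]mulrA; congr (_ * _); rewrite -!exprMn -expr_div_n; congr (_ ^+ _).
  rewrite /decay /slope -/C1; move: r0 S10 C10; clearbody C1; move: (side _ _) S1 => u v *; field.
  by rewrite !gt_eqF.
rewrite /C_const cos_theta -/C1 mulrA mul1r; congr (_ / _).
have pk : pi `^ (k%:R / 2) = Num.sqrt pi ^+ k :> R.
  by rewrite mulrC powRrM powR12_sqrt ?(ltW p0)// powR_mulrn// sqrtr_ge0.
have d0 : 0 < d_const R k by rewrite d_constE mulr_gt0// divr_gt0// mulr_gt0// exprn_gt0.
have dn : Num.sqrt (d_const R k) != 0 by rewrite gt_eqF// sqrtr_gt0.
have pn : Num.sqrt pi ^+ k != 0 :> R by rewrite expf_neq0// gt_eqF// sqrtr_gt0.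
have AB : Num.sqrt pi ^+ k * Num.sqrt (d_const R k) != 0 by rewrite mulf_neq0.
rewrite pk; apply: (mulfI AB); rewrite [RHS]mulrA mulfV// mul1r.
have j0 : (0 : R) <= joint_norm k by rewrite mulr_ge0 ?invr_ge0 ?mulr_ge0 ?sqrtr_ge0.
have jn2 : (joint_norm k : R) ^+ 2 = k%:R ^+ 2 / (8 * pi ^+ 2).
  rewrite /joint_norm /gauss_norm exprMn !exprVn !exprMn !sqr_sqrtr ?invr_ge0 ?divr_ge0 ?mulr_ge0 ?ler0n ?(ltW p0)//.
  by move: p0; move: (@pi R) => p ?; field; rewrite !gt_eqF.
have sq (x : R) m : 0 <= x -> (Num.sqrt x ^+ m) ^+ 2 = x ^+ m by move=> x0; rewrite -exprM mulnC exprM sqr_sqrtr.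
have M2 : (closed_mass k : R) ^+ 2 = 4 ^+ k * pi ^+ k / k%:R ^+ k / cycle_det k * (3 / (2 * pi)).
  rewrite sqr_sqrtr; first by rewrite expr_div_n exprMn.
  rewrite mulr_ge0//; last by rewrite divr_ge0// mulr_ge0// ltW.
  by rewrite divr_ge0 ?(ltW E0)// exprn_ge0// divr_ge0// mulr_ge0// ltW.
(* Both sides are nonnegative, so their squares are compared, which removes the square roots. *)
apply: (@pexpIrn R 2 isT); rewrite ?nnegrE.
- by rewrite !mulr_ge0 ?exprn_ge0 ?sqrtr_ge0.
- by rewrite exprn_ge0// sqrtr_ge0.
rewrite [RHS]sq//.
have -> : (Num.sqrt pi ^+ k * Num.sqrt (d_const R k) * (Num.sqrt (2 * pi) * joint_norm k ^+ k * closed_mass k * 2 ^+ k)) ^+ 2 =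
  (Num.sqrt pi ^+ k) ^+ 2 * Num.sqrt (d_const R k) ^+ 2 * Num.sqrt (2 * pi) ^+ 2 * (joint_norm k ^+ 2) ^+ k *
  closed_mass k ^+ 2 * (2 ^+ k) ^+ 2.
  rewrite -[(joint_norm k ^+ 2) ^+ k]exprM mul2n -addnn exprD.
  by move: (_ ^+ k) (joint_norm k ^+ k) (closed_mass k) (2 ^+ k) => *; ring.
rewrite (sq _ _ (ltW p0)) M2 jn2 !sqr_sqrtr ?(ltW d0) ?mulr_ge0 ?(ltW p0)// d_constE.
have -> : (k%:R ^+ 2 / (8 * pi ^+ 2)) ^+ k = (k%:R ^+ k) ^+ 2 / ((2 ^+ k) ^+ 3 * (pi ^+ k) ^+ 2) :> R.
  have swap (x : R) i : (x ^+ k) ^+ i = (x ^+ i) ^+ k by rewrite -!exprM mulnC.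
  rewrite !swap -exprMn -expr_div_n; congr ((_ / (_ * _)) ^+ k); ring.
have -> : 4 ^+ k = (2 ^+ k) ^+ 2 :> R by rewrite -exprM mulnC exprM; congr (_ ^+ k); ring.
rewrite [RHS]exprS.
have p1 : 0 < pi ^+ k :> R by rewrite exprn_gt0.
have p2 : 0 < k%:R ^+ k :> R by rewrite exprn_gt0.
have p3 : 0 < 2 ^+ k :> R by rewrite exprn_gt0.
move: p1 p2 p3 p0 E0; clear.
move: (cycle_det k) => E; move: (pi ^+ k) => a; move: (k%:R ^+ k) => b; move: (2 ^+ k) => d.
move: (@pi R) => p a0 b0 d0 p0 E0; field.
by rewrite !gt_eqF.
Qed.

End constants.

Section polynomial_geometric.
Context {R : realType}.

(** Writing [q] as the power [m + 1] of [s < 1], each of the [m] factors [n + 1] is paired with one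
    [s ^+ n] and stays bounded, while the last [s ^+ n] tends to zero. *)
Lemma cvg_poly_geometric (q : R) m : 0 < q < 1 -> n.+1%:R ^+ m * q ^+ n @[n --> \oo] --> (0 : R).
Proof.
move=> /andP[q0 q1]; pose x : R := - ln q / m.+1%:R.
have m1 : 0 < m.+1%:R :> R by [].
have x0 : 0 < x by rewrite divr_gt0// oppr_gt0 ln_lt0// q0.
pose s : R := expR (- x); have s0 : 0 < s := expR_gt0 _.
have s1 : s < 1 by rewrite /s expR_lt1 oppr_lt0.
have qE : q = s ^+ m * s.
  rewrite -exprSr -expRM_natl -[LHS]lnK ?posrE//; congr expR; rewrite /x.
  by move: (m.+1%:R) m1 => z z0; field; rewrite gt_eqF.
pose C : R := x^-1 + 1.
have C0 : 0 <= C by rewrite addr_ge0// invr_ge0 ltW.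
have bnd n : n.+1%:R * s ^+ n <= C.
  rewrite -expRM_natl mulrN expRN ler_pdivrMr ?expR_gt0//.
  apply: (@le_trans _ _ (C * (1 + n%:R * x))); last by rewrite ler_wpM2l// expR_ge1Dx.
  have -> : C * (1 + n%:R * x) = n.+1%:R + (x^-1 + n%:R * x).
    by rewrite /C -natr1; move: (n%:R : R) => z; field; rewrite gt_eqF.
  rewrite lerDl; apply: addr_ge0; first by rewrite invr_ge0 ltW.
  by apply: mulr_ge0 => //; exact: ltW.
apply: (@squeeze_cvgr _ _ _ R (fun=> 0) (fun n => C ^+ m * s ^+ n)).
- apply: nearW => n; rewrite mulr_ge0 ?exprn_ge0 ?(ltW q0)//=.
  rewrite qE exprMn -exprM mulnC exprM mulrA -exprMn ler_wpM2r ?exprn_ge0 ?(ltW s0)//.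
  by rewrite lerXn2r ?nnegrE ?mulr_ge0 ?exprn_ge0 ?(ltW s0)//; exact: bnd.
- exact: cvg_cst.
- rewrite -(mulr0 (C ^+ m)); apply: cvgM; first exact: cvg_cst.
  by apply: cvg_expr; rewrite gtr0_norm.
Qed.

End polynomial_geometric.

Lemma size_boxes m n : size (boxes m n) = (n ^ m)%N.
Proof.
elim: m => [|m IH]; first by rewrite expn0.
by rewrite /= size_allpairs size_iota IH expnS.
Qed.

Lemma fact_add_le a b : ((a + b)`! <= a`! * (a + b) ^ b)%N.
Proof.
elim: b => [|b IH]; first by rewrite addn0 muln1.
rewrite addnS factS expnS mulnCA leq_mul2l; apply/orP; right.
rewrite (leq_trans IH)// leq_mul2l; apply/orP; right; case: b {IH} => // b.
by rewrite leq_exp2r// leqnSn.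
Qed.

Lemma lee_sum_mem (R : realDomainType) (I : eqType) (s : seq I) (f g : I -> \bar R) :
  (forall i, i \in s -> (f i <= g i)%E) -> (\sum_(i <- s) f i <= \sum_(i <- s) g i)%E.
Proof. by move=> fg; rewrite big_seq [leRHS]big_seq; apply: lee_sum. Qed.

Section degenerate_sum.
Context {R : realType}.
Variables (k : nat) (c : R * R) (rho phi : R).
Hypotheses (k3 : (3 <= k)%N) (rho0 : 0 < rho).
Local Notation K := (regular_polygon k c rho phi).
Local Notation r := (side k rho).
Local Notation S1 := (@sinm R k 1).
Hypothesis K1 : lebesgue_measure2 R K = 1%E.

Let kpos : (0 < k)%N. Proof. by lia. Qed.
Let kp : 0 < k%:R :> R. Proof. by rewrite ltr0n. Qed.
Let S10 : 0 < S1. Proof. exact: sinm1_gt0. Qed.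
Let r0 : 0 < r. Proof. exact: side_gt0. Qed.

Definition deg_sum n : \bar R := (\sum_(p < k) \sum_(pi <- deg_patterns k p)
  \sum_(ts <- comps k (k + n - p)%N) deg_volume k c rho phi n p pi ts)%E.

Lemma deg_sum_le n : (deg_sum n <= (\sum_(p < k) k%:R ^+ k * (k + n).+1%:R ^+ k * deg_const k rho (k + n - p))%:E)%E.
Proof.
rewrite -sumEFin; apply: lee_sum => p _.
set M := (k + n - p)%N; have dc := deg_const_ge0 k3 rho0 M.
apply: (@le_trans _ _ (\sum_(pi <- deg_patterns k p) \sum_(ts <- comps k M) (deg_const k rho M)%:E))%E.
  apply: lee_sum_mem => pi pip; apply: lee_sum_mem => ts tsc.
  exact: deg_volume_le.
rewrite !sumEFin lee_fin !big_const_seq !count_predT !iter_addr_0 -mulrnA -[leLHS]mulr_natl.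
rewrite ler_wpM2r// natrM mulrC; apply: ler_pM; rewrite ?ler0n//.
  rewrite -natrX ler_nat size_filter (leq_trans (count_size _ _))// size_boxes leq_exp2r//.
  exact: ltnW.
rewrite -natrX ler_nat size_filter (leq_trans (count_size _ _))// size_boxes leq_exp2r//.
by rewrite ltnS leq_subr.
Qed.

(** By Stirling's bound for [(2 N)]!, the estimate [deg_const] grows like [growth] with one base [k]
    replaced by [k - 1]; all other discrepancies are polynomial in [N]. *)
Lemma deg_ratio_le : exists2 B : R, 0 <= B & forall N, (k <= N)%N ->
  N`!%:R * (\sum_(p < k) k%:R ^+ k * N.+1%:R ^+ k * deg_const k rho (N - p)) <=
  B * (N.+1%:R ^+ (5 * k) * (k.-1%:R / k%:R) ^+ N) * growth k rho N.
Proof.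
have [Cs Cs0 hCs] := @stir_inv_bound R.
have k10 : 0 < k.-1%:R :> R by rewrite ltr0n; lia.
have [A [A0 AE]] : exists x : R, 0 < x /\ x = S1 * (k%:R * r) ^+ 2 * k.-1%:R.
  by eexists; split; last reflexivity; rewrite mulr_gt0// mulr_gt0// exprn_gt0// mulr_gt0.
have [B1 [B10 B1E]] : exists x : R, 0 <= x /\ x = (1 + A^-1) ^+ k.
  by eexists; split; last reflexivity; rewrite exprn_ge0// addr_ge0// invr_ge0 ltW.
have [B2 [B20 B2E]] : exists x : R, 0 <= x /\ x = k.-1%:R ^+ k.-1 * B1 * 4 ^+ k * Cs.
  by eexists; split; last reflexivity; rewrite !mulr_ge0 ?exprn_ge0 ?(ltW Cs0).
exists (k%:R * k%:R ^+ k * B2); first by rewrite !mulr_ge0 ?exprn_ge0.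
move=> N kN; have N0 : (0 < N)%N by rewrite (leq_trans kpos).
have Np : 0 < N%:R :> R by rewrite ltr0n.
have gr := @growth_gt0 R k rho k3 rho0 N N0.
set q : R := k.-1%:R / k%:R; have q0 : 0 < q by rewrite divr_gt0.
have e5 : (5 * k = k + 4 * k)%N by rewrite -[5%N]/(1 + 4)%N mulnDl mul1n.
have e4 : (4 * k = 2 * k + 2 * k)%N by rewrite -mulnDl.
suff key p : (p < k)%N -> N`!%:R * deg_const k rho (N - p) <= B2 * (N.+1%:R ^+ (4 * k) * q ^+ N) * growth k rho N.
  rewrite mulr_sumr; apply: (@le_trans _ _ (\sum_(p < k) k%:R ^+ k * N.+1%:R ^+ k *
    (B2 * (N.+1%:R ^+ (4 * k) * q ^+ N) * growth k rho N))).
    apply: ler_sum => p _; rewrite mulrCA; apply: ler_wpM2l; last exact: key.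
    by rewrite mulr_ge0// exprn_ge0.
  rewrite sumr_const card_ord -[leLHS]mulr_natl e5 exprD le_eqVlt; apply/orP; left; apply/eqP.
  by move: (N.+1%:R ^+ k) (N.+1%:R ^+ (4 * k)) (growth _ _ _) (q ^+ N) (k%:R ^+ k) => *; ring.
move=> pk; set M := (N - p)%N.
have MN : (M + p = N)%N by rewrite subnK// (leq_trans (ltnW pk)).
(* There are at most [k - 1] contact points, so [M + k.-1 >= N]. *)
have f1 : N`!%:R / (M + k.-1)`!%:R <= 1 :> R.
  rewrite ler_pdivrMr ?ltr0n ?fact_gt0// mul1r ler_nat.
  by apply: leq_fact; move: MN pk kpos; clear; lia.
have f2 : ((2 * M)`!%:R)^-1 <= (2 * N)%:R ^+ (2 * k) / (2 * N)`!%:R :> R.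
  rewrite -[leLHS]mul1r ler_pdivrMr ?ltr0n ?fact_gt0// mulrAC ler_pdivlMr ?ltr0n ?fact_gt0// mul1r.
  rewrite -natrX -natrM ler_nat -MN mulnDr (leq_trans (fact_add_le _ _))//.
  rewrite mulnC leq_mul2r -mulnDr MN; apply/orP; right.
  by rewrite leq_pexp2l ?muln_gt0// leq_mul2l /= ltnW.
have f3 : ((2 * N)`!%:R)^-1 <= Cs * (expR N%:R ^+ 2 / (2 * N)%:R ^+ (2 * N)) :> R.
  have N2 : (0 < 2 * N)%N by rewrite muln_gt0.
  have Np2 : 0 < (2 * N)%:R :> R by rewrite ltr0n.
  have st := @stir_gt0 R _ N2; have sq1 : 1 <= Num.sqrt (2 * N)%:R :> R.
    by rewrite -[X in X <= _]sqrtr1 ler_sqrt// ler1n.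
  have e2 : expR (2 * N)%:R = expR N%:R ^+ 2 :> R by rewrite natrM expRM_natl.
  have -> : ((2 * N)`!%:R)^-1 = (stir (2 * N))^-1 * (Num.sqrt (2 * N)%:R)^-1 *
     (expR N%:R ^+ 2 / (2 * N)%:R ^+ (2 * N)) :> R.
    rewrite /stir expRN e2; have := @fact_gt0 (2 * N); rewrite -(ltr0n R).
    have := exprn_gt0 (2 * N) Np2; have := exprn_gt0 2 (@expR_gt0 R N%:R).
    have s0 : 0 < Num.sqrt (2 * N)%:R :> R by rewrite (lt_le_trans _ sq1).
    move: s0; move: (Num.sqrt _) ((_`!)%:R) (_ ^+ (2 * N)) (_ ^+ 2) => a b d f a0 f0 d0 b0; field.
    by rewrite !gt_eqF.
  rewrite ler_wpM2r ?divr_ge0 ?exprn_ge0 ?expR_ge0// -[leRHS]mulr1.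
  apply: ler_pM; rewrite ?invr_ge0 ?(ltW st) ?sqrtr_ge0 ?hCs//.
  by rewrite invf_le1// (lt_le_trans _ sq1).
have f4 : A ^+ M <= A ^+ N * B1.
  rewrite -MN exprD -mulrA ler_peMr ?exprn_ge0 ?(ltW A0)//.
  have -> : B1 = (1 + A^-1) ^+ p * (1 + A^-1) ^+ (k - p) by rewrite B1E -exprD subnKC// ltnW.
  have a1 : 1 <= 1 + A^-1 by rewrite lerDl invr_ge0 ltW.
  rewrite mulrA -exprMn mulr_ege1// exprn_ege1// mulrDr mulr1 mulfV ?gt_eqF//.
  by rewrite lerDr ltW.
(* [A] is [S1 * k^3 * r^2] times [q]: the spare factor [q = (k - 1) / k] per point is the geometric
   gain over the main part. *)
have f5 : A ^+ N * (expR N%:R ^+ 2 / (2 * N)%:R ^+ (2 * N)) = growth k rho N * Num.sqrt N%:R ^+ k * q ^+ N.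
  have -> : A = S1 * (k%:R ^+ 3 * r ^+ 2) * q.
    by rewrite AE /q exprMn; field; rewrite gt_eqF.
  have e2 : (2 * N)%:R ^+ (2 * N) = 4 ^+ N * (N%:R ^+ 2) ^+ N :> R.
    by rewrite natrM exprM -[RHS]exprMn; congr (_ ^+ N); ring.
  rewrite /growth expRM_natl e2 (exprM k%:R) (exprM r) (exprM N%:R).
  have -> : (S1 * (k%:R ^+ 3 * r ^+ 2) * q) ^+ N = S1 ^+ N * (k%:R ^+ 3) ^+ N * (r ^+ 2) ^+ N * q ^+ N.
    by rewrite -!exprMn; congr (_ ^+ N); ring.
  have := exprn_gt0 N (exprn_gt0 2 Np).
  have : 0 < Num.sqrt N%:R ^+ k :> R by rewrite exprn_gt0// sqrtr_gt0.
  have : 0 < 4 ^+ N :> R by rewrite exprn_gt0.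
  move: (4 ^+ N) (Num.sqrt _ ^+ k) ((N%:R ^+ 2) ^+ N) (expR _ ^+ 2) (S1 ^+ N) ((k%:R ^+ 3) ^+ N) ((r ^+ 2) ^+ N) (q ^+ N).
  by move=> a b d e f g h i a0 b0 d0; field; rewrite !gt_eqF.
rewrite /deg_const.
have -> : N`!%:R * (S1 ^+ M * (k%:R * r) ^+ (2 * M) / (2 * M)`!%:R * (k.-1%:R ^+ (M + k.-1) / (M + k.-1)`!%:R)) =
   A ^+ M * k.-1%:R ^+ k.-1 * ((2 * M)`!%:R)^-1 * (N`!%:R / (M + k.-1)`!%:R).
  rewrite AE exprD (exprM (k%:R * r)); move: ((k%:R * r) ^+ 2) => X; rewrite !exprMn.
  by move: ((2 * M)`!%:R^-1) ((M + k.-1)`!%:R^-1) (N`!%:R) (S1 ^+ M) (k.-1%:R ^+ M) (k.-1%:R ^+ k.-1) => *; ring.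
have kk0 : 0 <= k.-1%:R ^+ k.-1 :> R by rewrite exprn_ge0.
apply: (@le_trans _ _ (A ^+ M * k.-1%:R ^+ k.-1 * ((2 * M)`!%:R)^-1)).
  by rewrite ler_piMr// !mulr_ge0 ?exprn_ge0 ?invr_ge0 ?(ltW A0).
apply: (@le_trans _ _ (A ^+ N * B1 * k.-1%:R ^+ k.-1 * ((2 * N)%:R ^+ (2 * k) * (Cs * (expR N%:R ^+ 2 / (2 * N)%:R ^+ (2 * N)))))).
  apply: ler_pM; rewrite ?invr_ge0 ?ler0n ?mulr_ge0 ?exprn_ge0 ?(ltW A0)//.
    by rewrite ler_wpM2r.
  by apply: le_trans f2 _; rewrite ler_wpM2l ?exprn_ge0.
have -> : A ^+ N * B1 * k.-1%:R ^+ k.-1 * ((2 * N)%:R ^+ (2 * k) * (Cs * (expR N%:R ^+ 2 / (2 * N)%:R ^+ (2 * N)))) =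
   (B1 * k.-1%:R ^+ k.-1 * Cs) * (2 * N)%:R ^+ (2 * k) * (A ^+ N * (expR N%:R ^+ 2 / (2 * N)%:R ^+ (2 * N))) by ring.
rewrite f5.
have N1 : N%:R <= N.+1%:R :> R by rewrite ler_nat.
have N11 : 1 <= N.+1%:R :> R by rewrite ler1n.
have g1 : (2 * N)%:R ^+ (2 * k) <= 4 ^+ k * N.+1%:R ^+ (2 * k) :> R.
  rewrite natrM exprMn exprM (_ : 2 ^+ 2 = 4); last by ring.
  by rewrite ler_wpM2l ?exprn_ge0// lerXn2r ?nnegrE.
have g2 : Num.sqrt N%:R ^+ k <= N.+1%:R ^+ (2 * k) :> R.
  rewrite mul2n -addnn exprD (@le_trans _ _ (N.+1%:R ^+ k))// ?ler_peMl ?exprn_ge0 ?exprn_ege1//.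
  rewrite lerXn2r ?nnegrE ?sqrtr_ge0// -ler_sqr ?nnegrE ?sqrtr_ge0// sqr_sqrtr//.
  by rewrite (le_trans N1)// expr2 ler_peMr.
apply: (@le_trans _ _ ((B1 * k.-1%:R ^+ k.-1 * Cs) * (4 ^+ k * N.+1%:R ^+ (2 * k)) *
   (growth k rho N * N.+1%:R ^+ (2 * k) * q ^+ N))).
  have h0 : 0 <= B1 * k.-1%:R ^+ k.-1 * Cs by rewrite !mulr_ge0// ltW.
  apply: ler_pM; rewrite ?(mulr_ge0 h0) ?mulr_ge0 ?exprn_ge0 ?sqrtr_ge0 ?(ltW gr) ?(ltW q0) ?(ltW r0) ?(ltW S10)//.
    by rewrite ler_wpM2l.
  by rewrite ler_wpM2r ?exprn_ge0 ?(ltW q0)// ler_wpM2l// ltW.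
rewrite B2E e4 exprD.
by rewrite le_eqVlt; apply/orP; left; apply/eqP; ring.
Qed.

End degenerate_sum.

Section asymptotics.
Context {R : realType}.
Variables (k : nat) (c : R * R) (rho phi : R).
Hypotheses (k3 : (3 <= k)%N) (rho0 : 0 < rho).
Local Notation mu := (@lebesgue_measure R).
Local Notation K := (regular_polygon k c rho phi).
Local Notation U := (uniform_law (measurable_regular_polygon k c rho phi)).
Hypothesis K1 : lebesgue_measure2 R K = 1%E.

Let kpos : (0 < k)%N. Proof. by lia. Qed.
Let kp : 0 < k%:R :> R. Proof. by rewrite ltr0n. Qed.

Let proba n := convex_position_proba k c rho phi n.
Let I n := fine (iint mu (k.-1 + k) (fun t => (partial_slice k rho n t)%:E)).
Let lim : R := joint_norm k ^+ k * (decay k rho)^-1 ^+ k * closed_mass k.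
Let C0 : R := (2 / (@sinm R k 1 * side k rho * k%:R)) ^+ k.

Let fin_and_cvg : (\forall n \near \oo,
  iint mu (k.-1 + k) (fun t => (partial_slice k rho n t)%:E) \is a fin_num) /\ I n @[n --> \oo] --> lim.
Proof.
have := @cvg_iint_partial_slice R k rho k3 rho0.
by rewrite (iint_limit_slice k3 rho0) => /fine_cvgP.
Qed.

Let main_part n : R := stir (k + n) * C0 * I n * growth k rho (k + n).

Let main_partE n : iint mu (k.-1 + k) (fun t => (partial_slice k rho n t)%:E) \is a fin_num ->
  (((k + n)`!%:R)%:E * \sum_(ts <- comps k n) main_volume k c rho phi n ts = (main_part n)%:E)%E.
Proof.
move=> fin; rewrite (sum_main_volume c phi k3 rho0) -(fineK fin) -/(I n) -!EFinM; congr EFin.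
by rewrite mulrA (fact_slice_const k3 rho0) /main_part /C0; ring.
Qed.

Let C_gt0 : 0 < C_const R k.
Proof.
have d0 : 0 < d_const R k.
  by rewrite d_constE mulr_gt0 ?(cycle_det_gt0 k3 rho0)// divr_gt0// mulr_gt0// exprn_gt0.
rewrite /C_const (cos_theta k3 rho0) mulr_gt0//.
  by rewrite divr_gt0// mulr_gt0 ?sqrtr_gt0// powR_gt0 ?pi_gt0.
rewrite divr_gt0 ?exprn_gt0 ?sqrtr_gt0// mulr_gt0 ?exprn_gt0// subr_gt0.
exact: cos_step_lt1.
Qed.

Lemma cvg_proba_ratio : proba n / equivalent_seq R k n @[n --> \oo] --> (1 : R).
Proof.
(* The volumes are indexed by the number of inner vertices, which is the sample size minus [k]. *)
rewrite -(cvg_shiftn k).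
have [fin cI] := fin_and_cvg; have [B B0 hB] := @deg_ratio_le R k rho k3 rho0.
pose a n := stir (k + n) * C0 * I n / C_const R k.
pose q : R := k.-1%:R / k%:R.
pose b n := B * ((k + n).+1%:R ^+ (5 * k) * q ^+ (k + n)) / C_const R k.
have st : stir (k + n) @[n --> \oo] --> (Num.sqrt (2 * pi) : R).
  have s1 : stir n @[n --> \oo] --> (Num.sqrt (2 * pi) : R) by rewrite -cvg_shiftS; exact: cvg_stir.
  by move: s1; rewrite -(cvg_shiftn k); under eq_fun do rewrite addnC.
have ca : a n @[n --> \oo] --> (1 : R).
  have -> : 1 = Num.sqrt (2 * pi) * C0 * lim / C_const R k :> R.
    by rewrite (C_constE k3 rho0) divff// gt_eqF.
  apply: cvgM; last exact: cvg_cst.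
  by apply: cvgM => //; apply: cvgM => //; exact: cvg_cst.
have cb : b n @[n --> \oo] --> (0 : R).
  have q01 : 0 < q < 1.
    rewrite /q divr_gt0 ?ltr0n//=; last by lia.
    by rewrite ltr_pdivrMr// mul1r ltr_nat; lia.
  have c1 : n.+1%:R ^+ (5 * k) * q ^+ n @[n --> \oo] --> (0 : R) by exact: cvg_poly_geometric.
  have c2 : (k + n).+1%:R ^+ (5 * k) * q ^+ (k + n) @[n --> \oo] --> (0 : R).
    by move: c1; rewrite -(cvg_shiftn k); under eq_fun do rewrite addnC.
  rewrite -[X in _ --> X](mul0r (C_const R k)^-1) -[X in X * _](mulr0 B).
  by apply: cvgM; [apply: cvgM => //; exact: cvg_cst|exact: cvg_cst].
(* The main volumes alone bound the ratio from below by [a n]; the degenerate ones add at most [b n]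
   from above. *)
apply: (@squeeze_cvgr _ _ _ R a (fun n => a n + b n)) => //; last first.
  by rewrite -[X in _ --> X]addr0; exact: cvgD.
near=> n; rewrite /= [(n + k)%N]addnC.
have fn : iint mu (k.-1 + k) (fun t => (partial_slice k rho n t)%:E) \is a fin_num by near: n.
have N0 : (0 < k + n)%N by rewrite addn_gt0 kpos.
have g0 := @growth_gt0 R k rho k3 rho0 (k + n) N0.
have lo := main_volume_le_proba k3 rho0 K1 n; rewrite main_partE// in lo.
have hi := proba_le_volumes k3 rho0 K1 n.
have {}hi : (iid_law U (k + n) [set z | convex_position z] <=
    (main_part n + B * ((k + n).+1%:R ^+ (5 * k) * q ^+ (k + n)) * growth k rho (k + n))%:E)%E.
  apply: le_trans hi _; rewrite ge0_muleDr; last 2 first.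
  - by apply: sume_ge0 => ts _; apply: iint_ge0 => t; rewrite lee_fin.
  - by do 3![apply: sume_ge0 => ? _]; apply: iint_ge0 => t; rewrite lee_fin.
  rewrite main_partE// EFinD leeD2l//.
  apply: le_trans (_ : _ <= ((k + n)`!%:R)%:E *
     (\sum_(p < k) k%:R ^+ k * (k + n).+1%:R ^+ k * deg_const k rho (k + n - p))%:E)%E _.
    by rewrite lee_pmul2l//; exact: (deg_sum_le k3 rho0 K1).
  by rewrite -EFinM lee_fin; apply: hB; rewrite leq_addr.
have fP : iid_law U (k + n) [set z | convex_position z] \is a fin_num.
  by rewrite ge0_fin_numE ?measure_ge0// (le_lt_trans hi)// ltry.
rewrite -(fineK fP) !lee_fin -/(convex_position_proba k c rho phi (k + n)) in lo hi.
rewrite (equivalent_seqE k3 rho0 K1 N0).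
have Cg : 0 < C_const R k * growth k rho (k + n) by rewrite mulr_gt0.
rewrite ler_pdivlMr// ler_pdivrMr//; apply/andP; split.
  apply: le_trans lo; rewrite le_eqVlt; apply/orP; left; apply/eqP.
  by rewrite /a /main_part; move: (growth _ _ _) => g; field; rewrite gt_eqF.
apply: le_trans hi _; rewrite le_eqVlt; apply/orP; left; apply/eqP.
rewrite /a /b /main_part; move: (_ * q ^+ _) => z; move: (growth _ _ _) => g; field.
by rewrite gt_eqF.
Unshelve. all: by end_near. Qed.

End asymptotics.

Theorem theorem1p1 (R : realType) (kappa : nat) (c : R * R) (rho phi : R)
  (hkappa : (3 <= kappa)%N) (hrho : 0 < rho)
  (harea : lebesgue_measure2 R (regular_polygon kappa c rho phi) = 1%E) :
  (fun n : nat => convex_position_proba kappa c rho phi n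
                  / equivalent_seq R kappa n) @ \oo --> (1 : R).
Proof. exact: cvg_proba_ratio. Qed.
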